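(* Let $\sigma\ge\sigma_{crit}$. There exists $\lambda_{crit}(\sigma)>0$ such that for each $\lambda>\lambda_{crit}(\sigma)$ and each initial condition $u_0\in W^2_{q,D}(-1,1)$ (with $q\in(2,\infty)$ and $-1<u_0<1$) satisfying $u_0\ge u_{cat}$, the corresponding unique maximal solution $(u,\psi_u)$ to the free boundary problem described in the context has a finite maximal time of existence, $T_{max}(u_0)<\infty$.
   Context: $W^2_{q,D}(-1,1):=\{f\in W^2_q(-1,1): f(\pm1)=0\}$. For $v\in W^2_{q,D}(-1,1)$ with $-1<v<1$ let $\Omega(v):=\{(z,r)\in(-1,1)\times(0,2): v(z)+1<r<2\}$ and let $\psi_v\in W^2_2(\Omega(v))$ be the unique solution of $$\tfrac1r\partial_r(r\,\partial_r\psi_v)+\sigma^2\partial_z^2\psi_v=0\ \text{ in }\Omega(v),\qquad \psi_v=h_v\ \text{ on }\partial\Omega(v),\qquad h_v(z,r)=\frac{\ln\big(\frac{r}{v(z)+1}\big)}{\ln\big(\frac{2}{v(z)+1}\big)}.$$ The free boundary problem is $$\begin{cases}\partial_t u-\sigma\,\partial_z\arctan(\sigma\partial_z u)=-\dfrac{1}{u+1}+\lambda\,(1+\sigma^2(\partial_zu)^2)^{3/2}\,|\partial_r\psi_{u(t)}(z,u+1)|^2,\\ u(t,\pm1)=0,\quad -1<u<1,\\ u(0,z)=u_0(z),\quad z\in(-1,1).\end{cases}$$ For each $q\in(2,\infty)$, $\lambda\ge0$, $\sigma>0$ and $u_0\in W^2_{q,D}(-1,1)$ with $-1<u_0<1$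 it possesses a unique maximal solution $u\in C^1([0,T_{max}),L_q(-1,1))\cap C([0,T_{max}),W^2_{q,D}(-1,1))$, with $\psi_{u(t)}\in W^2_2(\Omega(u(t)))$ for each $t$, $T_{max}=T_{max}(u_0)\in(0,\infty]$; maximal means it cannot be extended in this regularity class to a larger interval $[0,T)$. $\sigma_{crit}>0$ is the threshold value such that the stationary problem with $\lambda=0$, $$-\sigma\,\partial_z\arctan(\sigma\partial_zu)=-\frac1{u+1},\qquad u(\pm1)=0,\quad -1<u<1,$$ has at least one solution for $\sigma\ge\sigma_{crit}$ and no solution for $\sigma<\sigma_{crit}$. All its solutions are of the form $u(z)=\frac{\cosh(cz)}{\cosh(c)}-1$ with $c>0$ such that $\sigma=\frac{\cosh(c)}{c}$ (so $\sigma_{crit}=\min_{c>0}\cosh(c)/c$). For $\sigma\ge\sigma_{crit}$, $u_{cat}$ denotes the (pointwise) smallest of these solutions. *)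

(* Defs.v *)
From HB Require Import structures.
From mathcomp Require Import all_boot all_order all_algebra.
From mathcomp Require Import all_classical all_reals all_analysis.
Set Implicit Arguments.
Unset Strict Implicit.
Unset Printing Implicit Defensive.
Import Order.TTheory GRing.Theory Num.Theory.
Import numFieldNormedType.Exports.
Local Open Scope classical_set_scope.
Local Open Scope ring_scope.

(* Elements of Sobolev spaces are represented by functions on all of R or     *)
(* R * R; only the values on the (closed) domain of interest are meaningful.  *)

(* Asking that every iterated directional derivative be differentiable        *)
(* amounts to C^oo in finite dimension.                                       *)
Definition smooth (R : realType) (V : normedModType R) (f : V -> R) : Prop :=
  forall (s : seq V) (x : V), differentiable (foldr (fun v g => 'D_v g) f s) x.

Definition test_function (R : realType) (V : normedModType R) (D : set V)
    (phi : V -> R) : Prop :=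
  smooth phi /\
  exists K : set V, [/\ compact K, K `<=` D & forall x, ~ K x -> phi x = 0].

Local Notation mR R := (measurableTypeR R).

Definition mu1 (R : realType) : {measure set (mR R) -> \bar R} :=
  @lebesgue_measure R.

Definition mu2 (R : realType) : {measure set (mR R * mR R)%type -> \bar R} :=
  (@lebesgue_measure R \x @lebesgue_measure R)%E.

Definition Lpnorm (d : measure_display) (T : measurableType d) (R : realType)
    (mu : {measure set T -> \bar R}) (D : set T) (q : R) (f : T -> R) : \bar R :=
  'N[mu]_(q%:E)[EFin \o (f \_ D)].

Definition Lp (d : measure_display) (T : measurableType d) (R : realType)
    (mu : {measure set T -> \bar R}) (D : set T) (q : R) (f : T -> R) : Prop :=
  measurable_fun D f /\ (Lpnorm mu D q f < +oo)%E.

Definition J (R : realType) : set R := `]-1, 1[.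
Arguments J : clear implicits.

Definition L1loc1 (R : realType) (f : R -> R) : Prop :=
  measurable_fun (J R) f /\ forall K : set R, compact K -> K `<=` J R ->
    (@mu1 R).-integrable K (EFin \o f).

Definition weak_deriv1 (R : realType) (f g : R -> R) : Prop :=
  [/\ L1loc1 f, L1loc1 g &
    forall phi : R -> R, test_function (J R) phi ->
      \int[@mu1 R]_(z in J R) (f z * derive1 phi z) =
      - \int[@mu1 R]_(z in J R) (g z * phi z)].

(* A weak derivative of f, unique up to a null set; the zero function if      *)
(* there is none.                                                             *)
Definition wD1 (R : realType) (f : R -> R) : R -> R :=
  xget (cst 0) [set g | weak_deriv1 f g].

Definition W1q (R : realType) (q : R) (f : R -> R) : Prop :=
  [/\ Lp (@mu1 R) (J R) q f, weak_deriv1 f (wD1 f) &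
      Lp (@mu1 R) (J R) q (wD1 f)].

(* By Sobolev embedding, classes in W^2_q(-1,1) have a representative that is *)
(* continuous on [-1,1]; it is the one used here, so that boundary values and *)
(* pointwise inequalities make sense.                                         *)
Definition W2q (R : realType) (q : R) (f : R -> R) : Prop :=
  [/\ {within `[-1, 1], continuous f}, Lp (@mu1 R) (J R) q f,
      weak_deriv1 f (wD1 f) & W1q q (wD1 f)].

Definition W2q_norm (R : realType) (q : R) (f : R -> R) : \bar R :=
  (Lpnorm (@mu1 R) (J R) q f + Lpnorm (@mu1 R) (J R) q (wD1 f)
   + Lpnorm (@mu1 R) (J R) q (wD1 (wD1 f)))%E.

Definition W2qD (R : realType) (q : R) (f : R -> R) : Prop :=
  [/\ W2q q f, f (-1) = 0 & f 1 = 0].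

(* Points of R * R are p = (z, r). *)

Definition ez (R : realType) : R * R := (1, 0).
Definition er (R : realType) : R * R := (0, 1).
Arguments ez : clear implicits.
Arguments er : clear implicits.

Definition L1loc2 (R : realType) (D : set (R * R)) (f : R * R -> R) : Prop :=
  measurable_fun D f /\ forall K : set (R * R), compact K -> K `<=` D ->
    (@mu2 R).-integrable K (EFin \o f).

Definition weak_deriv2 (R : realType) (D : set (R * R)) (v : R * R)
    (f g : R * R -> R) : Prop :=
  [/\ L1loc2 D f, L1loc2 D g &
    forall phi : R * R -> R, test_function D phi ->
      \int[@mu2 R]_(p in D) (f p * 'D_v phi p) =
      - \int[@mu2 R]_(p in D) (g p * phi p)].

Definition wD2 (R : realType) (D : set (R * R)) (v : R * R) (f : R * R -> R) :
    R * R -> R :=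
  xget (cst 0) [set g | weak_deriv2 D v f g].

Definition W12 (R : realType) (D : set (R * R)) (f : R * R -> R) : Prop :=
  Lp (@mu2 R) D 2 f /\
  forall v, v \in [:: ez R; er R] ->
    weak_deriv2 D v f (wD2 D v f) /\ Lp (@mu2 R) D 2 (wD2 D v f).

Definition W22 (R : realType) (D : set (R * R)) (f : R * R -> R) : Prop :=
  Lp (@mu2 R) D 2 f /\
  forall v, v \in [:: ez R; er R] ->
    weak_deriv2 D v f (wD2 D v f) /\ W12 D (wD2 D v f).

Definition Omega (R : realType) (v : R -> R) : set (R * R) :=
  [set p | [/\ -1 < p.1 < 1, 0 < p.2 < 2 & v p.1 + 1 < p.2 < 2]].

Definition bdry (R : realType) (D : set (R * R)) : set (R * R) :=
  closure D `\` interior D.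

Definition h (R : realType) (v : R -> R) (p : R * R) : R :=
  ln (p.2 / (v p.1 + 1)) / ln (2 / (v p.1 + 1)).

(* psi = psi_v on the closure of Omega v; the continuous representative of    *)
(* psi in W^2_2 is used, so that the boundary condition is pointwise.         *)
Definition is_potential (R : realType) (sigma : R) (v : R -> R)
    (psi : R * R -> R) : Prop :=
  let D := Omega v in
  [/\ W22 D psi,
      {within closure D, continuous psi},
      {ae @mu2 R, forall p : R * R, D p ->
        p.2^-1 * wD2 D (er R) (fun p' => p'.2 * wD2 D (er R) psi p') p
        + sigma ^+ 2 * wD2 D (ez R) (wD2 D (ez R) psi) p = 0} &
      forall p, bdry D p -> psi p = h v p].

(* g is the trace z |-> w(z, v(z) + 1) of w in W^1_2(Omega v) on the lower    *)
(* boundary: the L_2-limit of the restrictions of smooth functions converging *)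
(* to w in W^1_2(Omega v).                                                    *)
Definition is_lower_trace (R : realType) (v : R -> R) (w : R * R -> R)
    (g : R -> R) : Prop :=
  [/\ W12 (Omega v) w, Lp (@mu1 R) (J R) 2 g &
    exists phi : nat -> R * R -> R,
      [/\ forall n, smooth (phi n),
          Lpnorm (@mu2 R) (Omega v) 2 (phi n \- w) @[n --> \oo] --> 0%E,
          forall e, e \in [:: ez R; er R] ->
            Lpnorm (@mu2 R) (Omega v) 2 ('D_e (phi n) \- wD2 (Omega v) e w)
              @[n --> \oo] --> 0%E &
          Lpnorm (@mu1 R) (J R) 2 (fun z => phi n (z, v z + 1) - g z)
              @[n --> \oo] --> 0%E]].

Definition time_interval (R : realType) (T : \bar R) : set R :=
  [set t : R | 0 <= t /\ (t%:E < T)%E].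

Definition C_W2qD (R : realType) (q : R) (T : \bar R) (u : R -> R -> R) : Prop :=
  forall t, time_interval T t ->
    W2qD q (u t) /\
    W2q_norm q (u s \- u t) @[s --> within (time_interval T) (nbhs t)] --> 0%E.

(* u is in C^1([0,T), L_q(-1,1)) with time derivative ut; at t = 0 the        *)
(* difference quotient is one-sided.                                          *)
Definition C1_Lq (R : realType) (q : R) (T : \bar R) (u ut : R -> R -> R) : Prop :=
  forall t, time_interval T t ->
    [/\ Lp (@mu1 R) (J R) q (u t), Lp (@mu1 R) (J R) q (ut t),
        Lpnorm (@mu1 R) (J R) q (fun z => (u s z - u t z) / (s - t) - ut t z)
          @[s --> within (time_interval T) t^'] --> 0%E &
        Lpnorm (@mu1 R) (J R) q (ut s \- ut t)
          @[s --> within (time_interval T) (nbhs t)] --> 0%E].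

Definition evolution_eq (R : realType) (lambda sigma : R) (u ut : R -> R)
    (psi : R * R -> R) : Prop :=
  exists2 g : R -> R, is_lower_trace u (wD2 (Omega u) (er R) psi) g &
    {ae @mu1 R, forall z : R, J R z ->
      ut z - sigma * wD1 (fun y => atan (sigma * wD1 u y)) z =
      - (u z + 1)^-1
      + lambda * (1 + sigma ^+ 2 * wD1 u z ^+ 2) `^ (3 / 2) * `|g z| ^+ 2}.

Definition is_solution (R : realType) (q lambda sigma : R) (u0 : R -> R)
    (T : \bar R) (u : R -> R -> R) (psi : R -> R * R -> R) : Prop :=
  (0 < T)%E /\
  exists ut : R -> R -> R,
    [/\ C1_Lq q T u ut,
        C_W2qD q T u,
        forall t, time_interval T t ->
          (forall z, J R z -> -1 < u t z < 1) /\
          is_potential sigma (u t) (psi t),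
        forall z, `[-1, 1]%classic z -> u 0 z = u0 z &
        forall t, time_interval T t -> 0 < t ->
          evolution_eq lambda sigma (u t) (ut t) (psi t)].

Definition is_maximal_solution (R : realType) (q lambda sigma : R)
    (u0 : R -> R) (T : \bar R) (u : R -> R -> R) (psi : R -> R * R -> R) : Prop :=
  is_solution q lambda sigma u0 T u psi /\
  ~ (exists T' u' psi',
      [/\ (T < T')%E, is_solution q lambda sigma u0 T' u' psi' &
          forall t z, time_interval T t -> `[-1, 1]%classic z ->
            u' t z = u t z]).

(* Stationary solutions for lambda = 0 in the classical sense: W^2_q          *)
(* solutions of this ODE are smooth, so the notion does not depend on q.      *)
Definition is_stationary (R : realType) (sigma : R) (u : R -> R) : Prop :=
  let a := fun y => atan (sigma * derive1 u y) in
  [/\ {within `[-1, 1], continuous u}, u (-1) = 0, u 1 = 0 &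
    forall z, J R z ->
      [/\ -1 < u z < 1, derivable u z 1, derivable a z 1 &
          - (sigma * derive1 a z) = - (u z + 1)^-1]].

Definition is_sigma_crit (R : realType) (sc : R) : Prop :=
  0 < sc /\
  forall sigma, 0 < sigma ->
    (sc <= sigma -> exists u, is_stationary sigma u) /\
    (sigma < sc -> ~ exists u, is_stationary sigma u).

Definition is_ucat (R : realType) (sigma : R) (u : R -> R) : Prop :=
  is_stationary sigma u /\
  forall w, is_stationary sigma w ->
    forall z, `[-1, 1]%classic z -> u z <= w z.

(* Main.v *)
Require Import Defs.
From mathcomp Require Import all_boot all_order all_algebra.
From mathcomp Require Import all_classical all_reals measurable_realfun all_analysis.
From mathcomp Require Import ring lra.
Set Implicit Arguments.
Unset Strict Implicit.
Unset Printing Implicit Defensive.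
Import Order.TTheory GRing.Theory Num.Theory.
Import numFieldNormedType.Exports.
Local Open Scope classical_set_scope.
Local Open Scope ring_scope.

(** Suppose that the solution is global. By comparison it stays above [ucat],
    so [u + 1 >= delta > 0] for all times. The function
    [y(t) = int_J (u - u^2/4) dz] is bounded; the bulk terms of [y'] are bounded
    below, and integration by parts gives in addition
    [1/2 int sigma u_z atan(sigma u_z)], which grows linearly in [|u_z|].
    The force is controlled through the flux weighted by
    [G(z,r) = phi(z) b(r)]: testing the equation for [psi] with [G] yields
    [int (u+1) G(z,u+1) (1 + sigma^2 u_z^2) psi_r dz = int psi L G >= c0],
    where [L = d_r (r d_r) + sigma^2 r d_z^2] and [G] vanishes near [r = 2],
    satisfies [L G >= 0] for [r >= delta], and carries a fixed amount of [L G]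
    arbitrarily close to [r = 2], where [psi] is close to [1]; hence [c0] does
    not depend on [u]. By Young's inequality, for large [lambda] the force then
    contributes any prescribed constant up to a small multiple of [int |u_z|],
    so that [y' >= 1], which contradicts the boundedness of [y]. *)


(** * Smooth functions and cutoffs *)

(** The concave correction [-u^2/4] is what makes [y] work: for [int u] alone the curvature leaves
    only bounded boundary terms, whereas Young's inequality loses a multiple of
    [int (1 + sigma |u_z|)], because the squared flux comes with the power 3/2 of
    [1 + sigma^2 u_z^2] and the weighted flux with the power 1. The arctangent term pays for this
    loss. The other obstacle is regularity: [psi] is only continuous and in [W^2_2], above the graph
    of a [W^2_q] function, so its normal derivative exists as an L_2 trace and the classical maximum
    principle does not apply. The flux identity is therefore derived with test functions supported
    inside the domain and cut off along polynomial approximations of the graph; positivity of [psi]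
    comes from testing with truncated logarithms. The bump in [z] keeps these cut-offs away from the
    corners. The constants are chosen in the order [delta], [K], [B], [lambda]: [delta] from [ucat],
    [K] from [delta] and [sigma], [B] from [K]. The scale [m] of the weight near [r = 2] depends on
    the solution at each time, but drops out of the flux bound. *)

Section smooth_functions.
Context {R : realType} {V : normedModType R}.
Implicit Types f g : V -> R.

(** Coinduction: [smooth] is the largest class of everywhere differentiable functions that is stable
    under directional derivatives, so smoothness follows by exhibiting any such class containing the
    function. *)
Lemma smooth_ind (S : (V -> R) -> Prop) :
  (forall f, S f -> (forall x, differentiable f x) /\ forall v, S ('D_v f)) ->
  forall f, S f -> smooth f.
Proof.
move=> SP f Sf s x; suff /SP[] : S (foldr (fun v g => 'D_v g) f s) by [].
by elim: s => //= v s /SP[_]; apply.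
Qed.

Lemma smooth_differentiable f x : smooth f -> differentiable f x.
Proof. by move=> /(_ [::] x). Qed.

Lemma smoothD1 f v : smooth f -> smooth ('D_v f).
Proof. by move=> sf s x; have := sf (rcons s v) x; rewrite foldr_rcons. Qed.

Lemma smooth_derivable f x v : smooth f -> derivable f x v.
Proof. by move=> sf; apply/diff_derivable/smooth_differentiable. Qed.

Lemma smooth_continuous f : smooth f -> continuous f.
Proof. by move=> sf x; apply/differentiable_continuous/smooth_differentiable. Qed.

Lemma smooth_cst (c : R) : smooth (fun _ : V => c).
Proof.
apply: (@smooth_ind [set f | exists c, f = fun=> c]); last by exists c.
move=> _ [{}c ->]; split=> [x|v]; first exact: differentiable_cst.
by exists 0; apply/funext => x; rewrite derive_cst.
Qed.

Lemma smoothD f g : smooth f -> smooth g -> smooth (fun x => f x + g x).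
Proof.
move=> sf sg.
apply: (@smooth_ind [set h | exists f g, [/\ smooth f, smooth g & h = f \+ g]]);
  last by exists f, g.
move=> _ [{sf}f [{sg}g [sf sg ->]]]; split=> [x|v].
  by apply: differentiableD; exact: smooth_differentiable.
exists ('D_v f), ('D_v g); split; [exact: smoothD1..|].
by apply/funext => x; rewrite deriveD//; exact: smooth_derivable.
Qed.

(** The stable class for products: by Leibniz' rule the derivative of a product is a sum of
    products. *)
Inductive sumprod : (V -> R) -> Prop :=
| sumprodM f g of smooth f & smooth g : sumprod (f \* g)
| sumprodD f g of sumprod f & sumprod g : sumprod (f \+ g).

Lemma smoothM f g : smooth f -> smooth g -> smooth (fun x => f x * g x).
Proof.
move=> sf sg; apply: (@smooth_ind sumprod); last exact: sumprodM.
move=> {f g sf sg} h; elim=> {h} [f g sf sg|f g _ [df Df] _ [dg Dg]]; split=> [x|v].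
- by apply: differentiableM; exact: smooth_differentiable.
- have -> : 'D_v (f \* g) = (f \* 'D_v g) \+ (g \* 'D_v f).
    by apply/funext => x; rewrite deriveM//; exact: smooth_derivable.
  by apply: sumprodD; apply: sumprodM => //; exact: smoothD1.
- exact: differentiableD.
- have -> : 'D_v (f \+ g) = 'D_v f \+ 'D_v g.
    by apply/funext => x; rewrite deriveD//; apply: diff_derivable.
  exact: sumprodD.
Qed.

Lemma smoothN f : smooth f -> smooth (fun x => - f x).
Proof.
move=> sf; rewrite (_ : (fun _ => _) = fun x => -1 * f x).
  by apply: smoothM => //; exact: smooth_cst.
by apply/funext => x; rewrite mulN1r.
Qed.

Lemma smoothB f g : smooth f -> smooth g -> smooth (fun x => f x - g x).
Proof. by move=> sf sg; apply: smoothD => //; exact: smoothN. Qed.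

Lemma smooth_linear (l : {linear V -> R}) : continuous l -> smooth l.
Proof.
move=> cl.
apply: (@smooth_ind [set f : V -> R | f = (l : V -> R) \/ smooth f]); last by left.
move=> f [->|sf]; split=> [x|v].
- exact: linear_differentiable.
- right; rewrite (_ : 'D_v l = fun=> l v); first exact: smooth_cst.
  apply/funext => x; rewrite deriveE; last exact: linear_differentiable.
  by rewrite diff_lin.
- exact: smooth_differentiable.
- by right; exact: smoothD1.
Qed.

(** The stable class for the chain rule: derivatives of [a 0] after [f] are sums of terms [a k]
    after [f] times smooth factors. *)
Inductive sumcomp (a : nat -> R -> R) f : (V -> R) -> Prop :=
| sumcompM k h of smooth h : sumcomp a f ((a k \o f) \* h)
| sumcompD g h of sumcomp a f g & sumcomp a f h : sumcomp a f (g \+ h).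

Lemma derive_comp1 (a : R -> R) f x v (da : R) : is_derive (f x) 1 a da ->
  differentiable f x -> is_derive x v (a \o f) (da * 'D_v f x).
Proof.
move=> Da df; have da' : differentiable a (f x).
  by apply/derivable1_diffP; exact: ex_derive.
apply: DeriveDef; first by apply: diff_derivable; exact: differentiable_comp.
rewrite deriveE; last exact: differentiable_comp.
rewrite diff_comp//= deriveE//.
have -> : 'd a (f x) ('d f x v) = 'd f x v * 'd a (f x) 1.
  by rewrite -[X in 'd a _ X]mulr1 -[X in 'd a _ X]/(_ *: (1 : R)) linearZ.
by rewrite -[X in _ * X]deriveE// derive_val mulrC.
Qed.

(** The successive derivatives [a k] are supplied explicitly, and only on a set [I] containing the
    values of [f]; this covers the logarithm on positive numbers as well as functions glued at a
    point. *)
Lemma smooth_comp_family (a : nat -> R -> R) (I : set R) f :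
  (forall k x, I x -> is_derive x 1 (a k) (a k.+1 x)) ->
  smooth f -> (forall x, I (f x)) -> smooth (fun x => a 0%N (f x)).
Proof.
move=> Da sf If.
have daf k x v : is_derive x v (a k \o f) (a k.+1 (f x) * 'D_v f x).
  by apply: derive_comp1; [exact: Da|exact: smooth_differentiable].
have dk k x : differentiable (a k \o f) x.
  apply: differentiable_comp; first exact: smooth_differentiable.
  by apply/derivable1_diffP; have := Da k _ (If x) => -[].
apply: (@smooth_ind (sumcomp a f)); last first.
  rewrite (_ : (fun _ => _) = (a 0%N \o f) \* (fun=> 1)).
    by apply: sumcompM; exact: smooth_cst.
  by apply/funext => x /=; rewrite mulr1.
move=> g0; elim=> {g0} [k h sh|g h _ [dg Dg] _ [dh Dh]]; split=> [x|v].
- by apply: differentiableM; [exact: dk|exact: smooth_differentiable].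
- have -> : 'D_v ((a k \o f) \* h) =
      ((a k \o f) \* 'D_v h) \+ ((a k.+1 \o f) \* (fun x => h x * 'D_v f x)).
    apply/funext => x; have [dk1 dk2] := daf k x v.
    rewrite (deriveM dk1 (@smooth_derivable _ x v sh)) dk2 /= /GRing.scale /=; ring.
  apply: sumcompD; apply: sumcompM; first exact: smoothD1.
  by apply: smoothM => //; exact: smoothD1.
- exact: differentiableD.
- have -> : 'D_v (g \+ h) = 'D_v g \+ 'D_v h.
    by apply/funext => x; rewrite deriveD//; apply: diff_derivable.
  exact: sumcompD.
Qed.

End smooth_functions.

Section smooth_comp.
Context {R : realType}.

Lemma smooth_comp {V : normedModType R} (a : R -> R) (f : V -> R) :
  smooth a -> smooth f -> smooth (fun x => a (f x)).
Proof.
move=> sa sf.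
apply: (@smooth_comp_family _ _ (fun k => derive1n k a) setT) => // k x _.
have sk j : smooth (derive1n j a).
  elim: j => // j IH; rewrite derive1nS.
  rewrite (_ : derive1 _ = 'D_1 (derive1n j a)); first exact: smoothD1.
  by apply/funext => y; rewrite derive1E.
by rewrite derive1nS derive1E; apply/derivableP/smooth_derivable.
Qed.

Lemma smooth_id : smooth (@id R).
Proof. by apply: (@smooth_linear _ _ (@idfun R)); move=> x; exact: cvg_id. Qed.

Lemma smooth_fst : smooth (fst : R * R -> R).
Proof. by apply: smooth_linear; move=> x; exact: cvg_fst. Qed.

Lemma smooth_snd : smooth (snd : R * R -> R).
Proof. by apply: smooth_linear; move=> x; exact: cvg_snd. Qed.

Lemma smooth_horner (p : {poly R}) : smooth (horner p).
Proof.
elim/poly_ind: p => [|p c IH].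
  rewrite (_ : horner 0 = fun=> 0); first exact: smooth_cst.
  by apply/funext => x; rewrite horner0.
rewrite (_ : horner _ = fun x => p.[x] * x + c).
  by apply: smoothD; [apply: smoothM IH smooth_id|exact: smooth_cst].
by apply/funext => x; rewrite hornerMXaddC.
Qed.

Lemma smooth_expR : smooth (@expR R).
Proof.
exact (@smooth_comp_family R R (fun=> expR) setT id (fun k x _ => is_derive_expR x) smooth_id (fun=> I)).
Qed.

End smooth_comp.

Section scalar_rules.
Context {R : realType}.
Implicit Types (f g : R -> R) (x a b c : R).

Lemma dercst c x : is_derive x 1 (fun=> c : R) 0.
Proof. exact: is_derive_cst. Qed.

Lemma derid x : is_derive x 1 (fun y : R => y) 1.
Proof. exact: is_derive_id. Qed.

Lemma derD f g x a b : is_derive x 1 f a -> is_derive x 1 g b ->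
  is_derive x 1 (fun y => f y + g y) (a + b).
Proof. by move=> fa gb; exact: is_deriveD. Qed.

Lemma derB f g x a b : is_derive x 1 f a -> is_derive x 1 g b ->
  is_derive x 1 (fun y => f y - g y) (a - b).
Proof. by move=> fa gb; exact: is_deriveB. Qed.

Lemma derM f g x a b : is_derive x 1 f a -> is_derive x 1 g b ->
  is_derive x 1 (fun y => f y * g y) (a * g x + f x * b).
Proof.
move=> fa gb; apply: (@is_derive_eq _ _ _ _ _ _ _ _ (is_deriveM fa gb)).
by rewrite /GRing.scale /= addrC mulrC.
Qed.

Lemma derC f g x a b : is_derive (g x) 1 f a -> is_derive x 1 g b ->
  is_derive x 1 (fun y => f (g y)) (a * b).
Proof. by move=> fa gb; exact: is_derive1_comp. Qed.

Lemma dereq f x a b : is_derive x 1 f a -> a = b -> is_derive x 1 f b.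
Proof. by move=> fa <-. Qed.

End scalar_rules.

(** * Flat functions and a smooth step *)

Section bump.
Context {R : realType}.
Implicit Types (p : {poly R}) (x : R).

(** The form suited to direct estimates of a difference quotient, at a glueing point or under an
    integral sign. *)
Lemma is_derive_le (f : R -> R) x d :
  (forall e, 0 < e -> exists2 k, 0 < k & forall h, h != 0 -> `|h| < k ->
     `|(f (h + x) - f x) / h - d| <= e) -> is_derive x 1 f d.
Proof.
move=> H.
have cv : (fun h : R => h^-1 *: ((f \o shift x) (h *: 1) - f x)) @ 0^' --> d.
  apply/cvgrPdist_le => e e0; have [k k0 Hk] := H e e0.
  near=> h; rewrite distrC /= /GRing.scale /= mulr1 mulrC Hk//.
    by near: h; exact: nbhs_dnbhs_neq.
  by near: h; exact: dnbhs0_lt.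
apply: DeriveDef; first by apply/cvg_ex; exists d.
by apply/cvg_lim => //; exact: norm_hausdorff.
Unshelve. all: by end_near. Qed.

Lemma is_derive1_inv x : x != 0 -> is_derive x 1 (fun y : R => y^-1) (- x ^- 2).
Proof.
move=> x0; apply: DeriveDef; first exact: (@derivableV R R id).
by rewrite (@deriveV R R id)// derive_id /GRing.scale /= mulr1.
Qed.

(** The polynomial parameter makes the family closed under differentiation: with [y = 1/x], the
    derivative of [p(y) exp(-y)] is [y^2 (p - p')(y) exp(-y)]. *)
Definition flat p x : R := if 0 < x then p.[x^-1] * expR (- x^-1) else 0.

(** The extra power [y ^+ k] carries the induction on [p]; [k = 2] serves the difference quotient of
    [flat] at 0, with [y = h^-1]. *)
Lemma horner_expRN_bounded p (k : nat) : exists2 C, 0 <= C &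
  forall y : R, 0 < y -> `|p.[y]| * y ^+ k * expR (- y) <= C.
Proof.
have mono (j : nat) (y : R) : 0 < y -> y ^+ j * expR (- y) <= j.+1`!%:R.
  move=> y0; rewrite expRN ler_pdivrMr ?expR_gt0//.
  case: j => [|j]; first by rewrite expr0 mul1r ltW// expR_gt1.
  have h1 := expR_ge1Dxn j (ltW y0).
  have h2 : y ^+ j.+1 / j.+1`!%:R <= expR y by apply: le_trans h1; rewrite lerDr.
  rewrite ler_pdivrMr ?ltr0n ?fact_gt0// mulrC in h2.
  by apply: le_trans h2 _; rewrite ler_wpM2r ?expR_ge0// ler_nat leq_fact.
elim/poly_ind: p k => [|p c IH] k.
  by exists 0 => // y _; rewrite horner0 normr0 !mul0r.
have [C C0 HC] := IH k.+1.
exists (C + `|c| * k.+1`!%:R) => [|y y0]; first by rewrite addr_ge0// mulr_ge0.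
rewrite hornerMXaddC.
apply: (@le_trans _ _ ((`|p.[y]| * y ^+ k.+1 + `|c| * y ^+ k) * expR (- y))).
  have h : `|p.[y] * y + c| <= `|p.[y]| * y + `|c|.
    by rewrite (le_trans (ler_normD _ _))// normrM (gtr0_norm y0).
  rewrite ler_wpM2r ?expR_ge0// exprS mulrA -mulrDl ler_wpM2r ?exprn_ge0//.
  exact: ltW.
by rewrite mulrDl -mulrA lerD ?mulrA ?HC// -mulrA ler_wpM2l// mono.
Qed.

Lemma is_derive_flat p x : is_derive x 1 (flat p) (flat ('X^2 * (p - p^`())) x).
Proof.
have [x0|x0|->] := ltgtP x 0.
- apply: (@near_eq_is_derive _ _ _ (cst 0)).
    near=> y; rewrite /flat ifF//; apply/negbTE; rewrite -leNgt ltW//.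
    by near: y; exact: lt_nbhsl.
  by rewrite /flat ltNge (ltW x0)/=; exact: is_derive_cst.
- apply: (@near_eq_is_derive R R R (fun y : R => p.[y^-1] * expR (- y^-1))).
    near=> y; rewrite /flat ifT//.
    by near: y; exact: lt_nbhsr.
  rewrite /flat x0.
  have Dinv : is_derive x 1 (fun y : R => y^-1) (- x ^- 2).
    by apply: is_derive1_inv; rewrite gt_eqF.
  have Dp : is_derive x 1 (fun y => p.[y^-1]) (p^`().[x^-1] * - x ^- 2).
    have Dh : is_derive (x^-1) 1 (horner p) (p^`().[x^-1]).
      by rewrite derivE derive1E; apply/derivableP/derivable_horner.
    exact: (@is_derive1_comp _ (horner p) (fun y : R => y^-1)).
  have De : is_derive x 1 (fun y => expR (- y^-1)) (expR (- x^-1) * - - x ^- 2).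
    have Dn : is_derive x 1 (fun y : R => - y^-1) (- - x ^- 2) by exact: is_deriveN.
    exact: (@is_derive1_comp _ expR (fun y : R => - y^-1)).
  apply: is_derive_eq.
  rewrite !hornerE /= /GRing.scale /=; field.
  by rewrite gt_eqF.
- apply: is_derive_le => e e0; rewrite [flat _ 0]/flat ltxx.
  have [C C0 HC] := horner_expRN_bounded p 2.
  exists (e / (C + 1)) => [|h h0 he]; first by rewrite divr_gt0// ltr_wpDl.
  rewrite addr0 /flat ltxx !subr0; case: ifPn => [hp|_]; last by rewrite mul0r normr0 ltW.
  rewrite gtr0_norm// in he.
  rewrite !normrM (gtr0_norm (expR_gt0 _)) normfV (gtr0_norm hp).
  have {}HC := HC h^-1; rewrite invr_gt0 in HC; have {}HC := HC hp.
  have : `|p.[h^-1]| * expR (- h^-1) / h <= C * h.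
    have -> : `|p.[h^-1]| * expR (- h^-1) / h = (`|p.[h^-1]| * h^-1 ^+ 2 * expR (- h^-1)) * h.
      by field; rewrite gt_eqF.
    by rewrite ler_wpM2r// ltW.
  move=> /le_trans; apply.
  rewrite ltr_pdivlMr ?ltr_wpDl// in he.
  by rewrite mulrC (le_trans _ (ltW he))// ler_wpM2l ?ltW// ltrDl.
Unshelve. all: by end_near. Qed.

Fixpoint flat_poly p (k : nat) : {poly R} :=
  if k is k'.+1 then 'X^2 * (flat_poly p k' - (flat_poly p k')^`()) else p.

Lemma smooth_flat p : smooth (flat p).
Proof.
apply: (@smooth_comp_family _ _ (fun k => flat (flat_poly p k)) setT id _ smooth_id) => //.
by move=> k x _; exact: is_derive_flat.
Qed.

Lemma flat_le0 p x : x <= 0 -> flat p x = 0.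
Proof. by rewrite /flat leNgt; case: ifP. Qed.

Lemma flat_gt0 p x : 0 < x -> flat p x = p.[x^-1] * expR (- x^-1).
Proof. by rewrite /flat => ->. Qed.

Lemma flat1_ge0 x : 0 <= flat 1 x.
Proof. by rewrite /flat; case: ifP => // _; rewrite hornerC mul1r expR_ge0. Qed.

Lemma flat1_gt0 x : 0 < x -> 0 < flat 1 x.
Proof. by move=> x0; rewrite flat_gt0// hornerC mul1r expR_gt0. Qed.

Lemma flat1_homo : {homo flat 1 : x y / x <= y}.
Proof.
move=> x y xy; have [x0|x0] := leP x 0; first by rewrite flat_le0// flat1_ge0.
have y0 := lt_le_trans x0 xy.
rewrite !flat_gt0// !hornerC !mul1r ler_expR lerN2 lef_pV2 ?posrE//.
Qed.

(** Composing [flat 1] with a nondecreasing function that is nonpositive for [x <= 0] and constant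
    for [x >= 1] requires division by a constant only, unlike the usual quotient
    [f(x) / (f(x) + f(1 - x))]. *)
Definition step x : R := flat 1 (flat 1 1 - flat 1 (1 - x)) / flat 1 (flat 1 1).

Lemma smooth_step : smooth step.
Proof.
apply: smoothM; last exact: smooth_cst.
apply: smooth_comp (smooth_flat _) _; apply: smoothB; first exact: smooth_cst.
apply: smooth_comp (smooth_flat _) _; apply: smoothB (smooth_cst _) smooth_id.
Qed.

Lemma step_le0 x : x <= 0 -> step x = 0.
Proof.
move=> x0; rewrite /step flat_le0 ?mul0r// subr_le0 flat1_homo//; lra.
Qed.

Lemma step_ge1 x : 1 <= x -> step x = 1.
Proof.
move=> x1; rewrite /step [flat 1 (1 - x)]flat_le0 ?subr_le0// subr0 divff//.
by rewrite gt_eqF// !flat1_gt0.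
Qed.

Lemma step_ge0 x : 0 <= step x.
Proof. by rewrite divr_ge0// flat1_ge0. Qed.

Lemma step_le1 x : step x <= 1.
Proof.
rewrite ler_pdivrMr ?flat1_gt0// mul1r; apply: flat1_homo.
by rewrite lerBlDr lerDl flat1_ge0.
Qed.

Lemma is_derive_step x : is_derive x 1 step (derive1 step x).
Proof. by rewrite derive1E; apply/derivableP/smooth_derivable/smooth_step. Qed.

Lemma derive1_step_out x : x < 0 \/ 1 < x -> derive1 step x = 0.
Proof.
move=> H; rewrite derive1E; apply: derive_val; move: H.
case=> H; [apply: (@near_eq_is_derive R R R (cst 0))|apply: (@near_eq_is_derive R R R (cst 1))];
  near=> y; [rewrite step_le0//|rewrite step_ge1//]; apply: ltW; near: y;
  [exact: lt_nbhsl|exact: lt_nbhsr].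
Unshelve. all: by end_near. Qed.

Lemma derive1_step_bounded : exists2 C, 0 < C & forall x, `|derive1 step x| <= C.
Proof.
have cs : continuous (derive1 step).
  move=> x; rewrite (_ : derive1 step = 'D_1 step); last by apply/funext => y; rewrite derive1E.
  exact/smooth_continuous/smoothD1/smooth_step.
have [c _ Hc] := @EVT_max R (fun x => `|derive1 step x|) 0 1 ler01
  (continuous_subspaceT (fun x => cvg_norm (cs x))).
exists (`|derive1 step c| + 1) => [|x]; first by rewrite ltr_wpDl.
have [x01|x01] := boolP (x \in `[0, 1]).
  by rewrite (le_trans (Hc _ x01))// lerDl.
rewrite derive1_step_out ?normr0 ?addr_ge0//.
move: x01; rewrite in_itv/= negb_and -!ltNge => /orP[]; [left|right]; done.
Qed.

End bump.

(** * Integrals of real functions *)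

Section real_integrals.
Context {d : measure_display} {T : measurableType d} {R : realType}.
Variables (mu : {measure set T -> \bar R}) (D : set T).
Hypothesis mD : measurable D.
Implicit Types (f g h : T -> R) (C : R).

Local Notation L1 f := (mu.-integrable D (EFin \o f)).

Lemma L1_measurable f : L1 f -> measurable_fun D f.
Proof. by case/integrableP => /measurable_EFinP. Qed.

Lemma eq_L1 g f : {in D, f =1 g} -> L1 f -> L1 g.
Proof. by move=> fg; apply: eq_integrable => // x xD; rewrite /= fg. Qed.

Lemma L1D f g : L1 f -> L1 g -> L1 (fun x => f x + g x).
Proof. by move=> If Ig; have := integrableD mD If Ig; apply: eq_integrable. Qed.

Lemma L1B f g : L1 f -> L1 g -> L1 (fun x => f x - g x).
Proof.
by move=> If Ig; have := integrableB mD If Ig; apply: eq_integrable => // x _; rewrite /= EFinB.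
Qed.

Lemma L1Z k f : L1 f -> L1 (fun x => k * f x).
Proof. by move=> If; have := integrableZl mD k If; apply: eq_integrable. Qed.

Lemma L1N f : L1 f -> L1 (fun x => - f x).
Proof. by move=> If; have := integrableN If; apply: eq_integrable. Qed.

Lemma L1_normr f : L1 f -> L1 (fun x => `|f x|).
Proof. by move=> If; exact: integrable_norm If. Qed.

Lemma L1_le f g : measurable_fun D f -> (forall x, D x -> `|f x| <= g x) -> L1 g -> L1 f.
Proof.
move=> mf fg; apply: le_integrable => //; first exact/measurable_EFinP.
by move=> x Dx /=; rewrite lee_fin (le_trans (fg _ Dx))// ler_norm.
Qed.

Lemma L1M C h f : measurable_fun D h -> (forall x, D x -> `|h x| <= C) -> L1 f ->
  L1 (fun x => h x * f x).
Proof.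
move=> mh hC If; apply: (@L1_le _ (fun x => `|C| * `|f x|)); last exact/L1Z/L1_normr.
  by apply: measurable_funM => //; exact: L1_measurable.
move=> x Dx; rewrite normrM ler_wpM2r//.
by rewrite (le_trans (hC _ Dx))// ler_norm.
Qed.

Lemma L1_cst (c : R) : (mu D < +oo)%E -> L1 (fun=> c).
Proof.
move=> Doo; apply: measurable_bounded_integrable => //.
by exists `|c|; split => // M cM x _ /=; exact: ltW.
Qed.

Lemma L1_bounded C f : (mu D < +oo)%E -> measurable_fun D f ->
  (forall x, D x -> `|f x| <= C) -> L1 f.
Proof. by move=> Doo mf fC; apply: (L1_le mf fC); exact: L1_cst. Qed.

Lemma L1_patch f : mu.-integrable setT (EFin \o (f \_ D)) <-> L1 f.
Proof. by rewrite -restrict_EFin; split => /(integrable_mkcond _ mD). Qed.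

Lemma RintegralN f : L1 f -> \int[mu]_(x in D) - f x = - \int[mu]_(x in D) f x.
Proof.
move=> If; rewrite -mulN1r -RintegralZl//.
by apply: eq_Rintegral => x _; rewrite mulN1r.
Qed.

Lemma Rintegral_fineK f : L1 f ->
  (\int[mu]_(x in D) f x)%:E = (\int[mu]_(x in D) (f x)%:E)%E.
Proof. by move=> If; rewrite fineK//; exact: integrable_fin_num. Qed.

Lemma eq_Rintegral_ae f g : measurable_fun D f -> measurable_fun D g ->
  {ae mu, forall x, D x -> f x = g x} ->
  \int[mu]_(x in D) f x = \int[mu]_(x in D) g x.
Proof.
move=> mf mg fg; congr fine; apply: ae_eq_integral => //; try exact/measurable_EFinP.
by apply: filterS fg => x fg Dx /=; rewrite fg.
Qed.

Lemma eq_L1_ae f g : measurable_fun D g -> {ae mu, forall x, D x -> f x = g x} ->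
  L1 f -> L1 g.
Proof.
move=> mg fg If; apply/integrableP; split; first exact/measurable_EFinP.
have /integrableP[_] := If; apply: le_lt_trans.
rewrite (@ae_eq_integral _ _ _ mu D (fun x => `|(f x)%:E|)%E)//.
- by apply: measurableT_comp => //; exact/measurable_EFinP.
- by apply: measurableT_comp => //; exact/measurable_EFinP/L1_measurable.
- by apply: filterS fg => x fg Dx /=; rewrite fg.
Qed.

Lemma le_Rintegral_ae f g : L1 f -> L1 g -> {ae mu, forall x, D x -> f x <= g x} ->
  \int[mu]_(x in D) f x <= \int[mu]_(x in D) g x.
Proof.
move=> If Ig fg.
(* Replacing [g] by [max f g], equal to it almost everywhere, makes the inequality hold at every
   point. *)
have mm : measurable_fun D (fun x => Num.max (f x) (g x)).
  by apply: measurable_maxr; exact: L1_measurable.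
have E : {ae mu, forall x, D x -> g x = Num.max (f x) (g x)}.
  by apply: filterS fg => x fg Dx; rewrite max_r// fg.
rewrite (eq_Rintegral_ae (L1_measurable Ig) mm E).
by apply: le_Rintegral => //; [exact: eq_L1_ae E Ig|move=> x _; rewrite le_max lexx].
Qed.

Lemma normr_Rintegral_le C f h : L1 f -> measurable_fun D h -> (forall x, D x -> `|h x| <= C) ->
  `|\int[mu]_(x in D) (h x * f x)| <= C * \int[mu]_(x in D) `|f x|.
Proof.
move=> If mh hC.
rewrite (le_trans (le_normr_Rintegral mD (L1M mh hC If)))// -RintegralZl//; last exact: L1_normr.
apply: le_Rintegral => //; [exact/L1_normr/(L1M mh hC If)|exact/L1Z/L1_normr|].
by move=> x Dx; rewrite normrM ler_wpM2r// hC.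
Qed.

Lemma cvg_Rintegral (f_ : nat -> T -> R) f g :
  (forall n, measurable_fun D (f_ n)) -> measurable_fun D f ->
  {ae mu, forall x, D x -> f_ n x @[n --> \oo] --> f x} -> L1 g ->
  {ae mu, forall x, D x -> forall n, `|f_ n x| <= g x} ->
  \int[mu]_(x in D) f_ n x @[n --> \oo] --> \int[mu]_(x in D) f x.
Proof.
move=> mf_ mf f_f Ig fg.
have [If _ H] := @dominated_convergence _ _ _ mu D mD (fun n => EFin \o f_ n) (EFin \o f)
  (EFin \o g) (fun n => (measurable_EFinP _ _).2 (mf_ n)) ((measurable_EFinP _ _).2 mf)
  ltac:(by apply: filterS f_f => x H Dx; apply: cvg_EFin; [exact: nearW|exact: H]) Ig
  ltac:(by apply: filterS fg => x H n Dx; rewrite /= lee_fin H).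
have := H; rewrite -(Rintegral_fineK If) => /fine_cvg; exact.
Qed.

Lemma ae_imp (P Q : T -> Prop) : (forall x, P x -> Q x) ->
  {ae mu, forall x, P x} -> {ae mu, forall x, Q x}.
Proof. by move=> PQ; apply: filterS. Qed.

Lemma ae_and (P Q : T -> Prop) : {ae mu, forall x, P x} -> {ae mu, forall x, Q x} ->
  {ae mu, forall x, P x /\ Q x}.
Proof. by apply: filterS2. Qed.

End real_integrals.

(** * From Lebesgue norms to integrals of absolute values *)

Section Lp_lemmas.
Context {d : measure_display} {T : measurableType d} {R : realType}.
Variables (mu : {measure set T -> \bar R}) (D : set T).
Hypothesis mD : measurable D.
Implicit Types (f g h : T -> R) (q : R).

Local Notation L1 f := (mu.-integrable D (EFin \o f)).

Lemma LpnormE q f : 0 < q ->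
  Lpnorm mu D q f = ((\int[mu]_(x in D) (`|f x| `^ q)%:E) `^ q^-1)%E.
Proof.
move=> q0; rewrite /Lpnorm unlock; congr (_ `^ _)%E.
rewrite [RHS]integral_mkcond; apply: eq_integral => x _ /=.
rewrite /patch; case: ifP => // _; rewrite normr0 powR0// gt_eqF//.
Qed.

Lemma measurable_powRn q f : measurable_fun D f -> measurable_fun D (fun x => `|f x| `^ q).
Proof.
move=> mf; apply: (@measurableT_comp _ _ _ _ _ _ (@powR R ^~ q)) => //.
exact: measurableT_comp.
Qed.

Lemma Lp_powR q f : 0 < q -> Lp mu D q f -> L1 (fun x => `|f x| `^ q).
Proof.
move=> q0 [mf]; rewrite LpnormE// => foo.
have {}foo : (\int[mu]_(x in D) (`|f x| `^ q)%:E < +oo)%E.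
  by apply: (lty_poweRy _ foo); rewrite invr_eq0 gt_eqF.
apply/integrableP; split; first exact/measurable_EFinP/measurable_powRn.
apply: le_lt_trans foo; rewrite le_eqVlt; apply/orP; left; apply/eqP.
by apply: eq_integral => x _; rewrite /= ger0_norm// powR_ge0.
Qed.

(** Elementary substitute for Hoelder's inequality: either [|x| <= e], or [|x| ^ (q - 1)] exceeds
    [e ^ (q - 1)]. The additive [e] is harmless on a set of finite measure. *)
Lemma normr_le_powR (e q x : R) : 0 < e -> 1 <= q -> `|x| <= e + (e `^ (q - 1))^-1 * `|x| `^ q.
Proof.
move=> e0 q1; have [xe|xe] := leP `|x| e.
  by rewrite (le_trans xe)// lerDl mulr_ge0// ?invr_ge0 powR_ge0.
have x0 := lt_trans e0 xe.
apply: (@le_trans _ _ ((e `^ (q - 1))^-1 * `|x| `^ q)); last by rewrite lerDr ltW.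
have q0 : 0 < q by rewrite (lt_le_trans ltr01).
rewrite ler_pdivlMl ?powR_gt0// -(mulr_powRB1 (ltW x0) q0) mulrC ler_wpM2l//.
by apply: ge0_ler_powR; rewrite ?nnegrE ?subr_ge0// ltW.
Qed.

Hypothesis Doo : (mu D < +oo)%E.

Lemma Lp_L1 q f : 1 <= q -> Lp mu D q f -> L1 f.
Proof.
move=> q1 Lf; have [mf _] := Lf.
apply: (L1_le mD mf (fun x _ => normr_le_powR (f x) ltr01 q1)).
apply: L1D => //; first exact: L1_cst.
by apply: L1Z => //; apply: Lp_powR => //; rewrite (lt_le_trans ltr01).
Qed.

Lemma Lpnorm_cvg0_powR (I : Type) (F : set_system I) (FF : Filter F) q (f_ : I -> T -> R) :
  0 < q -> (\forall i \near F, measurable_fun D (f_ i)) ->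
  Lpnorm mu D q (f_ i) @[i --> F] --> 0%E ->
  forall e : R, 0 < e -> \forall i \near F,
    L1 (fun x => `|f_ i x| `^ q) /\ \int[mu]_(x in D) (`|f_ i x| `^ q) <= e.
Proof.
move=> q0 mf /fine_cvgP[fin cv] e e0.
have /cvgrPdist_lt/(_ (e `^ q^-1)) := cv.
rewrite powR_gt0// => /(_ isT); apply: filterS3 mf fin => i /= mfi fi; rewrite sub0r normrN => h.
have Li : Lp mu D q (f_ i) by split => //; rewrite ltey_eq fi.
have I1 := Lp_powR q0 Li; split=> //.
move: h; rewrite LpnormE// -Rintegral_fineK//=.
set X := \int[mu]_(x in D) _.
have X0 : 0 <= X by apply: Rintegral_ge0 => x _; exact: powR_ge0.
rewrite ger0_norm ?powR_ge0// => h.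
have := @ge0_ler_powR R q (ltW q0) (X `^ q^-1) (e `^ q^-1).
rewrite !nnegrE !powR_ge0 => /(_ isT isT (ltW h)).
by rewrite -!powRrM mulVf ?gt_eqF// !powRr1// ltW.
Qed.

(** Integrates [normr_le_powR] with a threshold adapted to the measure of [D]. The filter is
    arbitrary, to serve both sequences and limits in time restricted to an interval. *)
Lemma Lpnorm_cvg0_L1 (I : Type) (F : set_system I) (FF : Filter F) q (f_ : I -> T -> R) :
  1 <= q -> (\forall i \near F, measurable_fun D (f_ i)) ->
  Lpnorm mu D q (f_ i) @[i --> F] --> 0%E ->
  forall e : R, 0 < e -> \forall i \near F, L1 (f_ i) /\ \int[mu]_(x in D) `|f_ i x| <= e.
Proof.
move=> q1 mf cv e e0; have q0 : 0 < q by rewrite (lt_le_trans ltr01).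
pose m := fine (mu D); pose e1 := e / 2 / (m + 1).
have m0 : 0 <= m by rewrite fine_ge0.
have e10 : 0 < e1 by rewrite !divr_gt0// ltr_wpDl.
pose c := (e1 `^ (q - 1)); have c0 : 0 < c by rewrite powR_gt0.
have e20 : 0 < e / 2 by rewrite divr_gt0.
have := Lpnorm_cvg0_powR FF q0 mf cv (mulr_gt0 c0 e20).
apply: filterS2 mf => i mfi [Ii le_i].
have Ig : L1 (fun x => e1 + c^-1 * `|f_ i x| `^ q).
  by apply: L1D => //; [exact: L1_cst|exact: L1Z].
have If := L1_le mD mfi (fun x _ => normr_le_powR (f_ i x) e10 q1) Ig.
split=> //; apply: (@le_trans _ _ (\int[mu]_(x in D) (e1 + c^-1 * `|f_ i x| `^ q))).
  apply: le_Rintegral => //; first exact: L1_normr.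
  by move=> x _; exact: normr_le_powR.
rewrite RintegralD//; [|exact: L1_cst|exact: L1Z].
have -> : \int[mu]_(x in D) e1 = e1 * m by exact: (Rintegral_cst _ mD e1).
rewrite (RintegralZl c^-1 mD Ii).
have h1 : e1 * m <= e / 2.
  rewrite /e1 mulrAC ler_pdivrMr ?ltr_wpDl// ler_wpM2l ?(ltW e20)//.
  by rewrite lerDl.
have h2 : c^-1 * (\int[mu]_(x in D) (`|f_ i x| `^ q)) <= e / 2.
  by rewrite ler_pdivrMl.
by rewrite (le_trans (lerD h1 h2))// -splitr.
Qed.

End Lp_lemmas.

(** * Integrals over intervals with or without endpoints *)

Section interval_integrals.
Context {R : realType}.
Local Notation mu := (@mu1 R).
Local Notation L1 D f := (mu.-integrable D (EFin \o f)).
Implicit Types (f F : R -> R) (a b : R).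

Lemma measurable_J : measurable (J R : set (measurableTypeR R)).
Proof. exact: measurable_itv. Qed.

Lemma mu1_itv_lty a b (x y : bool) : (mu [set` Interval (BSide x a) (BSide y b)] < +oo)%E.
Proof.
have -> : mu [set` Interval (BSide x a) (BSide y b)] = _ :=
  lebesgue_measure_itv (Interval (BSide x a) (BSide y b)).
by rewrite /=; case: ifP => _; rewrite ?ltry.
Qed.

Lemma L1_itv_cc a b (x y : bool) f : L1 [set` Interval (BSide x a) (BSide y b)] f ->
  L1 `[a, b] f.
Proof.
move=> If; apply/integrableP; split.
  apply/measurable_EFinP; apply: (@measurable_fun_itv_cc _ _ _ x y).
  by apply: L1_measurable If; exact: measurable_itv.
have /integrableP[mf] := If.
have mf' : measurable_fun `]a, b[ (fun z => `|(f z)%:E|)%E.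
  apply: measurable_funS (measurableT_comp _ mf) => //.
  by apply: subset_itvW; case: x y {If mf} => [] [].
have E1 := @integral_itv_bndoo R a b _ x y mf'.
have E2 := @integral_itv_bndoo R a b _ true false mf'.
apply: le_lt_trans; rewrite le_eqVlt; apply/orP; left; apply/eqP.
exact: etrans E2 (esym E1).
Qed.

Lemma Rintegral_itv_cc a b (x y : bool) f : L1 `[a, b] f ->
  \int[mu]_(z in [set` Interval (BSide x a) (BSide y b)]) f z = \int[mu]_(z in `[a, b]) f z.
Proof.
move=> If; rewrite /Rintegral.
have mf : measurable_fun `]a, b[ (EFin \o f).
  by case/integrableP : If => + _; apply: measurable_funS => //; exact: subset_itv_oo_cc.
by rewrite (@integral_itv_bndoo R a b (EFin \o f) x y mf)
  (@integral_itv_bndoo R a b (EFin \o f) true false mf).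
Qed.

Lemma L1_subitv (i j : interval R) f : L1 [set` i] f -> [set` j] `<=` [set` i] -> L1 [set` j] f.
Proof. by move=> If ji; apply: integrableS If => //. Qed.

Lemma Rintegral_derive F f a b : a <= b -> continuous f ->
  (forall x : R, is_derive x 1 F (f x)) -> \int[mu]_(z in `[a, b]) f z = F b - F a.
Proof.
rewrite le_eqVlt => /predU1P[->|ab] cf dF.
  by rewrite set_itv1 Rintegral_set1 subrr.
have cF : continuous F.
  move=> x; apply/differentiable_continuous/derivable1_diffP; exact: ex_derive.
rewrite /Rintegral (@continuous_FTC2 _ f F)//.
- exact: continuous_subspaceT.
- split; first by move=> x _; exact: ex_derive.
  + by apply: cvg_at_right_filter; exact: cF.
  + by apply: cvg_at_left_filter; exact: cF.
- by move=> x _; rewrite derive1E; exact: derive_val.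
Qed.

End interval_integrals.

(** * A one-sided approximate identity *)

Section kernel.
Context {R : realType}.
Local Notation mu := (@mu1 R).
Local Notation L1 D f := (mu.-integrable D (EFin \o f)).

Implicit Types (n : nat) (x y : R).

(** A kernel of mass one supported in [[x, x + 1/(n+1)]]. Its primitive is a scaled [step], so
    differences of primitives are test functions whose derivatives are differences of kernels. *)
Definition kern (n : nat) (x y : R) : R := n.+1%:R * derive1 step (n.+1%:R * (y - x)).
Definition kstep (n : nat) (x y : R) : R := step (n.+1%:R * (y - x)).

Lemma is_derive_kstep n x y : is_derive y 1 (kstep n x) (kern n x y).
Proof.
rewrite /kstep /kern mulrC; apply: (@is_derive1_comp _ step (fun y => n.+1%:R * (y - x))).
  exact: is_derive_step.
by apply: is_derive_eq; rewrite /GRing.scale/= subr0 mulr1.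
Qed.

Lemma smooth_kstep n x : smooth (kstep n x).
Proof.
apply: smooth_comp; first exact: smooth_step.
by apply/smoothM/smoothB; [exact: smooth_cst|exact: smooth_id|exact: smooth_cst].
Qed.

Lemma derive1_kstep n x : derive1 (kstep n x) = kern n x.
Proof.
by apply/funext => y; rewrite derive1E; apply: derive_val; exact: is_derive_kstep.
Qed.

Lemma smooth_kern n x : smooth (kern n x).
Proof.
rewrite (_ : kern n x = 'D_1 (kstep n x)); first exact/smoothD1/smooth_kstep.
by rewrite -derive1_kstep; apply/funext => y; rewrite derive1E.
Qed.

Lemma kern_out n x y : y < x \/ x + n.+1%:R^-1 < y -> kern n x y = 0.
Proof.
move=> H; rewrite /kern derive1_step_out ?mulr0//.
case: H => H; [left; rewrite pmulr_rlt0// subr_lt0//|right].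
by rewrite -ltr_pdivrMl// mulr1 ltrBrDl.
Qed.

Lemma kstep_le n x y : y <= x -> kstep n x y = 0.
Proof. by move=> yx; rewrite /kstep step_le0// pmulr_rle0// subr_le0. Qed.

Lemma kstep_ge n x y : x + n.+1%:R^-1 <= y -> kstep n x y = 1.
Proof. by move=> yx; rewrite /kstep step_ge1// -ler_pdivrMl// mulr1 lerBrDl. Qed.

Lemma near_invSn (e : R) : 0 < e -> \forall n \near \oo, n.+1%:R^-1 < e.
Proof. by move=> e0; exact: near_infty_natSinv_lt (PosNum e0). Qed.

(** At a Lebesgue point of [f] extended by zero, the error is at most the bound [(n+1) C] of the
    kernel times the integral of [|f - f x|] over a ball of radius [2/(n+1)], that is, [4 C] times
    an average tending to 0. *)
Lemma cvg_kern (f : R -> R) a b : a < b -> L1 `[a, b] f ->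
  {ae mu, forall x, a < x < b ->
    \int[mu]_(y in `[a, b]) (f y * kern n x y) @[n --> \oo] --> f x}.
Proof.
move=> ab If; pose g := f \_ `[a, b].
have mab : measurable (`[a, b]%classic : set (measurableTypeR R)) by exact: measurable_itv.
have Ig : L1 setT g.
  by apply/L1_patch => //; exact: measurable_itv.
have : {ae mu, forall x, lebesgue_pt g x}.
  exact: lebesgue_differentiation (open_integrable_locally openT Ig).
apply: ae_imp => x gx /andP[ax xb].
have [C C0 HC] := @derive1_step_bounded R.
apply/cvgrPdist_le => e e0.
have e'0 : 0 < e / (4 * C) by rewrite divr_gt0// mulr_gt0.
have /fine_cvgP[fin /cvgrPdist_lt/(_ _ e'0)] := gx.
move=> /(filterI fin); case=> r /= r0 Hr.
have r20 : 0 < r / 2 by rewrite divr_gt0.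
have xb0 : 0 < b - x by rewrite subr_gt0.
near=> n.
have n0 : 0 < (n.+1%:R^-1 : R) by rewrite invr_gt0.
have nb : n.+1%:R^-1 <= b - x by apply: ltW; near: n; exact: near_invSn.
have nr : n.+1%:R^-1 < r / 2 by near: n; exact: near_invSn.
(* Twice the width of the kernel, so that its closed support lies in the open ball. *)
pose s : R := 2 * n.+1%:R^-1.
have s0 : 0 < s by rewrite mulr_gt0.
have sr : `|0 - s| < r.
  by rewrite /= sub0r normrN gtr0_norm// /s mulrC -ltr_pdivlMr.
have [fins] := Hr s sr s0.
rewrite sub0r normrN ger0_norm ?fine_ge0 ?davg_ge0//= => Hs.
have ck : continuous (kern n x) by apply/smooth_continuous/smooth_kern.
have mk D : measurable D -> measurable_fun D (kern n x).
  by move=> mD; apply: measurable_funTS; exact: continuous_measurable_fun.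
have bk y : `|kern n x y| <= n.+1%:R * C.
  by rewrite /kern normrM normr_nat ler_wpM2l.
have Ik : L1 `[a, b] (kern n x).
  apply: (@L1_bounded _ _ _ mu `[a, b]%classic mab (n.+1%:R * C)) => //.
    exact: mu1_itv_lty.
  exact: mk.
have Ifk : L1 `[a, b] (fun y => f y * kern n x y).
  have := L1M mab (mk _ mab) (fun y _ => bk y) If.
  by apply: (eq_L1 mab) => y _; rewrite mulrC.
have k1 : \int[mu]_(y in `[a, b]) kern n x y = 1.
  rewrite (Rintegral_derive (ltW ab) ck (is_derive_kstep n x)).
  have xnb : x + n.+1%:R^-1 <= b by rewrite -lerBrDl.
  by rewrite (kstep_ge xnb) (kstep_le n (ltW ax)) subr0.
have -> : f x - \int[mu]_(y in `[a, b]) (f y * kern n x y) =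
    - \int[mu]_(y in `[a, b]) ((f y - f x) * kern n x y).
  rewrite (_ : (\int[mu]_(y in `[a, b]) ((f y - f x) * kern n x y)) =
      \int[mu]_(y in `[a, b]) (f y * kern n x y - f x * kern n x y)); last first.
    by apply: eq_Rintegral => y _; rewrite mulrBl.
  rewrite (RintegralB mab Ifk (L1Z mab (f x) Ik)).
  by rewrite (RintegralZl (f x) mab Ik) k1; ring.
rewrite normrN.
have Id : L1 `[a, b] (fun y => (f y - f x) * kern n x y).
  apply: (@eq_L1 _ _ _ _ _ mab _ (fun y => f y * kern n x y - f x * kern n x y)).
    by move=> y _; rewrite mulrBl.
  exact: (L1B mab Ifk (L1Z mab (f x) Ik)).
apply: le_trans (le_normr_Rintegral mab Id) _.
rewrite -lee_fin (Rintegral_fineK mab (L1_normr Id)).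
have mg : measurable_fun setT (fun y => `|(g y - g x)%:E|)%E.
  apply: measurableT_comp => //; apply/measurable_EFinP/measurable_funB => //.
  exact: L1_measurable Ig.
have gxE : g x = f x by rewrite /g patchE mem_set//= in_itv/= !ltW.
apply: (@le_trans _ _ ((n.+1%:R * C)%:E * \int[mu]_(y in ball x s) `|(g y - g x)%:E|)%E).
  rewrite -ge0_integralZl//; last 3 first.
  - exact: measurable_ball.
  - by apply: measurable_funTS.
  - by rewrite lee_fin mulr_ge0// ltW.
  rewrite integral_mkcond [leRHS]integral_mkcond.
  apply: ge0_le_integral => //.
  - by move=> y _; rewrite /patch; case: ifP.
  - apply/(measurable_restrictT _ _).1 => //.
    apply/measurable_EFinP/measurableT_comp => //.
    exact: L1_measurable Id.
  - apply/(measurable_restrictT _ _).1; first exact: measurable_ball.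
    by apply: measurable_funTS; apply: emeasurable_funM => //.
  move=> y _; rewrite /patch.
  have [yab|yab] := boolP (y \in `[a, b]%classic); last first.
    by case: ifP => // _; rewrite mule_ge0// lee_fin mulr_ge0// ltW.
  have gyE : g y = f y by rewrite /g patchE yab.
  have [yB|yB] := boolP (y \in (ball x s : set R)).
    by rewrite gyE gxE lee_fin normrM mulrC ler_wpM2r.
  rewrite kern_out ?mulr0 ?normr0//.
  have := yB; rewrite notin_setE /ball/= => /negP; rewrite -leNgt => ys.
  have [yx|yx] := ltP y x; [by left|right].
  move: ys; rewrite distrC ger0_norm ?subr_ge0// /s.
  by move: n0; set k := _^-1 => k0 ys; lra.
move: Hs; rewrite /davg /iavg -lte_fin fineK//.
rewrite lebesgue_measure_ball ?(ltW s0)// inver ifF; last by rewrite mulrn_eq0/= gt_eqF.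
rewrite /= => Hs.
have nC : 0 < n.+1%:R * C by rewrite mulr_gt0.
rewrite -lee_pdivlMl//.
have s2 : 0 < s *+ 2 by rewrite pmulrn_lgt0.
move: Hs => /ltW; rewrite lee_pdivrMl// -EFinM => /le_trans; apply.
rewrite -EFinM lee_fin /s le_eqVlt; apply/orP; left; apply/eqP.
by field; rewrite ?gt_eqF//= ?nat1r ?pnatr_eq0.
Unshelve. all: by end_near. Qed.

End kernel.

(** * Polynomial approximation *)

Lemma compact_unif_continuous {R : realType} {T : pseudoMetricType R} (K : set T) (f : T -> R) :
  compact K -> {within K, continuous f} -> forall e : R, 0 < e ->
  exists2 k : R, 0 < k & forall x y, K x -> K y -> ball x k y -> `|f x - f y| <= e.
Proof.
move=> /compact_near_coveringP cK cf e e0.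
pose P (k : R) x := K x -> forall y, K y -> ball x k y -> `|f x - f y| <= e.
have : \forall k \near (0 : R)^'+, K `<=` P k.
  apply: cK => x Kx.
  move/subspace_continuousP : cf => /(_ x Kx) /cvgrPdist_le /(_ (e / 2)).
  rewrite divr_gt0// => /(_ isT).
  rewrite /within/= => /nbhs_ballP[d /= d0 Hd].
  exists (ball x (d / 2), [set k | k < d / 2]); first split => /=.
  - by apply: nbhsx_ballx; rewrite divr_gt0.
  - by apply: nbhs_right_lt; rewrite divr_gt0.
  move=> [x' k] [/= xx' kd] Kx' y Ky x'y.
  have h1 : `|f x - f x'| <= e / 2.
    by apply: Hd => //; apply: le_ball xx'; rewrite ler_pdivrMr// ler_pMr// ler1n.
  have h2 : `|f x - f y| <= e / 2.
    apply: Hd => //; rewrite [d]splitr; apply: ball_triangle xx' _.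
    by apply: le_ball x'y; exact: ltW.
  rewrite -(subrKA (f x)) [e]splitr (le_trans (ler_normD _ _))// lerD//.
  by rewrite distrC.
move=> /(filterI (nbhs_right_gt (0 : R))) /filter_ex[k [k0 Hk]].
by exists k => // x y Kx Ky; exact: Hk.
Qed.

Section bernstein.
Context {R : realType}.
Implicit Types (g : nat -> R) (x : R) (p : {poly R}).

(* Bernstein polynomials, through Pascal's recurrence: with [x] as success
   probability, [(bern n g).[x]] is the expectation of [g] under the binomial
   law of parameters [n] and [x]. *)
Fixpoint bern n g : {poly R} :=
  if n is n'.+1 then (1 - 'X) * bern n' g + 'X * bern n' (g \o S) else (g 0%N)%:P.

Lemma bernS n g x :
  (bern n.+1 g).[x] = (1 - x) * (bern n g).[x] + x * (bern n (g \o S)).[x].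
Proof. by rewrite /= !hornerE. Qed.

Lemma bern_le n g1 g2 x : 0 <= x <= 1 -> (forall k, (k <= n)%N -> g1 k <= g2 k) ->
  (bern n g1).[x] <= (bern n g2).[x].
Proof.
move=> /andP[x0 x1]; elim: n g1 g2 => [|n IH] g1 g2 H.
  by rewrite /= !hornerC H.
rewrite !bernS lerD// ler_wpM2l ?subr_ge0//; apply: IH => k kn; apply: H => //.
exact: leqW.
Qed.

(** The first two moments of the binomial law: mean [n x], variance [n x (1 - x)]. *)
Lemma bern_quadratic n (a b c : R) x :
  (bern n (fun k => a + b * k%:R + c * k%:R ^+ 2)).[x] =
  a + b * (n%:R * x) + c * (n%:R * x * (1 - x) + (n%:R * x) ^+ 2).
Proof.
elim: n a b c => [|n IH] a b c; first by rewrite /= hornerC; ring.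
rewrite bernS IH (_ : _ \o S =
    fun k => (a + b + c) + (b + 2 * c) * k%:R + c * k%:R ^+ 2); last first.
  by apply/funext => k /=; rewrite -natr1; ring.
by rewrite IH -natr1; ring.
Qed.

Lemma unif_continuous_itv (f : R -> R) (a b : R) : {within `[a, b], continuous f} ->
  forall e : R, 0 < e -> exists2 k : R, 0 < k & forall x y : R, a <= x <= b -> a <= y <= b ->
    `|x - y| < k -> `|f x - f y| <= e.
Proof.
move=> cf e e0.
have [k k0 Hk] := compact_unif_continuous (@segment_compact R a b) cf e0.
by exists k => // x y xab yab xy; apply: Hk.
Qed.

(** Chebyshev's argument: [f] is squeezed between two parabolas centred at [x]; the Bernstein
    operator is monotone, and at [x] it changes these parabolas by a multiple of the variance
    only. *)
Lemma weierstrass01 (f : R -> R) : {within `[0, 1], continuous f} ->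
  forall e, 0 < e -> exists p, forall x, 0 <= x <= 1 -> `|f x - p.[x]| <= e.
Proof.
move=> cf e e0.
have e20 : 0 < e / 2 by rewrite divr_gt0.
have [d d0 Hd] := unif_continuous_itv cf e20.
have [c _ Hc] := @EVT_max R (fun x => `|f x|) 0 1 ler01
  (fun x => continuous_comp (cf x) (@norm_continuous _ _ _)).
pose M := `|f c|; have M0 : 0 <= M by exact: normr_ge0.
have HM x : 0 <= x <= 1 -> `|f x| <= M by move=> x01; apply: Hc; rewrite in_itv.
(* Beyond distance [d] the parabola exceeds the largest possible oscillation [2 M]; within [d]
   uniform continuity suffices. *)
pose q := 2 * M / d ^+ 2.
have q0 : 0 <= q by apply: divr_ge0; [exact: mulr_ge0|exact: sqr_ge0].
have key x y : 0 <= x <= 1 -> 0 <= y <= 1 -> `|f x - f y| <= e / 2 + q * (x - y) ^+ 2.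
  move=> x01 y01; have [xy|xy] := ltP `|x - y| d.
    by rewrite (le_trans (Hd _ _ x01 y01 xy))// lerDl mulr_ge0 ?sqr_ge0.
  apply: (@le_trans _ _ (2 * M)).
    by rewrite (le_trans (ler_normB _ _))// mulr2n mulrDl mul1r lerD ?HM.
  have h : 2 * M <= q * (x - y) ^+ 2.
    rewrite /q mulrAC ler_pdivlMr ?exprn_gt0// ler_wpM2l ?mulr_ge0//.
    by rewrite -(real_normK (num_real (x - y))) lerXn2r ?nnegrE// ltW.
  by rewrite (le_trans h)// lerDr ltW.
have [n qn] : exists n : nat, q / n.+1%:R <= e / 2.
  have [n _ H] := @near_invSn R (e / 2 / (q + 1)) (divr_gt0 e20 (ltr_wpDl q0 ltr01)).
  exists n; have := H n (leqnn n); rewrite /= ltr_pdivlMr ?ltr_wpDl// => /ltW.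
  by apply: le_trans; rewrite mulrC ler_wpM2l// lerDl.
exists (bern n.+1 (fun k => f (k%:R / n.+1%:R))) => x x01.
have n0 : (n.+1%:R : R) != 0 by rewrite pnatr_eq0.
have k01 (k : nat) : (k <= n.+1)%N -> 0 <= (k%:R / n.+1%:R : R) <= 1.
  move=> kn; rewrite divr_ge0//= ler_pdivrMr// mul1r ler_nat//.
have xx : 0 <= x * (1 - x) <= 1 by case/andP: x01 => x0 x1; nra.
have up : q * (x * (1 - x)) / n.+1%:R <= e / 2.
  case/andP: xx => xx0 xx1; apply: le_trans qn; rewrite ler_wpM2r//.
  by rewrite -[leRHS]mulr1 ler_wpM2l.
rewrite ler_distlC; apply/andP; split.
(* Coefficients of the lower parabola as a polynomial in [k], the node being [k/(n+1)]. *)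
- pose a : R := f x - e / 2 - q * x ^+ 2; pose b : R := 2 * q * x / n.+1%:R.
  pose cc := - q / n.+1%:R ^+ 2.
  apply: (@le_trans _ _ (bern n.+1 (fun k => a + b * k%:R + cc * k%:R ^+ 2)).[x]).
    rewrite bern_quadratic /a /b /cc.
    rewrite [leRHS](_ : _ = f x - e / 2 - q * (x * (1 - x)) / n.+1%:R); last by field; rewrite nat1r.
    by move: up; set X := _ / _; move=> ?; lra.
  apply: bern_le => // k kn; have := key x (k%:R / n.+1%:R) x01 (k01 k kn).
  rewrite ler_distlC => /andP[H _].
  have -> : a + b * k%:R + cc * k%:R ^+ 2 = f x - (e / 2 + q * (x - k%:R / n.+1%:R) ^+ 2).
    by rewrite /a /b /cc; field; rewrite nat1r.
  by move: H; set X := f (_ / _); set Y := q * _; move=> ?; lra.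
- pose a : R := f x + e / 2 + q * x ^+ 2; pose b : R := - (2 * q * x / n.+1%:R).
  pose cc := q / n.+1%:R ^+ 2.
  apply: (@le_trans _ _ (bern n.+1 (fun k => a + b * k%:R + cc * k%:R ^+ 2)).[x]); last first.
    rewrite bern_quadratic /a /b /cc.
    rewrite [leLHS](_ : _ = f x + e / 2 + q * (x * (1 - x)) / n.+1%:R); last by field; rewrite nat1r.
    by move: up; set X := _ / _; move=> ?; lra.
  apply: bern_le => // k kn; have := key x (k%:R / n.+1%:R) x01 (k01 k kn).
  rewrite ler_distlC => /andP[_ H].
  have -> : a + b * k%:R + cc * k%:R ^+ 2 = f x + (e / 2 + q * (x - k%:R / n.+1%:R) ^+ 2).
    by rewrite /a /b /cc; field; rewrite nat1r.
  by move: H; set X := f (_ / _); set Y := q * _; move=> ?; lra.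
Qed.

Lemma weierstrass (f : R -> R) : continuous f ->
  forall e, 0 < e -> exists p, forall x, -1 <= x <= 1 -> `|f x - p.[x]| <= e.
Proof.
move=> cf e e0.
have cf' : {within `[0, 1], continuous (fun x => f (2 * x - 1))}.
  apply: continuous_subspaceT => x.
  apply: continuous_comp; last exact: cf.
  by apply: cvgB; [apply: cvgM; [exact: cvg_cst|exact: cvg_id]|exact: cvg_cst].
have [p Hp] := weierstrass01 cf' e0.
exists (p \Po (2^-1 *: ('X + 1))) => x /andP[x0 x1].
rewrite horner_comp !hornerE.
have := Hp (2^-1 * (x + 1)); rewrite (_ : 2 * _ - 1 = x); last by field.
by apply; apply/andP; split; lra.
Qed.

(** At [i = 0] the convention [0^-1 = 0] gives the constant term 0. *)
Definition primp p : {poly R} := \poly_(i < (size p).+1) (p`_i.-1 / i%:R).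

Lemma deriv_primp p : (primp p)^`() = p.
Proof.
apply/polyP => i; rewrite coef_deriv coef_poly ltnS.
case: ltnP => ip; last by rewrite mul0rn nth_default.
by rewrite /= -[LHS]mulr_natr mulfVK// pnatr_eq0.
Qed.

Lemma is_derive_horner p x : is_derive x 1 (horner p) (p^`().[x]).
Proof. by rewrite derivE derive1E; apply/derivableP/derivable_horner. Qed.

Lemma is_derive_primp p x : is_derive x 1 (horner (primp p)) p.[x].
Proof. by rewrite -[in X in is_derive _ _ _ X](deriv_primp p); exact: is_derive_horner. Qed.

End bernstein.

(** * Weak derivatives on an interval *)

Section primitives.
Context {R : realType}.
Local Notation mu := (@mu1 R).
Local Notation L1 D f := (mu.-integrable D (EFin \o f)).
Local Notation I := (`[(-1 : R), (1 : R)]%classic : set (measurableTypeR R)).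
Implicit Types (al be : R -> R) (p : {poly R}) (x y z : R).

Lemma measurable_cc (a b : R) : measurable (`[a, b]%classic : set (measurableTypeR R)).
Proof. exact: measurable_itv. Qed.
Let mI : measurable I := measurable_cc (-1) 1.

Lemma L1_continuous (a b : R) (f : R -> R) : {within `[a, b], continuous f} -> L1 `[a, b] f.
Proof. by move=> cf; apply: continuous_compact_integrable => //; exact: segment_compact. Qed.

Lemma L1_horner p D : D `<=` I -> measurable D -> L1 D (horner p).
Proof.
move=> DI mD; apply: integrableS DI _ => //; apply: L1_continuous.
exact/continuous_subspaceT/continuous_horner.
Qed.

Lemma Rint_cst (a b c : R) : a <= b -> \int[mu]_(x in `[a, b]) c = c * (b - a).
Proof.
move=> ab; have dc (x : R) : is_derive x 1 (fun x : R => c * x) c.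
  by apply: is_derive_eq; rewrite /GRing.scale/= !(mulr1, mulr0, addr0).
rewrite (Rintegral_derive ab _ dc) ?mulrBr//.
by move=> x; exact: cvg_cst.
Qed.

Lemma poly_approx al : L1 I al -> exists p_ : nat -> {poly R},
  forall n, \int[mu]_(z in I) `|al z - (p_ n).[z]| <= n.+1%:R^-1.
Proof.
move=> Ial.
suff H (e : R) : 0 < e -> exists p, \int[mu]_(z in I) `|al z - p.[z]| <= e.
  have H' n : exists p, \int[mu]_(z in I) `|al z - p.[z]| <= n.+1%:R^-1.
    by apply: H; rewrite invr_gt0.
  by exists (fun n => projT1 (cid (H' n))) => n; exact: projT2 (cid (H' n)).
move=> e0; have Ioo : (mu I < +oo)%E by exact: mu1_itv_lty.
have [g_ [cg Ig]] := approximation_continuous_integrable mI Ioo Ial.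
move=> /fine_cvgP[fin /cvgrPdist_lt/(_ (e / 2))]; rewrite divr_gt0// => /(_ isT).
move=> /(filterI fin) /filter_ex[n [fn Hn]].
(* The interval has length 2, so a uniform error [e / 4] costs [e / 2] in L_1. *)
have e40 : 0 < e / 4 by rewrite divr_gt0.
have [p Hp] := weierstrass (cg n) e40; exists p.
have Ip := L1_horner p (@subset_refl _ I) mI.
have I1 := L1_normr (L1B mI Ial (Ig n)).
have I2 := L1_normr (L1B mI (Ig n) Ip).
have I3 := L1_normr (L1B mI Ial Ip).
apply: (@le_trans _ _ (\int[mu]_(z in I) (`|al z - g_ n z| + `|g_ n z - p.[z]|))).
  apply: le_Rintegral => //; first exact: L1D.
  by move=> z _; rewrite (le_trans _ (ler_normD _ _))// subrKA.
rewrite RintegralD// [e]splitr lerD//.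
  move: Hn; rewrite /= sub0r normrN => /ltW; apply: le_trans.
  by rewrite (le_trans _ (ler_norm _)).
apply: (@le_trans _ _ (\int[mu]_(z in I) (e / 4))).
  apply: le_Rintegral => //; first exact: L1_cst.
rewrite Rint_cst; lra.
Qed.

Definition prim al z := \int[mu]_(y in `[-1, z]) al y.

Lemma prim_N1 al : prim al (-1) = 0.
Proof. by rewrite /prim set_itv1 Rintegral_set1. Qed.

Lemma prim_sub al x y : L1 I al -> -1 <= x -> x <= y -> y <= 1 ->
  prim al y - prim al x = \int[mu]_(z in `[x, y]) al z.
Proof.
move=> Ial x0 xy y1.
have Iy : L1 `[-1, y] al by apply: L1_subitv Ial _; apply: subset_itvl; rewrite bnd_simp.
rewrite /prim (@Rintegral_itvB _ _ (BLeft (-1)) (BRight y) x) ?bnd_simp//.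
rewrite (Rintegral_itv_cc false false)//.
by apply: L1_subitv Iy _; apply: subset_itvr; rewrite bnd_simp.
Qed.

Lemma primD al be z : L1 I al -> L1 I be -> -1 <= z <= 1 ->
  prim (fun x => al x - be x) z = prim al z - prim be z.
Proof.
move=> Ia Ib /andP[z0 z1]; rewrite /prim RintegralB//; try exact: measurable_cc.
  by apply: L1_subitv Ia _; apply: subset_itvl; rewrite bnd_simp.
by apply: L1_subitv Ib _; apply: subset_itvl; rewrite bnd_simp.
Qed.

Lemma le_Rintegral_subset (a b c d : R) (f : R -> R) : (forall x, 0 <= f x) -> L1 `[a, b] f ->
  a <= c -> d <= b -> \int[mu]_(x in `[c, d]) f x <= \int[mu]_(x in `[a, b]) f x.
Proof.
move=> f0 If ac db.
have sub : (`[c, d]%classic : set R) `<=` `[a, b].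
  by apply: subset_itv; rewrite bnd_simp.
have If' := L1_subitv If sub.
rewrite -lee_fin !Rintegral_fineK//; try exact: measurable_cc.
apply: ge0_subset_integral => //; try exact: measurable_cc.
  by case/integrableP : If.
by move=> x _; rewrite lee_fin.
Qed.

Lemma normr_prim_le al z : L1 I al -> -1 <= z <= 1 ->
  `|prim al z| <= \int[mu]_(y in I) `|al y|.
Proof.
move=> Ia /andP[z0 z1].
have Iz : L1 `[-1, z] al by apply: L1_subitv Ia _; apply: subset_itvl; rewrite bnd_simp.
apply: le_trans (le_normr_Rintegral (measurable_cc _ _) Iz) _.
by apply: le_Rintegral_subset => //; exact: L1_normr.
Qed.

Lemma prim_horner p z : -1 <= z -> prim (horner p) z = (primp p).[z] - (primp p).[-1].
Proof.
by move=> z0; apply: Rintegral_derive => //; [exact: continuous_horner|exact: is_derive_primp].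
Qed.

Lemma prim_continuous al : L1 I al -> {within `[-1, 1], continuous (prim al)}.
Proof. by move=> Ia; apply: (@parameterized_integral_continuous R (-1) 1 al). Qed.

Lemma is_derive_prim al z : {within `[-1, 1], continuous al} -> -1 < z < 1 ->
  is_derive z 1 (prim al) (al z).
Proof.
move=> ca /andP[z0 z1].
have [|d1 d2] := @continuous_FTC1_closed R al (-1) z 1 z1 (L1_continuous ca) z0.
  by apply: (within_continuous_continuous _ ca); rewrite ?in_itv/= ?z0.
by apply: DeriveDef; [exact: d1|rewrite -derive1E; exact: d2].
Qed.

(* The primitive of an integrable function is integrated by parts against a C^1
   function after replacing the integrand by polynomials. *)
Lemma ibp_prim al (c a b : R) (X X' : R -> R) : L1 I al -> -1 <= a -> a < b -> b <= 1 ->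
  {within `[a, b], continuous X'} -> derivable_oo_LRcontinuous X a b ->
  {in `]a, b[, derive1 X =1 X'} ->
  \int[mu]_(z in `[a, b]) (X z * al z) =
  X b * (c + prim al b) - X a * (c + prim al a) - \int[mu]_(z in `[a, b]) (X' z * (c + prim al z)).
Proof.
move=> Ia a0 ab b1 cX' dX XX'.
have mab := measurable_cc a b.
have cX := derivable_oo_LRcontinuous_within dX.
have sub : (`[a, b]%classic : set R) `<=` `[-1, 1] by apply: subset_itv; rewrite bnd_simp.
have Iab f : L1 I f -> L1 `[a, b] f by move=> If; exact: L1_subitv If sub.
have bnd (Y : R -> R) : {within `[a, b], continuous Y} ->
    exists2 C : R, 0 <= C & forall z : R, `[a, b]%classic z -> `|Y z| <= C.
  move=> cY; have cN : {within `[a, b], continuous (fun z => `|Y z|)}.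
    by move=> z; apply: cvg_norm; exact: cY.
  by have [k _ Hk] := EVT_max (ltW ab) cN; exists `|Y k| => // z zab; exact: Hk.
have mY (Y : R -> R) : {within `[a, b], continuous Y} -> measurable_fun `[a, b] Y.
  by move=> cY; apply: L1_measurable (L1_continuous cY).
have [C C0 HC] := bnd _ cX; have [C' C'0 HC'] := bnd _ cX'.
have [p_ Hp] := poly_approx Ia.
have Ipp n : L1 I (horner (p_ n)) by apply: L1_horner.
(* Error per unit of [d]: [C] at each endpoint, [C' (b - a)] for the integral with [X'], and [C] for
   the integral with [X]. *)
pose K := 2 * C + C' * (b - a) + C.
have K0 : 0 <= K by rewrite !addr_ge0 ?mulr_ge0 ?subr_ge0 ?(ltW ab).
apply/eqP; rewrite -subr_eq0 -normr_le0; apply/ler_addgt0Pr => e e0; rewrite add0r.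
have [n nK] : exists n : nat, n.+1%:R^-1 * K <= e.
  have [n _ H] := @near_invSn R (e / (K + 1)) (divr_gt0 e0 (ltr_wpDl K0 ltr01)).
  exists n; have := H n (leqnn n); rewrite /= ltr_pdivlMr ?ltr_wpDl// => /ltW.
  by apply: le_trans; rewrite ler_wpM2l// lerDl.
set d : R := n.+1%:R^-1 in nK.
have dprim z : -1 <= z <= 1 -> `|prim al z - prim (horner (p_ n)) z| <= d.
  move=> zI; rewrite -primD//; apply: le_trans (Hp n).
  by apply: normr_prim_le => //; exact: L1B.
pose A z := c + prim al z; pose B z := c - (primp (p_ n)).[-1] + (primp (p_ n)).[z].
have dA z : -1 <= z <= 1 -> `|A z - B z| <= d.
  move=> /[dup] zI /andP[z0 _].
  by have := dprim z zI; rewrite prim_horner// /A /B; congr (`|_| <= _); ring.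
have cB : continuous B.
  by move=> z; apply: cvgD; [exact: cvg_cst|exact: continuous_horner].
have dB z : is_derive z 1 B (p_ n).[z].
  have := is_derive_primp (p_ n) z => ?.
  rewrite /B; by apply: is_derive_eq; rewrite !(add0r, mul1r).
have ibpB := @Rintegration_by_parts R X B X' (horner (p_ n)) a b ab cX' dX XX'
  (continuous_subspaceT (@continuous_horner _ (p_ n))).
have {}ibpB : \int[mu]_(z in `[a, b]) (X z * (p_ n).[z]) =
    X b * B b - X a * B a - \int[mu]_(z in `[a, b]) (X' z * B z).
  apply: ibpB; last by move=> z _; rewrite derive1E; exact: derive_val.
  split; first by move=> z _; exact: ex_derive.
    by apply: cvg_at_right_filter; exact: cB.
  by apply: cvg_at_left_filter; exact: cB.
have IXa : L1 `[a, b] (fun z => X z * al z) by exact (L1M mab (mY _ cX) HC (Iab _ Ia)).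
have IXp : L1 `[a, b] (fun z => X z * (p_ n).[z]) by exact (L1M mab (mY _ cX) HC (Iab _ (Ipp n))).
have cA : {within `[a, b], continuous A}.
  have cA1 := continuous_subspaceW sub (prim_continuous Ia).
  by move=> z; apply: cvgD; [exact: cvg_cst|exact: cA1].
have IA := L1_continuous cA.
have IB : L1 `[a, b] B by apply: L1_continuous; exact: continuous_subspaceT.
have IXA : L1 `[a, b] (fun z => X' z * A z) by exact (L1M mab (mY _ cX') HC' IA).
have IXB : L1 `[a, b] (fun z => X' z * B z) by exact (L1M mab (mY _ cX') HC' IB).
have e1 : `|\int[mu]_(z in `[a, b]) (X z * al z) - \int[mu]_(z in `[a, b]) (X z * (p_ n).[z])| <= C * d.
  rewrite -RintegralB//.
  rewrite (_ : \int[mu]_(z in _) _ = \int[mu]_(z in `[a, b]) (X z * (al z - (p_ n).[z]))); last first.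
    by apply: eq_Rintegral => z _; rewrite mulrBr.
  have Id := L1B mab (Iab _ Ia) (Iab _ (Ipp n)).
  apply: le_trans (normr_Rintegral_le mab Id (mY _ cX) HC) _.
  rewrite ler_wpM2l//; apply: le_trans (Hp n).
  by apply: le_Rintegral_subset => //; exact/L1_normr/L1B.
have e2 : `|\int[mu]_(z in `[a, b]) (X' z * A z) - \int[mu]_(z in `[a, b]) (X' z * B z)| <= C' * (d * (b - a)).
  rewrite -RintegralB//.
  rewrite (_ : \int[mu]_(z in _) _ = \int[mu]_(z in `[a, b]) (X' z * (A z - B z))); last first.
    by apply: eq_Rintegral => z _; rewrite mulrBr.
  have Id := L1B mab IA IB.
  apply: le_trans (normr_Rintegral_le mab Id (mY _ cX') HC') _.
  rewrite ler_wpM2l// -Rint_cst ?(ltW ab)//.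
  apply: le_Rintegral => //; [exact: L1_normr|apply: L1_cst => //; exact: mu1_itv_lty|].
  by move=> z zab; apply: dA; exact: (sub _ zab).
have Pb : `|X b * A b - X b * B b| <= C * d.
  rewrite -mulrBr normrM ler_pM//; last by apply: dA; move: a0 ab b1; clear; move=> *; apply/andP; split; lra.
  by apply: HC; rewrite /= in_itv/= lexx ltW.
have Pa : `|X a * A a - X a * B a| <= C * d.
  rewrite -mulrBr normrM ler_pM//; last by apply: dA; move: a0 ab b1; clear; move=> *; apply/andP; split; lra.
  by apply: HC; rewrite /= in_itv/= lexx ltW.
apply: le_trans nK; rewrite /K -/(A b) -/(A a).
rewrite (_ : \int[mu]_(z in `[a, b]) (X' z * (c + prim al z)) = \int[mu]_(z in `[a, b]) (X' z * A z))//.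
move: e1 e2 Pb Pa; rewrite ibpB.
move: (\int[mu]_(z in `[a, b]) (X z * al z)) (\int[mu]_(z in `[a, b]) (X' z * A z))
  (\int[mu]_(z in `[a, b]) (X' z * B z)) => i1 i2 i3.
rewrite !ler_norml; clear => /andP[? ?] /andP[? ?] /andP[? ?] /andP[? ?].
by apply/andP; split; lra.
Qed.

End primitives.

Section weak_derivatives.
Context {R : realType}.
Local Notation mu := (@mu1 R).
Local Notation L1 D f := (mu.-integrable D (EFin \o f)).
Local Notation I := (`[(-1 : R), (1 : R)]%classic : set (measurableTypeR R)).
Implicit Types (al f g : R -> R) (p : {poly R}) (x y z a b : R).

Let mI : measurable I := measurable_cc (-1) 1.
Let mJ : measurable (J R : set (measurableTypeR R)) := measurable_J.

Lemma J_sub : (J R : set R) `<=` `[-1, 1].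
Proof. exact: subset_itv_oo_cc. Qed.

Lemma J_lty : (mu (J R) < +oo)%E.
Proof. exact: mu1_itv_lty. Qed.

Lemma L1_JI f : L1 (J R) f -> L1 I f.
Proof. exact: L1_itv_cc. Qed.

Lemma L1_IJ f : L1 I f -> L1 (J R) f.
Proof. by move=> If; apply: (@L1_subitv _ `[-1, 1] `]-1, 1[ _ If); exact: J_sub. Qed.

Lemma Rintegral_JI f : L1 I f -> \int[mu]_(z in J R) f z = \int[mu]_(z in I) f z.
Proof. exact: Rintegral_itv_cc. Qed.

Lemma ae_itv_ex a b (P : R -> Prop) : a < b -> {ae mu, forall z, P z} ->
  exists2 z, a < z < b & P z.
Proof.
move=> ab aeP; apply: contrapT => H.
have : mu.-negligible `]a, b[.
  apply: negligibleS aeP => z; rewrite /= in_itv/= => zab Pz.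
  by apply: H; exists z.
move=> /(negligibleP mu (measurable_itv `]a, b[)) H0.
have {H0} := etrans (esym (lebesgue_measure_itv `]a, b[)) H0.
rewrite /= lte_fin ab -EFinB => /eqP; rewrite eqe => /eqP; lra.
Qed.

Lemma test_function_kern n x : -1 < x -> x + n.+1%:R^-1 < 1 -> test_function (J R) (kern n x).
Proof.
move=> x0 x1; split; first exact: smooth_kern.
exists `[x, x + n.+1%:R^-1]%classic; split; first exact: segment_compact.
  by apply: subset_itv; rewrite bnd_simp.
move=> y /= /negP; rewrite in_itv/= negb_and -!ltNge => H.
by apply: kern_out; apply/orP.
Qed.

Lemma test_function_kstep n x y : -1 < x -> x <= y -> y + n.+1%:R^-1 < 1 ->
  test_function (J R) (fun z => kstep n x z - kstep n y z).
Proof.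
move=> x0 xy y1; split; first by apply: smoothB; exact: smooth_kstep.
exists `[x, y + n.+1%:R^-1]%classic; split; first exact: segment_compact.
  by apply: subset_itv; rewrite bnd_simp.
move=> z /= /negP; rewrite in_itv/= negb_and -!ltNge => /orP[zx|zy].
  by rewrite !kstep_le ?subrr// ltW// (lt_le_trans zx).
by rewrite !kstep_ge ?subrr// ?(ltW zy)// (le_trans _ (ltW zy))// lerD2r.
Qed.

Lemma Rintegral_J_sub a b f : -1 < a -> b < 1 ->
  (forall z, z < a \/ b < z -> f z = 0) -> L1 `[a, b] f ->
  L1 (J R) f /\ \int[mu]_(z in J R) f z = \int[mu]_(z in `[a, b]) f z.
Proof.
move=> a1 b1 f0 If.
have E : f \_ (J R) = f \_ `[a, b].
  apply/funext => z; rewrite !patchE.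
  have [zab|nab] := pselect (`[a, b]%classic z).
    rewrite [z \in J R]mem_set ?[z \in `[a, b]%classic]mem_set//.
    by move: zab; rewrite /J/= !in_itv/= => /andP[? ?]; apply/andP; split; lra.
  rewrite [z \in `[a, b]%classic]memNset//; case: ifP => // _; apply: f0.
  by apply/orP; move: nab => /= /negP; rewrite in_itv/= negb_and -!ltNge.
split; last by rewrite Rintegral_mkcond [RHS]Rintegral_mkcond E.
by apply/(L1_patch _ mJ); rewrite E; apply/L1_patch => //; exact: measurable_cc.
Qed.

Lemma weak_deriv1_prim al c A : L1 I al -> (forall z, J R z -> A z = c + prim al z) ->
  weak_deriv1 A al.
Proof.
move=> Ia AE.
have ca := prim_continuous Ia.
have cA : {within `[-1, 1], continuous (fun z => c + prim al z)}.
  by move=> z; apply: cvgD; [exact: cvg_cst|exact: ca].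
have IcA := L1_continuous cA.
have IA : L1 (J R) A.
  apply: (eq_L1 mJ _ (L1_IJ IcA)) => z; rewrite inE => zJ.
  by rewrite AE.
have loc f : L1 (J R) f -> L1loc1 f.
  move=> If; split; first exact: L1_measurable If.
  by move=> K cK KJ; apply: integrableS If => //; exact: compact_measurable.
split; [exact: loc|exact/loc/L1_IJ|].
move=> phi [sphi [K [cK KJ phi0]]].
have out z : ~ J R z -> phi z = 0 by move=> nJ; apply: phi0 => /KJ.
have sphi' : smooth (derive1 phi).
  rewrite (_ : derive1 _ = 'D_1 phi); first exact: smoothD1.
  by apply/funext => z; rewrite derive1E.
have cphi := smooth_continuous sphi; have cphi' := smooth_continuous sphi'.
have := @ibp_prim R al c (-1) 1 phi (derive1 phi) Ia (lexx _) ltac:(lra) (lexx _)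
  (continuous_subspaceT cphi').
have dphi : derivable_oo_LRcontinuous phi (-1) 1.
  split; first by move=> z _; exact: smooth_derivable.
    by apply: cvg_at_right_filter; exact: cphi.
  by apply: cvg_at_left_filter; exact: cphi.
move=> /(_ dphi (fun _ _ => erefl)).
have p1 : phi 1 = 0 by apply: out; rewrite /J/= in_itv/= ltxx andbF.
have pN1 : phi (-1) = 0 by apply: out; rewrite /J/= in_itv/= ltxx.
rewrite p1 pN1 !mul0r subrr add0r => E.
rewrite (Rintegral_JI (f := fun z => al z * phi z)); last first.
  apply/L1_JI; have Ipa : L1 I (fun z => phi z * al z).
    have [C _ HC] := @EVT_max R (fun x => `|phi x|) (-1) 1 ltac:(lra)
      (continuous_subspaceT (fun x => cvg_norm (cphi x))).
    exact (L1M mI (L1_measurable (L1_continuous (continuous_subspaceT cphi))) (HC : forall z, I z -> _) Ia).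
  by apply: (eq_L1 mJ _ (L1_IJ Ipa)) => z _; rewrite mulrC.
rewrite (_ : \int[mu]_(z in I) (al z * phi z) = \int[mu]_(z in `[-1, 1]) (phi z * al z)); last first.
  by apply: eq_Rintegral => z _; rewrite mulrC.
rewrite E opprK.
rewrite (_ : \int[mu]_(z in J R) (A z * derive1 phi z) = \int[mu]_(z in J R) (derive1 phi z * (c + prim al z))); last first.
  by apply: eq_Rintegral => z; rewrite inE => zJ; rewrite AE// mulrC.
apply: Rintegral_JI; apply: L1_continuous.
by move=> z; apply: cvgM; [exact: continuous_subspaceT|exact: cA].
Qed.

Lemma L1loc1_cc f a b : L1loc1 f -> -1 < a -> b < 1 -> L1 `[a, b] f.
Proof.
move=> [mf If] a1 b1; apply: If; first exact: segment_compact.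
by apply: subset_itv; rewrite bnd_simp.
Qed.

(** The difference of two weak derivatives is orthogonal to every [kern n z] supported inside, and
    these integrals tend to the difference at almost every [z]. *)
Lemma weak_deriv1_unique f g1 g2 : weak_deriv1 f g1 -> weak_deriv1 f g2 ->
  {ae mu, forall z, J R z -> g1 z = g2 z}.
Proof.
move=> [_ l1 H1] [_ l2 H2].
(* Weak derivatives are locally integrable only, so []-1, 1[] is exhausted by compact intervals; the
   shift by 2 keeps the first of them nondegenerate. *)
pose k (m : nat) : R := m.+2%:R^-1.
have k0 m : 0 < k m by rewrite invr_gt0.
have k2 m : k m <= 2^-1 by rewrite lef_pV2 ?posrE// ler_nat.
have ab m : -1 + k m < 1 - k m by have := k2 m; lra.
have Id m : L1 `[-1 + k m, 1 - k m] (fun z => g1 z - g2 z).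
  apply: L1B; first exact: measurable_cc.
    by apply: L1loc1_cc => //; have := k0 m; lra.
  by apply: L1loc1_cc => //; have := k0 m; lra.
have main : {ae mu, forall z, forall m, -1 + k m < z < 1 - k m ->
    \int[mu]_(y in `[-1 + k m, 1 - k m]) ((g1 y - g2 y) * kern n z y) @[n --> \oo] --> g1 z - g2 z}.
  by apply: ae_foralln => m; exact: cvg_kern (ab m) (Id m).
apply: ae_imp main => z H; rewrite /J/= in_itv/= => /andP[z0 z1].
have [m [zm0 zm1]] : exists m, -1 + k m < z /\ z < 1 - k m.
  have e0 : 0 < Num.min (z + 1) (1 - z) by rewrite lt_min; apply/andP; split; lra.
  have [N _ HN] := near_invSn e0.
  have h : k N < Num.min (z + 1) (1 - z) := HN N.+1 (leqnSn N).
  by exists N; move: h; rewrite lt_min; move: (k N) => t /andP[? ?]; split; lra.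
have {}H := H m; rewrite zm0 zm1 in H; have {}H := H isT.
apply/eqP; rewrite -subr_eq0; apply/eqP.
apply: (@cvg_unique _ (@norm_hausdorff _ _) _ _ _ _ H).
apply: (@cvg_trans _ ((fun=> 0 : R) @ \oo)); last exact: cvg_cst.
apply: near_eq_cvg; near=> n.
have n1 : n.+1%:R^-1 < 1 - k m - z by near: n; apply: near_invSn; lra.
have zn : z + n.+1%:R^-1 < 1 - k m by rewrite -ltrBrDl.
have kout y : y < -1 + k m \/ 1 - k m < y -> kern n z y = 0.
  by move=> []yk; apply: kern_out; [left|right]; [exact: lt_trans yk _|exact: lt_trans zn _].
have ck : {within `[-1 + k m, 1 - k m], continuous (kern n z)}.
  by apply: continuous_subspaceT; exact/smooth_continuous/smooth_kern.
have [C _ HC] := @EVT_max R (fun x => `|kern n z x|) _ _ (ltW (ab m)) (fun x => cvg_norm (ck x)).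
have mab := measurable_cc (-1 + k m) (1 - k m).
have J1 g : L1loc1 g -> L1 (J R) (fun y => g y * kern n z y) /\
    \int[mu]_(y in J R) (g y * kern n z y) = \int[mu]_(y in `[-1 + k m, 1 - k m]) (g y * kern n z y).
  move=> lg; apply: Rintegral_J_sub.
  - by have := k0 m; lra.
  - by have := k0 m; lra.
  - by move=> y /kout ->; rewrite mulr0.
  - have Ig : L1 `[-1 + k m, 1 - k m] g by apply: L1loc1_cc => //; have := k0 m; lra.
    have H3 := L1M mab (L1_measurable (L1_continuous ck)) (HC : forall y, `[-1 + k m, 1 - k m]%classic y -> _) Ig.
    by apply: (eq_L1 mab _ H3) => y _; rewrite mulrC.
have [I1 E1] := J1 _ l1; have [I2 E2] := J1 _ l2.
have tk : test_function (J R) (kern n z).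
  apply: test_function_kern; first by have := k0 m; lra.
  by rewrite (lt_trans zn)// ltrBlDr ltrDl.
have E : \int[mu]_(y in J R) (g1 y * kern n z y) = \int[mu]_(y in J R) (g2 y * kern n z y).
  by apply: oppr_inj; rewrite -H1// -H2.
have sJ : (`[-1 + k m, 1 - k m]%classic : set R) `<=` J R.
  by have := k0 m; move=> ?; apply: subset_itv; rewrite bnd_simp; lra.
have J2 g : L1 (J R) g -> L1 `[-1 + k m, 1 - k m] g by move=> Ig; apply: integrableS Ig.
transitivity (\int[mu]_(y in `[-1 + k m, 1 - k m]) (g1 y * kern n z y - g2 y * kern n z y)).
  rewrite RintegralB//; [|exact: J2|exact: J2].
  by rewrite -E1 -E2 E subrr.
by apply: eq_Rintegral => y _; rewrite mulrBl.
Unshelve. all: by end_near. Qed.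

(** Testing with [kstep n x - kstep n y], which tends to the indicator of []x, y]] and has
    derivative [kern n x - kern n y], yields the increment of [f] between two points where
    [cvg_kern] holds. One such point [x0] fixes the constant. *)
Lemma weak_deriv1_primitive f g : weak_deriv1 f g -> L1 (J R) f -> L1 (J R) g ->
  exists c, {ae mu, forall z, J R z -> f z = c + prim g z}.
Proof.
move=> [_ _ H] If Ig.
have IfI := L1_JI If; have IgI := L1_JI Ig.
have [C C0 HC] : exists2 C : R, 0 < C & forall n x y, `|kern n x y| <= n.+1%:R * C.
  have [C C0 HC] := @derive1_step_bounded R; exists C => // n x y.
  by rewrite /kern normrM normr_nat ler_wpM2l.
have mk n x D : measurable D -> measurable_fun D (kern n x : measurableTypeR R -> R).
  move=> mD; apply: measurable_funTS; apply: continuous_measurable_fun.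
  exact/smooth_continuous/smooth_kern.
have mks n x D : measurable D -> measurable_fun D (kstep n x : measurableTypeR R -> R).
  move=> mD; apply: measurable_funTS; apply: continuous_measurable_fun.
  exact/smooth_continuous/smooth_kstep.
have N11 : (-1 : R) < 1 by lra.
have good := cvg_kern N11 IfI.
pose G x := -1 < x < 1 -> \int[mu]_(y in `[-1, 1]) (f y * kern n x y) @[n --> \oo] --> f x.
have key x y : -1 < x -> x < y -> y < 1 -> G x -> G y -> f y - f x = prim g y - prim g x.
  move=> x0 xy y1 Gx Gy.
  have {}Gx := Gx ltac:(apply/andP; split; lra).
  have {}Gy := Gy ltac:(apply/andP; split; lra).
  pose phi n z := kstep n x z - kstep n y z.
  have phi1 n z : `|phi n z| <= 1.
    rewrite /phi /kstep; move: (step_ge0 (n.+1%:R * (z - x))) (step_le1 (n.+1%:R * (z - x)))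
      (step_ge0 (n.+1%:R * (z - y))) (step_le1 (n.+1%:R * (z - y))).
    move: (step _) (step _) => s t ? ? ? ?; rewrite ler_norml; apply/andP; split; lra.
  (* Open on the left, since [kstep n x] vanishes at [x] itself and tends to 1 at every later
     point. *)
  pose l := g \_ `]x, y].
  have subI : (`]x, y]%classic : set R) `<=` `[-1, 1].
    by apply: subset_itv; rewrite bnd_simp; lra.
  have lE : \int[mu]_(z in I) l z = \int[mu]_(z in `]x, y]) g z.
    rewrite Rintegral_mkcond [RHS]Rintegral_mkcond; congr Rintegral; apply/funext => z.
    rewrite patchE; case: ifPn => //; rewrite notin_setE => nI.
    by rewrite /l patchE memNset// => /subI.
  have mphi n D : measurable D -> measurable_fun D (phi n : measurableTypeR R -> R).
    by move=> mD; apply: measurable_funB; exact: mks.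
  have ml : measurable_fun I (l : measurableTypeR R -> R).
    apply: measurable_funTS; apply/(measurable_restrictT _ _).1; first exact: measurable_itv.
    exact: measurable_funS mI subI (L1_measurable IgI).
  have lim1 : \int[mu]_(z in I) (phi n z * g z) @[n --> \oo] --> \int[mu]_(z in I) l z.
    apply: (cvg_Rintegral mI _ ml _ (L1_normr IgI)).
    - by move=> n; apply: measurable_funM; [exact: mphi|exact: L1_measurable IgI].
    - apply: aeW => z _; rewrite /l patchE; case: ifPn; rewrite ?inE ?notin_setE/= in_itv/=.
        move=> /andP[xz zy].
        apply: (@cvg_trans _ ((fun=> g z) @ \oo)); last exact: cvg_cst.
        apply: near_eq_cvg; near=> n; rewrite /phi kstep_ge; first by rewrite kstep_le// subr0 mul1r.
        rewrite -lerBrDl ltW//; near: n; apply: near_invSn; lra.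
      move=> /negP; rewrite negb_and -leNgt -ltNge => /orP[zx|yz].
        apply: (@cvg_trans _ ((fun=> 0 : R) @ \oo)); last exact: cvg_cst.
        by apply: near_eq_cvg; near=> n; rewrite /phi !kstep_le ?subrr ?mul0r//; lra.
      apply: (@cvg_trans _ ((fun=> 0 : R) @ \oo)); last exact: cvg_cst.
      apply: near_eq_cvg; near=> n.
      have zy : y + n.+1%:R^-1 <= z.
        by rewrite -lerBrDl ltW//; near: n; apply: near_invSn; lra.
      by rewrite /phi !kstep_ge ?subrr ?mul0r// (le_trans _ zy)// lerD2r ltW.
    - by apply: aeW => z _ n; rewrite normrM ler_piMl.
  have lim2 : (\int[mu]_(z in `[-1, 1]) (f z * kern n x z) -
      \int[mu]_(z in `[-1, 1]) (f z * kern n y z)) @[n --> \oo] --> f x - f y.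
    exact: cvgB Gx Gy.
  have {}lim1 : (- (\int[mu]_(z in I) (phi n z * g z))) @[n --> \oo] --> - (\int[mu]_(z in I) l z).
    exact: cvgN.
  have Ifk n w : L1 I (fun z => f z * kern n w z).
    have H3 := L1M mI (mk n w _ mI) (fun z _ => HC n w z) IfI.
    by apply: (eq_L1 mI _ H3) => z _; rewrite mulrC.
  have lim3 : (- (\int[mu]_(z in I) (phi n z * g z))) @[n --> \oo] --> f x - f y.
    apply: cvg_trans lim2; apply: near_eq_cvg; near=> n.
    have n1 : n.+1%:R^-1 < 1 - y by near: n; apply: near_invSn; lra.
    have t1 : test_function (J R) (phi n).
      by apply: test_function_kstep; rewrite ?(ltW xy)// -ltrBrDl.
    have dphi : derive1 (phi n) = fun z => kern n x z - kern n y z.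
      apply/funext => z; rewrite derive1E; apply: derive_val.
      have k1 := is_derive_kstep n x z; have k2 := is_derive_kstep n y z.
      exact (derB k1 k2).
    have := H _ t1; rewrite dphi.
    rewrite (_ : \int[mu]_(z in J R) (f z * _) = \int[mu]_(z in J R) (f z * kern n x z - f z * kern n y z)); last first.
      by apply: eq_Rintegral => z _; rewrite mulrBr.
    rewrite (Rintegral_JI (L1B mI (Ifk n x) (Ifk n y))) (RintegralB mI (Ifk n x) (Ifk n y)) => ->.
    congr (- _); rewrite -Rintegral_JI.
      by apply: eq_Rintegral => z _; rewrite mulrC.
    exact (L1M mI (mphi n _ mI) (fun z _ => phi1 n z) IgI).
  have E : - (\int[mu]_(z in I) l z) = f x - f y.
    exact: (@cvg_unique _ (@norm_hausdorff _ _) _ _ _ _ lim1 lim3).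
  have xy' := ltW xy.
  rewrite (prim_sub IgI) ?(ltW x0) ?(ltW y1)//.
  rewrite -(Rintegral_itv_cc false false); last first.
    by apply: L1_subitv IgI _; apply: subset_itv; rewrite bnd_simp; lra.
  by rewrite -lE; lra.
have [x0 x01 Gx0] := ae_itv_ex N11 good.
have /andP[x0m x0M] := x01.
exists (f x0 - prim g x0); apply: ae_imp good => z Gz; rewrite /J/= in_itv/= => /andP[z0 z1].
have [zx|xz|->] := ltgtP z x0.
- by have := key z x0 z0 zx x0M Gz Gx0; lra.
- by have := key x0 z x0m xz z1 Gx0 Gz; lra.
- by rewrite subrK.
Unshelve. all: by end_near. Qed.

End weak_derivatives.

(** * Sobolev functions as iterated primitives *)

Lemma cvg_contR {R : realType} {T : Type} {F : set_system T} {FF : Filter F} (k : R -> R)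
  (f : T -> R) (l : R) : continuous k -> f x @[x --> F] --> l -> k (f x) @[x --> F] --> k l.
Proof. by move=> ck fl; apply: continuous_cvg => //; exact: ck. Qed.

Section sobolev.
Context {R : realType}.
Local Notation mu := (@mu1 R).
Local Notation L1 D f := (mu.-integrable D (EFin \o f)).
Local Notation I := (`[(-1 : R), (1 : R)]%classic : set (measurableTypeR R)).
Implicit Types (al f g v : R -> R) (p : {poly R}) (x y z a b c : R).

Let mI : measurable I := measurable_cc (-1) 1.
Let mJ : measurable (J R : set (measurableTypeR R)) := measurable_J.

Lemma continuous_ae_eq f g : {within `[-1, 1], continuous f} -> {within `[-1, 1], continuous g} ->
  {ae mu, forall z, J R z -> f z = g z} -> forall z, -1 <= z <= 1 -> f z = g z.
Proof.
move=> cf cg fg z zI; apply: contrapT => /eqP; rewrite -subr_eq0 => fgz.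
have ch : {within `[-1, 1], continuous (fun x => f x - g x)}.
  by move=> x; apply: cvgB; [exact: cf|exact: cg].
have e0 : 0 < `|f z - g z| / 2 by rewrite divr_gt0// normr_gt0.
have [k k0 Hk] := unif_continuous_itv ch e0.
have ab : Num.max (-1) (z - k) < Num.min 1 (z + k).
  by case/andP: zI => ? ?; rewrite gt_max !lt_min; do ?[apply/andP; split]; lra.
have [x] := ae_itv_ex ab fg.
rewrite gt_max lt_min => /andP[/andP[x1 xk] /andP[x2 xk']].
rewrite /J/= in_itv/= x1 x2 => /(_ isT) fgx.
have := Hk z x zI ltac:(apply/andP; split; lra) ltac:(rewrite ltr_norml; apply/andP; split; lra).
by rewrite fgx subrr subr0 => h; lra.
Qed.

(** Chain rule for an absolutely continuous function. It is classical for the polynomials [P n],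
    which converge uniformly; [h' (P n) al] passes to the limit by dominated convergence, and the
    remainder with [al - p_n] tends to 0 in L_1 because [h'] is bounded. *)
Lemma prim_comp al c C (h h' : R -> R) : (forall x, is_derive x 1 h (h' x)) -> continuous h' ->
  (forall x, `|h' x| <= C) -> L1 I al ->
  L1 I (fun y => h' (c + prim al y) * al y) /\
  forall z, -1 <= z <= 1 -> h (c + prim al z) = h c + prim (fun y => h' (c + prim al y) * al y) z.
Proof.
move=> dh ch' hC Ia.
have ca := prim_continuous Ia.
have cc (k : R -> R) : continuous k -> {within `[-1, 1], continuous (fun y => k (c + prim al y))}.
  move=> ck y; apply: (cvg_contR ck).
  by apply: cvgD; [exact: cvg_cst|exact: ca].
have mh' : measurable_fun I (fun y => h' (c + prim al y)).
  by apply: L1_measurable (L1_continuous (cc _ ch')).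
have Iha : L1 I (fun y => h' (c + prim al y) * al y) by exact (L1M mI mh' (fun y _ => hC _) Ia).
split=> // z zI; have /andP[z0 z1] := zI.
have [p_ Hp] := poly_approx Ia.
have Ip n : L1 I (horner (p_ n)) by apply: L1_horner.
pose P n y := c - (primp (p_ n)).[-1] + (primp (p_ n)).[y].
have PE n y : -1 <= y -> P n y = c + prim (horner (p_ n)) y.
  by move=> y0; rewrite prim_horner// /P; ring.
have cP n : continuous (P n).
  by move=> y; apply: cvgD; [exact: cvg_cst|exact: continuous_horner].
have dP n y : is_derive y 1 (P n) (p_ n).[y].
  have := is_derive_primp (p_ n) y => ?.
  by rewrite /P; apply: is_derive_eq; rewrite !(add0r, mul1r).
have dist n y : -1 <= y <= 1 -> `|P n y - (c + prim al y)| <= n.+1%:R^-1.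
  move=> /[dup] yI /andP[y0 _]; rewrite PE// opprD addrACA subrr add0r distrC -primD//.
  apply: le_trans (Hp n); apply: normr_prim_le => //; exact: L1B.
have cvP y : -1 <= y <= 1 -> P n y @[n --> \oo] --> c + prim al y.
  move=> yI; apply/cvgrPdist_le => e e0; near=> n.
  rewrite distrC (le_trans (dist n y yI))// ltW//; near: n; exact: near_invSn.
have ch : continuous h by move=> y; apply/differentiable_continuous/derivable1_diffP; exact: ex_derive.
have Hn n : h (P n z) - h (P n (-1)) = \int[mu]_(y in `[-1, z]) (h' (P n y) * (p_ n).[y]).
  have dc y : is_derive y 1 (h \o P n) (h' (P n y) * (p_ n).[y]).
    by apply: is_derive1_comp.
  rewrite (Rintegral_derive z0 _ dc)// => y.
  apply: cvgM; last exact: continuous_horner.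
  by apply: (continuous_comp (cP n y)); exact: ch'.
have mz := measurable_cc (-1) z.
have sz : (`[-1, z]%classic : set R) `<=` `[-1, 1] by apply: subset_itvl; rewrite bnd_simp.
have Iz f : L1 I f -> L1 `[-1, z] f by move=> If; exact: L1_subitv If sz.
have mhP n : measurable_fun `[-1, z] (fun y => h' (P n y)).
  apply: L1_measurable (L1_continuous _); apply: continuous_subspaceT => y.
  by apply: (continuous_comp (cP n y)); exact: ch'.
have l1 : \int[mu]_(y in `[-1, z]) (h' (P n y) * al y) @[n --> \oo] -->
    \int[mu]_(y in `[-1, z]) (h' (c + prim al y) * al y).
  apply: (cvg_Rintegral mz _ _ _ (L1Z mz C (L1_normr (Iz _ Ia)))).
  - by move=> n; apply: measurable_funM; [exact: mhP|exact: L1_measurable (Iz _ Ia)].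
  - exact: L1_measurable (Iz _ Iha).
  - apply: aeW => y /sz /=; rewrite in_itv/= => yI.
    apply: cvgM; last exact: cvg_cst.
    by apply: (cvg_contR ch'); exact: cvP.
  - by apply: aeW => y _ n; rewrite normrM ler_wpM2r.
have C0 : 0 <= C by exact: le_trans (normr_ge0 _) (hC 0).
have l2 : \int[mu]_(y in `[-1, z]) (h' (P n y) * (al y - (p_ n).[y])) @[n --> \oo] --> 0.
  apply/cvgrPdist_le => e e0; near=> n; rewrite sub0r normrN.
  have Id := L1B mI Ia (Ip n).
  apply: le_trans (normr_Rintegral_le mz (Iz _ Id) (mhP n) (fun y _ => hC _)) _.
  apply: (@le_trans _ _ (C * n.+1%:R^-1)).
    rewrite ler_wpM2l//; apply: le_trans (Hp n).
    by apply: le_Rintegral_subset => //; exact: L1_normr.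
  have : n.+1%:R^-1 < e / (C + 1) by near: n; apply: near_invSn; rewrite divr_gt0// ltr_wpDl.
  rewrite ltr_pdivlMr ?ltr_wpDl// => /ltW; apply: le_trans.
  by rewrite mulrC ler_wpM2l// lerDl.
have l3 : h (P n z) - h (P n (-1)) @[n --> \oo] --> h (c + prim al z) - h c.
  apply: cvgB; apply: (cvg_contR ch); first exact: cvP.
  by have := cvP (-1); rewrite prim_N1 addr0; apply; apply/andP; split; lra.
have l4 : h (P n z) - h (P n (-1)) @[n --> \oo] --> \int[mu]_(y in `[-1, z]) (h' (c + prim al y) * al y) - 0.
  have l12 : (\int[mu]_(y in `[-1, z]) (h' (P n y) * al y) -
      \int[mu]_(y in `[-1, z]) (h' (P n y) * (al y - (p_ n).[y]))) @[n --> \oo] -->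
      \int[mu]_(y in `[-1, z]) (h' (c + prim al y) * al y) - 0 by exact: cvgB l1 l2.
  apply: cvg_trans l12; apply: near_eq_cvg; near=> n; rewrite Hn.
  have IhP f : L1 `[-1, z] f -> L1 `[-1, z] (fun y => h' (P n y) * f y).
    by move=> If; exact (L1M mz (mhP n) (fun y _ => hC _) If).
  rewrite -RintegralB//; [|exact/IhP/Iz|exact/IhP/Iz/(L1B mI)].
  by apply: eq_Rintegral => y _; ring.
have := @cvg_unique _ (@norm_hausdorff _ _) _ _ _ _ l3 l4.
by rewrite subr0 /prim => <-; ring.
Unshelve. all: by end_near. Qed.

(* [v] vanishes at [-1], has the absolutely continuous derivative
   [c + prim g] and the integrable second derivative [g]. *)
Definition regular v c g :=
  L1 I g /\ forall z, -1 <= z <= 1 -> v z = prim (fun y => c + prim g y) z.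

Section regular.
Variables (v : R -> R) (c : R) (g : R -> R).
Hypothesis rv : regular v c g.
Local Notation p := (fun y => c + prim g y).

Lemma regular_dcontinuous : {within `[-1, 1], continuous p}.
Proof. by case: rv => Ig _ z; apply: cvgD; [exact: cvg_cst|exact: prim_continuous]. Qed.

Lemma regular_continuous : {within `[-1, 1], continuous v}.
Proof.
case: rv => Ig vE; apply: (@subspace_eq_continuous _ _ _ (prim p)).
  by move=> z; rewrite inE/= in_itv/= => /vE /esym.
exact/prim_continuous/L1_continuous/regular_dcontinuous.
Qed.

Lemma regular_is_derive z : -1 < z < 1 -> is_derive z 1 v (p z).
Proof.
move=> /andP[z0 z1]; case: rv => Ig vE.
apply: (@near_eq_is_derive _ _ _ (prim p)); last first.
  by apply: (is_derive_prim regular_dcontinuous); rewrite z0.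
near=> y; rewrite vE//; apply/andP; split; apply: ltW; near: y.
  exact: lt_nbhsr.
exact: lt_nbhsl.
Unshelve. all: by end_near. Qed.

(** [g] is approximated in L_1 and integrated twice. These polynomials shape the cut-offs along the
    graph, where L_1 control of second derivatives is enough. *)
Lemma regular_poly_approx : exists P_ : nat -> {poly R}, forall n,
  [/\ forall z, -1 <= z <= 1 -> `|v z - (P_ n).[z]| <= n.+1%:R^-1,
      forall z, -1 <= z <= 1 -> `|c + prim g z - ((P_ n)^`()).[z]| <= n.+1%:R^-1 &
      \int[mu]_(z in I) `|g z - ((P_ n)^`()^`()).[z]| <= n.+1%:R^-1].
Proof.
case: rv => Ig vE; have [p_ Hp] := poly_approx Ig.
pose q n := (c - (primp (p_ n)).[-1])%:P + primp (p_ n).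
pose Q n := primp (q n) - ((primp (q n)).[-1])%:P.
have dq n : (q n)^`() = p_ n by rewrite /q derivD derivC add0r deriv_primp.
have dQ n : (Q n)^`() = q n by rewrite /Q derivB derivC subr0 deriv_primp.
have Ip r : L1 I (horner r) by apply: L1_horner.
have h1 n z : -1 <= z <= 1 -> `|c + prim g z - (q n).[z]| <= n.+1%:R^-1.
  move=> /[dup] zI /andP[z0 _].
  have -> : c + prim g z - (q n).[z] = prim (fun y => g y - (p_ n).[y]) z.
    by rewrite primD// prim_horner// /q !hornerE; ring.
  by apply: le_trans (Hp n); apply: normr_prim_le => //; exact: L1B.
have Ipp : L1 I p by apply: L1_continuous; exact: regular_dcontinuous.
(* Integrating over an interval of length 2 doubles the error: index [2 n + 1] turns [2 / (2 n + 2)]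
   into [1 / (n + 1)]. *)
exists (fun n => Q n.*2.+1) => n; rewrite !dQ dq.
have n2 : n.*2.+2%:R^-1 <= (n.+1%:R^-1 : R) by rewrite lef_pV2 ?posrE// ler_nat ltnS -addnn leqW// leq_addr.
split.
- move=> z /[dup] zI /andP[z0 _].
  have -> : v z - (Q n.*2.+1).[z] = prim (fun y => p y - (q n.*2.+1).[y]) z.
    by rewrite vE// primD// prim_horner// /Q !hornerE; ring.
  apply: le_trans (normr_prim_le _ zI) _; first exact: L1B.
  apply: (@le_trans _ _ (\int[mu]_(y in `[-1, 1]) (n.*2.+2%:R^-1))).
    apply: le_Rintegral => //; first exact/L1_normr/L1B.
      by apply: L1_cst => //; exact: mu1_itv_lty.
    by move=> y; rewrite /= in_itv/= => yI; exact: h1.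
  rewrite Rint_cst; last lra.
  have -> : (n.*2.+2%:R : R) = 2 * n.+1%:R by rewrite -natrM mul2n doubleS.
  by rewrite invfM; move: (n.+1%:R^-1) => t; lra.
- by move=> z zI; apply: le_trans (h1 _ _ zI) n2.
- by apply: le_trans (Hp _) n2.
Qed.

End regular.

(** Two integrations: [wD1 v] is recovered up to a constant [c], then [v] up to a constant that
    [v (-1) = 0] forces to be 0. Continuity of [v] upgrades equality almost everywhere to equality
    at every point. *)
Lemma W2qD_regular q v : 1 <= q -> W2qD q v ->
  exists c g, regular v c g /\ {ae mu, forall z, J R z -> wD1 v z = c + prim g z}.
Proof.
move=> q1 [[cv Lv Dv [Lp1 Dp Lp2]] vN1 v1].
have Joo := @J_lty R.
have Iv := Lp_L1 mJ Joo q1 Lv; have Ip := Lp_L1 mJ Joo q1 Lp1; have Ig := Lp_L1 mJ Joo q1 Lp2.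
have [c Hc] := weak_deriv1_primitive Dp Ip Ig.
exists c, (wD1 (wD1 v)); split=> //; split; first exact: L1_JI.
have IgI := L1_JI Ig.
have [c0 Hc0] := weak_deriv1_primitive Dv Iv Ip.
have pE z : -1 <= z <= 1 -> prim (wD1 v) z = prim (fun y => c + prim (wD1 (wD1 v)) y) z.
  move=> /andP[z0 z1].
  have cpp : {within `[-1, 1], continuous (fun y => c + prim (wD1 (wD1 v)) y)}.
    by move=> y; apply: cvgD; [exact: cvg_cst|exact: prim_continuous].
  have s1 : (`]-1, z[%classic : set R) `<=` `[-1, 1] by apply: subset_itv; rewrite bnd_simp.
  have s2 : (`[-1, z]%classic : set R) `<=` `[-1, 1] by apply: subset_itv; rewrite bnd_simp.
  have IpI := L1_JI Ip; have IcI := L1_continuous cpp.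
  rewrite /prim -(Rintegral_itv_cc false true (L1_subitv IpI s2)) -[RHS](Rintegral_itv_cc false true (L1_subitv IcI s2)).
  apply: eq_Rintegral_ae; first exact: measurable_itv.
  - exact: L1_measurable (L1_subitv IpI s1).
  - exact: L1_measurable (L1_subitv IcI s1).
  - apply: ae_imp Hc => y Hy; rewrite /= in_itv/= => /andP[y0 yz]; apply: Hy.
    by rewrite /J/= in_itv/= y0 (lt_le_trans yz).
have cw : {within `[-1, 1], continuous (fun y => c0 + prim (wD1 v) y)}.
  by move=> y; apply: cvgD; [exact: cvg_cst|apply: prim_continuous; exact: L1_JI].
have vE := continuous_ae_eq cv cw Hc0.
have c00 : c0 = 0.
  have := vE (-1) ltac:(apply/andP; split; lra); rewrite vN1 prim_N1; lra.
by move=> z zI; rewrite vE// c00 add0r pE.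
Qed.

Lemma weak_deriv1_eq_ae f1 f2 g : measurable_fun (J R) f2 -> L1 (J R) f2 ->
  {ae mu, forall z, J R z -> f1 z = f2 z} -> weak_deriv1 f1 g -> weak_deriv1 f2 g.
Proof.
move=> mf2 If2 E [[mf1 lf1] lg H]; split=> //.
  by split=> // K cK KJ; apply: integrableS If2 => //; exact: compact_measurable.
move=> phi tphi; rewrite -H//.
have mphi' : measurable_fun (J R) (derive1 phi : measurableTypeR R -> R).
  apply: measurable_funTS; apply: continuous_measurable_fun.
  rewrite (_ : derive1 _ = 'D_1 phi); first by apply/smooth_continuous/smoothD1; case: tphi.
  by apply/funext => z; rewrite derive1E.
apply: eq_Rintegral_ae => //; try exact: measurable_funM.
by apply: ae_imp E => z E Jz; rewrite E.
Qed.

Lemma wD1P f g : weak_deriv1 f g -> weak_deriv1 f (wD1 f) /\ {ae mu, forall z, J R z -> wD1 f z = g z}.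
Proof.
move=> fg; have D : weak_deriv1 f (wD1 f).
  by rewrite /wD1; apply: (@xgetPex _ (cst 0) [set g | weak_deriv1 f g]); exists g.
by split=> //; exact: weak_deriv1_unique D fg.
Qed.

(** [f] stands for the chosen weak derivative of a profile, which agrees with [c + prim g] only
    almost everywhere. *)
Lemma wD1_atan (s c : R) f g : L1 I g -> measurable_fun (J R) f ->
  {ae mu, forall z, J R z -> f z = c + prim g z} ->
  let a z := s / (1 + (s * (c + prim g z)) ^+ 2) * g z in
  [/\ L1 I a, forall z, -1 <= z <= 1 -> atan (s * (c + prim g z)) = atan (s * c) + prim a z &
      {ae mu, forall z, J R z -> wD1 (fun y => atan (s * f y)) z = a z}].
Proof.
move=> Ig mf E a.
have dh x : is_derive x 1 (fun y => atan (s * y)) (s / (1 + (s * x) ^+ 2)).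
  have ds : is_derive x 1 (fun y : R => s * y) s.
    by apply: is_derive_eq; rewrite /GRing.scale/= !(mulr1, mulr0, addr0).
  have := @is_derive1_comp _ atan (fun y : R => s * y) x _ _ (is_derive1_atan (s * x)) ds.
  by rewrite mulrC.
have pos x : 0 < 1 + (s * x) ^+ 2 by rewrite ltr_wpDr// sqr_ge0.
have ch' : continuous (fun x => s / (1 + (s * x) ^+ 2)).
  move=> x; apply: cvgM; first exact: cvg_cst.
  apply: cvgV; first by rewrite gt_eqF.
  apply: cvgD; first exact: cvg_cst.
  apply: (cvg_contR (@exprn_continuous R 2)).
  by apply: cvgM; [exact: cvg_cst|exact: cvg_id].
have bh' x : `|s / (1 + (s * x) ^+ 2)| <= `|s|.
  rewrite normrM ler_piMr// normfV gtr0_norm// invf_le1// lerDl sqr_ge0//.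
have [Ia aE] := prim_comp c dh ch' bh' Ig.
split=> //.
have W1 : weak_deriv1 (fun z => atan (s * (c + prim g z))) a.
  apply: (weak_deriv1_prim Ia (c := atan (s * c))) => z.
  by rewrite /J/= in_itv/= => /andP[z0 z1]; apply: aE; rewrite !ltW.
have mat : measurable_fun (J R) (fun y => atan (s * f y)).
  apply: (measurableT_comp (f := @atan R)).
    by apply: continuous_measurable_fun; exact: continuous_atan.
  exact: measurable_funM.
have W2 : weak_deriv1 (fun y => atan (s * f y)) a.
  apply: weak_deriv1_eq_ae W1 => //.
    apply: (@L1_bounded _ _ _ _ _ mJ (pi / 2)); [exact: J_lty|exact: mat|].
    by move=> y _; rewrite ler_norml !ltW ?atan_gtNpi2 ?atan_ltpi2.
  by apply: ae_imp E => z E Jz; rewrite E.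
by have [] := wD1P W2.
Qed.

(** The difference vanishes at [-1], so the L_1 norm of its derivative dominates its sup norm. This
    turns continuity in time with values in [W^2_q] into uniform convergence of the profiles. *)
Lemma W2qD_sub_le q v w : 1 <= q -> W2qD q v -> W2qD q w ->
  measurable_fun (J R) (wD1 (v \- w)) /\
  (L1 (J R) (wD1 (v \- w)) -> forall z, -1 <= z <= 1 ->
    `|v z - w z| <= \int[mu]_(y in J R) `|wD1 (v \- w) y|).
Proof.
move=> q1 /(W2qD_regular q1)[cv [gv [rv _]]] /(W2qD_regular q1)[cw [gw [rw _]]].
pose d y := (cv + prim gv y) - (cw + prim gw y).
have Iv := L1_continuous (regular_dcontinuous rv).
have Iw := L1_continuous (regular_dcontinuous rw).
have Id : L1 I d by exact: L1B.
have dE z : -1 <= z <= 1 -> (v \- w) z = 0 + prim d z.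
  by move=> zI; rewrite add0r /d primD//= (rv.2 z zI) (rw.2 z zI).
have W : weak_deriv1 (v \- w) d.
  apply: (weak_deriv1_prim Id (c := 0)) => z.
  by rewrite /J/= in_itv/= => /andP[z0 z1]; apply: dE; rewrite !ltW.
have [[_ [mw _] _] E] := wD1P W; split=> // Iw' z zI.
rewrite -[v z - w z]/((v \- w) z) dE// add0r (le_trans (normr_prim_le Id zI))//.
rewrite -(Rintegral_JI (L1_normr Id)) le_eqVlt; apply/orP; left; apply/eqP.
apply: eq_Rintegral_ae => //.
- exact: L1_measurable (L1_IJ (L1_normr Id)).
- exact: L1_measurable (L1_normr Iw').
- by apply: ae_imp E => y E Jy; rewrite E.
Qed.

End sobolev.

(** * The weak formulation on a plane domain *)

Section plane.
Context {R : realType}.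
Local Notation mR2 := ((measurableTypeR R * measurableTypeR R)%type).
Local Notation mu := (@mu1 R).
Local Notation muu := (@mu2 R).
Implicit Types (D K : set (R * R)) (f g phi : R * R -> R).

(** The sigma-algebra on the plane is the product one; an open set belongs to it as a countable
    union of rational squares. *)
Lemma open_measurable2 (U : set (R * R)) : open U -> measurable (U : set mR2).
Proof.
move=> oU.
pose sq (i : rat * rat * rat) : set mR2 :=
  (ball (ratr i.1.1 : R) (ratr i.2 : R) : set R) `*` (ball (ratr i.1.2 : R) (ratr i.2 : R) : set R).
pose F i : set mR2 := if `[< sq i `<=` U >] then sq i else set0.
have -> : U = \bigcup_i F i.
  apply/seteqP; split=> [p Up|p [i _]]; last by rewrite /F; case: asboolP => // + Fp; exact.
  have /nbhs_ballP[e /= e0 He] := open_nbhs_nbhs (conj oU Up).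
  have [r] := @rat_in_itvoo R 0 (e / 2) ltac:(by rewrite divr_gt0).
  rewrite in_itv/= => /andP[r0 re].
  have [a] := @rat_in_itvoo R (p.1 - ratr r) (p.1 + ratr r) ltac:(lra).
  rewrite in_itv/= => /andP[a1 a2].
  have [b] := @rat_in_itvoo R (p.2 - ratr r) (p.2 + ratr r) ltac:(lra).
  rewrite in_itv/= => /andP[b1 b2].
  exists (a, b, r) => //; rewrite /F; case: asboolP => [_|].
    by split; rewrite /ball/= ltr_norml; apply/andP; split; lra.
  case=> q [/=]; rewrite /ball/= !ltr_norml => /andP[? ?] /andP[? ?].
  by apply: He; split; rewrite /ball/= ltr_norml; apply/andP; split; lra.
apply: countable_bigcupT_measurable; first exact: countableP.
move=> i; rewrite /F; case: asboolP => // _.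
by apply: measurableX; exact: measurable_ball.
Qed.

Lemma compact_measurable2 K : compact K -> measurable (K : set mR2).
Proof.
move=> cK; rewrite -(setCK K); apply: measurableC; apply: open_measurable2.
by apply: closed_openC; apply: compact_closed cK; exact: norm_hausdorff.
Qed.

Lemma continuous_measurable2 f : continuous f -> measurable_fun setT (f : mR2 -> R).
Proof.
move=> cf; apply: (measurability _ (RGenOpens.measurableE R)).
move=> _ [_ [a [b ->] <-]]; rewrite setTI; apply: open_measurable2.
by apply: open_comp; [move=> x _; exact: cf|exact: interval_open].
Qed.

Section domain.
Variables (D : set (R * R)).
Hypotheses (mD : measurable (D : set mR2)) (Doo : (muu D < +oo)%E).
Local Notation L1 f := (muu.-integrable D (EFin \o f)).

Lemma smooth_measurable2 phi : smooth phi -> measurable_fun D (phi : mR2 -> R).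
Proof.
move=> sphi; apply: measurable_funTS; apply: continuous_measurable2.
exact: smooth_continuous.
Qed.

Lemma test_functionM (a : R * R -> R) phi : smooth a -> test_function D phi ->
  test_function D (fun p => a p * phi p).
Proof.
move=> sa [sphi [K [cK KD phi0]]]; split; first exact: smoothM.
by exists K; split => // p Kp; rewrite phi0// mulr0.
Qed.

Lemma test_functionD1 phi v : test_function D phi -> test_function D ('D_v phi).
Proof.
move=> [sphi [K [cK KD phi0]]]; split; first exact: smoothD1.
exists K; split => // p Kp.
suff E : 'D_v phi p = 'D_v (cst 0 : R * R -> R) p by rewrite E derive_cst.
apply: near_eq_derive.
have oC : open (~` K) by apply: closed_openC; apply: compact_closed cK; exact: norm_hausdorff.
have := open_nbhs_nbhs (conj oC (Kp : (~` K) p)).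
by apply: filterS => q Kq; exact: phi0.
Qed.

Lemma test_function_bounded phi : test_function D phi ->
  exists2 C : R, 0 <= C & forall p, `|phi p| <= C.
Proof.
move=> [sphi [K [cK KD phi0]]].
have [K0|/set0P K0] := eqVneq K set0.
  by exists 0 => // p; rewrite phi0 ?normr0// K0.
have cphi := smooth_continuous sphi.
have [c _ Hc] := @compact_EVT_max _ R (fun p => `|phi p|) K K0 cK
  (continuous_subspaceT (fun x => cvg_norm (cphi x))).
exists `|phi c| => // p; have [Kp|Kp] := pselect (K p); first by apply: Hc; rewrite inE.
by rewrite phi0 // normr0.
Qed.

Lemma L1_test f phi : L1 f -> test_function D phi -> L1 (fun p => f p * phi p).
Proof.
move=> If tphi; have [C _ HC] := test_function_bounded tphi.
have H := L1M mD (smooth_measurable2 tphi.1) (fun p _ => HC p) If.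
by apply: (eq_L1 mD _ H) => p _; rewrite mulrC.
Qed.

Lemma L1_L1loc2 f : L1 f -> L1loc2 D f.
Proof.
move=> If; split; first exact: L1_measurable If.
by move=> K cK KD; apply: integrableS If => //; exact: compact_measurable2.
Qed.

Lemma wD2P v f g : weak_deriv2 D v f g -> weak_deriv2 D v f (wD2 D v f).
Proof.
move=> fg; rewrite /wD2; apply: (@xgetPex _ (cst 0) [set g | weak_deriv2 D v f g]).
by exists g.
Qed.

Lemma derive_er phi (z r : R) : smooth phi ->
  is_derive r 1 (fun r' => phi (z, r')) ('D_(er R) phi (z, r)).
Proof.
move=> sphi; have H := @smooth_derivable _ _ phi (z, r) (er R) sphi.
pose k : R -> R := fun r' => phi (z, r').
have E : (fun h : R => h^-1 *: ((phi \o shift (z, r)) (h *: er R) - phi (z, r))) =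
    (fun h : R => h^-1 *: ((k \o shift r) (h *: (1 : R)) - k r)).
  apply/funext => h; rewrite /k /= /er; congr (_ *: (phi _ - _)).
  by apply/pair_equal_spec; split; rewrite /= ?scaler0 ?add0r.
apply: (@DeriveDef _ _ _ _ _ k); first by rewrite /derivable -E.
by rewrite /derive -E.
Qed.

Lemma derive_ez phi (z r : R) : smooth phi ->
  is_derive z 1 (fun z' => phi (z', r)) ('D_(ez R) phi (z, r)).
Proof.
move=> sphi; have H := @smooth_derivable _ _ phi (z, r) (ez R) sphi.
pose k : R -> R := fun z' => phi (z', r).
have E : (fun h : R => h^-1 *: ((phi \o shift (z, r)) (h *: ez R) - phi (z, r))) =
    (fun h : R => h^-1 *: ((k \o shift z) (h *: (1 : R)) - k z)).
  apply/funext => h; rewrite /k /= /ez; congr (_ *: (phi _ - _)).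
  by apply/pair_equal_spec; split; rewrite /= ?scaler0 ?add0r.
apply: (@DeriveDef _ _ _ _ _ k); first by rewrite /derivable -E.
by rewrite /derive -E.
Qed.

Definition rmul phi (p : R * R) : R := p.2 * phi p.

Lemma test_function_rmul phi : test_function D phi -> test_function D (rmul phi).
Proof. exact: (test_functionM (@smooth_snd R)). Qed.

Lemma derive_sndM phi (v p : R * R) : smooth phi ->
  'D_v (rmul phi) p = v.2 * phi p + p.2 * 'D_v phi p.
Proof.
move=> sphi; rewrite /rmul deriveM; last 2 first.
- exact: smooth_derivable (@smooth_snd R).
- exact: smooth_derivable.
rewrite (_ : 'D_v snd p = v.2) ?/GRing.scale/=; first by rewrite addrC mulrC; ring.
rewrite deriveE; last exact: smooth_differentiable (@smooth_snd R).
by rewrite diff_lin//; move=> x; exact: cvg_snd.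
Qed.

(* Every derivative is thrown onto the test function. *)
Lemma very_weak_form (s : R) psi : L1 psi ->
  (forall v, v \in [:: ez R; er R] -> weak_deriv2 D v psi (wD2 D v psi) /\
     L1 (wD2 D v psi) /\ forall w, w \in [:: ez R; er R] ->
       weak_deriv2 D w (wD2 D v psi) (wD2 D w (wD2 D v psi)) /\ L1 (wD2 D w (wD2 D v psi))) ->
  (forall p, D p -> 0 < p.2 < 2) ->
  {ae muu, forall p : R * R, D p ->
        p.2^-1 * wD2 D (er R) (fun p' => p'.2 * wD2 D (er R) psi p') p
        + s ^+ 2 * wD2 D (ez R) (wD2 D (ez R) psi) p = 0} ->
  forall phi, test_function D phi ->
  \int[muu]_(p in D) (psi p * ('D_(er R) phi p + p.2 * 'D_(er R) ('D_(er R) phi) p +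
     s ^+ 2 * (p.2 * 'D_(ez R) ('D_(ez R) phi) p))) = 0.
Proof.
move=> Ipsi W D2 eqn phi tphi.
have tsnd : smooth (fun p : R * R => p.2) := @smooth_snd R.
have ezin : ez R \in [:: ez R; er R] by rewrite mem_head.
have erin : er R \in [:: ez R; er R] by rewrite in_cons mem_head orbT.
have [Wz [Iz Wz']] := W _ ezin; have [Wr [Ir Wr']] := W _ erin.
have [Wzz Izz] := Wz' _ ezin; have [Wrr Irr] := Wr' _ erin.
have msnd : measurable_fun D (snd : mR2 -> R) by exact: measurable_funTS.
have bsnd p : D p -> `|p.2| <= 2 by move=> /D2/andP[? ?]; rewrite ger0_norm ltW.
set F := fun p' => p'.2 * wD2 D (er R) psi p' in eqn.
have IF : L1 F by exact (L1M mD msnd bsnd Ir).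
have IrE : L1 (fun p => p.2 * wD2 D (er R) (wD2 D (er R) psi) p) by exact (L1M mD msnd bsnd Irr).
have t1 : test_function D (rmul phi) by exact: test_function_rmul.
(* The product rule provides a weak derivative of [F], so that the choice [wD2 D (er R) F] made in
   the equation is a genuine derivative. *)
have WF : weak_deriv2 D (er R) F
    (fun p => wD2 D (er R) psi p + p.2 * wD2 D (er R) (wD2 D (er R) psi) p).
  split; [exact (L1_L1loc2 IF)|exact (L1_L1loc2 (L1D mD Ir IrE))|].
  move=> chi tchi.
  have t2 : test_function D (rmul chi) by exact: test_function_rmul.
  have t3 := test_functionD1 (er R) t2; have t4 := test_functionD1 (er R) tchi.
  have [_ _ /(_ _ t2) H] := Wrr.
  have -> : \int[muu]_(p in D) (F p * 'D_(er R) chi p) =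
     \int[muu]_(p in D) (wD2 D (er R) psi p * 'D_(er R) (rmul chi) p - wD2 D (er R) psi p * chi p).
    apply: eq_Rintegral => p _; rewrite derive_sndM; last by case: tchi.
    by rewrite /F /er/=; ring.
  rewrite (RintegralB mD (L1_test Ir t3) (L1_test Ir tchi)) H.
  rewrite -opprD -(RintegralD mD (L1_test Irr t2) (L1_test Ir tchi)).
  by congr (- _); apply: eq_Rintegral => p _; rewrite /rmul; ring.
have [[mF _] [mE lE] HE] := wD2P WF.
set E := wD2 D (er R) F in mE lE HE eqn.
have tr := test_functionD1 (er R) tphi; have trr := test_functionD1 (er R) tr.
have tz := test_functionD1 (ez R) tphi; have tzz := test_functionD1 (ez R) tz.
have trz : test_function D (rmul ('D_(ez R) phi)) by exact: test_function_rmul.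
have trzz : test_function D (rmul ('D_(ez R) ('D_(ez R) phi))) by exact: test_function_rmul.
have trr' : test_function D (rmul ('D_(er R) phi)) by exact: test_function_rmul.
(* The equation multiplied by [r], which is positive on [D]; this is the form that is symmetric for
   [dz dr]. *)
have h1 : \int[muu]_(p in D) (E p * phi p) =
    - s ^+ 2 * \int[muu]_(p in D) (wD2 D (ez R) (wD2 D (ez R) psi) p * rmul phi p).
  rewrite -(RintegralZl _ mD (L1_test Izz t1)).
  apply: eq_Rintegral_ae => //.
  - by apply: measurable_funM => //; exact: smooth_measurable2 tphi.1.
  - apply: measurable_funM => //; exact: L1_measurable (L1_test Izz t1).
  - apply: ae_imp eqn => p H Dp; have {}H := H Dp; have /andP[p0 _] := D2 _ Dp.
    have -> : E p = - s ^+ 2 * wD2 D (ez R) (wD2 D (ez R) psi) p * p.2.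
      apply: (@mulfI _ (p.2^-1)); first by rewrite invr_eq0 gt_eqF.
      move/eqP : H; rewrite addr_eq0 => /eqP ->.
      by rewrite [RHS]mulrC mulfK ?gt_eqF// mulNr.
    by rewrite /rmul; ring.
have [_ _ /(_ _ t1) h2] := Wzz.
have [_ _ /(_ _ trz) h3] := Wz.
have [_ _ /(_ _ trr') h4] := Wr.
have dz chi p : smooth chi -> 'D_(ez R) (rmul chi) p = rmul ('D_(ez R) chi) p.
  by move=> schi; rewrite derive_sndM// /ez/= mul0r add0r.
have {}h2 : \int[muu]_(p in D) (wD2 D (ez R) psi p * rmul ('D_(ez R) phi) p) =
    - \int[muu]_(p in D) (wD2 D (ez R) (wD2 D (ez R) psi) p * rmul phi p).
  by rewrite -h2; apply: eq_Rintegral => p _; rewrite dz//; exact: tphi.1.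
have {}h3 : \int[muu]_(p in D) (psi p * rmul ('D_(ez R) ('D_(ez R) phi)) p) =
    - \int[muu]_(p in D) (wD2 D (ez R) psi p * rmul ('D_(ez R) phi) p).
  by rewrite -h3; apply: eq_Rintegral => p _; rewrite dz//; exact: tz.1.
have h5 := HE _ tphi.
have h6 : \int[muu]_(p in D) (F p * 'D_(er R) phi p) =
    \int[muu]_(p in D) (wD2 D (er R) psi p * rmul ('D_(er R) phi) p).
  by apply: eq_Rintegral => p _; rewrite /F /rmul; ring.
have dr p : 'D_(er R) (rmul ('D_(er R) phi)) p = 'D_(er R) phi p + p.2 * 'D_(er R) ('D_(er R) phi) p.
  by rewrite derive_sndM ?/er/= ?mul1r//; exact: tr.1.
have {}h4 : \int[muu]_(p in D) (psi p * ('D_(er R) phi p + p.2 * 'D_(er R) ('D_(er R) phi) p)) =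
    - \int[muu]_(p in D) (wD2 D (er R) psi p * rmul ('D_(er R) phi) p).
  by rewrite -h4; apply: eq_Rintegral => p _; rewrite dr.
have tL : test_function D (fun p => 'D_(er R) phi p + p.2 * 'D_(er R) ('D_(er R) phi) p).
  have := test_functionD1 (er R) trr'; congr test_function.
  by apply/funext => p; rewrite -dr.
have -> : \int[muu]_(p in D) (psi p * ('D_(er R) phi p + p.2 * 'D_(er R) ('D_(er R) phi) p +
     s ^+ 2 * rmul ('D_(ez R) ('D_(ez R) phi)) p)) =
  \int[muu]_(p in D) (psi p * ('D_(er R) phi p + p.2 * 'D_(er R) ('D_(er R) phi) p) +
     s ^+ 2 * (psi p * rmul ('D_(ez R) ('D_(ez R) phi)) p)).
  by apply: eq_Rintegral => p _; rewrite /rmul mulrDr; congr (_ + _); rewrite mulrCA.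
apply: (etrans (RintegralD mD (L1_test Ipsi tL) (L1Z mD (s ^+ 2) (L1_test Ipsi trzz)))).
apply: (etrans (congr2 +%R h4
  (etrans (RintegralZl (s ^+ 2) mD (L1_test Ipsi trzz)) (congr1 ( *%R (s ^+ 2)) h3)))).
have hA := etrans (esym h6) (etrans h5 (congr1 -%R h1)).
have fin (a b c : R) : a = - (- s ^+ 2 * c) -> b = - c -> - a + s ^+ 2 * - b = 0.
  by move=> -> ->; ring.
exact (fin _ _ _ hA h2).
Qed.

End domain.
End plane.

(** * The domain below the upper boundary *)

Section plane_integrals.
Context {R : realType}.
Local Notation mR2 := ((measurableTypeR R * measurableTypeR R)%type).
Local Notation mu := (@mu1 R).
Local Notation muu := (@mu2 R).
Implicit Types (F : R * R -> R).

Lemma Rintegral_fubini12 F : muu.-integrable setT (EFin \o F : mR2 -> \bar R) ->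
  \int[muu]_p F p = \int[mu]_z (\int[mu]_r F (z, r)).
Proof.
move=> IF.
have IG := @integrable_fubini_F _ _ _ _ _ (@lebesgue_measure R) (@lebesgue_measure R) _ IF.
have E := @integral12_prod_meas1 _ _ _ _ _ (@lebesgue_measure R) (@lebesgue_measure R) _ IF.
rewrite /Rintegral; congr fine; rewrite /mu2 -E; apply: ae_eq_integral => //.
- by case/integrableP : IG.
- apply/measurable_EFinP; apply: (measurableT_comp (f := @fine R)) => //.
  by case/integrableP : IG.
- have := integrable_ae measurableT IG.
  by apply: ae_imp => z /(_ I) H _; rewrite fineK.
Qed.

Lemma Rintegral_fubini21 F : muu.-integrable setT (EFin \o F : mR2 -> \bar R) ->
  \int[muu]_p F p = \int[mu]_r (\int[mu]_z F (z, r)).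
Proof.
move=> IF.
have mG := @measurable_fubini_G _ _ _ _ _ (@lebesgue_measure R) (@lebesgue_measure R) _ IF.
have E := @integral21_prod_meas1 _ _ _ _ _ (@lebesgue_measure R) (@lebesgue_measure R) _ IF.
rewrite /Rintegral; congr fine; rewrite /mu2 -E; apply: ae_eq_integral => //.
- by apply/measurable_EFinP; apply: (measurableT_comp (f := @fine R)).
- have := @ae_integrable2 _ _ _ _ _ (@lebesgue_measure R) (@lebesgue_measure R) _ IF.
  by apply: ae_imp => z H _; rewrite fineK//; exact: integrable_fin_num.
Qed.

Lemma mu2_box (a b c d : R) :
  (muu ((`[a, b]%classic : set (measurableTypeR R)) `*` (`[c, d]%classic : set (measurableTypeR R))) =
  mu (`[a, b]%classic : set (measurableTypeR R)) * mu (`[c, d]%classic : set (measurableTypeR R)))%E.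
Proof. by apply: product_measure1E; exact: measurable_itv. Qed.

Lemma mu2_box_lty (a b c d : R) :
  (muu ((`[a, b]%classic : set (measurableTypeR R)) `*` (`[c, d]%classic : set (measurableTypeR R))) < +oo)%E.
Proof. by rewrite mu2_box lte_mul_pinfty ?ge0_fin_numE ?measure_ge0 ?mu1_itv_lty. Qed.

Lemma open_ltr (T : topologicalType) (f g : T -> R) : continuous f -> continuous g ->
  open [set p | f p < g p].
Proof.
move=> cf cg; have -> : [set p | f p < g p] = (fun p => g p - f p) @^-1` [set x | 0 < x].
  by apply/seteqP; split => p /=; rewrite subr_gt0.
by apply: open_comp; [move=> p _; apply: cvgB; [exact: cg|exact: cf]|exact: open_gt].
Qed.

Lemma closed_ler (T : topologicalType) (f g : T -> R) : continuous f -> continuous g ->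
  closed [set p | f p <= g p].
Proof.
move=> cf cg; have -> : [set p | f p <= g p] = ~` [set p | g p < f p].
  by apply/seteqP; split => p /=; rewrite leNgt => /negP.
by apply: open_closedC; exact: open_ltr.
Qed.

Lemma cvg_contR2 (T : Type) (F : set_system T) {FF : Filter F} (f g : T -> R)
    (k : R * R -> R) (a b : R) : continuous k ->
  f x @[x --> F] --> a -> g x @[x --> F] --> b -> k (f x, g x) @[x --> F] --> k (a, b).
Proof.
move=> ck fa gb.
exact: (@cvg_comp _ _ _ (fun x => (f x, g x)) k _ _ _ (cvg_pair fa gb) (ck (a, b))).
Qed.

(** Profiles are meaningful on [[-1, 1]] only. Composing with this projection makes them continuous
    on the whole line, so that the domain is cut out by strict inequalities between continuous
    functions of the plane. *)
Definition clamp (z : R) : R := Num.max (-1) (Num.min 1 z).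

Lemma clamp_itv z : -1 <= clamp z <= 1.
Proof. by rewrite /clamp le_max ge_max ge_min !lexx /= andbT; lra. Qed.

Lemma clamp_id z : -1 <= z <= 1 -> clamp z = z.
Proof. by move=> /andP[z0 z1]; rewrite /clamp min_r// max_r. Qed.

Lemma continuous_clamp (f : R -> R) : {within `[-1, 1], continuous f} -> continuous (f \o clamp).
Proof.
move=> /subspace_continuousP cf z.
have cc : clamp y @[y --> z] --> clamp z.
  apply: (@continuous_max R R (fun=> -1) (fun y => Num.min 1 y)); first exact: cvg_cst.
  by apply: (@continuous_min R R (fun=> 1) id); [exact: cvg_cst|exact: cvg_id].
have fz := cf (clamp z) ltac:(by rewrite /= in_itv/=; exact: clamp_itv).
move=> A /fz; rewrite /within/= => H.
have H' : nbhs z (fun y => `[-1, 1]%classic (clamp y) -> A (f (clamp y))) := cc _ H.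
have : nbhs z (fun y => A (f (clamp y))) by apply: filterS H' => y; apply; rewrite /= in_itv/=; exact: clamp_itv.
by [].
Qed.

End plane_integrals.

(** * Topology of the domain and integrals of derivatives over it *)

Section omega.
Context {R : realType}.
Local Notation mR2 := ((measurableTypeR R * measurableTypeR R)%type).
Local Notation mu := (@mu1 R).
Local Notation muu := (@mu2 R).
Variable v : R -> R.
Hypotheses (cv : {within `[-1, 1], continuous v}) (vN1 : v (-1) = 0) (v1 : v 1 = 0)
  (vJ : forall z, J R z -> -1 < v z < 1).
Local Notation D := (Omega v).
Local Notation L1 f := (muu.-integrable D (EFin \o f)).
Implicit Types (phi Y : R * R -> R) (z r : R) (p : R * R).

Lemma v_itv z : -1 <= z <= 1 -> -1 < v z < 1.
Proof.
move=> /andP[]; rewrite le_eqVlt => /predU1P[<- _|z0]; first by rewrite vN1; lra.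
rewrite le_eqVlt => /predU1P[->|z1]; first by rewrite v1; lra.
by apply: vJ; rewrite /J/= in_itv/= z0.
Qed.

Lemma OmegaE p : D p <-> [/\ -1 < p.1, p.1 < 1, p.2 < 2 & v (clamp p.1) + 1 < p.2].
Proof.
split=> [[/andP[z0 z1] _ /andP[vr r2]]|[z0 z1 r2 vr]].
  by split => //; rewrite clamp_id// !ltW.
rewrite clamp_id ?ltW// in vr.
have := @v_itv p.1 ltac:(rewrite !ltW//) => /andP[? ?].
by split; apply/andP; split => //; lra.
Qed.

Let w p := v (clamp p.1) + 1.
Let cw : continuous w.
Proof.
move=> p; apply: cvgD; last exact: cvg_cst.
by apply: (cvg_contR (continuous_clamp cv)); exact: cvg_fst.
Qed.
Let cfst : continuous (fst : R * R -> R). Proof. by move=> p; exact: cvg_fst. Qed.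
Let csnd : continuous (snd : R * R -> R). Proof. by move=> p; exact: cvg_snd. Qed.
Let ccst (c : R) : continuous (fun _ : R * R => c). Proof. by move=> p; exact: cvg_cst. Qed.

Lemma Omega_open : open D.
Proof.
have -> : D = [set p | -1 < p.1] `&` [set p | p.1 < 1] `&` [set p | p.2 < 2] `&` [set p | w p < p.2].
  by apply/seteqP; split=> p; [move=> /OmegaE[]|move=> [[[? ?] ?] ?]; apply/OmegaE].
by do ?apply: openI; exact: open_ltr.
Qed.

Lemma measurable_Omega : measurable (D : set mR2).
Proof. exact: open_measurable2 Omega_open. Qed.
Let mD := measurable_Omega.

Lemma Omega_box : D `<=` (`[-1, 1]%classic `*` `[0, 2]%classic).
Proof.
move=> p [/andP[? ?] /andP[? ?] _]; split; rewrite /= in_itv/=; apply/andP; split; exact: ltW.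
Qed.

Lemma Omega_lty : (muu D < +oo)%E.
Proof.
apply: le_lt_trans (mu2_box_lty (-1) 1 0 2); apply: le_measure; rewrite ?inE//.
- by apply: measurableX; exact: measurable_itv.
- exact: Omega_box.
Qed.

Definition Kset : set (R * R) := [set p | [/\ -1 <= p.1, p.1 <= 1, p.2 <= 2 & v (clamp p.1) + 1 <= p.2]].

Lemma closure_Omega : closure D `<=` Kset.
Proof.
have cK : closed Kset.
  have -> : Kset = [set p | -1 <= p.1] `&` [set p | p.1 <= 1] `&` [set p | p.2 <= 2] `&` [set p | w p <= p.2].
    by apply/seteqP; split=> p; [move=> []|move=> [[[? ?] ?] ?]].
  by do ?apply: closedI; exact: closed_ler.
rewrite [X in _ `<=` X](closure_id _).1//; apply: closure_subset.
by move=> p /OmegaE[? ? ? ?]; split; exact: ltW.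
Qed.

Lemma compact_closure_Omega : compact (closure D).
Proof.
apply: (@subclosed_compact _ _ ((`[-1, 1]%classic : set R) `*` (`[0, 2]%classic : set R))).
- exact: closed_closure.
- by apply: compact_setX; exact: segment_compact.
- move=> p /closure_Omega[? ? ? H]; have /andP[? ?] := v_itv (clamp_itv p.1).
  split; rewrite /= in_itv/=; apply/andP; split => //; lra.
Qed.

Lemma bdryE p : bdry D p <-> closure D p /\ ~ D p.
Proof. by rewrite /bdry; have /interior_id -> := Omega_open; split=> [[]|[]]. Qed.

Lemma lower_bdry z : -1 < z < 1 -> bdry D (z, v z + 1).
Proof.
move=> /[dup] zI /andP[z0 z1]; have /andP[v0 v2] := @v_itv z ltac:(rewrite !ltW//).
apply/bdryE; split; last by move=> [_ _ /= /andP[]]; rewrite ltxx.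
move=> B /nbhs_ballP[e /= e0 He].
pose t := Num.min (e / 2) ((1 - v z) / 2).
have t0 : 0 < t by rewrite lt_min; apply/andP; split; lra.
have [te tv] : t <= e / 2 /\ t <= (1 - v z) / 2 by split; rewrite /t ge_min lexx ?orbT.
exists (z, v z + 1 + t); split.
  by apply/OmegaE; split => //=; rewrite ?clamp_id ?ltW//; lra.
apply: He; split; rewrite /ball/=; first by rewrite subrr normr0.
by rewrite opprD addrA subrr sub0r normrN gtr0_norm//; lra.
Qed.

Lemma upper_bdry z : -1 < z < 1 -> bdry D (z, 2).
Proof.
move=> /[dup] zI /andP[z0 z1]; have /andP[v0 v2] := @v_itv z ltac:(rewrite !ltW//).
apply/bdryE; split; last by move=> [_ /= /andP[_]]; rewrite ltxx.
move=> B /nbhs_ballP[e /= e0 He].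
pose t := Num.min (e / 2) ((1 - v z) / 2).
have t0 : 0 < t by rewrite lt_min; apply/andP; split; lra.
have [te tv] : t <= e / 2 /\ t <= (1 - v z) / 2 by split; rewrite /t ge_min lexx ?orbT.
exists (z, 2 - t); split.
  by apply/OmegaE; split => //=; rewrite ?clamp_id ?ltW//; lra.
apply: He; split; rewrite /ball/=; first by rewrite subrr normr0.
by rewrite opprB addrC subrK gtr0_norm//; lra.
Qed.

Lemma ln2v_gt0 z : -1 <= z <= 1 -> 0 < ln (2 / (v z + 1)).
Proof.
move=> zI; have /andP[v0 v2] := v_itv zI; apply: ln_gt0.
by rewrite ltr_pdivlMr; lra.
Qed.

Lemma h_lower z : -1 < z < 1 -> h v (z, v z + 1) = 0.
Proof.
move=> /andP[z0 z1]; have /andP[v0 v2] := @v_itv z ltac:(rewrite !ltW//).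
by rewrite /h /= divff ?ln1 ?mul0r//; apply/eqP; lra.
Qed.

Lemma h_upper z : -1 < z < 1 -> h v (z, 2) = 1.
Proof.
move=> /andP[z0 z1]; rewrite /h /= divff// gt_eqF// ln2v_gt0// !ltW//.
Qed.

Lemma h_ge0 p : bdry D p -> 0 <= h v p.
Proof.
move=> /bdryE[/closure_Omega[z0 z1 _ vr] _]; rewrite clamp_id ?z0// in vr.
have zI : -1 <= p.1 <= 1 by rewrite z0.
have /andP[v0 v2] := v_itv zI.
apply: divr_ge0; last exact/ltW/ln2v_gt0.
by apply: ln_ge0; rewrite ler_pdivlMr; lra.
Qed.

(** Fubini along the vertical fibres, on each of which the fundamental theorem of calculus
    applies. *)
Lemma Rintegral_fiber Y : smooth Y -> (forall z, -1 < z < 1 -> Y (z, 2) = 0) ->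
  \int[muu]_(p in D) 'D_(er R) Y p = - \int[mu]_(z in J R) Y (z, v z + 1).
Proof.
move=> sY Y0.
have sDY := smoothD1 (er R) sY.
have IDY : L1 ('D_(er R) Y).
  have cB : compact ((`[-1, 1]%classic : set R) `*` (`[0, 2]%classic : set R)).
    by apply: compact_setX; exact: segment_compact.
  have B0 : ((`[-1, 1]%classic : set R) `*` (`[0, 2]%classic : set R)) !=set0.
    by exists (0, 0); split; rewrite /= in_itv/=; lra.
  have cDY := smooth_continuous sDY.
  have [c _ Hc] := @compact_EVT_max _ R (fun p => `|'D_(er R) Y p|) _ B0 cB
    (continuous_subspaceT (fun x => cvg_norm (cDY x))).
  apply: (@L1_bounded _ _ _ _ _ mD `|'D_(er R) Y c|); first exact: Omega_lty.
    exact: smooth_measurable2 sDY.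
  by move=> p /Omega_box Bp; apply: Hc; rewrite inE.
have IP := (L1_patch muu mD _).2 IDY.
rewrite Rintegral_mkcond (Rintegral_fubini12 IP).
have JI z : J R z -> -1 < z < 1 by rewrite /J/= in_itv.
rewrite (_ : - (\int[mu]_(z in J R) Y (z, v z + 1)) = \int[mu]_(z in J R) (- Y (z, v z + 1))).
  rewrite [RHS]Rintegral_mkcond; apply: eq_Rintegral => z _.
  have [Jz|nJ] := pselect (J R z); last first.
    rewrite patchE memNset//.
    rewrite [LHS](_ : _ = \int[mu]_r (0 : R)); last first.
      apply: eq_Rintegral => r _; rewrite patchE memNset// => -[/= zI _ _].
      by apply: nJ; rewrite /J/= in_itv.
    by have := @Rintegral_cst _ _ R mu setT measurableT 0; rewrite mul0r.
  rewrite patchE mem_set//.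
  have zI := JI _ Jz; have /andP[z0 z1] := zI.
  have /andP[v0 v2] := @v_itv z ltac:(rewrite !ltW//).
  have dY r := derive_er z r sY.
  have cY : continuous (fun r => 'D_(er R) Y (z, r)).
    move=> r; apply: (cvg_contR2 (smooth_continuous sDY)); [exact: cvg_cst|exact: cvg_id].
  rewrite (_ : (fun r => ('D_(er R) Y \_ D) (z, r)) = (fun r => 'D_(er R) Y (z, r)) \_ `]v z + 1, 2[); last first.
    apply/funext => r; rewrite !patchE; have [Dr|nD] := pselect (D (z, r)).
      have [_ _ /= vr] := Dr.
      by rewrite mem_set// mem_set// /= in_itv.
    rewrite memNset// memNset// /= in_itv/= => /andP[? ?]; apply: nD.
    by apply/OmegaE; split => //=; rewrite clamp_id// !ltW.
  rewrite -Rintegral_mkcond Rintegral_itv_cc; last exact/L1_continuous/continuous_subspaceT.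
  rewrite (Rintegral_derive _ cY dY); last lra.
  by rewrite Y0// sub0r.
rewrite RintegralN//; first exact: measurable_J.
apply: L1_IJ; apply: L1_continuous => z.
apply: (cvg_contR2 (smooth_continuous sY)).
  by apply: continuous_subspaceT => x; exact: cvg_id.
by apply: cvgD; [exact: cv|exact: cvg_cst].
Qed.

Lemma Rintegral_test_er phi : test_function D phi -> \int[muu]_(p in D) 'D_(er R) phi p = 0.
Proof.
move=> [sphi [K [cK KD phi0]]]; rewrite Rintegral_fiber//; last first.
  move=> z zI; apply: phi0 => /KD Dp.
  by have /bdryE[_] := upper_bdry zI; exact.
rewrite [X in - X](_ : _ = \int[mu]_(z in J R) (0 : R)); last first.
  apply: eq_Rintegral => z; rewrite inE /J/= in_itv/= => zI; apply: phi0 => /KD Dp.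
  by have /bdryE[_] := lower_bdry zI; exact.
by rewrite (Rintegral_cst _ measurable_J 0) mul0r oppr0.
Qed.

Lemma Rintegral_test_ez phi : test_function D phi -> \int[muu]_(p in D) 'D_(ez R) phi p = 0.
Proof.
move=> tphi; have [sphi [K [cK KD phi0]]] := tphi.
have tz := test_functionD1 (ez R) tphi.
have [C C0 HC] := test_function_bounded tz.
have Iz : L1 ('D_(ez R) phi).
  apply: (@L1_bounded _ _ _ _ _ mD C); first exact: Omega_lty.
    exact: smooth_measurable2 (smoothD1 _ sphi).
  by move=> p _; exact: HC.
have IP := (L1_patch muu mD _).2 Iz.
rewrite Rintegral_mkcond (Rintegral_fubini21 IP).
rewrite (_ : (fun r => _) = fun=> 0); last first.
  apply/funext => r.
  have dphi z := derive_ez z r sphi.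
  have cphi : continuous (fun z => 'D_(ez R) phi (z, r)).
    move=> z; apply: (cvg_contR2 (smooth_continuous (smoothD1 (ez R) sphi))); [exact: cvg_id|exact: cvg_cst].
  rewrite (_ : (fun z => ('D_(ez R) phi \_ D) (z, r)) = (fun z => 'D_(ez R) phi (z, r)) \_ `[-1, 1]); last first.
    have [_ [K' [_ KD' phi0']]] := tz.
    apply/funext => z; rewrite !patchE; have [Dr|nD] := pselect (D (z, r)).
      rewrite mem_set// mem_set//; have [/andP[? ?] _ _] := Dr.
      by rewrite /= in_itv/= !ltW.
    rewrite memNset//; case: ifP => // _; rewrite phi0'// => /KD'; exact: nD.
  rewrite -Rintegral_mkcond (Rintegral_derive _ cphi dphi); last lra.
  by rewrite !phi0 ?subrr// => /KD[/andP[/=]]; rewrite ?ltxx.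
by have := @Rintegral_cst _ _ R mu setT measurableT 0; rewrite mul0r.
Qed.

End omega.

(** * The minimum principle *)

Section scalar_derivatives.
Context {R : realType}.
Implicit Types (f g : R -> R) (x a b c : R).

Lemma D_erE (phi : R * R -> R) (z r d : R) : smooth phi ->
  is_derive r 1 (fun r' => phi (z, r')) d -> 'D_(er R) phi (z, r) = d.
Proof. by move=> sphi [_ <-]; have [_ ->] := derive_er z r sphi. Qed.

Lemma D_ezE (phi : R * R -> R) (z r d : R) : smooth phi ->
  is_derive z 1 (fun z' => phi (z', r)) d -> 'D_(ez R) phi (z, r) = d.
Proof. by move=> sphi [_ <-]; have [_ ->] := derive_ez z r sphi. Qed.

Lemma D_erEs (phi : R * R -> R) (d : R -> R -> R) : smooth phi ->
  (forall z r : R, is_derive r 1 (fun r0 => phi (z, r0)) (d z r)) ->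
  'D_(er R) phi = fun p => d p.1 p.2.
Proof. by move=> sphi H; apply/funext => -[z r]; exact: D_erE. Qed.

Lemma D_ezEs (phi : R * R -> R) (d : R -> R -> R) : smooth phi ->
  (forall z r : R, is_derive z 1 (fun z0 => phi (z0, r)) (d z r)) ->
  'D_(ez R) phi = fun p => d p.1 p.2.
Proof. by move=> sphi H; apply/funext => -[z r]; exact: D_ezE. Qed.

Lemma smooth_ln {V : normedModType R} (f : V -> R) : smooth f -> (forall y, 0 < f y) ->
  smooth (fun y => ln (f y)).
Proof.
move=> sf f0.
(* [Q k] evaluated at [x^-1] is the derivative of order [k + 1] of the logarithm. *)
pose Q := fix Q (k : nat) := if k is k'.+1 then - 'X^2 * (Q k')^`() else 'X : {poly R}.
apply: (@smooth_comp_family _ _ (fun k => if k is k'.+1 then fun x => (Q k').[x^-1] else @ln R)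
  [set x | 0 < x] f) => // -[|k] x /= x0.
  by rewrite hornerX; exact: is_derive1_ln.
have x1 : x != 0 by rewrite gt_eqF.
apply: (dereq (derC (is_derive_horner (Q k) x^-1) (is_derive1_inv x1))).
by rewrite !hornerE/= -exprVn; ring.
Qed.

(** A smooth convex substitute for the positive part: [x exp(-1/x)] for [x > 0], with first
    derivative [Bt1] between 0 and 1 and second derivative [Bt2 >= 0]. *)
Definition Bt (x : R) := x * flat 1 x.
Definition Bt1 := flat (1 + 'X : {poly R}).
Definition Bt2 := flat ('X^3 : {poly R}).

Lemma is_derive_Bt x : is_derive x 1 Bt (Bt1 x).
Proof.
apply: (dereq (derM (derid x) (is_derive_flat 1 x))).
have [x0|x0] := leP x 0; first by rewrite /Bt1 !flat_le0// !mulr0 addr0.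
rewrite /Bt1 !flat_gt0// derivC !hornerE/= ?expr1n. move: (expR _) => E; field; exact: lt0r_neq0.
Qed.

Lemma is_derive_Bt1 x : is_derive x 1 Bt1 (Bt2 x).
Proof.
apply: (dereq (is_derive_flat _ x)); rewrite /Bt2; congr flat.
by rewrite derivD derivC derivX; ring.
Qed.

Lemma smooth_Bt : smooth Bt.
Proof. by apply: smoothM; [exact: smooth_id|exact: smooth_flat]. Qed.

Lemma Bt_le0 x : x <= 0 -> Bt x = 0.
Proof. by move=> x0; rewrite /Bt flat_le0// mulr0. Qed.

Lemma Bt_gt0 x : 0 < x -> 0 < Bt x.
Proof. by move=> x0; rewrite mulr_gt0// flat1_gt0. Qed.

Lemma Bt_ge0 x : 0 <= Bt x.
Proof. by have [/Bt_le0->//|/Bt_gt0/ltW] := leP x 0. Qed.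

Lemma flat1_le1 x : flat 1 x <= 1 :> R.
Proof.
have [x0|x0] := leP x 0; first by rewrite flat_le0.
by rewrite flat_gt0// hornerC mul1r expR_le1 oppr_le0 invr_ge0 ltW.
Qed.

Lemma Bt_homo : {homo Bt : x y / x <= y}.
Proof.
move=> x y xy; have [x0|x0] := leP x 0; first by rewrite Bt_le0// Bt_ge0.
by apply: ler_pM => //; [exact: ltW|exact: flat1_ge0|exact: flat1_homo].
Qed.

Lemma Bt1_le0 x : x <= 0 -> Bt1 x = 0.
Proof. exact: flat_le0. Qed.

Lemma Bt2_le0 x : x <= 0 -> Bt2 x = 0.
Proof. exact: flat_le0. Qed.

Lemma Bt1_ge0 x : 0 <= Bt1 x.
Proof.
have [/Bt1_le0->//|x0] := leP x 0.
by rewrite /Bt1 flat_gt0// !hornerE mulr_ge0 ?expR_ge0// addr_ge0// invr_ge0 ltW.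
Qed.

Lemma Bt1_le1 x : Bt1 x <= 1.
Proof.
have [/Bt1_le0->//|x0] := leP x 0.
by rewrite /Bt1 flat_gt0// !hornerE expRN ler_pdivrMr ?expR_gt0// mul1r expR_ge1Dx.
Qed.

Lemma Bt2_ge0 x : 0 <= Bt2 x.
Proof.
have [/Bt2_le0->//|x0] := leP x 0.
by rewrite /Bt2 flat_gt0// !hornerE mulr_ge0 ?expR_ge0// exprn_ge0// invr_ge0 ltW.
Qed.

End scalar_derivatives.

(** * Logarithmic test functions *)

Section log_test.
Context {R : realType}.
Variables (s z0 r0 rho l : R).
Hypotheses (s0 : 0 < s) (r00 : 0 < r0) (rho0 : 0 < rho).
Implicit Types (z r : R) (p : R * R).

(** Squared distance in the variables [(z / s, r)], in which [d_r^2 + s^2 d_z^2] is the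
    Laplacian. *)
Definition dist2 z r : R := (r - r0) ^+ 2 + (z - z0) ^+ 2 / s ^+ 2.
(** With [x = r / r0 - 1] this is [1 - x/2 + b x^2] for [b = 5/16]. In the operator, the truncated
    logarithm then has the coefficient [(2 b - 1/2 + 4 b x) / r0], nonnegative for [|x| <= 1/10],
    and its first derivative, which is nonpositive, gets the factor
    [(r - r0) ((4 b - 3/2) x + ...)], nonpositive as well. These two signs at small [x] require
    [1/4 < b < 3/8]; the endpoint 3/8 is the Taylor coefficient of [(1 + x) ^ (-1/2)]. *)
Definition weight r : R := 1 - (r / r0 - 1) / 2 + 5 / 16 * (r / r0 - 1) ^+ 2.
(* The Laplacian of [ln (1 / (dist2 + rho^2))] is a Poisson kernel of mass
   bounded in [rho]; the factor [weight], close to [(r0 / r)^(1/2)], absorbs the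
   first order term of the radial operator, and [Bt] truncates. *)
Definition log_test p := weight p.2 * Bt (l - ln (dist2 p.1 p.2 + rho ^+ 2)).

Let k q : R := Bt (l - ln q).
Let k1 q : R := - Bt1 (l - ln q) / q.
Let k2 q : R := (Bt2 (l - ln q) + Bt1 (l - ln q)) / q ^+ 2.
Let W1 r : R := (- (1 / 2) + 5 / 8 * (r / r0 - 1)) / r0.
Let q z r : R := dist2 z r + rho ^+ 2.

Lemma dist2_ge0 z r : 0 <= dist2 z r.
Proof. by rewrite addr_ge0 ?sqr_ge0// divr_ge0 ?sqr_ge0. Qed.

Lemma q_gt0 z r : 0 < dist2 z r + rho ^+ 2.
Proof. by rewrite ltr_wpDl ?dist2_ge0// exprn_gt0. Qed.

Lemma smooth_log_test : smooth log_test.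
Proof.
have s1 := @smooth_fst R; have s2 := @smooth_snd R.
have X (f : R * R -> R) : smooth f -> smooth (fun p => f p ^+ 2).
  by move=> sf; rewrite (_ : (fun _ => _) = fun p => f p * f p); [exact: smoothM|].
apply: smoothM.
  apply: smoothD; last first.
    apply: smoothM; first exact: smooth_cst.
    by apply: X; apply: smoothB; [apply: smoothM => //; exact: smooth_cst|exact: smooth_cst].
  apply: smoothB; first exact: smooth_cst.
  apply: smoothM; last exact: smooth_cst.
  by apply: smoothB; [apply: smoothM => //; exact: smooth_cst|exact: smooth_cst].
apply: (smooth_comp smooth_Bt); apply: smoothB; first exact: smooth_cst.
apply: smooth_ln => [|p]; last exact: q_gt0.
apply: smoothD; last exact: smooth_cst.
apply: smoothD; first by apply: X; apply: smoothB => //; exact: smooth_cst.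
apply: smoothM; last exact: smooth_cst.
by apply: X; apply: smoothB => //; exact: smooth_cst.
Qed.

Let derk (x : R) : 0 < x -> is_derive x 1 k (k1 x).
Proof.
move=> x0; apply: (dereq (derC (is_derive_Bt _) (derB (dercst l x) (is_derive1_ln x0)))).
by rewrite /k1 sub0r mulrN mulNr.
Qed.

Let derk1 (x : R) : 0 < x -> is_derive x 1 k1 (k2 x).
Proof.
move=> x0; have x1 : x != 0 by rewrite gt_eqF.
have dB := derC (is_derive_Bt1 _) (derB (dercst l x) (is_derive1_ln x0)).
have dN := derB (dercst 0 x) dB.
have dm := derM dN (is_derive1_inv x1).
rewrite (_ : k1 = fun y => (0 - Bt1 (l - ln y)) * y^-1); last first.
  by apply/funext => y; rewrite /k1 sub0r.
apply: (dereq dm); rewrite /k2; field; exact: x1.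
Qed.

Let derqr z r : is_derive r 1 (q z) (2 * (r - r0)).
Proof.
have d1 := derB (derid r) (dercst r0 r).
have d2 := derD (derD (derM d1 d1) (dercst ((z - z0) ^+ 2 / s ^+ 2) r)) (dercst (rho ^+ 2) r).
by apply: (dereq d2); ring.
Qed.

Let derqz z r : is_derive z 1 (q ^~ r) (2 * (z - z0) / s ^+ 2).
Proof.
have d1 := derB (derid z) (dercst z0 z).
have d2 := derD (derD (dercst ((r - r0) ^+ 2) z) (derM (derM d1 d1) (dercst (s ^+ 2)^-1 z)))
  (dercst (rho ^+ 2) z).
by apply: (dereq d2); ring.
Qed.

Let derW r : is_derive r 1 weight (W1 r).
Proof.
have dx := derB (derM (derid r) (dercst r0^-1 r)) (dercst 1 r).
have d2 := derD (derB (dercst 1 r) (derM dx (dercst 2^-1 r)))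
  (derM (dercst (5 / 16) r) (derM dx dx)).
by apply: (dereq d2); rewrite /W1; field; exact: lt0r_neq0.
Qed.

Let derW1 r : is_derive r 1 W1 (5 / 8 / r0 ^+ 2).
Proof.
have dx := derB (derM (derid r) (dercst r0^-1 r)) (dercst 1 r).
have d2 := derM (derD (dercst (- (1 / 2)) r) (derM (dercst (5 / 8) r) dx)) (dercst r0^-1 r).
by apply: (dereq d2); field; exact: lt0r_neq0.
Qed.

Let dr z r := W1 r * k (q z r) + weight r * (k1 (q z r) * (2 * (r - r0))).
Let dz z r := weight r * (k1 (q z r) * (2 * (z - z0) / s ^+ 2)).

(** The first two terms come from the derivatives of [weight] and the first order part of the
    operator. The last is [r * weight r] times the two-dimensional Laplacian of the truncated
    logarithm. *)
Lemma log_test_operator z r :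
  'D_(er R) log_test (z, r) + r * 'D_(er R) ('D_(er R) log_test) (z, r) +
    s ^+ 2 * (r * 'D_(ez R) ('D_(ez R) log_test) (z, r)) =
  (W1 r + r * (5 / 8 / r0 ^+ 2)) * k (q z r) +
  2 * (weight r + 2 * r * W1 r) * (r - r0) * k1 (q z r) +
  4 * r * weight r * (dist2 z r * k2 (q z r) + k1 (q z r)).
Proof.
have sl := smooth_log_test.
have q0 z' r' : 0 < q z' r' := q_gt0 z' r'.
have er1 : 'D_(er R) log_test = fun p => dr p.1 p.2.
  apply: (@D_erEs _ log_test dr sl) => z' r'.
  exact (derM (derW r') (derC (derk (q0 z' r')) (derqr z' r'))).
have ez1 : 'D_(ez R) log_test = fun p => dz p.1 p.2.
  apply: (@D_ezEs _ log_test dz sl) => z' r'.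
  have d := derM (dercst (weight r') z') (derC (g := q ^~ r') (derk (q0 z' r')) (derqz z' r')).
  by apply: (dereq d); rewrite mul0r add0r.
have er2 : 'D_(er R) ('D_(er R) log_test) (z, r) = 5 / 8 / r0 ^+ 2 * k (q z r)
    + 2 * W1 r * (k1 (q z r) * (2 * (r - r0)))
    + weight r * (k2 (q z r) * (2 * (r - r0)) ^+ 2 + k1 (q z r) * 2).
  have sd := smoothD1 (er R) sl; rewrite er1 in sd *; apply: (D_erE sd) => /=.
  have d1 := derM (dercst 2 r) (derB (derid r) (dercst r0 r)).
  have A := derM (derW1 r) (derC (derk (q0 z r)) (derqr z r)).
  have B := derM (derW r) (derM (derC (derk1 (q0 z r)) (derqr z r)) d1).
  by apply: (dereq (derD A B)); ring.
have ez2 : 'D_(ez R) ('D_(ez R) log_test) (z, r) =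
    weight r * (k2 (q z r) * (2 * (z - z0) / s ^+ 2) ^+ 2 + k1 (q z r) * (2 / s ^+ 2)).
  have sd := smoothD1 (ez R) sl; rewrite ez1 in sd *; apply: (D_ezE sd) => /=.
  have d1 := derM (derM (dercst 2 z) (derB (derid z) (dercst z0 z))) (dercst (s ^+ 2)^-1 z).
  have B := derM (dercst (weight r) z) (derM (derC (g := q ^~ r) (derk1 (q0 z r)) (derqz z r)) d1).
  by apply: (dereq B); ring.
have er0 : 'D_(er R) log_test (z, r) = dr z r.
  exact (congr1 (fun f => f (z, r)) er1).
apply: (etrans (congr2 +%R (congr2 +%R er0 (congr1 ( *%R r) er2))
  (congr1 ( *%R (s ^+ 2)) (congr1 ( *%R r) ez2)))).
rewrite /dr /dist2.
move: (k (q z r)) (k1 (q z r)) (k2 (q z r)) (weight r) (W1 r) => K K1 K2 W W'.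
field; rewrite ?lt0r_neq0 //.
Qed.

Lemma weight_ge r : `|r - r0| <= r0 / 10 -> 9 / 10 <= weight r <= 11 / 10.
Proof.
move=> H; have : `|r / r0 - 1| <= 1 / 10.
  have -> : r / r0 - 1 = (r - r0) / r0 by field; exact: lt0r_neq0.
  by rewrite normrM normfV (gtr0_norm r00) ler_pdivrMr//; lra.
rewrite /weight ler_norml; move: (r / r0 - 1) => x /andP[x0 x1].
have : x ^+ 2 <= 1 / 100 by nra.
by have := sqr_ge0 x; lra.
Qed.

Lemma log_test_operator_ge z r : `|r - r0| <= r0 / 10 -> r <= 2 ->
  - (9 * (rho ^+ 2 / (dist2 z r + rho ^+ 2) ^+ 2)) <=
  'D_(er R) log_test (z, r) + r * 'D_(er R) ('D_(er R) log_test) (z, r) +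
    s ^+ 2 * (r * 'D_(ez R) ('D_(ez R) log_test) (z, r)).
Proof.
move=> rr r2; have /andP[w0 w1] := weight_ge rr; rewrite log_test_operator.
have [x xE] : exists x, r = r0 * (1 + x).
  by exists (r / r0 - 1); field; exact: lt0r_neq0.
have xE' : r / r0 - 1 = x by rewrite xE; field; exact: lt0r_neq0.
have /andP[x0 x1] : - (1 / 10) <= x <= 1 / 10.
  rewrite -ler_norml -xE'; have -> : r / r0 - 1 = (r - r0) / r0 by field; exact: lt0r_neq0.
  by rewrite normrM normfV (gtr0_norm r00) ler_pdivrMr//; lra.
have A : 0 <= (W1 r + r * (5 / 8 / r0 ^+ 2)) * k (q z r).
  apply: mulr_ge0; last exact: Bt_ge0.
  have -> : W1 r + r * (5 / 8 / r0 ^+ 2) = (1 / 8 + 5 / 4 * x) / r0.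
    by rewrite /W1 xE' xE; field; exact: lt0r_neq0.
  by apply: divr_ge0; [lra|exact: ltW].
have Q0 := q_gt0 z r.
have k10 : k1 (q z r) <= 0 by rewrite /k1 mulNr oppr_le0 divr_ge0 ?Bt1_ge0 ?ltW.
have B : 0 <= 2 * (weight r + 2 * r * W1 r) * (r - r0) * k1 (q z r).
  rewrite mulr_le0// .
  have -> : 2 * (weight r + 2 * r * W1 r) * (r - r0) = 2 * r0 * (x ^+ 2 * (- (1 / 4) + 25 / 16 * x)).
    by rewrite /weight /W1 xE' xE; field; exact: lt0r_neq0.
  by rewrite pmulr_rle0 ?mulr_gt0// mulr_ge0_le0 ?sqr_ge0//; lra.
have C : - (9 * (rho ^+ 2 / (dist2 z r + rho ^+ 2) ^+ 2)) <=
    4 * r * weight r * (dist2 z r * k2 (q z r) + k1 (q z r)).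
  have r_0 : 0 <= r by rewrite xE; apply: mulr_ge0; [exact: ltW|lra].
  (* As [q = dist2 + rho^2], the [Bt1] terms combine into minus a Poisson kernel, the only negative
     contribution. *)
  have -> : dist2 z r * k2 (q z r) + k1 (q z r) =
     dist2 z r * Bt2 (l - ln (q z r)) / (q z r) ^+ 2
     - Bt1 (l - ln (q z r)) * (rho ^+ 2 / (dist2 z r + rho ^+ 2) ^+ 2).
    by rewrite /k2 /k1 /q; field; exact: lt0r_neq0.
  have := Bt1_le1 (l - ln (q z r)); have := Bt1_ge0 (l - ln (q z r)).
  have : 0 <= dist2 z r * Bt2 (l - ln (q z r)) / (q z r) ^+ 2.
    by rewrite divr_ge0 ?sqr_ge0// mulr_ge0 ?dist2_ge0 ?Bt2_ge0.
  have : 0 <= rho ^+ 2 / (dist2 z r + rho ^+ 2) ^+ 2 by rewrite divr_ge0 ?sqr_ge0.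
  move: (_ / _) (Bt1 _) (rho ^+ 2 / _) => X Y Z Z0 X0 Y0 Y1.
  (* From [r <= 2] and [weight r <= 11/10] the product is at most 8.8; this is the origin of the
     factor 9. *)
  have rw : 4 * r * weight r <= 9 by nra.
  have rw0 : 0 <= 4 * r * weight r by nra.
  have : Y * Z <= Z by nra.
  by nra.
by rewrite (le_trans C)// lerDr addr_ge0.
Qed.

End log_test.

Section plane_more.
Context {R : realType}.
Local Notation mR2 := ((measurableTypeR R * measurableTypeR R)%type).
Local Notation mu := (@mu1 R).
Local Notation muu := (@mu2 R).
Local Notation box a b c d := ((`[a, b]%classic : set (measurableTypeR R)) `*` (`[c, d]%classic : set (measurableTypeR R))).

Lemma le_Rintegral_sub (d : measure_display) (T : measurableType d) (nu : {measure set T -> \bar R})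
    (D E : set T) (f : T -> R) : measurable D -> measurable E -> E `<=` D ->
  nu.-integrable D (EFin \o f) -> (forall x, D x -> 0 <= f x) ->
  \int[nu]_(x in E) f x <= \int[nu]_(x in D) f x.
Proof.
move=> mD mE ED If f0; have DE : D `&` E = E by rewrite setIC; exact/setIidPl.
rewrite -[X in \int[nu]_(x in X) _ <= _]DE Rintegral_mkcondr; apply: le_Rintegral => //.
  have IE := (L1_patch nu mE f).2 (integrableS mD mE ED If).
  exact: (integrableS measurableT mD (@subsetT _ _) IE).
by move=> x Dx; rewrite patchE; case: ifP => // _; exact: f0.
Qed.

Lemma measurable_box (a b c d : R) : measurable (box a b c d : set mR2).
Proof. by apply: measurableX; exact: measurable_itv. Qed.

Lemma continuous_fst_comp (f : R -> R) : continuous f -> continuous (fun p : R * R => f p.1).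
Proof. by move=> cf p; apply: (cvg_contR cf); exact: cvg_fst. Qed.

Lemma continuous_snd_comp (f : R -> R) : continuous f -> continuous (fun p : R * R => f p.2).
Proof. by move=> cf p; apply: (cvg_contR cf); exact: cvg_snd. Qed.

Lemma L1_box (a b c d : R) (F : R * R -> R) : continuous F ->
  muu.-integrable (box a b c d) (EFin \o (F : mR2 -> R)).
Proof.
move=> cF; have mF := continuous_measurable2 cF.
have cB : compact ((`[a, b]%classic : set R) `*` (`[c, d]%classic : set R)).
  by apply: compact_setX; exact: segment_compact.
have [B0|/set0P B0] := eqVneq (box a b c d) set0.
  by rewrite B0; exact: integrable_set0.
have [e _ He] := @compact_EVT_max _ R (fun p => `|F p|) _ B0 cB
    (continuous_subspaceT (fun x => cvg_norm (cF x))).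
apply: (@L1_bounded _ _ _ _ _ (measurable_box a b c d) `|F e|).
- exact: mu2_box_lty.
- exact: measurable_funTS.
- by move=> p Bp; apply: He; rewrite inE.
Qed.

Lemma Rintegral_box_prod (a b c d : R) (f g : R -> R) : continuous f -> continuous g ->
  \int[muu]_(p in box a b c d) (f p.1 * g p.2) =
  \int[mu]_(x in `[a, b]) f x * \int[mu]_(y in `[c, d]) g y.
Proof.
move=> cf cg; have mB := measurable_box a b c d.
have IB : muu.-integrable (box a b c d) (EFin \o ((fun p => f p.1 * g p.2) : mR2 -> R)).
  by apply: L1_box => p; apply: cvgM; [exact: continuous_fst_comp|exact: continuous_snd_comp].
have If : mu.-integrable `[a, b] (EFin \o f) by exact/L1_continuous/continuous_subspaceT.
have Ig : mu.-integrable `[c, d] (EFin \o g) by exact/L1_continuous/continuous_subspaceT.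
rewrite Rintegral_mkcond (Rintegral_fubini12 ((L1_patch muu mB _).2 IB)).
rewrite -(RintegralZr _ (measurable_cc a b) If) [RHS]Rintegral_mkcond.
apply: eq_Rintegral => x _; rewrite patchE; case: ifPn => xab.
  rewrite -(RintegralZl _ (measurable_cc c d) Ig) [RHS]Rintegral_mkcond.
  apply: eq_Rintegral => y _; rewrite !patchE; rewrite inE in xab.
  have [ycd|ycd] := pselect (`[c, d]%classic y).
    by rewrite !mem_set.
  by rewrite !memNset// => -[].
rewrite [LHS](_ : _ = \int[mu]_r (0 : R)); last first.
  apply: eq_Rintegral => y _; rewrite patchE memNset// => -[/= xI _].
  by move: xab; rewrite notin_setE; apply.
by have := @Rintegral_cst _ _ R mu setT measurableT 0; rewrite mul0r.
Qed.

Lemma Rintegral_atan_le (rho s z0 a b : R) : 0 < rho -> 0 < s -> a <= b ->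
  \int[mu]_(z in `[a, b]) (rho / ((z - z0) ^+ 2 / s ^+ 2 + rho ^+ 2)) <= s * pi.
Proof.
move=> rho0 s0 ab.
pose F z := s * atan ((z - z0) / s / rho).
pose f z := rho / ((z - z0) ^+ 2 / s ^+ 2 + rho ^+ 2).
have den z : 0 < (z - z0) ^+ 2 / s ^+ 2 + rho ^+ 2.
  by rewrite ltr_wpDl ?exprn_gt0// divr_ge0 ?sqr_ge0.
have dF (z : R) : is_derive z 1 F (f z).
  have d1 := derM (derM (derB (derid z) (dercst z0 z)) (dercst s^-1 z)) (dercst rho^-1 z).
  have d2 := derM (dercst s z) (derC (is_derive1_atan _) d1).
  apply: (dereq d2); rewrite /f; field.
  have Q : 0 < (z - z0) ^+ 2 + (rho * s) ^+ 2 by rewrite ltr_wpDl ?sqr_ge0// exprn_gt0// mulr_gt0.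
  by rewrite !lt0r_neq0.
have cf : continuous f.
  have -> : f = fun z => rho * (((z - z0) * (z - z0) * (s ^+ 2)^-1 + rho ^+ 2)^-1).
    by apply/funext => z; rewrite /f expr2.
  move=> z; apply: cvgM; first exact: cvg_cst.
  apply: cvgV; first by have := den z; rewrite expr2 => /lt0r_neq0.
  apply: cvgD; last exact: cvg_cst.
  have c1 : (y - z0) @[y --> z] --> z - z0 by apply: cvgB; [exact: cvg_id|exact: cvg_cst].
  by apply: cvgM; [exact: cvgM|exact: cvg_cst].
rewrite (Rintegral_derive ab cf dF) /F -mulrBr ler_wpM2l ?(ltW s0)//.
have := @atan_ltpi2 R ((b - z0) / s / rho); have := @atan_gtNpi2 R ((a - z0) / s / rho).
by lra.
Qed.

End plane_more.

(** * The radial operator tested on the domain *)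

Section operator.
Context {R : realType}.
Local Notation mR2 := ((measurableTypeR R * measurableTypeR R)%type).
Local Notation muu := (@mu2 R).

(* [r (1/r d_r (r d_r) + s^2 d_z^2)], formally self-adjoint for [dz dr] *)
Definition Lop (s : R) (phi : R * R -> R) (p : R * R) : R :=
  'D_(er R) phi p + p.2 * 'D_(er R) ('D_(er R) phi) p +
    s ^+ 2 * (p.2 * 'D_(ez R) ('D_(ez R) phi) p).

Lemma smooth_Lop s phi : smooth phi -> smooth (Lop s phi).
Proof.
move=> sphi; have s2 := @smooth_snd R; have sd := @smoothD1 R _.
apply: smoothD; first by apply: smoothD; [exact: sd|apply: smoothM; [exact: s2|exact/sd/sd]].
by apply: smoothM; [exact: smooth_cst|apply: smoothM; [exact: s2|exact/sd/sd]].
Qed.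

Variable v : R -> R.
Hypotheses (cv : {within `[-1, 1], continuous v}) (vN1 : v (-1) = 0) (v1 : v 1 = 0)
  (vJ : forall z, J R z -> -1 < v z < 1).
Local Notation D := (Omega v).
Let mD : measurable (D : set mR2) := measurable_Omega cv vN1 v1 vJ.
Let Doo : (muu D < +oo)%E := Omega_lty cv vN1 v1 vJ.

Lemma L1_smooth_Omega phi : smooth phi -> muu.-integrable D (EFin \o (phi : mR2 -> R)).
Proof.
move=> sphi; have := L1_box (-1) 1 0 2 (smooth_continuous sphi).
by apply: integrableS => //; [exact: measurable_box|exact: Omega_box].
Qed.

(** Symmetry of the operator against [c + e r^2], whose image is [4 e r]: the difference of the two
    integrands is a combination of derivatives of the test functions [Y1], [Y2], [Y3]. *)
Lemma Rintegral_Lop_quad (s c e : R) (phi : R * R -> R) : test_function D phi ->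
  \int[muu]_(p in D) ((c + e * p.2 ^+ 2) * Lop s phi p) =
  4 * e * \int[muu]_(p in D) (p.2 * phi p).
Proof.
move=> tphi; have sphi := tphi.1; have s2 := @smooth_snd R.
pose A (p : R * R) := (c + e * p.2 ^+ 2) * p.2 : R; pose B (p : R * R) := 2 * e * p.2 ^+ 2 : R.
have sX : smooth (fun p : R * R => p.2 ^+ 2).
  by rewrite (_ : (fun _ => _) = fun p : R * R => p.2 * p.2)//; exact: smoothM.
have sA : smooth A.
  apply: smoothM s2; apply: smoothD; first exact: smooth_cst.
  by apply: smoothM sX; exact: smooth_cst.
have sB : smooth B by apply: smoothM sX; exact: smooth_cst.
pose Y1 p := A p * 'D_(er R) phi p; pose Y2 p := B p * phi p; pose Y3 p := A p * 'D_(ez R) phi p.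
have t1 : test_function D Y1 by exact: (test_functionM sA (test_functionD1 _ tphi)).
have t2 : test_function D Y2 by exact: (test_functionM sB tphi).
have t3 : test_function D Y3 by exact: (test_functionM sA (test_functionD1 _ tphi)).
have fin (r X Xr Xrr Xzz : R) : (c + e * r ^+ 2) * (Xr + r * Xrr + s ^+ 2 * (r * Xzz)) =
    ((c + 3 * e * r ^+ 2) * Xr + (c + e * r ^+ 2) * r * Xrr) - (4 * e * r * X + 2 * e * r ^+ 2 * Xr)
    + s ^+ 2 * ((c + e * r ^+ 2) * r * Xzz) + 4 * e * (r * X) by ring.
have E (p : R * R) : D p -> (c + e * p.2 ^+ 2) * Lop s phi p =
    'D_(er R) Y1 p - 'D_(er R) Y2 p + s ^+ 2 * 'D_(ez R) Y3 p + 4 * e * (p.2 * phi p).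
  case: p => z r _.
  have dX := derM (derid r) (derid r).
  have dA := derM (derD (dercst c r) (derM (dercst e r) dX)) (derid r).
  have dB := derM (dercst (2 * e) r) dX.
  have e1 : 'D_(er R) Y1 (z, r) =
      (c + 3 * e * r ^+ 2) * 'D_(er R) phi (z, r) + A (z, r) * 'D_(er R) ('D_(er R) phi) (z, r).
    apply: (D_erE t1.1).
    by refine (dereq (derM dA (derive_er z r (smoothD1 (er R) sphi))) _); rewrite /A /=; ring.
  have e2 : 'D_(er R) Y2 (z, r) = 4 * e * r * phi (z, r) + B (z, r) * 'D_(er R) phi (z, r).
    apply: (D_erE t2.1).
    by refine (dereq (derM dB (derive_er z r sphi)) _); rewrite /B /=; ring.
  have e3 : 'D_(ez R) Y3 (z, r) = A (z, r) * 'D_(ez R) ('D_(ez R) phi) (z, r).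
    apply: (D_ezE t3.1).
    by refine (dereq (derM (dercst (A (z, r)) z) (derive_ez z r (smoothD1 (ez R) sphi))) _); ring.
  apply: (etrans _ (esym (congr2 +%R (congr2 +%R (congr2 +%R e1 (congr1 -%R e2))
    (congr1 ( *%R (s ^+ 2)) e3)) (erefl (4 * e * (r * phi (z, r))))))).
  exact (fin r _ _ _ _).
have I1 := L1_smooth_Omega (smoothD1 (er R) t1.1).
have I2 := L1_smooth_Omega (smoothD1 (er R) t2.1).
have I3 := L1_smooth_Omega (smoothD1 (ez R) t3.1).
have I4 := L1_smooth_Omega (smoothM s2 sphi).
apply: (etrans (eq_Rintegral (g := fun p => 'D_(er R) Y1 p - 'D_(er R) Y2 p + s ^+ 2 * 'D_(ez R) Y3 p + 4 * e * (p.2 * phi p)) muu _)).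
  by move=> p; rewrite inE; exact: E.
apply: (etrans (RintegralD mD (L1D mD (L1B mD I1 I2) (L1Z mD (s ^+ 2) I3)) (L1Z mD (4 * e) I4))).
rewrite (RintegralZl (4 * e) mD I4) -[RHS]add0r; congr (_ + _).
have fin0 : (0 - 0) + s ^+ 2 * 0 = 0 :> R by ring.
have h1 := etrans (RintegralB mD I1 I2) (congr2 (fun a b => a - b)
  (Rintegral_test_er cv vN1 v1 vJ t1) (Rintegral_test_er cv vN1 v1 vJ t2)).
have h3 := etrans (RintegralZl (s ^+ 2) mD I3)
  (congr1 ( *%R (s ^+ 2)) (Rintegral_test_ez cv vN1 v1 vJ t3)).
exact (etrans (RintegralD mD (L1B mD I1 I2) (L1Z mD (s ^+ 2) I3))
  (etrans (congr2 +%R h1 h3) fin0)).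
Qed.

Lemma potential_very_weak s psi phi : is_potential s v psi -> test_function D phi ->
  \int[muu]_(p in D) (psi p * Lop s phi p) = 0.
Proof.
move=> [[Lpsi W] _ eqn _] tphi.
have L12 f : Lp muu D 2 f -> muu.-integrable D (EFin \o f).
  by move=> Lf; exact (Lp_L1 mD Doo (ler1n _ 2) Lf).
refine (very_weak_form mD (L12 _ Lpsi) _ _ eqn tphi) => [w /W[wd [Lw W']]|p [_ + _]//].
split; [exact wd|split; [exact (L12 _ Lw)|]].
by move=> w' /W'[wd' L']; split; [exact wd'|exact (L12 _ L')].
Qed.

End operator.

Section minimum_principle.
Context {R : realType}.
Local Notation mR2 := ((measurableTypeR R * measurableTypeR R)%type).
Local Notation mu := (@mu1 R).
Local Notation muu := (@mu2 R).
Local Notation box a b c d := ((`[a, b]%classic : set (measurableTypeR R)) `*` (`[c, d]%classic : set (measurableTypeR R))).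

(** Where [dist2 + rho^2] exceeds [delta^2] the argument of [Bt] is nonpositive and every term
    vanishes; elsewhere [|r - r0| <= delta <= r0 / 10], the range of [log_test_operator_ge]. *)
Lemma log_test_Lop_ge (s z0 r0 rho delta : R) (p : R * R) : 0 < s -> 0 < r0 -> 0 < rho -> 0 < delta ->
  delta <= r0 / 10 -> p.2 <= 2 ->
  - (9 * (rho ^+ 2 / (dist2 s z0 r0 p.1 p.2 + rho ^+ 2) ^+ 2)) <=
  Lop s (log_test s z0 r0 rho (ln (delta ^+ 2))) p.
Proof.
case: p => z r s0 r00 rho0 d0 dr /= r2.
have q0 := q_gt0 s z0 r0 rho0 z r.
have [H|H] := leP (dist2 s z0 r0 z r + rho ^+ 2) (delta ^+ 2).
  apply: log_test_operator_ge => //; apply: le_trans dr.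
  rewrite -[delta]ger0_norm ?(ltW d0)// -ler_sqr ?nnegrE ?normr_ge0// !real_normK ?num_real//.
  apply: le_trans H; rewrite /dist2 -addrA lerDl addr_ge0 ?sqr_ge0//.
  by rewrite divr_ge0 ?sqr_ge0.
have L0 : ln (delta ^+ 2) - ln (dist2 s z0 r0 z r + rho ^+ 2) <= 0.
  by rewrite subr_le0 ler_ln ?posrE ?exprn_gt0// ltW.
have -> : Lop s (log_test s z0 r0 rho (ln (delta ^+ 2))) (z, r) = 0.
  apply: (etrans (log_test_operator z0 (ln (delta ^+ 2)) s0 r00 rho0 z r)).
  rewrite (Bt_le0 L0) (Bt1_le0 L0) (Bt2_le0 L0) addr0 oppr0 !(mul0r, mulr0, addr0).
  by [].
by rewrite oppr_le0 mulr_ge0// divr_ge0 ?sqr_ge0.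
Qed.

Lemma dist2_le (s z0 r0 d : R) (p : R * R) : 0 < s -> 0 <= d -> dist2 s z0 r0 p.1 p.2 <= d ^+ 2 ->
  `|p.1 - z0| <= s * d /\ `|p.2 - r0| <= d.
Proof.
move=> s0 d0; rewrite /dist2 => H.
have sd0 : 0 <= s * d by rewrite mulr_ge0// ltW.
have A := sqr_ge0 (p.2 - r0).
have B : 0 <= (p.1 - z0) ^+ 2 / s ^+ 2 by rewrite divr_ge0 ?sqr_ge0.
split; rewrite -ler_sqr ?nnegrE// real_normK ?num_real//; last lra.
have : (p.1 - z0) ^+ 2 / s ^+ 2 <= d ^+ 2 by lra.
by rewrite ler_pdivrMr ?exprn_gt0// exprMn mulrC.
Qed.

Lemma continuous_dist2 (s z0 r0 : R) : continuous (fun p : R * R => dist2 s z0 r0 p.1 p.2).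
Proof.
have c1 : continuous (fun p : R * R => p.1 - z0).
  by move=> p; apply: cvgB; [exact: cvg_fst|exact: cvg_cst].
have c2 : continuous (fun p : R * R => p.2 - r0).
  by move=> p; apply: cvgB; [exact: cvg_snd|exact: cvg_cst].
rewrite /dist2 => p; apply: cvgD.
  by rewrite (_ : (fun _ => _) = fun p : R * R => (p.2 - r0) * (p.2 - r0)) //; apply: cvgM; exact: c2.
apply: cvgM; last exact: cvg_cst.
by rewrite (_ : (fun _ => _) = fun p : R * R => (p.1 - z0) * (p.1 - z0)) //; apply: cvgM; exact: c1.
Qed.

Lemma test_function_log_test (D : set (R * R)) (s z0 r0 rho delta : R) : 0 < s -> 0 < rho -> 0 < delta ->
  (forall p : R * R, `|p.1 - z0| <= s * delta -> `|p.2 - r0| <= delta -> D p) ->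
  test_function D (log_test s z0 r0 rho (ln (delta ^+ 2))).
Proof.
move=> s0 rho0 d0 HD; split; first exact: smooth_log_test.
pose K := [set p : R * R | dist2 s z0 r0 p.1 p.2 <= delta ^+ 2].
exists K; split.
- apply: (@subclosed_compact _ _ ((`[z0 - s * delta, z0 + s * delta]%classic : set R) `*`
    (`[r0 - delta, r0 + delta]%classic : set R))).
  + apply: (@closed_ler R (R * R)%type (fun p => dist2 s z0 r0 p.1 p.2) (fun=> delta ^+ 2)).
      exact: continuous_dist2.
    by move=> p; exact: cvg_cst.
  + by apply: compact_setX; exact: segment_compact.
  + move=> p /(dist2_le s0 (ltW d0))[]; rewrite !ler_norml => /andP[? ?] /andP[? ?].
    by split; rewrite /= in_itv/=; apply/andP; split; lra.
- by move=> p /(dist2_le s0 (ltW d0))[]; exact: HD.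
- move=> [z r] /= /negP; rewrite -ltNge => H; rewrite /log_test Bt_le0 ?mulr0//=.
  rewrite subr_le0 ler_ln ?posrE ?exprn_gt0// ?q_gt0//.
  by rewrite (le_trans (ltW H))// lerDl sqr_ge0.
Qed.

Lemma mu2_box_gt0 (a b c d : R) : a < b -> c < d -> 0 < fine (muu (box a b c d)).
Proof.
move=> ab cd; rewrite mu2_box.
have E (x y : R) : x < y -> mu (`[x, y]%classic : set (measurableTypeR R)) = (y - x)%:E.
  by move=> xy; have := lebesgue_measure_itv `[x, y]; rewrite /= lte_fin xy => ->; rewrite EFinB.
by rewrite !E//= mulr_gt0// subr_gt0.
Qed.

Variable v : R -> R.
Hypotheses (cv : {within `[-1, 1], continuous v}) (vN1 : v (-1) = 0) (v1 : v 1 = 0)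
  (vJ : forall z, J R z -> -1 < v z < 1).
Local Notation D := (Omega v).
Let mD : measurable (D : set mR2) := measurable_Omega cv vN1 v1 vJ.
Let Doo : (muu D < +oo)%E := Omega_lty cv vN1 v1 vJ.

(** Since [(X + Y + rho^2)^2 >= (X + rho^2) (Y + rho^2)], the kernel is at most a product of two
    Cauchy kernels in one variable, of masses at most [s pi] and [pi] whatever [rho] is. *)
Lemma Poisson_le (s z0 r0 rho : R) : 0 < s -> 0 < rho ->
  \int[muu]_(p in D) (rho ^+ 2 / (dist2 s z0 r0 p.1 p.2 + rho ^+ 2) ^+ 2) <= s * pi * pi.
Proof.
move=> s0 rho0.
pose f z := rho / ((z - z0) ^+ 2 / s ^+ 2 + rho ^+ 2).
pose g r := rho / ((r - r0) ^+ 2 / 1 ^+ 2 + rho ^+ 2).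
have den (t y c : R) : 0 < (y - c) ^+ 2 / t ^+ 2 + rho ^+ 2.
  by rewrite ltr_wpDl ?exprn_gt0// divr_ge0 ?sqr_ge0.
have cden (t c : R) : continuous (fun y : R => rho / ((y - c) ^+ 2 / t ^+ 2 + rho ^+ 2)).
  move=> y; apply: cvgM; first exact: cvg_cst.
  apply: cvgV; first by rewrite lt0r_neq0.
  apply: cvgD; last exact: cvg_cst.
  have c1 : continuous (fun y : R => y - c) by move=> x; apply: cvgB; [exact: cvg_id|exact: cvg_cst].
  apply: cvgM; last exact: cvg_cst.
  by rewrite (_ : (fun _ => _) = fun y : R => (y - c) * (y - c))//; apply: cvgM; exact: c1.
have cf : continuous f by exact: cden.
have cg : continuous g by exact: cden.
have cF : continuous (fun p : R * R => f p.1 * g p.2).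
  by move=> p; apply: cvgM; [exact: continuous_fst_comp|exact: continuous_snd_comp].
have IB := L1_box (-1) 1 0 2 cF.
have f0 z : 0 <= f z by rewrite divr_ge0 ?ltW.
have g0 z : 0 <= g z by rewrite divr_ge0 ?ltW.
have IDF : muu.-integrable D (EFin \o ((fun p => f p.1 * g p.2) : mR2 -> R)).
  by apply: integrableS IB => //; [exact: measurable_box|exact: Omega_box].
have le1 p : rho ^+ 2 / (dist2 s z0 r0 p.1 p.2 + rho ^+ 2) ^+ 2 <= f p.1 * g p.2.
  have d1 := den s p.1 z0; have d2 := den 1 p.2 r0.
  rewrite /f /g; move: d1 d2; rewrite /dist2 expr1n divr1.
  have X0 := sqr_ge0 (p.2 - r0); have Y0 : 0 <= (p.1 - z0) ^+ 2 / s ^+ 2 by rewrite divr_ge0 ?sqr_ge0.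
  move: ((p.2 - r0) ^+ 2) (_ / s ^+ 2) X0 Y0 => X Y X0 Y0 d1 d2.
  have r2 : 0 < rho ^+ 2 by rewrite exprn_gt0.
  rewrite mulrACA -invfM -expr2 ler_pM2l// lef_pV2 ?posrE ?exprn_gt0 ?mulr_gt0//; last lra.
  by rewrite expr2; apply: ler_pM; lra.
have mh : measurable_fun D ((fun p => rho ^+ 2 / (dist2 s z0 r0 p.1 p.2 + rho ^+ 2) ^+ 2) : mR2 -> R).
  apply: measurable_funTS; apply: continuous_measurable2 => p.
  apply: cvgM; first exact: cvg_cst.
  apply: cvgV; first by rewrite expf_neq0// lt0r_neq0// q_gt0.
  have c1 : continuous (fun p : R * R => dist2 s z0 r0 p.1 p.2 + rho ^+ 2).
    by move=> x; apply: cvgD; [exact: continuous_dist2|exact: cvg_cst].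
  by rewrite (_ : (fun _ => _) = (fun p : R * R => (dist2 s z0 r0 p.1 p.2 + rho ^+ 2) * (dist2 s z0 r0 p.1 p.2 + rho ^+ 2)))//; apply: cvgM; exact: c1.
have Ih : muu.-integrable D (EFin \o ((fun p => rho ^+ 2 / (dist2 s z0 r0 p.1 p.2 + rho ^+ 2) ^+ 2) : mR2 -> R)).
  apply: (L1_le mD mh _ IDF) => p _; rewrite ger0_norm ?le1//.
  by rewrite divr_ge0 ?sqr_ge0.
apply: (le_trans (le_Rintegral mD Ih IDF (fun p _ => le1 p))).
apply: (le_trans (le_Rintegral_sub (measurable_box _ _ _ _) mD (@Omega_box R v) IB _)).
  by move=> p _; rewrite mulr_ge0.
rewrite (Rintegral_box_prod _ _ _ _ cf cg); apply: ler_pM.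
- exact: Rintegral_ge0.
- exact: Rintegral_ge0.
- by apply: Rintegral_atan_le => //; lra.
- by rewrite -[pi]mul1r; apply: Rintegral_atan_le => //; lra.
Qed.

(* If [psi] were negative somewhere, [f = psi - e r^2] would have an interior
   minimum [p0]. Testing [f - f p0 >= 0], which vanishes at [p0], with
   logarithms concentrating at [p0] contradicts [L (- e r^2) = - 4 e r < 0]. *)
Lemma potential_ge0 (s : R) psi p : 0 < s -> is_potential s v psi -> D p -> 0 <= psi p.
Proof.
move=> s0 Hpsi Dp; have [_ cpsi _ bpsi] := Hpsi.
rewrite leNgt; apply/negP => neg.
(* With this scale [e r^2 <= 4 e], so that [f >= - 4 e] on the boundary, whereas
   [f p <= psi p = - 8 e]. *)
pose e : R := - psi p / 8; have e0 : 0 < e by rewrite /e; lra.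
pose f (x : R * R) := psi x - e * x.2 ^+ 2.
have cX : continuous (fun x : R * R => e * x.2 ^+ 2).
  move=> x; apply: cvgM; first exact: cvg_cst.
  by rewrite (_ : (fun _ => _) = fun y : R * R => y.2 * y.2)//; apply: cvgM; exact: cvg_snd.
have cf : {within closure D, continuous f}.
  move=> x; apply: cvgB; first exact: cpsi.
  exact: (continuous_subspaceT cX).
have cK := compact_closure_Omega cv vN1 v1 vJ.
have K0 : closure D !=set0 by exists p; exact: subset_closure.
have [p0 /set_mem Kp0 Hmin] := @compact_EVT_min _ R f _ K0 cK cf.
have [pM _ Hmax] := @compact_EVT_max _ R f _ K0 cK cf.
have Dp0 : D p0.
  apply: contrapT => nD; have Hb : bdry D p0 by apply/(bdryE cv vN1 v1 vJ).
  have h0 : 0 <= f p0 + 4 * e.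
    rewrite /f bpsi//; have := h_ge0 cv vN1 v1 vJ Hb.
    have [_ _ r2 H] := closure_Omega cv vN1 v1 vJ Kp0.
    have /andP[? _] := v_itv vN1 v1 vJ (clamp_itv p0.1).
    have : e * p0.2 ^+ 2 <= e * 4 by rewrite ler_pM2l//; nra.
    by lra.
  have := Hmin p (mem_set (subset_closure Dp)); rewrite /f.
  have : 0 <= e * p.2 ^+ 2 by rewrite mulr_ge0 ?sqr_ge0// ltW.
  have -> : psi p = - (8 * e) by rewrite /e; lra.
  rewrite /f in h0; lra.
pose w x := f x - f p0.
pose M := f pM - f p0.
have w0 x : D x -> 0 <= w x.
  by move=> Dx; rewrite subr_ge0; apply: Hmin; apply/mem_set/subset_closure.
have wM x : D x -> w x <= M.
  by move=> Dx; rewrite lerB//; apply: Hmax; apply/mem_set/subset_closure.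
have M0 : 0 <= M := le_trans (w0 _ Dp0) (wM _ Dp0).
have oD := Omega_open cv vN1 v1 vJ.
have /nbhs_ballP[d /= d0 Hd] : nbhs p0 D by exact: open_nbhs_nbhs.
have wnear (eta : R) : 0 < eta -> exists2 tau, 0 < tau & forall x, D x ->
    `|x.1 - p0.1| <= s * tau -> `|x.2 - p0.2| <= tau -> w x <= eta.
  move=> eta0.
  have cfp : f x @[x --> p0] --> f p0.
    have cfD : {within D, continuous f} by apply: continuous_subspaceW cf; exact: subset_closure.
    rewrite continuous_open_subspace// in cfD.
    by apply: cfD; rewrite inE.
  have : \forall x \near p0, `|f p0 - f x| < eta by move/cvgrPdist_lt : cfp; apply.
  move=> /nbhs_ballP[t /= t0 Ht].
  exists (Num.min (t / 2) (t / (2 * s))) => [|x Dx].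
    by rewrite lt_min !divr_gt0// mulr_gt0.
  set tau := Num.min _ _ => x1 x2.
  have t1 : tau <= t / 2 by rewrite ge_min lexx.
  have t2 : s * tau <= t / 2.
    have : tau <= t / (2 * s) by rewrite ge_min lexx orbT.
    rewrite ler_pdivlMr ?mulr_gt0//; lra.
  have := Ht x; rewrite /w; have H : ball p0 t x.
    split; rewrite /ball/= distrC; [apply: le_lt_trans x1 _|apply: le_lt_trans x2 _]; lra.
  by move=> /(_ H); rewrite /= ltr_norml => /andP[? ?]; lra.
pose r0 := p0.2; pose z0 := p0.1.
have [r00 r02] : 0 < r0 /\ r0 < 2 by case: Dp0 => _ /andP[].
pose delta := Num.min (Num.min (d / 2) (r0 / 10)) (d / (2 * s)).
have delta0 : 0 < delta by rewrite !lt_min !divr_gt0// mulr_gt0.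
have [dl1 dl2 dl3] : [/\ delta <= d / 2, delta <= r0 / 10 & s * delta <= d / 2].
  split; rewrite ?ge_min ?lexx ?orbT//.
  have : delta <= d / (2 * s) by rewrite ge_min lexx orbT.
  rewrite ler_pdivlMr ?mulr_gt0//; lra.
have subD x : `|x.1 - z0| <= s * delta -> `|x.2 - r0| <= delta -> D x.
  move=> x1 x2; apply: Hd; split; rewrite /ball/= distrC; lra.
pose B := box (z0 - s * (delta / 4)) (z0 + s * (delta / 4)) (r0 - delta / 4) (r0 + delta / 4).
have BE x : B x -> `|x.1 - z0| <= s * (delta / 4) /\ `|x.2 - r0| <= delta / 4.
  by move=> [/=]; rewrite !in_itv/= => /andP[? ?] /andP[? ?]; rewrite !ler_norml; split; apply/andP; split; lra.
have sd4 : s * (delta / 4) <= s * delta by rewrite ler_pM2l//; lra.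
have BD : B `<=` D.
  by move=> x /BE[? ?]; apply: subD; lra.
have mB : measurable (B : set mR2) by exact: measurable_box.
(* On [B], for [rho <= delta / 4], one has [dist2 + rho^2 <= 3 delta^2 / 16 < delta^2 / 4], so the
   argument of [Bt] is at least [ln 4]. The factors 9/10 bound [r / r0] and [weight] from below. *)
pose b0 := 9 / 10 * r0 * (9 / 10 * Bt (ln 4)).
have Bt40 : 0 < Bt (ln 4) :> R by apply: Bt_gt0; apply: ln_gt0; lra.
have b00 : 0 < b0.
  have n9 : 0 < 9 / 10 :> R by lra.
  by rewrite /b0; apply: mulr_gt0; apply: mulr_gt0.
pose c0 := b0 * fine (muu B).
have c00 : 0 < c0.
  rewrite mulr_gt0// mu2_box_gt0//; last lra.
  have : 0 < s * (delta / 4) by rewrite mulr_gt0//; lra.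
  by lra.
pose phi rho := log_test s z0 r0 rho (ln (delta ^+ 2)).
have tphi rho : 0 < rho -> test_function D (phi rho) by move=> rho0; exact: test_function_log_test.
have lower rho : 0 < rho -> rho <= delta / 4 -> c0 <= \int[muu]_(x in D) (x.2 * phi rho x).
  move=> rho0 rhod; have sp := (tphi _ rho0).1.
  have I := L1_smooth_Omega cv vN1 v1 vJ (smoothM (@smooth_snd R) sp).
  have p0' x : D x -> 0 <= x.2 * phi rho x.
    move=> [_ /andP[x20 _] _]; apply: mulr_ge0; first exact: ltW.
    have [H|H] := leP `|x.2 - r0| (r0 / 10).
      apply: mulr_ge0; last exact: Bt_ge0.
      by have /andP[? _] := weight_ge r00 H; lra.
    rewrite /phi /log_test Bt_le0 ?mulr0//.
    rewrite subr_le0 ler_ln ?posrE ?exprn_gt0// ?q_gt0//.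
    have : delta ^+ 2 <= `|x.2 - r0| ^+ 2 by rewrite ler_sqr ?nnegrE//; lra.
    rewrite real_normK ?num_real// => /le_trans; apply; rewrite /dist2 -addrA lerDl.
    by rewrite addr_ge0 ?sqr_ge0// divr_ge0 ?sqr_ge0.
  apply: le_trans (le_Rintegral_sub mD mB BD I p0').
  have IB : muu.-integrable B (EFin \o ((fun x => x.2 * phi rho x) : mR2 -> R)).
    exact: (integrableS mD mB BD I).
  rewrite /c0 -(Rintegral_cst _ mB b0); apply: le_Rintegral => //.
    exact: (L1_cst mB b0 (mu2_box_lty _ _ _ _)).
  move=> x /BE[x1 x2]; rewrite /b0 /phi /log_test.
  have /andP[w1 _] := @weight_ge _ _ r00 x.2 (ltac:(lra)).
  have BtB : Bt (ln 4) <= Bt (ln (delta ^+ 2) - ln (dist2 s z0 r0 x.1 x.2 + rho ^+ 2)).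
    apply: Bt_homo; rewrite -ln_div ?posrE ?exprn_gt0// ?q_gt0//.
    rewrite ler_ln ?posrE ?divr_gt0 ?exprn_gt0// ?q_gt0// ler_pdivlMr ?q_gt0//.
    have h1 : (x.2 - r0) ^+ 2 <= (delta / 4) ^+ 2.
      by rewrite -[leLHS]real_normK ?num_real// ler_sqr ?nnegrE//; lra.
    have h2 : (x.1 - z0) ^+ 2 / s ^+ 2 <= (delta / 4) ^+ 2.
      rewrite ler_pdivrMr ?exprn_gt0// -[leLHS]real_normK ?num_real// mulrC -exprMn.
      by rewrite ler_sqr ?nnegrE// mulr_ge0 ?ltW//; lra.
    have h3 : rho ^+ 2 <= (delta / 4) ^+ 2 by rewrite ler_sqr ?nnegrE ?(ltW rho0)//; lra.
    rewrite /dist2; have : (delta / 4) ^+ 2 = delta ^+ 2 / 16 by field.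
    have : 0 <= delta ^+ 2 by exact: sqr_ge0.
    by lra.
  have x2' : 9 / 10 * r0 <= x.2.
    by move: x2; rewrite ler_norml => /andP[? ?]; lra.
  apply: ler_pM => //; [rewrite mulr_ge0//; lra|rewrite mulr_ge0// ltW//|].
  by apply: ler_pM => //; exact: ltW.
have Iw : muu.-integrable D (EFin \o (w : mR2 -> R)).
  have [[Lpsi _] _ _ _] := Hpsi.
  have Ipsi := Lp_L1 mD Doo (ler1n _ 2) Lpsi.
  have sX : smooth (fun x : R * R => e * x.2 ^+ 2).
    apply: smoothM; first exact: smooth_cst.
    rewrite (_ : (fun _ => _) = fun y : R * R => y.2 * y.2)//.
    exact: smoothM (@smooth_snd R) (@smooth_snd R).
  exact (L1B mD (L1B mD Ipsi (L1_smooth_Omega cv vN1 v1 vJ sX)) (L1_cst mD (f p0) Doo)).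
(* As [psi = w + (f p0 + e r^2)], the very weak form exchanges [w] for the quadratic function up to
   sign. *)
have ident rho : 0 < rho ->
    \int[muu]_(x in D) (w x * Lop s (phi rho) x) = - (4 * e * \int[muu]_(x in D) (x.2 * phi rho x)).
  move=> rho0; have tp := tphi _ rho0.
  rewrite -(Rintegral_Lop_quad cv vN1 v1 vJ s (f p0) e tp).
  have sL := smooth_Lop s tp.1.
  have sQ : smooth (fun x : R * R => f p0 + e * x.2 ^+ 2).
    apply: smoothD; first exact: smooth_cst.
    apply: smoothM; first exact: smooth_cst.
    rewrite (_ : (fun _ => _) = fun y : R * R => y.2 * y.2)//.
    exact: smoothM (@smooth_snd R) (@smooth_snd R).
  have IQ := L1_smooth_Omega cv vN1 v1 vJ (smoothM sQ sL).
  have [C _ HC] : exists2 C, 0 <= C & forall x, D x -> `|Lop s (phi rho) x| <= C.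
    have cL := smooth_continuous sL.
  have [c _ Hc] := @compact_EVT_max _ R (fun x => `|Lop s (phi rho) x|) _ K0 cK
      (continuous_subspaceT (fun x => cvg_norm (cL x))).
    exists `|Lop s (phi rho) c|; first exact: normr_ge0.
    by move=> x Dx; exact (Hc x (mem_set (subset_closure Dx))).
  have IwL : muu.-integrable D (EFin \o ((fun x => w x * Lop s (phi rho) x) : mR2 -> R)).
    by refine (eq_L1 mD _ (L1M mD (smooth_measurable2 sL) HC Iw)) => x _; rewrite mulrC.
  have E0 : \int[muu]_(x in D) (w x * Lop s (phi rho) x) +
     \int[muu]_(x in D) ((f p0 + e * x.2 ^+ 2) * Lop s (phi rho) x) = 0.
    rewrite -(RintegralD mD IwL IQ) -[RHS](potential_very_weak cv vN1 v1 vJ Hpsi tp).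
    by apply: eq_Rintegral => x _; rewrite -mulrDl /w /f; congr (_ * _); ring.
  by move/eqP : E0; rewrite addr_eq0 => /eqP.
pose P rho (x : R * R) := rho ^+ 2 / (dist2 s z0 r0 x.1 x.2 + rho ^+ 2) ^+ 2.
have P0 rho x : 0 <= P rho x by rewrite divr_ge0 ?sqr_ge0.
(* Error budget: near [p0], where [w <= eta], the negative part costs at most [9 eta s pi^2 = e c0]
   by [Poisson_le], while the right side of [ident] is at most [- 4 e c0]. *)
pose eta := e * c0 / (9 * (s * pi * pi)).
have pp : 0 < s * pi * pi by rewrite !mulr_gt0// pi_gt0.
have eta0 : 0 < eta by rewrite /eta; apply: divr_gt0; apply: mulr_gt0.
have [tau tau0 Htau] := wnear _ eta0.
pose mes := fine (muu D).
have mes0 : 0 <= mes by exact: fine_ge0.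
(* Far from [p0], where [dist2 > tau^2], the kernel is at most [rho^2 / tau^4]; the total cost
   [Q rho^2] stays below [e c0] by the choice of [rho]. *)
pose Q := 9 * M * mes / tau ^+ 4.
have Q0 : 0 <= Q.
  by rewrite /Q; apply: divr_ge0; [do 2 apply: mulr_ge0 => //|exact/exprn_ge0/ltW].
pose rho := Num.min (delta / 4) (Num.min 1 (e * c0 / (Q + 1))).
have rho0 : 0 < rho.
  have Q1 : 0 < Q + 1 by rewrite ltr_wpDl.
  by rewrite !lt_min ltr01/= divr_gt0//=; apply: divr_gt0 => //; apply: mulr_gt0.
have [rho1 rho2 rho3] : [/\ rho <= delta / 4, rho <= 1 & rho <= e * c0 / (Q + 1)].
  by rewrite /rho !ge_min !lexx ?orbT.
have sL := smooth_Lop s (tphi _ rho0).1.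
have cP : continuous (P rho).
  move=> x; apply: cvgM; first exact: cvg_cst.
  apply: cvgV; first by rewrite expf_neq0// lt0r_neq0// q_gt0.
  have c1 : continuous (fun p : R * R => dist2 s z0 r0 p.1 p.2 + rho ^+ 2).
    by move=> y; apply: cvgD; [exact: continuous_dist2|exact: cvg_cst].
  by rewrite (_ : (fun _ => _) = (fun p : R * R => (dist2 s z0 r0 p.1 p.2 + rho ^+ 2) * (dist2 s z0 r0 p.1 p.2 + rho ^+ 2)))//; apply: cvgM; exact: c1.
have IP : muu.-integrable D (EFin \o (P rho : mR2 -> R)).
  by have := L1_box (-1) 1 0 2 cP; apply: integrableS => //; [exact: measurable_box|exact: Omega_box].
have pt x : D x -> - (9 * eta * P rho x + 9 * M * rho ^+ 2 / tau ^+ 4) <= w x * Lop s (phi rho) x.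
  move=> Dx; have [_ /andP[_ x2] _] := Dx.
  have L1 := log_test_Lop_ge z0 s0 r00 rho0 delta0 dl2 (ltW x2).
  rewrite -/(phi rho) -/(P rho x) in L1.
  have wx0 := w0 _ Dx; have wxM := wM _ Dx; have Px0 := P0 rho x.
  have H1 : w x * - (9 * P rho x) <= w x * Lop s (phi rho) x by exact: ler_wpM2l.
  have H2 : 0 <= 9 * M * rho ^+ 2 / tau ^+ 4.
    apply: divr_ge0; last exact/exprn_ge0/ltW.
    by apply: mulr_ge0; [apply: mulr_ge0|exact: sqr_ge0].
  have [near|far] := leP (dist2 s z0 r0 x.1 x.2) (tau ^+ 2).
    have [n1 n2] := dist2_le s0 (ltW tau0) near.
    have wxe := Htau _ Dx n1 n2.
    have : w x * (9 * P rho x) <= eta * (9 * P rho x) by rewrite ler_wpM2r// mulr_ge0.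
    by lra.
  have PE : P rho x <= rho ^+ 2 / tau ^+ 4.
    rewrite ler_pM2l ?exprn_gt0// lef_pV2 ?posrE ?exprn_gt0 ?q_gt0//.
    rewrite (_ : tau ^+ 4 = (tau ^+ 2) ^+ 2); last by rewrite -exprM.
    rewrite ler_sqr ?nnegrE ?(ltW (q_gt0 _ _ _ _ _ _)) ?sqr_ge0//.
    by rewrite (le_trans (ltW far))// lerDl sqr_ge0.
  have H3 : w x * P rho x <= M * (rho ^+ 2 / tau ^+ 4) by exact: ler_pM.
  have H4 : 0 <= 9 * eta * P rho x by apply: mulr_ge0 => //; apply: mulr_ge0 => //; exact: ltW.
  have : 9 * M * rho ^+ 2 / tau ^+ 4 = 9 * (M * (rho ^+ 2 / tau ^+ 4)) by rewrite !mulrA.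
  by lra.
have int1 : - (9 * eta * \int[muu]_(x in D) P rho x + 9 * M * rho ^+ 2 / tau ^+ 4 * mes) <=
   \int[muu]_(x in D) (w x * Lop s (phi rho) x).
  set k := 9 * M * rho ^+ 2 / tau ^+ 4.
  have Ik := L1_cst mD k Doo.
  have I1 := L1D mD (L1Z mD (9 * eta) IP) Ik.
  rewrite -(RintegralZl _ mD IP) -(Rintegral_cst _ mD k) -(RintegralD mD (L1Z mD (9 * eta) IP) Ik).
  rewrite -(RintegralN mD I1); apply: le_Rintegral => //; first exact: L1N.
  have cL := smooth_continuous sL.
  have [c _ Hc] := @compact_EVT_max _ R (fun x => `|Lop s (phi rho) x|) _ K0 cK
      (continuous_subspaceT (fun x => cvg_norm (cL x))).
  refine (eq_L1 mD _ (L1M (C := `|Lop s (phi rho) c|) mD (smooth_measurable2 sL) _ Iw)) => [x _|x Dx]; first by rewrite mulrC.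
  exact (Hc x (mem_set (subset_closure Dx))).
rewrite (ident _ rho0) in int1.
have low := lower _ rho0 rho1.
have poi := Poisson_le z0 r0 s0 rho0; rewrite -/(P rho) in poi.
have A1 : 9 * eta * \int[muu]_(x in D) P rho x <= e * c0.
  have : 9 * eta * \int[muu]_(x in D) P rho x <= 9 * eta * (s * pi * pi).
    by rewrite ler_pM2l//; apply: mulr_gt0.
  move/le_trans; apply; rewrite /eta le_eqVlt; apply/orP; left; apply/eqP.
  have fld (a t : R) : t != 0 -> 9 * (a / (9 * t)) * t = a by move=> ?; field.
  exact (fld _ _ (lt0r_neq0 pp)).
have A2 : 9 * M * rho ^+ 2 / tau ^+ 4 * mes <= e * c0.
  have fld (a b t m : R) : 9 * a * b / t * m = 9 * a * m / t * b by ring.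
  have -> : 9 * M * rho ^+ 2 / tau ^+ 4 * mes = Q * rho ^+ 2 by exact: fld.
  have : Q * rho ^+ 2 <= (Q + 1) * rho.
    have : rho ^+ 2 <= rho by rewrite expr2 ger_pMr.
    by nra.
  move/le_trans; apply; rewrite mulrC -ler_pdivlMr//; lra.
have A3 : e * c0 <= e * \int[muu]_(x in D) (x.2 * phi rho x) by rewrite ler_pM2l.
have : 0 < e * c0 by rewrite mulr_gt0.
by move: int1 A1 A2 A3; lra.
Qed.

End minimum_principle.

(** * The weighted flux through the lower boundary *)

Section profiles.
Context {R : realType}.
Implicit Types (x y z r : R).

Lemma smooth_derive1 (f : R -> R) : smooth f -> smooth (derive1 f).
Proof.
move=> sf; rewrite (_ : derive1 f = 'D_1 f); first exact: smoothD1.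
by apply/funext => y; rewrite derive1E.
Qed.

Lemma smooth_is_derive (f : R -> R) x : smooth f -> is_derive x 1 f (derive1 f x).
Proof. by move=> sf; rewrite derive1E; apply/derivableP/smooth_derivable. Qed.

Lemma flat_ge0 (p : {poly R}) x : (forall y, 0 < y -> 0 <= p.[y]) -> 0 <= flat p x.
Proof.
move=> p0; have [x0|x0] := leP x 0; first by rewrite flat_le0.
by rewrite flat_gt0// mulr_ge0 ?expR_ge0// p0// invr_gt0.
Qed.

Lemma is_derive_flat1 x : is_derive x 1 (flat 1) (flat 'X^2 x).
Proof. by apply: (dereq (is_derive_flat 1 x)); rewrite derivC subr0 mulr1. Qed.

(** Makes [step' / d] a nonnegative weight, of mass at most one across a strip of any width. *)
Lemma derive1_step_ge0 x : 0 <= derive1 (@step R) x.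
Proof.
have [_ E] := is_derive_step x.
have dI := derB (dercst (flat 1 1) x) (derC (is_derive_flat1 _) (derB (dercst 1 x) (derid x))).
have d := derM (derC (is_derive_flat1 _) dI) (dercst (flat 1 (flat 1 1))^-1 x).
have [_ E'] := d; rewrite -E /step E'.
have p2 (p : R) : 0 <= flat 'X^2 p by apply: flat_ge0 => y _; rewrite hornerXn sqr_ge0.
rewrite mulr0 addr0; apply: mulr_ge0; last by rewrite invr_ge0 flat1_ge0.
have fin (a b : R) : 0 <= a -> 0 <= b -> 0 <= a * (0 - b * (0 - 1)).
  by move=> a0 b0; rewrite sub0r sub0r mulrN1 opprK; exact: mulr_ge0.
exact (fin _ _ (p2 _) (p2 _)).
Qed.

Definition bump0 z := flat 1 (1 / 4 - z ^+ 2).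
Definition bump1 z := flat 'X^2 (1 / 4 - z ^+ 2) * (- 2 * z).
Definition bump2 z := flat ('X^2 * ('X^2 - ('X^2)^`())) (1 / 4 - z ^+ 2) * (4 * z ^+ 2)
   - 2 * flat 'X^2 (1 / 4 - z ^+ 2).

Let derq z : is_derive z 1 (fun z => 1 / 4 - z ^+ 2) (- 2 * z).
Proof.
refine (dereq (derB (dercst (1 / 4) z) (derM (derid z) (derid z))) _); ring.
Qed.

Lemma is_derive_bump0 z : is_derive z 1 bump0 (bump1 z).
Proof. exact (derC (is_derive_flat1 _) (derq z)). Qed.

Lemma is_derive_bump1 z : is_derive z 1 bump1 (bump2 z).
Proof.
refine (dereq (derM (derC (is_derive_flat 'X^2 _) (derq z)) (derM (dercst (- 2) z) (derid z))) _).
by rewrite /bump2; move: (flat _ _) (flat 'X^2 _) => a b; ring.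
Qed.

Lemma smooth_bump0 : smooth bump0.
Proof.
apply: (smooth_comp (smooth_flat 1)); apply: smoothB; first exact: smooth_cst.
rewrite (_ : (fun _ => _) = fun x => x * x)//; apply: smoothM; exact: smooth_id.
Qed.

Lemma smooth_bump1 : smooth bump1.
Proof.
have -> : bump1 = derive1 bump0 by apply/funext => x; rewrite derive1E; have [_ ->] := is_derive_bump0 x.
exact/smooth_derive1/smooth_bump0.
Qed.

Lemma smooth_bump2 : smooth bump2.
Proof.
have -> : bump2 = derive1 bump1 by apply/funext => x; rewrite derive1E; have [_ ->] := is_derive_bump1 x.
exact/smooth_derive1/smooth_bump1.
Qed.

Lemma bump0_ge0 z : 0 <= bump0 z. Proof. exact: flat1_ge0. Qed.

Lemma bump0_le1 z : bump0 z <= 1. Proof. exact: flat1_le1. Qed.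

Lemma bump0_out z : 1 / 2 <= `|z| -> bump0 z = 0.
Proof.
move=> H; apply: flat_le0; have : (1 / 2) ^+ 2 <= `|z| ^+ 2 by rewrite ler_sqr ?nnegrE//; lra.
rewrite real_normK ?num_real//; lra.
Qed.

(** With [Y = 1 / (1/4 - z^2) >= 4], the second derivative is [Y^2 (Y^2 - 6 Y + 6) exp(-Y)]: for
    [Y <= 8] the bracket is at least [-2] and [Y^2 <= 64], for larger [Y] it is positive. A bound
    relative to [bump0] itself lets the radial terms absorb the [z]-derivatives up to the edge of
    the support. *)
Lemma bump2_ge z : - 128 * bump0 z <= bump2 z.
Proof.
rewrite /bump2 /bump0; have [x0|x0] := leP (1 / 4 - z ^+ 2) 0.
  by rewrite !flat_le0//; lra.
rewrite !flat_gt0// !derivXn !hornerE/=.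
have zE : z ^+ 2 = 1 / 4 - (1 / 4 - z ^+ 2)^-1^-1 by rewrite invrK; ring.
have Y4 : 4 <= (1 / 4 - z ^+ 2)^-1.
  rewrite -[leLHS]invrK lef_pV2 ?posrE ?invr_gt0//.
  by have := sqr_ge0 z; lra.
have aux (Y E zz : R) : 4 <= Y -> 0 < E -> zz = 1 / 4 - Y^-1 ->
    - 128 * E <= Y ^+ 2 * (Y ^+ 2 - Y *+ 2) * E * (4 * zz) - 2 * (Y ^+ 2 * E).
  move=> {}Y4 E0 ->; have Y0 : Y != 0 by rewrite lt0r_neq0//; lra.
  have -> : Y ^+ 2 * (Y ^+ 2 - Y *+ 2) * E * (4 * (1 / 4 - Y^-1)) - 2 * (Y ^+ 2 * E) =
      Y ^+ 2 * (Y ^+ 2 - 6 * Y + 6) * E by rewrite mulr2n; field.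
  rewrite ler_pM2r//; have [Y8|Y8] := leP Y 8.
    have : - 2 <= Y ^+ 2 - 6 * Y + 6 by nra.
    have : 0 <= Y ^+ 2 <= 64 by nra.
    by move: (Y ^+ 2 - 6 * Y + 6) (Y ^+ 2) => a b; nra.
  have : 0 <= Y ^+ 2 - 6 * Y + 6 by nra.
  have := sqr_ge0 Y; move: (Y ^+ 2 - 6 * Y + 6) (Y ^+ 2) => a b; nra.
have := aux _ _ _ Y4 (expR_gt0 (- (1 / 4 - z ^+ 2)^-1)) zE.
rewrite div1r; move: ((4^-1 - z ^+ 2)^-1) => Y; rewrite mulr2n; move: (expR _) => E; lra.
Qed.

Lemma Bt_le_Bt1 x : Bt x <= Num.max 0 x * Bt1 x.
Proof.
have [x0|x0] := leP x 0; first by rewrite Bt_le0// Bt1_le0// mulr0.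
rewrite /Bt /Bt1 ler_pM2l// !flat_gt0// !hornerE mulrDl mul1r lerDl.
by rewrite mulr_ge0 ?expR_ge0// invr_ge0 ltW.
Qed.

Lemma Bt1_incr : 0 < Bt1 2 - Bt1 1 :> R.
Proof.
rewrite /Bt1 !flat_gt0// !hornerE subr_gt0 invr1.
have -> : - 2^-1 = 2^-1 + - 1 :> R by field.
rewrite expRD mulrA ltr_pM2r ?expR_gt0//.
by have := @expR_ge1Dx R 2^-1; lra.
Qed.

Variables (K m : R).
Hypotheses (K0 : 0 < K) (m0 : 0 < m).

Definition gam r := expR (K * (2 - r)) - 1.
(** Smoothing at scale [m] of the positive part of [gam - m]; as [gam] vanishes at [r = 2], [b0]
    vanishes near [r = 2]. Its slope factor [Bt1] has the same increments at every scale, so the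
    second derivative concentrated near [r = 2] keeps its mass as [m] tends to 0. *)
Definition b0 r := m * Bt ((gam r - m) / m).
Definition b1 r := Bt1 ((gam r - m) / m) * (- K * (gam r + 1)).
Definition b2 r := Bt2 ((gam r - m) / m) * (- K * (gam r + 1)) ^+ 2 / m
   + Bt1 ((gam r - m) / m) * (K ^+ 2 * (gam r + 1)).

Lemma is_derive_gam r : is_derive r 1 gam (- K * (gam r + 1)).
Proof.
have d := derM (dercst K r) (derB (dercst 2 r) (derid r)).
refine (dereq (derB (derC (is_derive_expR _) d) (dercst 1 r)) _).
by rewrite /gam; move: (expR _) => e; ring.
Qed.

Let derx r : is_derive r 1 (fun r => (gam r - m) / m) (- K * (gam r + 1) / m).
Proof.
refine (dereq (derM (derB (is_derive_gam r) (dercst m r)) (dercst m^-1 r)) _); ring.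
Qed.

Lemma is_derive_b0 r : is_derive r 1 b0 (b1 r).
Proof.
refine (dereq (derM (dercst m r) (derC (is_derive_Bt _) (derx r))) _).
by rewrite /b1; field; exact: lt0r_neq0.
Qed.

Lemma is_derive_Bt1_gam r : is_derive r 1 (fun r => Bt1 ((gam r - m) / m))
  (Bt2 ((gam r - m) / m) * (- K * (gam r + 1) / m)).
Proof. exact (derC (is_derive_Bt1 _) (derx r)). Qed.

Lemma is_derive_b1 r : is_derive r 1 b1 (b2 r).
Proof.
have d := derM (dercst (- K) r) (derD (is_derive_gam r) (dercst 1 r)).
refine (dereq (derM (is_derive_Bt1_gam r) d) _).
rewrite /b2; move: (Bt1 ((gam r - m) / m)) (Bt2 ((gam r - m) / m)) (gam r) => x y t.
by field; exact: lt0r_neq0.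
Qed.

Lemma smooth_gam : smooth gam.
Proof.
apply: smoothB; last exact: smooth_cst.
apply: (smooth_comp smooth_expR); apply: smoothM; first exact: smooth_cst.
by apply: smoothB; [exact: smooth_cst|exact: smooth_id].
Qed.

Lemma smooth_b0 : smooth b0.
Proof.
apply: smoothM; first exact: smooth_cst.
apply: (smooth_comp smooth_Bt); apply: smoothM; last exact: smooth_cst.
by apply: smoothB; [exact: smooth_gam|exact: smooth_cst].
Qed.

Lemma smooth_b1 : smooth b1.
Proof.
have -> : b1 = derive1 b0 by apply/funext => x; rewrite derive1E; have [_ ->] := is_derive_b0 x.
exact/smooth_derive1/smooth_b0.
Qed.

Lemma smooth_b2 : smooth b2.
Proof.
have -> : b2 = derive1 b1 by apply/funext => x; rewrite derive1E; have [_ ->] := is_derive_b1 x.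
exact/smooth_derive1/smooth_b1.
Qed.

Lemma b0_ge0 r : 0 <= b0 r.
Proof. by rewrite mulr_ge0 ?Bt_ge0// ltW. Qed.

Lemma b0_out r : gam r <= m -> b0 r = 0.
Proof.
by move=> H; rewrite /b0 Bt_le0 ?mulr0// pmulr_lle0 ?invr_gt0// subr_le0.
Qed.

(** Bounds [b0] by the quantity that multiplies [K^2] in [b2], which is what absorbs the
    [z]-derivatives for large [K]. *)
Lemma b0_le r : b0 r <= (gam r + 1) * Bt1 ((gam r - m) / m).
Proof.
have E0 : 0 <= gam r + 1 by rewrite subrK expR_ge0.
have [H|H] := leP (gam r) m.
  by rewrite b0_out// mulr_ge0// Bt1_ge0.
have x0 : 0 < (gam r - m) / m by rewrite divr_gt0// subr_gt0.
rewrite /b0; have := Bt_le_Bt1 ((gam r - m) / m); rewrite max_r ?(ltW x0)//.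
move=> h; apply: (@le_trans _ _ (m * ((gam r - m) / m * Bt1 ((gam r - m) / m)))).
  by rewrite ler_pM2l.
have B0 := Bt1_ge0 ((gam r - m) / m); move: (Bt1 ((gam r - m) / m)) B0 => B B0.
have -> : m * ((gam r - m) / m * B) = (gam r - m) * B by field; exact: lt0r_neq0.
have le1 : gam r - m <= gam r + 1 by rewrite lerD2l (le_trans _ ler01)// oppr_le0 ltW.
by exact: ler_wpM2r.
Qed.

Lemma b0_le_exp r : 0 <= r -> b0 r <= expR (K * 2).
Proof.
move=> r0; apply: (le_trans (b0_le r)); rewrite subrK.
apply: (@le_trans _ _ (expR (K * (2 - r)))).
  by rewrite ger_pMr ?expR_gt0// Bt1_le1.
by rewrite ler_expR ler_pM2l//; lra.
Qed.

(* [L] of [bump0 z * b0 r] dominates its [Bt2] part once [K] is large. *)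
Lemma Lop_profile_ge (s delta z r : R) : 0 < delta -> delta <= r <= 2 ->
  256 * s ^+ 2 <= K * (delta * K - 1) ->
  bump0 z * (r * (Bt2 ((gam r - m) / m) * (- K * (gam r + 1)) ^+ 2 / m)) <=
  bump0 z * (b1 r + r * b2 r) + s ^+ 2 * (r * (bump2 z * b0 r)).
Proof.
move=> d0 /andP[dr r2] HK.
have E0 : 0 <= gam r + 1 by rewrite subrK expR_ge0.
have r0 : 0 <= r by lra.
have B1 := Bt1_ge0 ((gam r - m) / m); have hb := b0_le r; have hb0 := b0_ge0 r.
have f0 := bump0_ge0 z; have f2 := bump2_ge z.
rewrite /b1 /b2; move: (Bt2 ((gam r - m) / m) * (- K * (gam r + 1)) ^+ 2 / m) => X.
move: (Bt1 ((gam r - m) / m)) (gam r + 1) (b0 r) (bump0 z) (bump2 z) E0 B1 hb hb0 f0 f2 => B E b f f'' E0 B1 hb hb0 f0 f2.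
have h1 : - 128 * f * b <= f'' * b by rewrite ler_wpM2r.
(* The factor 256 is 128 from [bump2_ge] times the bound [r <= 2]. *)
have h2 : - 256 * s ^+ 2 * (f * (E * B)) <= s ^+ 2 * (r * (f'' * b)).
  have s2 := sqr_ge0 s; have fb : 0 <= f * b by exact: mulr_ge0.
  have fb' : f * b <= f * (E * B) by exact: ler_wpM2l.
  have h3 : s ^+ 2 * r * (- 128 * (f * b)) <= s ^+ 2 * r * (f'' * b).
    by apply: ler_wpM2l; [exact: mulr_ge0|rewrite mulrA].
  have h4 : s ^+ 2 * r * (f * b) <= s ^+ 2 * 2 * (f * (E * B)).
    by apply: ler_pM => //; [exact: mulr_ge0|exact: ler_wpM2l].
  by rewrite [leRHS]mulrA; lra.
have h5 : 256 * s ^+ 2 * (f * (E * B)) <= K * (r * K - 1) * (f * (E * B)).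
  apply: ler_wpM2r; first by apply: mulr_ge0 => //; exact: mulr_ge0.
  by apply: (le_trans HK); rewrite ler_pM2l// lerD2r ler_pM2r.
have -> : f * (B * (- K * E) + r * (X + B * (K ^+ 2 * E))) =
   f * (r * X) + K * (r * K - 1) * (f * (E * B)) by ring.
lra.
Qed.

End profiles.

Lemma trace_elim (R : realType) (C C' c e a b t X Y : R) : 0 < c -> (2 * C + C' + 1) * c = e ->
  `|a| <= C * c -> `|b| <= C' * c -> `|t| <= C * c -> a + b + X = - (t + Y) -> `|X - - Y| <= e.
Proof.
move=> c0 <-; rewrite !ler_norml => /andP[? ?] /andP[? ?] /andP[? ?] ?.
by apply/andP; split; lra.
Qed.

(** * Integration by parts up to the lower boundary *)

Section trace_ibp.
Context {R : realType}.
Local Notation mR2 := ((measurableTypeR R * measurableTypeR R)%type).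
Local Notation mu := (@mu1 R).
Local Notation muu := (@mu2 R).
Variable v : R -> R.
Hypotheses (cv : {within `[-1, 1], continuous v}) (vN1 : v (-1) = 0) (v1 : v 1 = 0)
  (vJ : forall z, J R z -> -1 < v z < 1).
Local Notation D := (Omega v).
Let mD : measurable (D : set mR2) := measurable_Omega cv vN1 v1 vJ.
Let Doo : (muu D < +oo)%E := Omega_lty cv vN1 v1 vJ.

Lemma smooth_bounded_Omega (F : R * R -> R) : smooth F ->
  exists2 C : R, 0 <= C & forall p, closure D p -> `|F p| <= C.
Proof.
move=> sF; have cF := smooth_continuous sF.
have K0 : closure D !=set0.
  exists (0, v 0 + 1); have [] := (bdryE cv vN1 v1 vJ (0, v 0 + 1)).1; last by [].
  by apply: lower_bdry => //; lra.
have [c _ Hc] := @compact_EVT_max _ R (fun x => `|F x|) _ K0 (compact_closure_Omega cv vN1 v1 vJ)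
  (continuous_subspaceT (fun x => cvg_norm (cF x))).
exists `|F c|; first exact: normr_ge0.
by move=> x Dx; exact (Hc x (mem_set Dx)).
Qed.

Lemma L1_smoothM (f F : R * R -> R) : muu.-integrable D (EFin \o (f : mR2 -> R)) -> smooth F ->
  muu.-integrable D (EFin \o ((fun p => f p * F p) : mR2 -> R)).
Proof.
move=> If sF; have [C _ HC] := smooth_bounded_Omega sF.
have HD p : D p -> `|F p| <= C by move=> Dp; apply: HC; exact: subset_closure.
by refine (eq_L1 mD _ (L1M mD (smooth_measurable2 sF) HD If)) => p _; rewrite mulrC.
Qed.

Lemma lower_closure z : J R z -> closure D (z, v z + 1).
Proof.
rewrite /J/= in_itv/= => zI.
by have [] := (bdryE cv vN1 v1 vJ (z, v z + 1)).1 (lower_bdry cv vN1 v1 vJ zI).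
Qed.

Lemma L1_lower (F : R * R -> R) : smooth F -> mu.-integrable (J R) (EFin \o (fun z => F (z, v z + 1))).
Proof.
move=> sF; apply: L1_IJ; apply: L1_continuous => z.
apply: (cvg_contR2 (smooth_continuous sF)).
  by apply: continuous_subspaceT => x; exact: cvg_id.
by apply: cvgD; [exact: cv|exact: cvg_cst].
Qed.

(** For smooth functions this is [Rintegral_fiber]. The approximating sequence in the definition of
    the trace converges in L_1 together with its [r]-derivative and its boundary values, and [H] is
    bounded. *)
Lemma lower_trace_ibp w g (H : R * R -> R) : is_lower_trace v w g -> smooth H ->
  (forall z, -1 < z < 1 -> H (z, 2) = 0) ->
  \int[muu]_(p in D) (wD2 D (er R) w p * H p + w p * 'D_(er R) H p) =
  - \int[mu]_(z in J R) (g z * H (z, v z + 1)).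
Proof.
move=> [[Lw W] Lg [phi [sphi cw cd ct]]] sH H2.
have erin : er R \in [:: ez R; er R] by rewrite in_cons mem_head orbT.
have [_ Lr] := W _ erin; have {}cd := cd _ erin.
set wr := wD2 D (er R) w in Lr cd *.
have Iw := Lp_L1 mD Doo (ler1n _ 2) Lw; have Ir := Lp_L1 mD Doo (ler1n _ 2) Lr.
have mJ := @measurable_J R; have Joo := @J_lty R.
have Ig := Lp_L1 mJ Joo (ler1n _ 2) Lg.
have [C C0 HC] := smooth_bounded_Omega sH.
have [C' C'0 HC'] := smooth_bounded_Omega (smoothD1 (er R) sH).
have HD p : D p -> `|H p| <= C by move=> Dp; apply: HC; exact: subset_closure.
have HD' p : D p -> `|'D_(er R) H p| <= C' by move=> Dp; apply: HC'; exact: subset_closure.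
have HJ z : J R z -> `|H (z, v z + 1)| <= C by move=> Jz; apply: HC; exact: lower_closure.
have mH : measurable_fun D (H : mR2 -> R) by exact: smooth_measurable2.
have mH' : measurable_fun D ('D_(er R) H : mR2 -> R) by exact: smooth_measurable2 (smoothD1 _ sH).
have mHJ : measurable_fun (J R) ((fun z => H (z, v z + 1)) : measurableTypeR R -> R).
  exact: L1_measurable (L1_lower sH).
have mw : measurable_fun D (w : mR2 -> R) by case: Lw.
have mwr : measurable_fun D (wr : mR2 -> R) by case: Lr.
have mg : measurable_fun (J R) (g : measurableTypeR R -> R) by case: Lg.
pose A n := phi n \- w; pose B n := 'D_(er R) (phi n) \- wr.
pose T n := fun z => phi n (z, v z + 1) - g z.
have nearA := @Lpnorm_cvg0_L1 _ _ _ _ _ mD Doo nat \oo _ 2 A (ler1n _ 2).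
have nearB := @Lpnorm_cvg0_L1 _ _ _ _ _ mD Doo nat \oo _ 2 B (ler1n _ 2).
have nearT := @Lpnorm_cvg0_L1 _ _ _ _ _ mJ Joo nat \oo _ 2 T (ler1n _ 2).
have {}nearA : forall e : R, 0 < e -> \forall n \near \oo, muu.-integrable D (EFin \o (A n : mR2 -> R)) /\
    \int[muu]_(x in D) `|A n x| <= e.
  apply: nearA => //; apply: nearW => n; apply: measurable_funB => //.
  exact: smooth_measurable2 (sphi n).
have {}nearB : forall e : R, 0 < e -> \forall n \near \oo, muu.-integrable D (EFin \o (B n : mR2 -> R)) /\
    \int[muu]_(x in D) `|B n x| <= e.
  apply: nearB => //; apply: nearW => n; apply: measurable_funB => //.
  exact: smooth_measurable2 (smoothD1 _ (sphi n)).
have {}nearT : forall e : R, 0 < e -> \forall n \near \oo, mu.-integrable (J R) (EFin \o T n) /\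
    \int[mu]_(x in J R) `|T n x| <= e.
  apply: nearT => //; apply: nearW => n; apply: measurable_funB => //.
  exact: L1_measurable (L1_lower (sphi n)).
apply/eqP; rewrite -subr_eq0 -normr_le0; apply/ler_addgt0Pr => e e0; rewrite add0r.
pose c := e / (2 * C + C' + 1).
have den0 : 0 < 2 * C + C' + 1 by rewrite ltr_wpDl// addr_ge0// mulr_ge0.
have c0 : 0 < c by rewrite divr_gt0.
have [n [[IA HA] [[IB HB] [IT HT]]]] := filter_ex (filterI (nearA _ c0) (filterI (nearB _ c0) (nearT _ c0))).
have fib : \int[muu]_(p in D) ('D_(er R) (phi n) p * H p + phi n p * 'D_(er R) H p) =
    - \int[mu]_(z in J R) (phi n (z, v z + 1) * H (z, v z + 1)).
  rewrite -(Rintegral_fiber cv vN1 v1 vJ (Y := fun p => phi n p * H p)); first last.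
  - by move=> z zI; rewrite H2// mulr0.
  - exact: smoothM.
  apply: eq_Rintegral => -[z r] _; apply/esym/(D_erE (smoothM (sphi n) sH)).
  exact (derM (derive_er z r (sphi n)) (derive_er z r sH)).
have IBH : muu.-integrable D (EFin \o ((fun p => H p * B n p) : mR2 -> R)) by exact (L1M mD mH HD IB).
have IAH : muu.-integrable D (EFin \o ((fun p => 'D_(er R) H p * A n p) : mR2 -> R)) by exact (L1M mD mH' HD' IA).
have ITH : mu.-integrable (J R) (EFin \o (fun z => H (z, v z + 1) * T n z)) by exact (L1M mJ mHJ HJ IT).
have IgH : mu.-integrable (J R) (EFin \o (fun z => H (z, v z + 1) * g z)) by exact (L1M mJ mHJ HJ Ig).
have IwH := L1D mD (L1M mD mH HD Ir) (L1M mD mH' HD' Iw).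
have e1 : \int[muu]_(p in D) ('D_(er R) (phi n) p * H p + phi n p * 'D_(er R) H p) =
   \int[muu]_(p in D) (H p * B n p) + \int[muu]_(p in D) ('D_(er R) H p * A n p) +
   \int[muu]_(p in D) (H p * wr p + 'D_(er R) H p * w p).
  apply: (etrans _ (etrans (RintegralD mD (L1D mD IBH IAH) IwH)
    (congr2 +%R (RintegralD mD IBH IAH) (erefl _)))).
  by apply: eq_Rintegral => p _; rewrite /A /B /=; ring.
have e2 : \int[mu]_(z in J R) (phi n (z, v z + 1) * H (z, v z + 1)) =
   \int[mu]_(z in J R) (H (z, v z + 1) * T n z) + \int[mu]_(z in J R) (H (z, v z + 1) * g z).
  apply: (etrans _ (RintegralD mJ ITH IgH)).
  by apply: eq_Rintegral => p _; rewrite /T /=; ring.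
have e3 : \int[muu]_(p in D) (wr p * H p + w p * 'D_(er R) H p) =
  \int[muu]_(p in D) (H p * wr p + 'D_(er R) H p * w p).
  by apply: eq_Rintegral => p _; congr (_ + _); exact: mulrC.
have e4 : \int[mu]_(z in J R) (g z * H (z, v z + 1)) = \int[mu]_(z in J R) (H (z, v z + 1) * g z).
  by apply: eq_Rintegral => z _; exact: mulrC.
have b1 := le_trans (normr_Rintegral_le mD IB mH HD) (ler_wpM2l C0 HB).
have b2 := le_trans (normr_Rintegral_le mD IA mH' HD') (ler_wpM2l C'0 HA).
have b3 := le_trans (normr_Rintegral_le mJ IT mHJ HJ) (ler_wpM2l C0 HT).
have cE : (2 * C + C' + 1) * c = e by rewrite /c mulrC divfK// lt0r_neq0.
move: fib; rewrite e1 e2 e3 e4 => fib; exact (trace_elim c0 cE b1 b2 b3 fib).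
Qed.

End trace_ibp.

Lemma cutoff_elim (R : realType) (a b c x y t : R) :
  a + b + c = 0 -> c = - x -> y - x = - t -> t = a + b - y.
Proof. lra. Qed.

(** * The flux identity with a cut-off along the graph *)

Section cutoff_identity.
Context {R : realType}.
Local Notation mR2 := ((measurableTypeR R * measurableTypeR R)%type).
Local Notation mu := (@mu1 R).
Local Notation muu := (@mu2 R).
Implicit Types (z r : R) (p : R * R).
Variables (K m s d : R) (P : {poly R}).
Hypotheses (K0 : 0 < K) (m0 : 0 < m) (d0 : 0 < d).

(** [step (xi z r)] rises from 0 to 1 for [r] between [P.[z] + 1 + d] and [P.[z] + 1 + 2 d], a strip
    that lies above the graph of [v + 1] as soon as [|v - P| <= d / 2]. *)
Definition xi z r : R := (r - (P.[z] + 1 + d)) / d.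
Definition metric z : R := 1 + s ^+ 2 * (P^`()).[z] ^+ 2.
Local Notation st := (@step R).
Local Notation st1 := (derive1 (@step R)).
Local Notation st2 := (derive1 (derive1 (@step R))).
Local Notation P1 z := ((P^`()).[z]).
Local Notation P2 z := ((P^`()^`()).[z]).
Local Notation f0 := (@bump0 R).
Local Notation f1 := (@bump1 R).
Local Notation f2 := (@bump2 R).
Local Notation c0 := (b0 K m).
Local Notation c1 := (b1 K m).
Local Notation c2 := (b2 K m).

Definition cutF p : R := f0 p.1 * (c0 p.2 * st (xi p.1 p.2)).
(** Applying the operator to [cutF] produces the second derivative of [step] with a factor [d^-2].
    It is gathered in the [r]-derivative of [cutX]; one integration by parts onto [psi] then leaves
    [step' / d]. *)
Definition cutX p : R := p.2 * c0 p.2 * (f0 p.1 * metric p.1 * (st1 (xi p.1 p.2) / d)).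
(** Built so that [d_r cutH = cutY - cutX]: the weight [cutX], which concentrates on the graph, is
    exchanged for the boundary value of [cutH], up to integrals over the region below
    [P + 1 + 2 d]. *)
Definition cutH p : R := p.2 * c0 p.2 * (f0 p.1 * metric p.1) * (1 - st (xi p.1 p.2)).
Definition LG p : R := f0 p.1 * (c1 p.2 + p.2 * c2 p.2) + s ^+ 2 * (p.2 * (f2 p.1 * c0 p.2)).
(** What is left in front of [step' / d]. It contains the second derivative of [P], which will be
    controlled in L_1 only. *)
Definition cutZ p : R := f0 p.1 * c0 p.2 + 2 * p.2 * (f0 p.1 * c1 p.2)
  - 2 * s ^+ 2 * p.2 * c0 p.2 * f1 p.1 * P1 p.1 - s ^+ 2 * p.2 * c0 p.2 * f0 p.1 * P2 p.1
  - f0 p.1 * metric p.1 * (c0 p.2 + p.2 * c1 p.2).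
Definition cutY p : R := f0 p.1 * metric p.1 * (c0 p.2 + p.2 * c1 p.2) * (1 - st (xi p.1 p.2)).

Let sst1 : smooth st1 := smooth_derive1 (@smooth_step R).
Let dst1 (x : R) : is_derive x 1 st1 (st2 x) := smooth_is_derive x sst1.

Lemma smooth_xi : smooth (fun p : R * R => xi p.1 p.2).
Proof.
apply: smoothM; last exact: smooth_cst.
apply: smoothB; first exact: smooth_snd.
apply: smoothD; last exact: smooth_cst.
apply: smoothD; last exact: smooth_cst.
exact: (smooth_comp (smooth_horner P) (@smooth_fst R)).
Qed.

Lemma smooth_metric : smooth (fun p : R * R => metric p.1).
Proof.
have sP := smooth_comp (smooth_horner P^`()) (@smooth_fst R).
rewrite /metric; apply: smoothD; first exact: smooth_cst.
apply: smoothM; first exact: smooth_cst.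
by rewrite (_ : (fun _ => _) = fun p : R * R => P1 p.1 * P1 p.1)//; apply: smoothM.
Qed.

Let sf0 : smooth (fun p : R * R => f0 p.1) := smooth_comp (@smooth_bump0 R) (@smooth_fst R).
Let sc0 : smooth (fun p : R * R => c0 p.2) := smooth_comp (smooth_b0 K m) (@smooth_snd R).
Let sst : smooth (fun p : R * R => st (xi p.1 p.2)) := smooth_comp (@smooth_step R) smooth_xi.

Lemma smooth_cutF : smooth cutF.
Proof. by apply: smoothM => //; exact: smoothM. Qed.

Lemma smooth_cutX : smooth cutX.
Proof.
apply: smoothM; first by apply: smoothM => //; exact: smooth_snd.
apply: smoothM; first by apply: smoothM => //; exact: smooth_metric.
by apply: smoothM; [exact: (smooth_comp sst1 smooth_xi)|exact: smooth_cst].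
Qed.

Lemma smooth_cutH : smooth cutH.
Proof.
apply: smoothM; last by apply: smoothB => //; exact: smooth_cst.
apply: smoothM; first by apply: smoothM => //; exact: smooth_snd.
by apply: smoothM => //; exact: smooth_metric.
Qed.

Lemma der_xi_r z r : is_derive r 1 (xi z) d^-1.
Proof.
refine (dereq (derM (derB (derid r) (dercst (P.[z] + 1 + d) r)) (dercst d^-1 r)) _); ring.
Qed.

Lemma der_xi_z z r : is_derive z 1 (xi ^~ r) (- P1 z / d).
Proof.
have dP := derD (derD (is_derive_horner P z) (dercst 1 z)) (dercst d z).
refine (dereq (derM (derB (dercst r z) dP) (dercst d^-1 z)) _); ring.
Qed.

Let dsr (z r : R) : is_derive r 1 (fun r => st (xi z r)) (st1 (xi z r) / d) :=
  derC (g := xi z) (is_derive_step _) (der_xi_r z r).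
Let ds1r (z r : R) : is_derive r 1 (fun r => st1 (xi z r)) (st2 (xi z r) / d) :=
  derC (g := xi z) (dst1 _) (der_xi_r z r).
Let dsz (z r : R) : is_derive z 1 (fun z => st (xi z r)) (st1 (xi z r) * (- P1 z / d)) :=
  derC (g := xi ^~ r) (is_derive_step _) (der_xi_z z r).
Let ds1z (z r : R) : is_derive z 1 (fun z => st1 (xi z r)) (st2 (xi z r) * (- P1 z / d)) :=
  derC (g := xi ^~ r) (dst1 _) (der_xi_z z r).

Lemma der_cutX z r : 'D_(er R) cutX (z, r) =
  f0 z * metric z / d * ((c0 r + r * c1 r) * st1 (xi z r) + r * c0 r * (st2 (xi z r) / d)).
Proof.
apply: (D_erE smooth_cutX).
have d1 := derM (derid r) (is_derive_b0 K m0 r).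
have d2 := derM (dercst (f0 z * metric z) r) (derM (ds1r z r) (dercst d^-1 r)).
refine (dereq (derM d1 d2) _).
move: (c0 r) (c1 r) (st1 (xi z r)) (st2 (xi z r)) (f0 z) (metric z) => *; ring.
Qed.

Lemma der_cutH z r : 'D_(er R) cutH (z, r) = cutY (z, r) - cutX (z, r).
Proof.
apply: (D_erE smooth_cutH).
have d1 := derM (derM (derid r) (is_derive_b0 K m0 r)) (dercst (f0 z * metric z) r).
refine (dereq (derM d1 (derB (dercst 1 r) (dsr z r))) _); rewrite /cutY /cutX /=.
move: (c0 r) (c1 r) (st1 (xi z r)) (st (xi z r)) (f0 z) (metric z) => *; ring.
Qed.

Lemma Lop_cutF z r : Lop s cutF (z, r) =
  st (xi z r) * LG (z, r) + st1 (xi z r) / d * cutZ (z, r) + 'D_(er R) cutX (z, r).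
Proof.
have sF := smooth_cutF.
have er1 : 'D_(er R) cutF = fun p => f0 p.1 * (c1 p.2 * st (xi p.1 p.2) + c0 p.2 * (st1 (xi p.1 p.2) / d)).
  apply: (@D_erEs _ cutF (fun z r => f0 z * (c1 r * st (xi z r) + c0 r * (st1 (xi z r) / d))) sF) => z' r'.
  refine (dereq (derM (dercst (f0 z') r') (derM (is_derive_b0 K m0 r') (dsr z' r'))) _).
  by rewrite mul0r add0r.
have ez1 : 'D_(ez R) cutF = fun p => c0 p.2 * (f1 p.1 * st (xi p.1 p.2) + f0 p.1 * (st1 (xi p.1 p.2) * (- P1 p.1 / d))).
  apply: (@D_ezEs _ cutF (fun z r => c0 r * (f1 z * st (xi z r) + f0 z * (st1 (xi z r) * (- P1 z / d)))) sF) => z' r'.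
  refine (dereq (derM (is_derive_bump0 z') (derM (dercst (c0 r') z') (dsz z' r'))) _).
  move: (c0 r') (f1 z') (st1 (xi z' r')) (st (xi z' r')) (f0 z') (P1 z') => *; ring.
have er0 : 'D_(er R) cutF (z, r) = f0 z * (c1 r * st (xi z r) + c0 r * (st1 (xi z r) / d)).
  exact (congr1 (fun f => f (z, r)) er1).
have er2 : 'D_(er R) ('D_(er R) cutF) (z, r) =
    f0 z * (c2 r * st (xi z r) + 2 * (c1 r * (st1 (xi z r) / d)) + c0 r * (st2 (xi z r) / d / d)).
  have sd := smoothD1 (er R) sF; rewrite er1 in sd *; apply: (D_erE sd) => /=.
  have dA := derM (is_derive_b1 K m0 r) (dsr z r).
  have dB := derM (is_derive_b0 K m0 r) (derM (ds1r z r) (dercst d^-1 r)).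
  refine (dereq (derM (dercst (f0 z) r) (derD dA dB)) _).
  move: (c0 r) (c1 r) (c2 r) (st1 (xi z r)) (st (xi z r)) (st2 (xi z r)) (f0 z) => *; ring.
have ez2 : 'D_(ez R) ('D_(ez R) cutF) (z, r) =
    c0 r * (f2 z * st (xi z r) + 2 * (f1 z * (st1 (xi z r) * (- P1 z / d)))
      + f0 z * (st2 (xi z r) * (- P1 z / d) ^+ 2 + st1 (xi z r) * (- P2 z / d))).
  have sd := smoothD1 (ez R) sF; rewrite ez1 in sd *; apply: (D_ezE sd) => /=.
  have dA := derM (is_derive_bump1 z) (dsz z r).
  have dP := derM (derB (dercst 0 z) (is_derive_horner P^`() z)) (dercst d^-1 z).
  have dB := derM (is_derive_bump0 z) (derM (ds1z z r) dP).
  have E : (fun z => c0 r * (f1 z * st (xi z r) + f0 z * (st1 (xi z r) * (- P1 z / d)))) =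
      (fun z => c0 r * (f1 z * st (xi z r) + f0 z * (st1 (xi z r) * ((0 - P1 z) / d)))).
    by apply/funext => z'; rewrite sub0r.
  rewrite E; refine (dereq (derM (dercst (c0 r) z) (derD dA dB)) _).
  move: (c0 r) (f1 z) (f2 z) (st1 (xi z r)) (st (xi z r)) (st2 (xi z r)) (f0 z) (P1 z) (P2 z) => *; ring.
apply: (etrans (congr2 +%R (congr2 +%R er0 (congr1 ( *%R r) er2))
  (congr1 ( *%R (s ^+ 2)) (congr1 ( *%R r) ez2)))).
rewrite der_cutX /LG /cutZ /metric /=.
move: (c0 r) (c1 r) (c2 r) (f1 z) (f2 z) (st1 (xi z r)) (st (xi z r)) (st2 (xi z r)) (f0 z) (P1 z) (P2 z).
by move=> *; field; exact: lt0r_neq0.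
Qed.

Lemma smooth_LG : smooth LG.
Proof.
have sr := @smooth_snd R; have sb1 := smooth_comp (smooth_b1 K m0) sr.
have sb2 := smooth_comp (smooth_b2 K m0) sr; have sf2 := smooth_comp (@smooth_bump2 R) (@smooth_fst R).
apply: smoothD; first exact (smoothM sf0 (smoothD sb1 (smoothM sr sb2))).
exact (smoothM (smooth_cst _) (smoothM sr (smoothM sf2 sc0))).
Qed.

Let sYZ : smooth (fun p : R * R => f0 p.1 * metric p.1 * (c0 p.2 + p.2 * c1 p.2)).
Proof.
have sr := @smooth_snd R; have sb1 := smooth_comp (smooth_b1 K m0) sr.
exact (smoothM (smoothM sf0 smooth_metric) (smoothD sc0 (smoothM sr sb1))).
Qed.

Lemma smooth_cutY : smooth cutY.
Proof. exact (smoothM sYZ (smoothB (smooth_cst 1) sst)). Qed.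

Lemma smooth_cutZ : smooth cutZ.
Proof.
have sr := @smooth_snd R; have sb1 := smooth_comp (smooth_b1 K m0) sr.
have sf1 := smooth_comp (@smooth_bump1 R) (@smooth_fst R).
have sP1 := smooth_comp (smooth_horner P^`()) (@smooth_fst R).
have sP2 := smooth_comp (smooth_horner P^`()^`()) (@smooth_fst R).
have s1 := smoothD (smoothM sf0 sc0) (smoothM (smoothM (smooth_cst 2) sr) (smoothM sf0 sb1)).
have s2 := smoothM (smoothM (smoothM (smoothM (smooth_cst (2 * s ^+ 2)) sr) sc0) sf1) sP1.
have s3 := smoothM (smoothM (smoothM (smoothM (smooth_cst (s ^+ 2)) sr) sc0) sf0) sP2.
exact (smoothB (smoothB (smoothB s1 s2) s3) sYZ).
Qed.

Variable v : R -> R.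
Hypotheses (cv : {within `[-1, 1], continuous v}) (vN1 : v (-1) = 0) (v1 : v 1 = 0)
  (vJ : forall z, J R z -> -1 < v z < 1).
Local Notation D := (Omega v).
Let mD : measurable (D : set mR2) := measurable_Omega cv vN1 v1 vJ.
Let Doo : (muu D < +oo)%E := Omega_lty cv vN1 v1 vJ.
Hypothesis vP : forall z, -1 <= z <= 1 -> `|v z - P.[z]| <= d / 2.

(** The three conditions keep the support away from the corners, from the graph and from [r = 2]. *)
Let Ksupp : set (R * R) := [set p | [/\ `|p.1| <= 1 / 2, P.[p.1] + 1 + d <= p.2 & m <= gam K p.2]].

Let Ksupp_D : Ksupp `<=` D.
Proof.
move=> p [p1 p2 p3]; have p2le : p.2 < 2.
  rewrite ltNge; apply/negP => H; move: p3; apply/negP; rewrite -ltNge.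
  apply: le_lt_trans m0; rewrite subr_le0 expR_le1.
  by rewrite pmulr_rle0// subr_le0.
move: p1; rewrite ler_norml => /andP[z0 z1].
have zI : -1 <= p.1 <= 1 by apply/andP; split; lra.
have := vP zI; rewrite ler_norml => /andP[_ H].
by apply/(OmegaE vN1 v1 vJ); rewrite clamp_id//; have := d0; split; lra.
Qed.

Let compact_Ksupp : compact Ksupp.
Proof.
apply: (@subclosed_compact _ _ ((`[-1, 1]%classic : set R) `*` (`[0, 2]%classic : set R))).
- have -> : Ksupp = [set p | `|p.1| <= 1 / 2] `&` [set p | P.[p.1] + 1 + d <= p.2] `&`
      [set p | m <= gam K p.2].
    by apply/seteqP; split=> p; [move=> []|move=> [[? ?] ?]].
  have cP := smooth_continuous (smooth_comp (smooth_horner P) (@smooth_fst R)).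
  have cg := smooth_continuous (smooth_comp (smooth_gam K) (@smooth_snd R)).
  apply: closedI; last by apply: closed_ler => // p; exact: cvg_cst.
  apply: closedI; apply: closed_ler => p.
  + by apply: cvg_norm; exact: cvg_fst.
  + exact: cvg_cst.
  + by apply: cvgD; [apply: cvgD; [exact: cP|exact: cvg_cst]|exact: cvg_cst].
  + exact: cvg_snd.
- by apply: compact_setX; exact: segment_compact.
- by move=> p /Ksupp_D /(@Omega_box R v).
Qed.

Let out_Ksupp p : ~ Ksupp p -> [\/ f0 p.1 = 0, xi p.1 p.2 < 0 | c0 p.2 = 0].
Proof.
move=> nK; have [H|H] := leP (1 / 2) `|p.1|; first by apply: Or31; exact: bump0_out.
have [H'|H'] := ltP p.2 (P.[p.1] + 1 + d).
  by apply: Or32; rewrite /xi pmulr_llt0 ?invr_gt0// subr_lt0.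
have [H''|H''] := leP (gam K p.2) m; first by apply: Or33; exact: b0_out.
by exfalso; apply: nK; split => //; exact: ltW.
Qed.

Lemma test_cutF : test_function D cutF.
Proof.
split; first exact: smooth_cutF.
exists Ksupp; split => // p /out_Ksupp[E|E|E]; rewrite /cutF ?E ?mul0r//.
  by rewrite step_le0 ?mulr0// ltW.
by rewrite mulr0.
Qed.

Lemma test_cutX : test_function D cutX.
Proof.
split; first exact: smooth_cutX.
exists Ksupp; split => // p /out_Ksupp[E|E|E]; rewrite /cutX ?E ?(mul0r, mulr0)//.
by rewrite derive1_step_out ?(mul0r, mulr0)//; left.
Qed.

Lemma cutH_lower z : J R z -> cutH (z, v z + 1) = (v z + 1) * c0 (v z + 1) * (f0 z * metric z).
Proof.
rewrite /J/= in_itv/= => /andP[/ltW z0 /ltW z1].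
have := @vP z; rewrite z0 z1 => /(_ isT); rewrite ler_norml => /andP[_ H].
rewrite /cutH /= step_le0 ?subr0 ?mulr1//.
by rewrite /xi pmulr_lle0 ?invr_gt0//; have := d0; lra.
Qed.

(** Combines the very weak form tested with [cutF], the weak derivative of [psi] tested with [cutX],
    and [lower_trace_ibp] for [psi_r] with [cutH]; the integral of [psi_r cutX] cancels. *)
Lemma cutoff_identity psi g : is_potential s v psi ->
  is_lower_trace v (wD2 D (er R) psi) g ->
  \int[mu]_(z in J R) (g z * cutH (z, v z + 1)) =
  \int[muu]_(p in D) (psi p * (st (xi p.1 p.2) * LG p))
  + \int[muu]_(p in D) (psi p * (st1 (xi p.1 p.2) / d * cutZ p))
  - \int[muu]_(p in D) (wD2 D (er R) (wD2 D (er R) psi) p * cutH p + wD2 D (er R) psi p * cutY p).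
Proof.
move=> Hpsi tg; have [[Lpsi W] _ _ _] := Hpsi.
have erin : er R \in [:: ez R; er R] by rewrite in_cons mem_head orbT.
have [[_ _ wd] [Lw W']] := W _ erin; have [_ Lwr] := W' _ erin.
have Ipsi := Lp_L1 mD Doo (ler1n _ 2) Lpsi.
have Iw := Lp_L1 mD Doo (ler1n _ 2) Lw; have Iwr := Lp_L1 mD Doo (ler1n _ 2) Lwr.
set w := wD2 D (er R) psi in wd Iw Iwr tg *; set wr := wD2 D (er R) w in Iwr *.
have tF := test_cutF; have tX := test_cutX.
have LM := L1_smoothM cv vN1 v1 vJ.
have sst' : smooth (fun p : R * R => st1 (xi p.1 p.2) / d).
  exact (smoothM (smooth_comp sst1 smooth_xi) (smooth_cst d^-1)).
have sL := smooth_LG; have sY := smooth_cutY; have sZ := smooth_cutZ.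
have sL1 : smooth (fun p : R * R => st (xi p.1 p.2) * LG p) by exact (smoothM sst sL).
have sZ1 : smooth (fun p : R * R => st1 (xi p.1 p.2) / d * cutZ p) by exact (smoothM sst' sZ).
have I1 := LM psi (fun p => st (xi p.1 p.2) * LG p) Ipsi sL1.
have I2 := LM psi (fun p => st1 (xi p.1 p.2) / d * cutZ p) Ipsi sZ1.
have I3 := LM psi ('D_(er R) cutX) Ipsi (smoothD1 (er R) smooth_cutX).
have h1 := potential_very_weak cv vN1 v1 vJ Hpsi tF.
have h2 := wd _ tX.
have H2 z : -1 < z < 1 -> cutH (z, 2) = 0.
  move=> _; rewrite /cutH /= b0_out ?(mulr0, mul0r)//.
  by rewrite /gam subrr mulr0 expR0 subrr ltW.
have h3 := lower_trace_ibp cv vN1 v1 vJ tg smooth_cutH H2.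
have IX := LM w cutX Iw smooth_cutX.
have IHY := L1D mD (LM wr cutH Iwr smooth_cutH) (LM w cutY Iw sY).
have e1 := etrans (RintegralD mD (L1D mD I1 I2) I3) (congr2 +%R (RintegralD mD I1 I2) (erefl _)).
have e1' : \int[muu]_(p in D) (psi p * Lop s cutF p) =
  \int[muu]_(p in D) (psi p * (st (xi p.1 p.2) * LG p) + psi p * (st1 (xi p.1 p.2) / d * cutZ p)
    + psi p * 'D_(er R) cutX p).
  apply: eq_Rintegral => -[z r] _; rewrite -!mulrDr; congr (_ * _); exact: Lop_cutF.
have e3 : \int[muu]_(p in D) (wr p * cutH p + w p * 'D_(er R) cutH p) =
  \int[muu]_(p in D) (wr p * cutH p + w p * cutY p - w p * cutX p).
  apply: eq_Rintegral => -[z r] _.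
  by rewrite -addrA -mulrBr; congr (_ + _ * _); exact: der_cutH.
have e3' := etrans (esym (etrans e3 (RintegralB mD IHY IX))) h3.
have {}e1 := etrans (esym (etrans e1' e1)) h1.
exact (cutoff_elim e1 h2 e3').
Qed.

End cutoff_identity.

Section norm_bounds.
Context {R : realType}.
Implicit Types x y a b : R.

Lemma norm_le_M x y a b : `|x| <= a -> `|y| <= b -> `|x * y| <= a * b.
Proof. by move=> xa yb; rewrite normrM; apply: ler_pM. Qed.

Lemma norm_le_D x y a b : `|x| <= a -> `|y| <= b -> `|x + y| <= a + b.
Proof. by move=> xa yb; rewrite (le_trans (ler_normD _ _))// lerD. Qed.

Lemma norm_le_B x y a b : `|x| <= a -> `|y| <= b -> `|x - y| <= a + b.
Proof. by move=> xa yb; rewrite (le_trans (ler_normB _ _))// lerD. Qed.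

Lemma bounded_itv (f : R -> R) a b : a <= b -> {within `[a, b], continuous f} ->
  exists2 C : R, 0 <= C & forall x, a <= x <= b -> `|f x| <= C.
Proof.
move=> ab cf.
have [c _ Hc] := @EVT_max R (fun x => `|f x|) a b ab (fun x => cvg_norm (cf x)).
by exists `|f c| => // x xab; apply: Hc; rewrite in_itv.
Qed.

End norm_bounds.

Section plane_strip.
Context {R : realType}.
Local Notation mR2 := ((measurableTypeR R * measurableTypeR R)%type).
Local Notation mu := (@mu1 R).
Local Notation muu := (@mu2 R).
Local Notation box a b c d := ((`[a, b]%classic : set (measurableTypeR R)) `*` (`[c, d]%classic : set (measurableTypeR R))).
Local Notation st1 := (derive1 (@step R)).

Lemma Rintegral_box_iter (a b c d : R) (F : R * R -> R) : continuous F ->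
  \int[muu]_(p in box a b c d) F p = \int[mu]_(x in `[a, b]) (\int[mu]_(y in `[c, d]) F (x, y)).
Proof.
move=> cF; have mB := measurable_box a b c d; have IB := L1_box a b c d cF.
rewrite Rintegral_mkcond (Rintegral_fubini12 ((L1_patch muu mB _).2 IB)) [RHS]Rintegral_mkcond.
apply: eq_Rintegral => x _; rewrite [RHS]patchE; case: ifPn => xab.
  rewrite [RHS]Rintegral_mkcond; rewrite inE in xab.
  apply: eq_Rintegral => y _; rewrite !patchE.
  have [ycd|ycd] := pselect (`[c, d]%classic y); first by rewrite !mem_set.
  by rewrite !memNset// => -[].
rewrite [LHS](_ : _ = \int[mu]_r (0 : R)); last first.
  apply: eq_Rintegral => y _; rewrite patchE memNset// => -[/= xI _].
  by move: xab; rewrite notin_setE; apply.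
by have := @Rintegral_cst _ _ R mu setT measurableT 0; rewrite mul0r.
Qed.

(** In [r] the factor [step' / d] integrates to an increment of [step], at most 1; thinner strips do
    not worsen the bound. *)
Lemma strip_integral (d : R) (P Q : {poly R}) : 0 < d ->
  \int[muu]_(p in box (-1) 1 0 2) (st1 (xi d P p.1 p.2) / d * (1 + `|Q.[p.1]|)) <=
  \int[mu]_(z in `[(-1 : R), 1]) (1 + `|Q.[z]|).
Proof.
move=> d0.
have cst1 : continuous st1 := smooth_continuous (smooth_derive1 (@smooth_step R)).
have cxi : continuous (fun p : R * R => xi d P p.1 p.2) := smooth_continuous (smooth_xi d P).
have cQ : continuous (fun z => 1 + `|Q.[z]|).
  move=> z; apply: cvgD; first exact: cvg_cst.
  by apply: cvg_norm; exact: (smooth_continuous (smooth_horner Q)).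
have cF : continuous (fun p : R * R => st1 (xi d P p.1 p.2) / d * (1 + `|Q.[p.1]|)).
  move=> p; apply: cvgM; last exact: (continuous_fst_comp cQ).
  by apply: cvgM; [exact: (cvg_contR cst1 (cxi p))|exact: cvg_cst].
rewrite (Rintegral_box_iter _ _ _ _ cF).
have inner z : \int[mu]_(r in `[0, 2]) (st1 (xi d P z r) / d * (1 + `|Q.[z]|)) =
    (step (xi d P z 2) - step (xi d P z 0)) * (1 + `|Q.[z]|).
  have dst (r : R) : is_derive r 1 (fun r => step (xi d P z r) * (1 + `|Q.[z]|)) (st1 (xi d P z r) / d * (1 + `|Q.[z]|)).
    refine (dereq (derM (derC (g := xi d P z) (is_derive_step _) (der_xi_r d P z r)) (dercst (1 + `|Q.[z]|) r)) _).
    by rewrite mulr0 addr0.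
  have cr : continuous (fun r => st1 (xi d P z r) / d * (1 + `|Q.[z]|)).
    by move=> r; apply: (cvg_contR2 cF (f := fun=> z) (g := id)); [exact: cvg_cst|exact: cvg_id].
  by rewrite (Rintegral_derive _ cr dst) ?mulrBl//; lra.
have IQ : mu.-integrable `[(-1 : R), 1] (EFin \o (fun z => 1 + `|Q.[z]|)).
  exact/L1_continuous/continuous_subspaceT.
have cstep : continuous (@step R) := smooth_continuous (@smooth_step R).
have cI : continuous (fun z => (step (xi d P z 2) - step (xi d P z 0)) * (1 + `|Q.[z]|)).
  move=> z; apply: cvgM; last exact: cQ.
  apply: cvgB; apply: (cvg_contR cstep).
    by apply: (cvg_contR2 cxi (f := id) (g := fun=> 2)); [exact: cvg_id|exact: cvg_cst].
  by apply: (cvg_contR2 cxi (f := id) (g := fun=> 0)); [exact: cvg_id|exact: cvg_cst].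
have -> : \int[mu]_(z in `[(-1 : R), 1]) (\int[mu]_(r in `[0, 2]) (st1 (xi d P z r) / d * (1 + `|Q.[z]|))) =
    \int[mu]_(z in `[(-1 : R), 1]) ((step (xi d P z 2) - step (xi d P z 0)) * (1 + `|Q.[z]|)).
  by apply: eq_Rintegral => z _; exact: inner.
apply: le_Rintegral => //; first exact/L1_continuous/continuous_subspaceT.
move=> z _; rewrite ler_piMl ?addr_ge0//.
by have := step_le1 (xi d P z 2); have := step_ge0 (xi d P z 0); clear; lra.
Qed.

(** [r2] and [r3] solve [gam = 2 m] and [gam = 3 m], so the argument [(gam - m) / m] runs between 1
    and 2 and the integral of this exact derivative does not depend on [m]. The interval shrinks to
    [r = 2] as [m] tends to 0. *)
Lemma profile_integral (K m : R) : 0 < K -> 0 < m ->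
  let r2 := 2 - ln (1 + 2 * m) / K in let r3 := 2 - ln (1 + 3 * m) / K in
  [/\ r3 < r2, r2 < 2, 2 - r3 <= 3 * m / K,
      (forall r, r3 <= r <= r2 -> 2 * m <= gam K r) &
      \int[mu]_(r in `[r3, r2]) (Bt2 ((gam K r - m) / m) * (K * (gam K r + 1) / m)) = Bt1 2 - Bt1 1].
Proof.
move=> K0 m0 r2 r3.
have l2 : 0 < ln (1 + 2 * m) by apply: ln_gt0; rewrite ltrDl mulr_gt0.
have l23 : ln (1 + 2 * m) < ln (1 + 3 * m).
  by rewrite ltr_ln ?posrE ?addr_gt0 ?mulr_gt0// ltrD2l ltr_pM2r//; lra.
have g2 : gam K r2 = 2 * m.
  rewrite /gam /r2 subKr mulrC divfK ?lt0r_neq0//.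
  by rewrite lnK ?posrE ?addr_gt0 ?mulr_gt0// addrC addKr.
have g3 : gam K r3 = 3 * m.
  rewrite /gam /r3 subKr mulrC divfK ?lt0r_neq0//.
  by rewrite lnK ?posrE ?addr_gt0 ?mulr_gt0// addrC addKr.
have r32 : r3 < r2 by rewrite ltrD2l ltrN2 ltr_pM2r ?invr_gt0.
split => //.
- by rewrite ltrBlDr ltrDl divr_gt0.
- rewrite /r3 subKr ler_pM2r ?invr_gt0//.
  have := @expR_ge1Dx R (ln (1 + 3 * m)); rewrite lnK ?posrE ?addr_gt0 ?mulr_gt0//.
  by rewrite lerD2l.
- move=> r /andP[_ rr]; rewrite -g2 lerD2r ler_expR ler_pM2l//; lra.
have dF (r : R) : is_derive r 1 (fun r => 0 - Bt1 ((gam K r - m) / m))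
    (Bt2 ((gam K r - m) / m) * (K * (gam K r + 1) / m)).
  refine (dereq (derB (dercst 0 r) (is_derive_Bt1_gam K m r)) _).
  by rewrite sub0r !mulNr mulrN opprK.
have cB2 : continuous (@Bt2 R) := smooth_continuous (@smooth_flat R _).
have cg : continuous (gam K) := smooth_continuous (smooth_gam K).
have cf : continuous (fun r => Bt2 ((gam K r - m) / m) * (K * (gam K r + 1) / m)).
  move=> r; apply: cvgM.
    apply: (cvg_contR cB2); apply: cvgM; last exact: cvg_cst.
    by apply: cvgB; [exact: cg|exact: cvg_cst].
  apply: cvgM; last exact: cvg_cst.
  apply: cvgM; first exact: cvg_cst.
  by apply: cvgD; [exact: cg|exact: cvg_cst].
rewrite (Rintegral_derive (ltW r32) cf dF) g2 g3 !sub0r opprK addrC.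
by congr (Bt1 _ - Bt1 _); field; exact: lt0r_neq0.
Qed.

End plane_strip.

(** * The potential near the lower and upper boundaries *)

Section potential_near_boundary.
Context {R : realType}.
Variable v : R -> R.
Hypotheses (cv : {within `[-1, 1], continuous v}) (vN1 : v (-1) = 0) (v1 : v 1 = 0)
  (vJ : forall z, J R z -> -1 < v z < 1).
Local Notation D := (Omega v).
Variables (s : R) (psi : R * R -> R).
Hypothesis (Hpsi : is_potential s v psi).

Lemma potential_small e : 0 < e -> exists2 t : R, 0 < t & forall p, D p ->
  p.2 <= v p.1 + 1 + t -> `|psi p| <= e.
Proof.
move=> e0; have [_ cpsi _ bpsi] := Hpsi.
have [k k0 Hk] := compact_unif_continuous (compact_closure_Omega cv vN1 v1 vJ) cpsi e0.
exists (k / 2); first by rewrite divr_gt0.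
move=> [z r] Dp /= rt; have [zI _ /andP[vr _]] := Dp; rewrite /= in zI vr.
have Hb := lower_bdry cv vN1 v1 vJ zI.
have Kq : closure D (z, v z + 1) by have [] := (bdryE cv vN1 v1 vJ (z, v z + 1)).1 Hb.
have := Hk (z, r) (z, v z + 1) (subset_closure Dp) Kq.
rewrite (bpsi _ Hb) (h_lower vN1 v1 vJ zI) subr0; apply; split; rewrite /ball/=.
  by rewrite subrr normr0.
by rewrite gtr0_norm; lra.
Qed.

(** Uniform continuity and the boundary value 1 at [r = 2], away from the corners. The thickness [t]
    depends on the potential; it is also small enough to place the layer above [r = 1] and above the
    cut-off strip. *)
Lemma potential_large : exists2 t : R, 0 < t & forall z r, `|z| <= 1 / 4 -> 2 - t <= r -> r < 2 ->
  [/\ D (z, r), 1 / 2 <= psi (z, r), 1 <= r & v z + 1 + t <= r].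
Proof.
have [_ cpsi _ bpsi] := Hpsi.
have e0 : 0 < 1 / 2 :> R by lra.
have [k k0 Hk] := compact_unif_continuous (compact_closure_Omega cv vN1 v1 vJ) cpsi e0.
have [c cI Hc] := @EVT_max R v (-1) 1 ltac:(lra) cv.
have /andP[_ vc1] := @v_itv R v vN1 v1 vJ c ltac:(by rewrite in_itv in cI).
pose t := Num.min (k / 2) (Num.min ((1 - v c) / 2) 1).
have t0 : 0 < t by rewrite !lt_min ltr01 andbT !divr_gt0// subr_gt0.
have [t1 t2 t3] : [/\ t <= k / 2, t <= (1 - v c) / 2 & t <= 1].
  by rewrite /t !ge_min !lexx ?orbT.
exists t => // z r; rewrite ler_norml => /andP[z0 z1] rt r2.
have zI : -1 < z < 1 by apply/andP; split; lra.
have zI' : -1 <= z <= 1 by apply/andP; split; lra.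
have vz : v z <= v c by apply: Hc; rewrite in_itv.
have Dp : D (z, r).
  by apply/(OmegaE vN1 v1 vJ); rewrite /= clamp_id//; split; lra.
split => //; [|lra|lra].
have Hb := upper_bdry cv vN1 v1 vJ zI.
have Kq : closure D (z, 2) by have [] := (bdryE cv vN1 v1 vJ (z, 2)).1 Hb.
have := Hk (z, r) (z, 2) (subset_closure Dp) Kq.
rewrite (bpsi _ Hb) (h_upper vN1 v1 vJ zI) => H.
have : ball (z, r) k (z, 2).
  split; rewrite /ball/=; first by rewrite subrr normr0.
  by rewrite distrC gtr0_norm; lra.
by move=> /H; rewrite ler_norml => /andP[? ?]; lra.
Qed.

End potential_near_boundary.

Lemma flux_elim (R : realType) (F x1 x2 x3 x4 e : R) :
  F <= x1 -> `|x2| <= e -> `|x3| <= e -> `|x4| <= e -> F <= x2 + (x1 + x3 - x4) + (e + e + e).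
Proof. by rewrite !ler_norml => ? /andP[? ?] /andP[? ?] /andP[? ?]; lra. Qed.

(** * Lower bound of the weighted flux *)

Section trace_bound.
Context {R : realType}.
Local Notation mR2 := ((measurableTypeR R * measurableTypeR R)%type).
Local Notation mu := (@mu1 R).
Local Notation muu := (@mu2 R).
Local Notation I := (`[(-1 : R), (1 : R)]%classic : set (measurableTypeR R)).
Local Notation box a b c d := ((`[a, b]%classic : set (measurableTypeR R)) `*` (`[c, d]%classic : set (measurableTypeR R))).
Local Notation st1 := (derive1 (@step R)).

(** The lower bound 1/2 of [psi], times the length 1/2 of [[-1/4, 1/4]], times the minimum
    [flat 1 (3/16)] of [bump0] there, times [K] and the integral of [profile_integral]. *)
Definition flux_const (K : R) : R := flat 1 (3 / 16) / 4 * (K * (Bt1 2 - Bt1 1)).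

Lemma flux_const_gt0 K : 0 < K -> 0 < flux_const K.
Proof.
move=> K0; rewrite /flux_const; apply: mulr_gt0; last exact: (mulr_gt0 K0 Bt1_incr).
by apply: divr_gt0 => //; apply: flat1_gt0; lra.
Qed.

Lemma LG_ge (v : R -> R) (s delta K m z r : R) : 0 < delta -> (forall z, -1 <= z <= 1 -> delta <= v z + 1) ->
  0 < K -> 256 * s ^+ 2 <= K * (delta * K - 1) -> 0 < m -> Omega v (z, r) ->
  bump0 z * (r * (Bt2 ((gam K r - m) / m) * (- K * (gam K r + 1)) ^+ 2 / m)) <= LG K m s (z, r).
Proof.
move=> delta0 vdelta K0 HK m0 [/= zI /andP[_ r2] /andP[vr _]].
have zI' : -1 <= z <= 1 by case/andP: zI => *; rewrite !ltW.
apply: (Lop_profile_ge K0 m0 (delta := delta)) => //.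
by rewrite (ltW r2) andbT (le_trans (vdelta _ zI'))// ltW.
Qed.

Lemma LG_ge0 (v : R -> R) (s delta K m : R) q : 0 < delta -> (forall z, -1 <= z <= 1 -> delta <= v z + 1) ->
  0 < K -> 256 * s ^+ 2 <= K * (delta * K - 1) -> 0 < m -> Omega v q -> 0 <= LG K m s q.
Proof.
case: q => z r delta0 vdelta K0 HK m0 Dq; apply: le_trans (LG_ge delta0 vdelta K0 HK m0 Dq).
have [_ /andP[/= r0 _] _] := Dq.
apply: mulr_ge0; first exact: bump0_ge0.
apply: mulr_ge0; first exact: ltW.
apply: divr_ge0; last exact: ltW.
by apply: mulr_ge0; [exact: Bt2_ge0|exact: sqr_ge0].
Qed.

(** Both [psi] and [LG] are nonnegative on the domain, so everything outside the box of [z] in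
    [[-1/4, 1/4]] and [r] in [[r3, r2]] may be dropped. In the box [psi >= 1/2] and the cut-off
    equals 1. *)
Lemma flux_ge (v : R -> R) (s delta K m t d : R) (P : {poly R}) (psi : R * R -> R) :
  {within `[-1, 1], continuous v} -> v (-1) = 0 -> v 1 = 0 -> (forall z, J R z -> -1 < v z < 1) ->
  0 < s -> 0 < delta -> (forall z, -1 <= z <= 1 -> delta <= v z + 1) -> 1 <= K ->
  256 * s ^+ 2 <= K * (delta * K - 1) -> is_potential s v psi ->
  0 < m -> 3 * m <= t -> 0 < d -> 3 * d <= t ->
  (forall z, -1 <= z <= 1 -> `|v z - P.[z]| <= d / 2) ->
  (forall z r, `|z| <= 1 / 4 -> 2 - t <= r -> r < 2 ->
    [/\ (Omega v) (z, r), 1 / 2 <= psi (z, r), 1 <= r & v z + 1 + t <= r]) ->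
  flux_const K <= \int[muu]_(q in (Omega v)) (psi q * (step (xi d P q.1 q.2) * LG K m s q)).
Proof.
move=> cv vN1 v1 vJ s0 delta0 vdelta K1 HK Hpsi m0 mt d0 dt vP Ht.
have mD : measurable (Omega v : set mR2) := measurable_Omega cv vN1 v1 vJ.
have Doo : (muu (Omega v) < +oo)%E := Omega_lty cv vN1 v1 vJ.
have K0 : 0 < K := lt_le_trans ltr01 K1.
have [r32 r22 r3t gr intr] := profile_integral K0 m0.
set r2 := 2 - ln (1 + 2 * m) / K in r32 r22 gr intr *; set r3 := 2 - ln (1 + 3 * m) / K in r32 r3t gr intr *.
have r3t' : 2 - t <= r3.
  have : 3 * m / K <= 3 * m by rewrite ler_pdivrMr// ler_peMr// mulr_ge0// ltW.
  by move: r3t mt; clear; lra.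
pose B := box (- (1 / 4)) (1 / 4) r3 r2.
have mB : measurable (B : set mR2) by exact: measurable_box.
have HB q : B q -> [/\ `|q.1| <= 1 / 4, r3 <= q.2 <= r2 & [/\ (Omega v) q, 1 / 2 <= psi q, 1 <= q.2 & v q.1 + 1 + t <= q.2]].
  case: q => z r [/=]; rewrite !in_itv/= => zI rI.
  have z4 : `|z| <= 1 / 4 by rewrite ler_norml.
  split => //; apply: Ht => //; case/andP: rI => h1 h2; first exact: le_trans h1.
  exact: le_lt_trans h2 r22.
have BD : B `<=` (Omega v) by move=> q /HB[_ _ []].
have [[Lpsi _] _ _ _] := Hpsi; have Ipsi := Lp_L1 mD Doo (ler1n _ 2) Lpsi.
have sF : smooth (fun q : R * R => step (xi d P q.1 q.2) * LG K m s q).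
  exact (smoothM (smooth_comp (@smooth_step R) (smooth_xi d P)) (smooth_LG K s m0)).
have IF := L1_smoothM cv vN1 v1 vJ Ipsi sF.
have F0 q : (Omega v) q -> 0 <= psi q * (step (xi d P q.1 q.2) * LG K m s q).
  move=> Dq; apply: mulr_ge0; first exact (potential_ge0 cv vN1 v1 vJ s0 Hpsi Dq).
  by apply: mulr_ge0; [exact: step_ge0|exact (LG_ge0 delta0 vdelta K0 HK m0 Dq)].
apply: le_trans (le_Rintegral_sub mD mB BD IF F0).
pose Y r := K * (Bt2 ((gam K r - m) / m) * (K * (gam K r + 1) / m)).
have cB2 : continuous (@Bt2 R) := smooth_continuous (@smooth_flat R _).
have cg : continuous (gam K) := smooth_continuous (smooth_gam K).
have cY0 : continuous (fun r => Bt2 ((gam K r - m) / m) * (K * (gam K r + 1) / m)).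
  move=> r; apply: cvgM.
    apply: (cvg_contR cB2); apply: cvgM; last exact: cvg_cst.
    by apply: cvgB; [exact: cg|exact: cvg_cst].
  apply: cvgM; last exact: cvg_cst.
  apply: cvgM; first exact: cvg_cst.
  by apply: cvgD; [exact: cg|exact: cvg_cst].
have cY : continuous Y by move=> r; apply: cvgM; [exact: cvg_cst|exact: cY0].
have cb : continuous (fun z => 1 / 2 * @bump0 R z).
  by move=> z; apply: cvgM; [exact: cvg_cst|exact: (smooth_continuous (@smooth_bump0 R))].
have cBY : continuous (fun q : R * R => (1 / 2 * bump0 q.1) * Y q.2).
  by move=> q; apply: cvgM; [exact: (continuous_fst_comp cb)|exact: (continuous_snd_comp cY)].
have IBY := L1_box (- (1 / 4)) (1 / 4) r3 r2 cBY.
apply: (@le_trans _ _ (\int[muu]_(q in B) ((1 / 2 * bump0 q.1) * Y q.2))).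
  rewrite (Rintegral_box_prod _ _ _ _ cb cY) /flux_const.
  have IY0 : mu.-integrable `[r3, r2] (EFin \o (fun r => Bt2 ((gam K r - m) / m) * (K * (gam K r + 1) / m))).
    exact/L1_continuous/continuous_subspaceT.
  have -> : \int[mu]_(y in `[r3, r2]) Y y = K * (Bt1 2 - Bt1 1).
    exact (etrans (RintegralZl K (measurable_cc _ _) IY0) (congr1 ( *%R K) intr)).
  apply: ler_wpM2r; first exact: (mulr_ge0 (ltW K0) (ltW Bt1_incr)).
  have q4 : - (1 / 4) <= 1 / 4 :> R by clear; lra.
  have Ec := Rint_cst (1 / 2 * flat 1 (3 / 16)) q4.
  apply: (@le_trans _ _ (\int[mu]_(x in `[- (1 / 4) : R, 1 / 4]) (1 / 2 * flat 1 (3 / 16)))).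
    by rewrite Ec; clear; lra.
  apply: le_Rintegral => //.
  - by apply: L1_continuous; apply: continuous_subspaceT => x; exact: cvg_cst.
  - exact/L1_continuous/continuous_subspaceT.
  - move=> z; rewrite /= in_itv/= => zI; rewrite ler_pM2l//.
    apply: flat1_homo; have : `|z| ^+ 2 <= (1 / 4) ^+ 2 by rewrite ler_sqr ?nnegrE// ler_norml.
    rewrite real_normK ?num_real//; lra.
apply: le_Rintegral => //; first exact: (integrableS mD mB BD IF).
case=> z r /HB[/= z4 rI [Dq psi2 r1 vt]].
have [zJ _ _] := Dq; have zI : -1 <= z <= 1 by case/andP: zJ => /= *; rewrite !ltW.
have -> : step (xi d P z r) = 1.
  apply: step_ge1; rewrite /xi ler_pdivlMr// mul1r.
  have := vP z zI; rewrite ler_norml => /andP[h _].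
  by move: h vt dt d0; clear; lra.
rewrite (mul1r (LG K m s (z, r))) /= -(mulrA (1 / 2)); have HL := LG_ge delta0 vdelta K0 HK m0 Dq.
have B2 := Bt2_ge0 ((gam K r - m) / m); have f0 := bump0_ge0 z.
have g0 : 0 <= gam K r by apply: le_trans (gr _ rI); rewrite mulr_ge0// ltW.
(* [r >= 1] and [gam >= 0] allow one factor [r K (gam + 1)] to be replaced by [K]; the rest is the
   exact derivative of [profile_integral]. *)
have YX : Y r <= r * (Bt2 ((gam K r - m) / m) * (- K * (gam K r + 1)) ^+ 2 / m).
  have aux (b y : R) : 0 <= b -> 0 <= y -> K * (b * (K * (y + 1) / m)) <= r * (b * (- K * (y + 1)) ^+ 2 / m).
    move=> b_0 y0; have E : (r * (K * (y + 1))) * (b * (K * (y + 1) / m)) = r * (b * (- K * (y + 1)) ^+ 2 / m) by ring.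
    rewrite -E; have Ky : K <= K * (y + 1) by rewrite ler_peMr ?(ltW K0)// lerDr.
    have Ky0 : 0 <= K * (y + 1) := le_trans (ltW K0) Ky.
    apply: ler_wpM2r; first by apply: mulr_ge0 => //; apply: divr_ge0 => //; exact: ltW.
    by apply: (le_trans Ky); rewrite ler_peMl.
  exact: aux.
have Y0 : 0 <= Y r.
  apply: mulr_ge0; first exact: ltW.
  apply: mulr_ge0 => //; apply: divr_ge0; last exact: ltW.
  by apply: mulr_ge0; [exact: ltW|rewrite addr_ge0].
have fY : bump0 z * Y r <= LG K m s (z, r) by apply: (le_trans _ HL); rewrite ler_wpM2l.
by apply: ler_pM => //; exact: mulr_ge0.
Qed.

(** The value of [cutH] at [r = v z + 1], without the factor [metric]. *)
Definition flux_weight (v : R -> R) (K m z : R) : R := (v z + 1) * (b0 K m (v z + 1) * bump0 z).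

Lemma flux_weight_itv (v : R -> R) (K m z : R) : v (-1) = 0 -> v 1 = 0 -> (forall z, J R z -> -1 < v z < 1) ->
  0 < K -> 0 < m -> -1 <= z <= 1 -> 0 <= flux_weight v K m z <= 2 * expR (K * 2).
Proof.
move=> vN1 v1 vJ K0 m0 zI; have /andP[va vb] := v_itv vN1 v1 vJ zI.
have v0 : 0 <= v z + 1 by move: va; clear; lra.
have v2 : v z + 1 <= 2 by move: vb; clear; lra.
have h0 := b0_ge0 K m0 (v z + 1); have h1 := b0_le_exp K0 m0 v0.
have f0 := bump0_ge0 z; have f1 := bump0_le1 z.
have bf0 := mulr_ge0 h0 f0.
have bf1 : b0 K m (v z + 1) * bump0 z <= expR (K * 2) by rewrite -[leRHS]mulr1; apply: ler_pM.
by rewrite /flux_weight; apply/andP; split; [exact: mulr_ge0|exact: ler_pM].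
Qed.

Lemma continuous_flux_weight (v : R -> R) (K m : R) : {within `[-1, 1], continuous v} ->
  {within `[-1, 1], continuous (flux_weight v K m)}.
Proof.
move=> cv; have cb : continuous (b0 K m) := smooth_continuous (smooth_b0 K m).
have cf : continuous (@bump0 R) := smooth_continuous (@smooth_bump0 R).
have cw : {within `[-1, 1], continuous (fun z => v z + 1)}.
  by move=> z; apply: cvgD; [exact: cv|exact: cvg_cst].
move=> z; apply: cvgM; first exact: cw.
apply: cvgM; first exact: (cvg_contR cb (cw z)).
by have := continuous_subspaceT cf; exact.
Qed.

(** Limit of [cutoff_identity] along polynomials [P_ n] and strips of width [d n]. The left side
    converges since the slopes do so uniformly; the integrals of [cutH] and [cutY] vanish by
    dominated convergence on shrinking strips; the term with [cutZ] is small because [psi] vanishes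
    on the lower boundary; [flux_ge] bounds the remaining one. *)
Theorem trace_bound (v : R -> R) (c : R) (g2 : R -> R) (s delta K : R) (psi : R * R -> R) (g : R -> R) :
  regular v c g2 -> v (-1) = 0 -> v 1 = 0 -> (forall z, J R z -> -1 < v z < 1) ->
  0 < s -> 0 < delta -> (forall z, -1 <= z <= 1 -> delta <= v z + 1) -> 1 <= K ->
  256 * s ^+ 2 <= K * (delta * K - 1) -> is_potential s v psi ->
  is_lower_trace v (wD2 (Omega v) (er R) psi) g ->
  exists2 m : R, 0 < m &
  flux_const K <= \int[mu]_(z in J R) (g z * (flux_weight v K m z * (1 + s ^+ 2 * (c + prim g2 z) ^+ 2))).
Proof.
move=> rv vN1 v1 vJ s0 delta0 vdelta K1 HK Hpsi tg.
pose p z := c + prim g2 z.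
have cv := regular_continuous rv.
have mD : measurable (Omega v : set mR2) := measurable_Omega cv vN1 v1 vJ.
have Doo : (muu (Omega v) < +oo)%E := Omega_lty cv vN1 v1 vJ.
have K0 : 0 < K := lt_le_trans ltr01 K1.
have A : exists2 A : R, 0 <= A & forall z, -1 <= z <= 1 -> `|p z| <= A.
  by apply: bounded_itv; [lra|exact: (regular_dcontinuous rv)].
have [t t0 Ht] := potential_large cv vN1 v1 vJ Hpsi.
(* [3 m <= t] and [K >= 1] put the box of [flux_ge] into the layer where [psi >= 1/2]. *)
exists (t / 3); first by rewrite divr_gt0.
set m := t / 3; have m0 : 0 < m by rewrite /m divr_gt0.
have mt : 3 * m <= t by rewrite /m mulrC divfK.
have [a a_0 Ha] := A.
have [P_ HP] := regular_poly_approx rv.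
have [Ig2 _] := rv.
have mJ := @measurable_J R; have Joo := @J_lty R.
have [_ Lg _] := tg; have Ig := Lp_L1 mJ Joo (ler1n _ 2) Lg.
set w := wD2 (Omega v) (er R) psi in tg *.
have [[Lpsi W] _ _ _] := Hpsi.
have erin : er R \in [:: ez R; er R] by rewrite in_cons mem_head orbT.
have [_ [Lw W']] := W _ erin; have [_ Lwr] := W' _ erin.
rewrite -/w in Lw Lwr; set wr := wD2 (Omega v) (er R) w in Lwr *.
have Ipsi := Lp_L1 mD Doo (ler1n _ 2) Lpsi.
have Iw := Lp_L1 mD Doo (ler1n _ 2) Lw; have Iwr := Lp_L1 mD Doo (ler1n _ 2) Lwr.
(* Twice the error of [P_ n], as the requirement [|v - P| <= d / 2] dictates. *)
pose d n : R := 2 * n.+1%:R^-1.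
have d0 n : 0 < d n by rewrite mulr_gt0// invr_gt0.
have dE n : d n / 2 = n.+1%:R^-1 by rewrite /d mulrC mulKf.
have vP n z : -1 <= z <= 1 -> `|v z - (P_ n).[z]| <= d n / 2.
  by rewrite dE; case: (HP n) => + _ _; exact.
have u1 n : n.+1%:R^-1 <= 1 :> R by rewrite invf_le1// ler1n.
have P1 n z : -1 <= z <= 1 -> `|((P_ n)^`()).[z]| <= a + 1.
  move=> zI; have [_ + _] := HP n => /(_ z zI) H.
  have -> : ((P_ n)^`()).[z] = p z - (p z - ((P_ n)^`()).[z]) by rewrite subKr.
  by apply: norm_le_B; [exact: Ha|exact: le_trans H (u1 n)].
have identity n := cutoff_identity K0 m0 (d0 n) cv vN1 v1 vJ (vP n) Hpsi tg.
have [B1 B1_0 HB1] := bounded_itv (ler0n R 2) (continuous_subspaceT (smooth_continuous (smooth_b0 K m))).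
have [B2 B2_0 HB2] := bounded_itv (ler0n R 2) (continuous_subspaceT (smooth_continuous (smooth_b1 K m0))).
have [F1 F1_0 HF1] := @bounded_itv R (@bump1 R) (-1) 1 ltac:(lra) (continuous_subspaceT (smooth_continuous (@smooth_bump1 R))).
pose S := 1 + s ^+ 2 * (a + 1) ^+ 2.
have a1 : 0 <= a + 1 by rewrite addr_ge0.
have S0 : 0 <= S by rewrite addr_ge0// mulr_ge0 ?sqr_ge0.
have HS n z : -1 <= z <= 1 -> `|metric s (P_ n) z| <= S.
  move=> zI; have s2 := sqr_ge0 s; rewrite /metric /S ger0_norm; last first.
    by apply: addr_ge0 => //; apply: mulr_ge0 => //; exact: sqr_ge0.
  rewrite lerD2l ler_wpM2l//.
  by rewrite -real_normK ?num_real// ler_sqr ?nnegrE// P1.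
have HD q : (Omega v) q -> [/\ -1 <= q.1 <= 1, 0 <= q.2 <= 2 & `|q.2| <= 2].
  move=> [/andP[h1 h2] /andP[h3 h4] _]; rewrite (ltW h1) (ltW h2) (ltW h3) (ltW h4); split => //.
  by rewrite gtr0_norm// ltW.
have f1n z : `|@bump0 R z| <= 1 by rewrite ger0_norm ?bump0_ge0 ?bump0_le1.
have st01 x : `|1 - @step R x| <= 1.
  by rewrite ger0_norm ?subr_ge0 ?step_le1// gerBl step_ge0.
have HH n q : (Omega v) q -> `|cutH K m s (d n) (P_ n) q| <= 2 * B1 * (1 * S) * 1.
  move=> /HD[zI rI r2]; apply: norm_le_M => //; apply: norm_le_M.
    by apply: norm_le_M => //; exact: HB1.
  by apply: norm_le_M => //; exact: HS.
have HY n q : (Omega v) q -> `|cutY K m s (d n) (P_ n) q| <= 1 * S * (B1 + 2 * B2) * 1.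
  move=> /HD[zI rI r2]; apply: norm_le_M => //; apply: norm_le_M.
    by apply: norm_le_M => //; exact: HS.
  by apply: norm_le_D; [exact: HB1|apply: norm_le_M => //; exact: HB2].
(* [C1] collects the uniformly bounded terms of [cutZ], and [C2] is the coefficient of the second
   derivative of [P_ n]. *)
pose C1 := 1 * B1 + 2 * 2 * (1 * B2) + 2 * s ^+ 2 * 2 * B1 * F1 * (a + 1) + 1 * S * (B1 + 2 * B2).
pose C2 := s ^+ 2 * 2 * B1 * 1.
have s2 := sqr_ge0 s.
have C20 : 0 <= C2 by rewrite /C2; do ?(apply: mulr_ge0 => //).
have BB0 : 0 <= B1 + 2 * B2 by apply: addr_ge0 => //; exact: mulr_ge0.
have C10 : 0 <= C1 by rewrite /C1; do ?(apply: addr_ge0 => //); do ?(apply: mulr_ge0 => //).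
have HZ n q : (Omega v) q -> `|cutZ K m s (P_ n) q| <= (C1 + C2) * (1 + `|((P_ n)^`()^`()).[q.1]|).
  move=> /HD[zI rI r2]; pose y := `|((P_ n)^`()^`()).[q.1]|.
  have y0 : 0 <= y by exact: normr_ge0.
  have n2 : `|2 * q.2| <= 2 * 2 by apply: norm_le_M => //; rewrite normr_nat.
  have b1 := HB1 _ rI; have b2 := HB2 _ rI; have fn := f1n q.1; have f1' := HF1 _ zI.
  have p1 := P1 n _ zI; have S1 := HS n _ zI.
  have ns : `|s ^+ 2| <= s ^+ 2 by rewrite ger0_norm.
  have ns2 : `|2 * s ^+ 2| <= 2 * s ^+ 2 by rewrite ger0_norm// mulr_ge0.
  have z1 := norm_le_M fn b1.
  have z2 := norm_le_M n2 (norm_le_M fn b2).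
  have z3 := norm_le_M (norm_le_M (norm_le_M (norm_le_M ns2 r2) b1) f1') p1.
  have z4 := norm_le_M (norm_le_M (norm_le_M (norm_le_M ns r2) b1) fn) (lexx y).
  have z5 := norm_le_M (norm_le_M fn S1) (norm_le_D b1 (norm_le_M r2 b2)).
  apply: (le_trans (norm_le_B (norm_le_B (norm_le_B (norm_le_D z1 z2) z3) z4) z5)).
  apply: (@le_trans _ _ (C1 + C2 * y)); first by rewrite le_eqVlt; apply/orP; left; apply/eqP; rewrite /C1 /C2; ring.
  rewrite mulrDr mulr1 mulrDl; apply: lerD; first by rewrite lerDl.
  by rewrite lerDr mulr_ge0.
have Icut n : muu.-integrable (Omega v) (EFin \o ((fun q => psi q * (st1 (xi (d n) (P_ n) q.1 q.2) / d n * cutZ K m s (P_ n) q)) : mR2 -> R)).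
  apply: (L1_smoothM cv vN1 v1 vJ Ipsi (F := fun q => st1 (xi (d n) (P_ n) q.1 q.2) / d n * cutZ K m s (P_ n) q)).
  refine (smoothM (smoothM (smooth_comp (smooth_derive1 (@smooth_step R)) (smooth_xi (d n) (P_ n))) (smooth_cst _)) _).
  exact (smooth_cutZ K s (P_ n) m0).
have cstrip n : continuous (fun q : R * R => st1 (xi (d n) (P_ n) q.1 q.2) / d n * (1 + `|((P_ n)^`()^`()).[q.1]|)).
  have cst1 : continuous st1 := smooth_continuous (smooth_derive1 (@smooth_step R)).
  have cxi : continuous (fun q : R * R => xi (d n) (P_ n) q.1 q.2) := smooth_continuous (smooth_xi _ _).
  have cQ : continuous (fun z => 1 + `|((P_ n)^`()^`()).[z]|).
    move=> z; apply: cvgD; first exact: cvg_cst.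
    by apply: cvg_norm; exact: (smooth_continuous (smooth_horner _)).
  move=> q; apply: cvgM; last exact: (continuous_fst_comp cQ).
  by apply: cvgM; [exact: (cvg_contR cst1 (cxi q))|exact: cvg_cst].
(* The length 2 of the interval, plus at most 1 for the L_1 error of the second derivative of
   [P_ n]. *)
pose N2 := 3 + \int[mu]_(z in I) `|g2 z|.
have N20 : 0 < N2 by rewrite ltr_wpDr// Rintegral_ge0// => z _.
have strip n : \int[muu]_(q in (Omega v)) (st1 (xi (d n) (P_ n) q.1 q.2) / d n * (1 + `|((P_ n)^`()^`()).[q.1]|)) <= N2.
  have IB := L1_box (-1) 1 0 2 (cstrip n).
  apply: (le_trans (le_Rintegral_sub (measurable_box _ _ _ _) mD (@Omega_box R v) IB _)).
    move=> q _; apply: mulr_ge0; last by rewrite addr_ge0.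
    by apply: divr_ge0; [exact: derive1_step_ge0|exact: ltW].
  apply: (le_trans (strip_integral _ _ (d0 n))).
  have Ip := @L1_horner R ((P_ n)^`()^`()) I (@subset_refl _ _) (measurable_cc (-1) 1).
  have Ic : mu.-integrable I (EFin \o (fun=> 1 : R)).
    by apply: L1_continuous; apply: continuous_subspaceT => x; exact: cvg_cst.
  have IgP := L1B (measurable_cc (-1) 1) Ig2 Ip.
  apply: (le_trans (y := \int[mu]_(z in I) (1 + (`|g2 z| + `|g2 z - ((P_ n)^`()^`()).[z]|)))).
    apply: le_Rintegral => //.
    - exact (L1D (measurable_cc (-1) 1) Ic (L1_normr Ip)).
    - exact (L1D (measurable_cc (-1) 1) Ic (L1D (measurable_cc (-1) 1) (L1_normr Ig2) (L1_normr IgP))).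
    - move=> z _; rewrite lerD2l; have -> : ((P_ n)^`()^`()).[z] = g2 z - (g2 z - ((P_ n)^`()^`()).[z]) by rewrite subKr.
      by rewrite {2}subKr; apply: ler_normB.
  rewrite (RintegralD (measurable_cc (-1) 1) Ic (L1D (measurable_cc (-1) 1) (L1_normr Ig2) (L1_normr IgP))).
  rewrite (RintegralD (measurable_cc (-1) 1) (L1_normr Ig2) (L1_normr IgP)).
  have l11 : -1 <= 1 :> R by clear; lra.
  rewrite (Rint_cst 1 l11).
  have [_ _ h3] := HP n; have := le_trans h3 (u1 n); rewrite /N2.
  by move: (\int[mu]_(z in I) `|g2 z|) (\int[mu]_(z in I) `|g2 z - _|); clear; move=> X Y; lra.
apply/ler_addgt0Pr => e e0.
pose e' := e / 3; have e'0 : 0 < e' by rewrite divr_gt0.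
(* Size of [psi] in the strip for which the term with [cutZ] costs at most [e']. *)
pose eB := e' / ((C1 + C2) * N2 + 1).
have CC0 : 0 <= C1 + C2 by exact: addr_ge0.
have CN0 : 0 <= (C1 + C2) * N2 by apply: mulr_ge0 => //; exact: ltW.
have eB0 : 0 < eB by rewrite divr_gt0// ltr_wpDl.
have [tB tB0 HtB] := potential_small cv vN1 v1 vJ Hpsi eB0.
have cvgA : \int[muu]_(q in (Omega v)) (wr q * cutH K m s (d n) (P_ n) q + w q * cutY K m s (d n) (P_ n) q) @[n --> \oo] -->
    \int[muu]_(q in (Omega v)) (0 : R).
  have mw : measurable_fun (Omega v) (w : mR2 -> R) by case: Lw.
  have mwr : measurable_fun (Omega v) (wr : mR2 -> R) by case: Lwr.
  apply: (cvg_Rintegral mD (g := fun q => 2 * B1 * (1 * S) * 1 * `|wr q| + 1 * S * (B1 + 2 * B2) * 1 * `|w q|)).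
  - move=> n; apply: measurable_funD; apply: measurable_funM => //.
      exact (smooth_measurable2 (smooth_cutH K m s (d n) (P_ n))).
    exact (smooth_measurable2 (smooth_cutY K s (d n) (P_ n) m0)).
  - exact: measurable_cst.
  - apply: aeW => q Dq; have [zI _ _] := HD _ Dq; have [_ _ /andP[vq _]] := Dq.
    apply: cvg_near_cst.
    have tq : 0 < (q.2 - (v q.1 + 1)) / 6 by rewrite divr_gt0// subr_gt0.
    have := near_invSn tq; apply: filterS => n Hn.
    have sE : step (xi (d n) (P_ n) q.1 q.2) = 1.
      apply: step_ge1; rewrite /xi ler_pdivlMr// mul1r.
      have un : 0 < n.+1%:R^-1 :> R by rewrite invr_gt0.
      have := vP n _ zI; rewrite dE ler_norml /d => /andP[h _].
      by move: (n.+1%:R^-1) un Hn h; clear; move=> u; lra.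
    by rewrite /cutH /cutY sE subrr !mulr0 addr0.
  - exact (L1D mD (L1Z mD _ (L1_normr Iwr)) (L1Z mD _ (L1_normr Iw))).
  - apply: aeW => q Dq n; apply: norm_le_D; rewrite normrM mulrC.
      by apply: ler_wpM2r => //; exact: HH.
    by apply: ler_wpM2r => //; exact: HY.
rewrite (Rintegral_cst _ mD) mul0r in cvgA.
have nearA : \forall n \near \oo, `|\int[muu]_(q in (Omega v)) (wr q * cutH K m s (d n) (P_ n) q + w q * cutY K m s (d n) (P_ n) q)| <= e'.
  by move/cvgrPdist_le : cvgA => /(_ _ e'0); apply: filterS => n; rewrite sub0r normrN.
(* Bound for the change of metric: a difference of squares is a sum at most [2 (a + 1)] times a
   difference at most [1 / (n + 1)]. *)
pose kw := 2 * expR (K * 2) * (s ^+ 2 * (2 * (a + 1))).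
pose G := \int[mu]_(z in J R) `|g z|.
have G0 : 0 <= G by apply: Rintegral_ge0 => z _.
have kw0 : 0 <= kw.
  by have E0 := expR_ge0 (K * 2); rewrite /kw; do ?(apply: mulr_ge0 => //).
have eT : 0 < e' / (kw * G + 1) by rewrite divr_gt0// ltr_wpDl// mulr_ge0.
have eB6 : 0 < tB / 6 by rewrite divr_gt0.
have et6 : 0 < t / 6 by rewrite divr_gt0.
have [n [[[hA hT] hB] hC]] := filter_ex (filterI (filterI (filterI nearA (near_invSn eT)) (near_invSn eB6)) (near_invSn et6)).
have un0 : 0 < n.+1%:R^-1 :> R by rewrite invr_gt0.
have flux : flux_const K <= \int[muu]_(q in (Omega v)) (psi q * (step (xi (d n) (P_ n) q.1 q.2) * LG K m s q)).
  apply: (flux_ge cv vN1 v1 vJ s0 delta0 vdelta K1 HK Hpsi m0 mt (d0 n) _ (vP n) Ht).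
  by rewrite /d; move: (n.+1%:R^-1) hC; clear; move=> u; lra.
have bB : `|\int[muu]_(q in (Omega v)) (psi q * (st1 (xi (d n) (P_ n) q.1 q.2) / d n * cutZ K m s (P_ n) q))| <= e'.
  have Is : muu.-integrable (Omega v) (EFin \o ((fun q : R * R => st1 (xi (d n) (P_ n) q.1 q.2) / d n * (1 + `|((P_ n)^`()^`()).[q.1]|)) : mR2 -> R)).
    by have := L1_box (-1) 1 0 2 (cstrip n); apply: integrableS => //; [exact: measurable_box|exact: Omega_box].
  apply: (le_trans (le_normr_Rintegral mD (Icut n))).
  apply: (@le_trans _ _ (\int[muu]_(q in (Omega v)) (eB * (C1 + C2) * (st1 (xi (d n) (P_ n) q.1 q.2) / d n * (1 + `|((P_ n)^`()^`()).[q.1]|))))).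
    apply: le_Rintegral => //; [exact: (L1_normr (Icut n))|exact (L1Z mD _ Is)|].
    move=> q Dq; have [zI _ _] := HD _ Dq.
    have sd0 : 0 <= st1 (xi (d n) (P_ n) q.1 q.2) / d n by apply: divr_ge0; [exact: derive1_step_ge0|exact: ltW].
    (* Above the strip [step'] vanishes; up to its top, [r] exceeds [v + 1] by at most
       [5 / (n + 1)], whence the requirement [1 / (n + 1) < tB / 6]. *)
    have [H|H] := leP (xi (d n) (P_ n) q.1 q.2) 1; last first.
      rewrite derive1_step_out; last by right.
      by rewrite !(mul0r, mulr0) normr0.
    have psmall : `|psi q| <= eB.
      apply: HtB => //; move: H; rewrite /xi ler_pdivrMr// mul1r.
      have := vP n _ zI; rewrite dE ler_norml /d => /andP[h1 h2].
      by move: (n.+1%:R^-1) hB h1 h2 un0; clear; move=> u; lra.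
    have nz := norm_le_M psmall (norm_le_M (lexx `|st1 (xi (d n) (P_ n) q.1 q.2) / d n|) (HZ n q Dq)).
    rewrite (ger0_norm sd0) in nz; apply: (le_trans nz).
    by rewrite le_eqVlt; apply/orP; left; apply/eqP; ring.
  rewrite (RintegralZl _ mD Is).
  apply: (@le_trans _ _ (eB * (C1 + C2) * N2)).
    by apply: (ler_wpM2l _ (strip n)); apply: mulr_ge0 => //; exact: ltW.
  rewrite -mulrA /eB mulrAC ler_pdivrMr ?ltr_wpDl//.
  by apply: ler_wpM2l; [exact: ltW|rewrite lerDl].
have cfw : {within `[-1, 1], continuous (flux_weight v K m)} := @continuous_flux_weight v K m cv.
have cp : {within `[-1, 1], continuous p} := regular_dcontinuous rv.
have ckp : {within `[-1, 1], continuous (fun z => flux_weight v K m z * (1 + s ^+ 2 * p z ^+ 2))}.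
  move=> z; apply: cvgM; first exact: cfw.
  apply: cvgD; first exact: cvg_cst.
  apply: cvgM; first exact: cvg_cst.
  by rewrite (_ : (fun _ => _) = fun y => p y * p y)//; apply: cvgM; exact: cp.
have mk : measurable_fun (J R) ((fun z => flux_weight v K m z * (1 + s ^+ 2 * p z ^+ 2)) : measurableTypeR R -> R).
  exact: L1_measurable (L1_IJ (L1_continuous ckp)).
have mkn : measurable_fun (J R) ((fun z => flux_weight v K m z * metric s (P_ n) z) : measurableTypeR R -> R).
  apply: L1_measurable (L1_IJ (L1_continuous _)) => z; apply: cvgM; first exact: cfw.
  apply: cvgD; first exact: cvg_cst.
  apply: cvgM; first exact: cvg_cst.
  have cP : {within `[-1, 1], continuous (horner (P_ n)^`())} := continuous_subspaceT (smooth_continuous (smooth_horner _)).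
  by rewrite (_ : (fun _ => _) = fun y => ((P_ n)^`()).[y] * ((P_ n)^`()).[y])//; apply: cvgM; exact: cP.
have JI z : J R z -> -1 <= z <= 1 by rewrite /J/= in_itv/= => /andP[h1 h2]; rewrite !ltW.
have bk z : J R z -> `|flux_weight v K m z| <= 2 * expR (K * 2).
  by move=> /JI /(flux_weight_itv vN1 v1 vJ K0 m0)/andP[h1 h2]; rewrite ger0_norm.
pose Dk z := flux_weight v K m z * (1 + s ^+ 2 * p z ^+ 2) - flux_weight v K m z * metric s (P_ n) z.
have bDk z : J R z -> `|Dk z| <= kw * n.+1%:R^-1.
  move=> Jz; have zI := JI _ Jz; have [_ /(_ z zI) h _] := HP n.
  have -> : Dk z = flux_weight v K m z * (s ^+ 2 * ((p z + ((P_ n)^`()).[z]) * (p z - ((P_ n)^`()).[z]))).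
    by rewrite /Dk /metric; ring.
  have ns : `|s ^+ 2| <= s ^+ 2 by rewrite ger0_norm.
  have pa : `|p z| <= a + 1 by apply: (le_trans (Ha _ zI)); rewrite lerDl.
  apply: (le_trans (norm_le_M (bk _ Jz) (norm_le_M ns (norm_le_M (norm_le_D pa (P1 n _ zI)) h)))).
  rewrite /kw le_eqVlt; apply/orP; left; apply/eqP.
  by move: (n.+1%:R^-1) (expR (K * 2)) => u E; ring.
have mDk : measurable_fun (J R) (Dk : measurableTypeR R -> R) by exact: measurable_funB mk mkn.
have IDk := L1M mJ mDk bDk Ig.
have bkm z : J R z -> `|flux_weight v K m z * metric s (P_ n) z| <= 2 * expR (K * 2) * S.
  by move=> Jz; apply: norm_le_M; [exact: bk|exact/HS/JI].
have Ikn := L1M mJ mkn bkm Ig.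
have bT : `|\int[mu]_(z in J R) (Dk z * g z)| <= e'.
  apply: (le_trans (normr_Rintegral_le mJ Ig mDk bDk)); rewrite -/G.
  have kG : 0 <= kw * G by rewrite mulr_ge0.
  rewrite mulrAC; apply: (@le_trans _ _ ((kw * G + 1) * n.+1%:R^-1)).
    by apply: ler_wpM2r; [exact: ltW|rewrite lerDl].
  by rewrite mulrC -ler_pdivlMr ?ltr_wpDl// ltW.
have lhs : \int[mu]_(z in J R) (g z * cutH K m s (d n) (P_ n) (z, v z + 1)) =
    \int[mu]_(z in J R) (flux_weight v K m z * metric s (P_ n) z * g z).
  apply: eq_Rintegral => z; rewrite inE => Jz.
  by rewrite (cutH_lower _ _ _ (d0 n) (vP n))// /flux_weight; ring.
have T_ : \int[mu]_(z in J R) (g z * (flux_weight v K m z * (1 + s ^+ 2 * p z ^+ 2))) =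
    \int[mu]_(z in J R) (Dk z * g z) + \int[mu]_(z in J R) (flux_weight v K m z * metric s (P_ n) z * g z).
  apply: (etrans _ (RintegralD mJ IDk Ikn)); apply: eq_Rintegral => z _.
  by rewrite /Dk; ring.
rewrite T_ -lhs (identity n).
have eE : e = e' + e' + e' by rewrite /e'; field.
rewrite eE; exact (flux_elim flux bT bB hA).
Qed.

End trace_bound.

(** * Integrals along the evolution *)

Section time_derivative.
Context {R : realType}.
Local Notation mu := (@mu1 R).
Local Notation L1 f := (mu.-integrable (J R) (EFin \o f)).
Let mJ : measurable (J R : set (measurableTypeR R)) := @measurable_J R.
Let Joo : (mu (J R) < +oo)%E := @J_lty R.
Variables (q : R) (u ut : R -> R -> R).
Hypotheses (q2 : 2 < q) (hC1 : C1_Lq q +oo u ut) (hCW : C_W2qD q +oo u).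

Lemma time_intervaly (t : R) : 0 <= t -> time_interval +oo%E t.
Proof. by move=> t0; split => //; exact: ltry. Qed.

Let q1 : 1 <= q. Proof. by apply: (le_trans _ (ltW q2)); rewrite ler1n. Qed.

(** The first derivative term of the [W^2_q] norm dominates the sup norm, by [W2qD_sub_le]. *)
Lemma sup_continuity (t e : R) : 0 <= t -> 0 < e -> exists2 eta : R, 0 < eta &
  forall s, 0 <= s -> `|s - t| < eta -> forall z, -1 <= z <= 1 -> `|u s z - u t z| <= e.
Proof.
move=> t0 e0; have [Wt cW] := hCW (time_intervaly t0).
have FF : Filter (within (time_interval +oo%E) (nbhs t)) by exact _.
pose F := within (time_interval +oo%E) (nbhs t).
have c1 : Lpnorm mu (J R) q (wD1 (u s \- u t)) @[s --> F] --> 0%E.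
  refine (squeeze_cvge (f := fun=> 0%E) (h := fun s => W2q_norm q (u s \- u t)) _ (cvg_cst _) cW).
  apply: nearW => s; apply/andP; split; first exact: Lnorm_ge0.
  rewrite /W2q_norm -addeA addeCA leeDl// adde_ge0//; exact: Lnorm_ge0.
have D : \forall s \near F, time_interval +oo%E s by exact: withinT.
have m : \forall s \near F, measurable_fun (J R) (wD1 (u s \- u t) : measurableTypeR R -> R).
  by apply: filterS D => s /hCW[Ws _]; exact (W2qD_sub_le q1 Ws Wt).1.
have H := @Lpnorm_cvg0_L1 _ _ _ _ _ mJ Joo R F FF q _ q1 m c1 e e0.
have {}H : nbhs t (fun s => time_interval +oo%E s -> L1 (wD1 (u s \- u t)) /\
    \int[mu]_(z in J R) `|wD1 (u s \- u t) z| <= e) := H.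
have /nbhs_ballP[eta /= eta0 Heta] := H.
exists eta => // s s0 st z zI; have ts := time_intervaly s0.
have [Ws _] := hCW ts.
have [|I1 I2] := Heta s _ ts; first by rewrite /ball/= distrC.
by apply: le_trans I2; exact: (W2qD_sub_le q1 Ws Wt).2.
Qed.

(** The difference quotient of [u] converges in L_1, so the linear part passes to the limit. The
    Taylor remainder is quadratic in [u s - u t]: one factor is small in sup norm, the other divided
    by the time step is bounded in L_1. *)
Lemma is_derive_integral (th th1 : R -> R -> R) (C t : R) : 0 < t -> 0 <= C ->
  (forall s, 0 <= s -> measurable_fun (J R) ((fun z => th z (u s z)) : measurableTypeR R -> R) /\
    forall z, J R z -> `|th z (u s z)| <= C) ->
  measurable_fun (J R) ((fun z => th1 z (u t z)) : measurableTypeR R -> R) ->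
  (forall z, J R z -> `|th1 z (u t z)| <= C) ->
  (forall s z, 0 <= s -> J R z ->
    `|th z (u s z) - th z (u t z) - th1 z (u t z) * (u s z - u t z)| <= C * (u s z - u t z) ^+ 2) ->
  is_derive t 1 (fun s => \int[mu]_(z in J R) th z (u s z)) (\int[mu]_(z in J R) (th1 z (u t z) * ut t z)).
Proof.
move=> t0 C0 hth mth1 bth1 taylor.
have [Lu Lut cq _] := hC1 (time_intervaly (ltW t0)).
have Iut := Lp_L1 mJ Joo q1 Lut.
pose M := \int[mu]_(z in J R) `|ut t z|.
have M0 : 0 <= M by apply: Rintegral_ge0 => z _.
apply: is_derive_le => e e0.
pose den := C * (M + 1) + C + 1.
have den0 : 0 < den by rewrite ltr_wpDl// addr_ge0// mulr_ge0// addr_ge0.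
pose e1 := Num.min 1 (e / den).
have e10 : 0 < e1 by rewrite lt_min ltr01 divr_gt0.
have [e1a e1b] : e1 <= 1 /\ e1 <= e / den by rewrite /e1 !ge_min !lexx ?orbT.
have [eta1 eta10 H1] := sup_continuity (ltW t0) e10.
pose Q s z := (u s z - u t z) / (s - t) - ut t z.
have FF : Filter (within (time_interval +oo%E) t^') by exact _.
pose F := within (time_interval +oo%E) t^'.
have D : \forall s \near F, time_interval +oo%E s by exact: withinT.
have m : \forall s \near F, measurable_fun (J R) (Q s : measurableTypeR R -> R).
  apply: filterS D => s /hC1[[ms _] _ _ _]; apply: measurable_funB; last by case: Lut.
  by apply: measurable_funM => //; apply: measurable_funB => //; case: Lu.
have H := @Lpnorm_cvg0_L1 _ _ _ _ _ mJ Joo R F FF q Q q1 m cq e1 e10.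
have {}H : nbhs t (fun s => s != t -> time_interval +oo%E s -> L1 (Q s) /\ \int[mu]_(z in J R) `|Q s z| <= e1) := H.
have /nbhs_ballP[eta2 /= eta20 H2] := H.
exists (Num.min eta1 (Num.min eta2 t)) => [|h h0]; first by rewrite !lt_min eta10 eta20.
rewrite !lt_min => /and3P[he1 he2 het].
have s0 : 0 <= h + t by move: het; rewrite ltr_norml => /andP[? _]; lra.
have hst : h + t - t = h by rewrite addrK.
have sup := H1 _ s0; rewrite hst in sup; have {}sup := sup he1.
have [||IQ bQ] := H2 (h + t) _ _ (time_intervaly s0).
- by rewrite /ball/= opprD addrCA subrr addr0 normrN.
- by rewrite -subr_eq0 hst.
have [ms bs] := hth _ s0; have [mt bt] := hth _ (ltW t0).
have Is := L1_bounded mJ Joo ms bs; have It := L1_bounded mJ Joo mt bt.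
have I1 := L1M mJ mth1 bth1 Iut; have I2 := L1M mJ mth1 bth1 IQ.
have Id := L1Z mJ h^-1 (L1B mJ Is It).
have IR := L1B mJ (L1B mJ Id I1) I2.
set Rm := (fun z => _ - _ - _) in IR.
have bR z : J R z -> `|Rm z| <= C * e1 * (`|Q (h + t) z| + `|ut t z|).
  move=> Jz; have zI : -1 <= z <= 1 by move: Jz; rewrite /J/= in_itv/= => /andP[? ?]; rewrite !ltW.
  have dE : u (h + t) z - u t z = h * (Q (h + t) z + ut t z) by rewrite /Q hst subrK mulrC divfK.
  have RE : Rm z = h^-1 * (th z (u (h + t) z) - th z (u t z) - th1 z (u t z) * (u (h + t) z - u t z)).
    by rewrite dE /Rm; field.
  rewrite RE normrM normfV ler_pdivrMl ?normr_gt0//.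
  apply: (le_trans (taylor _ _ s0 Jz)); rewrite -real_normK ?num_real// expr2.
  have n1 := sup _ zI.
  have n2 : `|u (h + t) z - u t z| <= `|h| * (`|Q (h + t) z| + `|ut t z|).
    by rewrite dE normrM ler_wpM2l// ler_normD.
  rewrite mulrA; apply: (@le_trans _ _ (C * e1 * (`|h| * (`|Q (h + t) z| + `|ut t z|)))).
    by apply: ler_pM => //; [exact: mulr_ge0|exact: ler_wpM2l].
  by rewrite mulrCA.
have intR : `|\int[mu]_(z in J R) Rm z| <= C * e1 * (e1 + M).
  have IQu := L1D mJ (L1_normr IQ) (L1_normr Iut).
  apply: (le_trans (le_normr_Rintegral mJ IR)).
  apply: (le_trans (le_Rintegral mJ (L1_normr IR) (L1Z mJ (C * e1) IQu) bR)).
  rewrite (RintegralZl (C * e1) mJ IQu) (RintegralD mJ (L1_normr IQ) (L1_normr Iut)).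
  by apply: ler_wpM2l; [rewrite mulr_ge0// ltW|rewrite lerD2r].
have int2 : `|\int[mu]_(z in J R) (th1 z (u t z) * Q (h + t) z)| <= C * e1.
  by apply: (le_trans (normr_Rintegral_le mJ IQ mth1 bth1)); exact: ler_wpM2l.
have eqR : \int[mu]_(z in J R) Rm z =
   h^-1 * (\int[mu]_(z in J R) th z (u (h + t) z) - \int[mu]_(z in J R) th z (u t z))
   - \int[mu]_(z in J R) (th1 z (u t z) * ut t z) - \int[mu]_(z in J R) (th1 z (u t z) * Q (h + t) z).
  apply: (etrans (RintegralB mJ (L1B mJ Id I1) I2)); congr (_ - _).
  apply: (etrans (RintegralB mJ Id I1)); congr (_ - _).
  by apply: (etrans (RintegralZl h^-1 mJ (L1B mJ Is It))); rewrite (RintegralB mJ Is It).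
rewrite [X in X - _]mulrC.
have E : h^-1 * (\int[mu]_(z in J R) th z (u (h + t) z) - \int[mu]_(z in J R) th z (u t z))
   - \int[mu]_(z in J R) (th1 z (u t z) * ut t z) =
   \int[mu]_(z in J R) Rm z + \int[mu]_(z in J R) (th1 z (u t z) * Q (h + t) z).
  by rewrite eqR subrK.
rewrite E; apply: (le_trans (ler_normD _ _)); apply: (le_trans (lerD intR int2)).
apply: (@le_trans _ _ (e1 * den)); last by rewrite -ler_pdivlMr.
have -> : C * e1 * (e1 + M) + C * e1 = e1 * (C * (M + e1) + C) by ring.
apply: ler_wpM2l; first exact: ltW.
rewrite /den -addrA lerD// ?lerDl//; apply: ler_wpM2l => //.
by rewrite lerD2l.
Qed.

End time_derivative.

(** * Scalar inequalities *)

Section positive_part.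
Context {R : realType}.
Implicit Types x y : R.

Definition pos x : R := Num.max 0 x.

Lemma pos_ge0 x : 0 <= pos x. Proof. by rewrite le_max lexx. Qed.

Lemma pos_le0 x : x <= 0 -> pos x = 0. Proof. exact: max_l. Qed.

Lemma pos_id x : 0 <= x -> pos x = x. Proof. exact: max_r. Qed.

Lemma pos_sqrM x : pos x ^+ 2 * x = pos x ^+ 3.
Proof.
have [x0|/ltW x0] := leP x 0; first by rewrite pos_le0// !expr0n/= mul0r.
by rewrite pos_id// -exprSr.
Qed.

Lemma continuous_pos : continuous pos.
Proof. by move=> x; apply: (@continuous_max R R (fun=> 0) id); [exact: cvg_cst|exact: cvg_id]. Qed.

Lemma is_derive_pos2 x : is_derive x 1 (fun y => pos y ^+ 2) (2 * pos x).
Proof.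
apply: is_derive_le => e e0; exists e => // h h0 he.
rewrite -(@ler_pM2l _ `|h|) ?normr_gt0// -normrM mulrBr mulrC divfK//.
apply: (@le_trans _ _ (`|h| * `|h|)); last by rewrite ler_pM2l ?normr_gt0// ltW.
rewrite -normrM -expr2 [X in _ <= X]ger0_norm ?sqr_ge0// ler_norml; clear he e0 h0.
have [x0|/ltW x0] := leP x 0; have [y0|/ltW y0] := leP (h + x) 0;
  rewrite ?(pos_le0 x0) ?(pos_le0 y0) ?(pos_id x0) ?(pos_id y0); apply/andP; split; nra.
Qed.

(** The comparison functional is built on [pos ^+ 3 / 3]: its derivative [pos ^+ 2] is still C^1,
    hence admissible in the integration by parts in space, and the remainder is quadratic as
    [is_derive_integral] demands. *)
Lemma pos3_taylor x y : `|x| <= 2 -> `|y| <= 2 ->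
  `|pos y ^+ 3 / 3 - pos x ^+ 3 / 3 - pos x ^+ 2 * (y - x)| <= 2 * (y - x) ^+ 2.
Proof.
rewrite !ler_norml => /andP[xa xb] /andP[ya yb].
have [x0|/ltW x0] := leP x 0; have [y0|/ltW y0] := leP y 0;
  rewrite ?(pos_le0 x0) ?(pos_le0 y0) ?(pos_id x0) ?(pos_id y0).
- by rewrite !expr0n/= !mul0r !subrr; have := sqr_ge0 (y - x) => h; apply/andP; split; lra.
- rewrite !expr0n/= !mul0r !subr0.
  have h1 : y ^+ 2 <= (y - x) ^+ 2 by rewrite ler_sqr ?nnegrE; lra.
  have h2 : 0 <= y ^+ 2 := sqr_ge0 y.
  have h3 : y ^+ 3 <= 2 * y ^+ 2 by rewrite exprS ler_wpM2r.
  have h4 : 0 <= y ^+ 3 by rewrite exprn_ge0.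
  by apply/andP; split; lra.
- have -> : 0 ^+ 3 / 3 - x ^+ 3 / 3 - x ^+ 2 * (y - x) = x ^+ 2 * (2 / 3 * x - y) by field.
  have h1 : x ^+ 2 <= (y - x) ^+ 2 by rewrite -[leRHS]sqrrN opprB ler_sqr ?nnegrE; lra.
  have h2 : 0 <= x ^+ 2 := sqr_ge0 x.
  have h3 : 0 <= 2 / 3 * x - y by lra.
  have h5 : 0 <= x - y by lra.
  have h4 : x ^+ 2 * (2 / 3 * x - y) <= 2 * (y - x) ^+ 2.
    apply: (@le_trans _ _ (x * (x - y) * (x - y))).
      by rewrite expr2 -mulrA -[leRHS]mulrA ler_wpM2l//; apply: ler_pM => //; lra.
    have -> : (y - x) ^+ 2 = (x - y) * (x - y) by ring.
    by rewrite mulrA ler_wpM2r// ler_wpM2r.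
  have h6 : 0 <= x ^+ 2 * (2 / 3 * x - y) by exact: mulr_ge0.
  by apply/andP; split; lra.
- have -> : y ^+ 3 / 3 - x ^+ 3 / 3 - x ^+ 2 * (y - x) = (y - x) ^+ 2 * ((y + 2 * x) / 3) by field.
  have h := sqr_ge0 (y - x); have h1 : 0 <= (y + 2 * x) / 3 by lra.
  have h2 : (y + 2 * x) / 3 <= 2 by lra.
  have h3 : (y - x) ^+ 2 * ((y + 2 * x) / 3) <= (y - x) ^+ 2 * 2 by exact: ler_wpM2l.
  have h4 : 0 <= (y - x) ^+ 2 * ((y + 2 * x) / 3) by exact: mulr_ge0.
  by apply/andP; split; lra.
Qed.

(** For [|x| > 1] the arctangent of [|x|] is at least [pi / 4]; otherwise the left side is
    nonpositive. The linear growth is what absorbs the loss in Young's inequality. *)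
Lemma mulr_atan_ge x : pi / 4 * (`|x| - 1) <= x * atan x.
Proof.
have -> : x * atan x = `|x| * atan `|x|.
  have [x0|/ltW x0] := leP 0 x; first by rewrite ger0_norm.
  by rewrite ler0_norm// atanN mulrNN.
have y0 : 0 <= `|x| by []. move: `|x| y0 => y y0.
have p0 := @pi_gt0 R; have a0 : 0 <= atan y by rewrite -atan0; exact: le_atan.
have [y1|y1] := leP y 1.
  have h1 : pi / 4 * (y - 1) <= 0 by apply: mulr_ge0_le0; lra.
  by apply: (le_trans h1); exact: mulr_ge0.
have a1 : pi / 4 <= atan y by rewrite -atan1; exact/le_atan/ltW.
have q0 : 0 <= pi / 4 :> R by lra.
apply: (@le_trans _ _ (y * (pi / 4))); last exact: ler_wpM2l.
by rewrite mulrBr mulr1 mulrC gerBl.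
Qed.

(* [s (s |g| - e k)^2 >= 0] with [s = sqrt (1 + x^2)] *)
Lemma flux_quadratic x g k e : 0 <= e * k ->
  2 * e * (k * (1 + x ^+ 2) * g) - (e * k) ^+ 2 * (1 + `|x|) <= (1 + x ^+ 2) `^ (3 / 2) * `|g| ^+ 2.
Proof.
move=> ek0; pose s := Num.sqrt (1 + x ^+ 2).
have Q0 : 0 <= 1 + x ^+ 2 by rewrite addr_ge0// sqr_ge0.
have s0 : 0 <= s by exact: sqrtr_ge0.
have s2 : s ^+ 2 = 1 + x ^+ 2 by rewrite sqr_sqrtr.
have -> : (1 + x ^+ 2) `^ (3 / 2) = s ^+ 3.
  have -> : 3 / 2 = 1 + 2^-1 :> R by field.
  rewrite powRD; last by apply/implyP => _; apply: lt0r_neq0; apply: (lt_le_trans ltr01); rewrite lerDl sqr_ge0.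
  by rewrite powRr1// powR12_sqrt// -/s [RHS]exprSr s2.
have sx : s <= 1 + `|x|.
  rewrite -ler_sqr ?nnegrE ?addr_ge0// s2 sqrrD expr1n mul1r real_normK ?num_real//.
  by rewrite lerD2r lerDl mulrn_wge0.
have gg : g <= `|g| by exact: ler_norm.
have g0 : 0 <= `|g| by [].
rewrite -s2; move: `|x| s s0 s2 sx => ax s s0 s2 sx; move: `|g| gg g0 => ag gg g0; clear s2 Q0.
have h1 : 0 <= s * (s * ag - e * k) ^+ 2 by rewrite mulr_ge0 ?sqr_ge0.
have h2 : (e * k) ^+ 2 * s <= (e * k) ^+ 2 * (1 + ax) by rewrite ler_wpM2l ?sqr_ge0.
have h3 : e * k * s ^+ 2 * g <= e * k * s ^+ 2 * ag by rewrite ler_wpM2l// mulr_ge0 ?sqr_ge0.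
have E : s * (s * ag - e * k) ^+ 2 = s ^+ 3 * ag ^+ 2 - 2 * (e * k * s ^+ 2 * ag) + (e * k) ^+ 2 * s by ring.
have E2 : 2 * e * (k * s ^+ 2 * g) = 2 * (e * k * s ^+ 2 * g) by ring.
by rewrite E in h1; rewrite E2; lra.
Qed.

End positive_part.

Section integration_by_parts.
Context {R : realType}.
Local Notation mu := (@mu1 R).
Local Notation L1 D f := (mu.-integrable D (EFin \o f)).
Local Notation I := (`[(-1 : R), (1 : R)]%classic : set (measurableTypeR R)).

Lemma ibp_itv (al : R -> R) (c a b : R) (X X' : R -> R) : L1 I al -> -1 <= a -> a < b -> b <= 1 ->
  {within `[a, b], continuous X} -> {within `[a, b], continuous X'} ->
  (forall z, a < z < b -> is_derive z 1 X (X' z)) ->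
  \int[mu]_(z in `[a, b]) (X z * al z) =
  X b * (c + prim al b) - X a * (c + prim al a) - \int[mu]_(z in `[a, b]) (X' z * (c + prim al z)).
Proof.
move=> Ia a0 ab b1 cX cX' dX; apply: ibp_prim => //; last first.
  by move=> z; rewrite in_itv/= => /dX [_ E]; rewrite derive1E.
have [_ cr cl] := (continuous_within_itvP X ab).1 cX.
by split => // z; rewrite in_itv/= => /dX [].
Qed.

Lemma const_oo (f : R -> R) : (forall z : R, -1 < z < 1 -> is_derive z 1 f 0) ->
  forall x y : R, -1 < x < 1 -> -1 < y < 1 -> f x = f y.
Proof.
move=> df; suff H (x y : R) : -1 < x < 1 -> -1 < y < 1 -> x <= y -> f x = f y.
  move=> x y xI yI; have [xy|/ltW xy] := leP x y; first exact: H.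
  by apply/esym/H.
move=> /andP[x0 x1] /andP[y0 y1] xy.
have dI (z : R) : x <= z <= y -> is_derive z 1 f 0.
  move=> /andP[h1 h2]; apply: df; apply/andP; split; first exact: lt_le_trans h1.
  exact: le_lt_trans y1.
have [|//|] := @MVT_segment R f (fun=> 0) x y xy.
- by move=> z; rewrite in_itv/= => /andP[h1 h2]; apply: dI; rewrite !ltW.
- apply: derivable_within_continuous => z; rewrite in_itv/= => /dI [] //.
- by move=> z _ /eqP; rewrite mul0r subr_eq0 => /eqP.
Qed.

Lemma continuous_int0 (f : R -> R) : {within `[-1, 1], continuous f} -> (forall z, 0 <= f z) ->
  \int[mu]_(z in J R) f z <= 0 -> forall z, -1 < z < 1 -> f z = 0.
Proof.
move=> cf f0 int0 z /andP[z0 z1]; apply/eqP; rewrite eq_le f0 andbT leNgt; apply/negP => fz.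
have If : L1 I f by exact: L1_continuous.
rewrite Rintegral_JI// in int0.
have fz2 : 0 < f z / 2 by rewrite divr_gt0.
have [k k0 Hk] := unif_continuous_itv cf fz2.
pose t := Num.min (k / 2) (1 - z).
have t0 : 0 < t by rewrite lt_min divr_gt0// subr_gt0.
have [t1 t2] : t <= k / 2 /\ t <= 1 - z by rewrite /t !ge_min !lexx ?orbT.
have zt1 : z + t <= 1 by lra.
have sub := le_Rintegral_subset f0 If (ltW z0) zt1.
have Izt : L1 `[z, z + t] f by apply: L1_subitv If _; apply: subset_itv; rewrite bnd_simp ?(ltW z0).
have Ic : L1 `[z, z + t] (fun=> f z / 2).
  by apply: L1_continuous; apply: continuous_subspaceT => x; exact: cvg_cst.
have : \int[mu]_(x in `[z, z + t]) (f z / 2) <= \int[mu]_(x in `[z, z + t]) f x.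
  refine (le_Rintegral (measurable_cc _ _) Ic Izt _).
  move=> x; rewrite /= in_itv/= => /andP[zx xz].
  have zI : -1 <= z <= 1 by rewrite !ltW.
  have xI : -1 <= x <= 1 by apply/andP; split; lra.
  have := Hk z x zI xI; rewrite distrC ger0_norm ?subr_ge0// => /(_ ltac:(lra)).
  by rewrite ler_norml => /andP[_ ?]; lra.
rewrite Rint_cst; last lra.
have -> : z + t - z = t by ring.
have : 0 < f z / 2 * t by rewrite mulr_gt0.
lra.
Qed.

End integration_by_parts.

(** * Comparison and energy estimates *)

Section spatial_estimates.
Context {R : realType}.
Local Notation mu := (@mu1 R).
Local Notation L1 D f := (mu.-integrable D (EFin \o f)).
Local Notation I := (`[(-1 : R), (1 : R)]%classic : set (measurableTypeR R)).

Lemma atan_lipP (x y : R) : `|atan x - atan y| <= pi.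
Proof.
have := @atan_gtNpi2 R x; have := @atan_ltpi2 R x.
have := @atan_gtNpi2 R y; have := @atan_ltpi2 R y.
by rewrite ler_norml => *; apply/andP; split; lra.
Qed.

(** The derivative of [atan (s v')] when [v' = c + prim g]. *)
Definition curvature (s c : R) (g : R -> R) z := s / (1 + (s * (c + prim g z)) ^+ 2) * g z.

Lemma curvatureP (s c : R) g : L1 I g -> L1 I (curvature s c g) /\
  forall z, -1 <= z <= 1 -> atan (s * (c + prim g z)) = atan (s * c) + prim (curvature s c g) z.
Proof.
move=> Ig.
have cp : {within `[-1, 1], continuous (fun z => c + prim g z)}.
  by move=> z; apply: cvgD; [exact: cvg_cst|exact: prim_continuous].
have mp := L1_measurable (L1_IJ (L1_continuous cp)).
have [Ia aE _] := wD1_atan s Ig mp (aeW _ (fun z _ => erefl _)).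
by split.
Qed.

(** Differentiating the weight [1 - v/2] yields [1/2 s v' atan (s v')]. At both endpoints the weight
    is 1, and the boundary terms cost at most [s pi] as two arctangents differ by at most [pi]. *)
Lemma energy_ibp (v g : R -> R) (c s : R) : regular v c g -> v (-1) = 0 -> v 1 = 0 -> 0 < s ->
  \int[mu]_(z in J R) (1 / 2 * ((s * (c + prim g z)) * atan (s * (c + prim g z)))) - s * pi <=
  \int[mu]_(z in J R) ((1 - v z / 2) * (s * curvature s c g z)).
Proof.
move=> rv vN1 v1 s0; have [Ig _] := rv; have [Ia aE] := curvatureP s c Ig.
have cv := regular_continuous rv; have cp := regular_dcontinuous rv.
pose p z := c + prim g z.
have cX : {within `[-1, 1], continuous (fun z => 1 - v z / 2)}.
  move=> z; apply: cvgB; first exact: cvg_cst.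
  by apply: cvgM; [exact: cv|exact: cvg_cst].
have cX' : {within `[-1, 1], continuous (fun z => 0 - (p z * 2^-1 + v z * 0))}.
  move=> z; apply: cvgB; first exact: cvg_cst.
  by apply: cvgD; [apply: cvgM; [exact: cp|exact: cvg_cst]|apply: cvgM; [exact: cv|exact: cvg_cst]].
have dX (z : R) : -1 < z < 1 -> is_derive z 1 (fun z => 1 - v z / 2) (0 - (p z * 2^-1 + v z * 0)).
  by move=> zI; exact (derB (dercst 1 z) (derM (regular_is_derive rv zI) (dercst 2^-1 z))).
have l11 : -1 < 1 :> R by lra.
have E := ibp_itv (atan (s * c)) Ia (lexx _) l11 (lexx _) cX cX' dX.
have aE1 := aE 1 ltac:(lra); have aEN1 := aE (-1) ltac:(lra).
rewrite vN1 v1 mul0r subr0 !mul1r -aE1 -aEN1 in E.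
have cA : {within `[-1, 1], continuous (fun z => atan (s * p z))}.
  move=> z; apply: (cvg_contR (@continuous_atan R)).
  by apply: cvgM; [exact: cvg_cst|exact: cp].
have cpA : {within `[-1, 1], continuous (fun z => 1 / 2 * ((s * p z) * atan (s * p z)))}.
  move=> z; apply: cvgM; first exact: cvg_cst.
  by apply: cvgM; [apply: cvgM; [exact: cvg_cst|exact: cp]|exact: cA].
have mX : measurable_fun I ((fun z => 1 - v z / 2) : measurableTypeR R -> R) := L1_measurable (L1_continuous cX).
have [C _ HC] : exists2 C : R, True & forall z, I z -> `|1 - v z / 2| <= C.
  have [c0 _ Hc0] := @EVT_max R (fun z => `|1 - v z / 2|) (-1) 1 (ltW l11) (fun x => cvg_norm (cX x)).
  by exists `|1 - v c0 / 2| => // z Iz; apply: Hc0.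
have IXa := L1M (measurable_cc (-1) 1) mX HC Ia.
have IsXa : L1 I (fun z => (1 - v z / 2) * (s * curvature s c g z)).
  refine (eq_L1 (measurable_cc (-1) 1) _ (L1Z (measurable_cc (-1) 1) s IXa)) => z _; exact: mulrCA.
have IX'A : L1 I (fun z => (0 - (p z * 2^-1 + v z * 0)) * (atan (s * c) + prim (curvature s c g) z)).
  apply: L1_continuous => z; apply: cvgM; first exact: cX'.
  by apply: cvgD; [exact: cvg_cst|exact: prim_continuous].
have J1 := Rintegral_JI (L1_continuous cpA); have J2 := Rintegral_JI IsXa.
suff H : \int[mu]_(z in I) (1 / 2 * ((s * p z) * atan (s * p z))) - s * pi <=
    \int[mu]_(z in I) ((1 - v z / 2) * (s * curvature s c g z)).
  by rewrite -J1 -J2 in H; exact H.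
have -> : \int[mu]_(z in I) ((1 - v z / 2) * (s * curvature s c g z)) = s * \int[mu]_(z in I) ((1 - v z / 2) * curvature s c g z).
  rewrite -(RintegralZl s (measurable_cc (-1) 1) IXa); apply: eq_Rintegral => z _; exact: mulrCA.
have -> : \int[mu]_(z in I) (1 / 2 * ((s * p z) * atan (s * p z))) =
    - s * \int[mu]_(z in I) ((0 - (p z * 2^-1 + v z * 0)) * (atan (s * c) + prim (curvature s c g) z)).
  rewrite -(RintegralZl (- s) (measurable_cc (-1) 1) IX'A); apply: eq_Rintegral => z.
  rewrite inE /= in_itv/= => zI; rewrite -(aE z zI) -/(p z).
  by move: (p z) (atan _) => x y; field.
rewrite E mulrBr mulNr -/(p 1) -/(p (-1)).
have := atan_lipP (s * p 1) (s * p (-1)); rewrite ler_norml => /andP[h _].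
have : s * - pi <= s * (atan (s * p 1) - atan (s * p (-1))) by rewrite ler_wpM2l// ltW.
by lra.
Qed.

(** [is_stationary] gives derivatives in the open interval only. There the flux has the derivative
    [be], continuous up to the endpoints since [uc + 1] stays positive; hence the flux is a constant
    plus [prim be], and [derive1 uc] is continuous as the tangent of the flux divided by [s]. *)
Lemma stationary_flux (s : R) (uc : R -> R) : 0 < s -> is_stationary s uc ->
  (forall z, -1 <= z <= 1 -> 0 < uc z + 1) ->
  let be z := (s * (uc z + 1))^-1 in
  [/\ {within `[-1, 1], continuous be},
      (forall z : R, -1 < z < 1 -> {for z, continuous (derive1 uc)}) &
      exists k, forall z, -1 < z < 1 -> atan (s * derive1 uc z) = k + prim be z].
Proof.
move=> s0 [cu _ _ st] u0 be.
have cb : {within `[-1, 1], continuous be}.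
  have cD : {within `[-1, 1], continuous (fun z => s * (uc z + 1))}.
    move=> z; apply: cvgM; first exact: cvg_cst.
    by apply: cvgD; [exact: cu|exact: cvg_cst].
  apply/subspace_continuousP => z zI; have uz : 0 < uc z + 1.
    by apply: u0; move: zI; rewrite /= in_itv.
  move/subspace_continuousP : cD => /(_ z zI).
  by apply: cvgV; rewrite lt0r_neq0// mulr_gt0.
have JI z : -1 < z < 1 -> J R z by rewrite /J/= in_itv.
pose a y := atan (s * derive1 uc y).
have da (z : R) : -1 < z < 1 -> is_derive z 1 a (be z).
  move=> zI; have [_ _ da E] := st z (JI z zI).
  apply: DeriveDef; first exact: da.
  rewrite -derive1E; apply: (@mulfI _ s); first by rewrite lt0r_neq0.
  move/eqP : E; rewrite eqr_opp => /eqP ->.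
  by rewrite /be invfM mulrA divff ?mul1r// lt0r_neq0.
split => //.
- move=> z zI; have -> : derive1 uc = fun y => tan (a y) / s.
    by apply/funext => y; rewrite /a atanK mulrC mulrA mulVf ?mul1r// lt0r_neq0.
  apply: cvgM; last exact: cvg_cst.
  have ca : {for z, continuous a}.
    apply: differentiable_continuous; apply/derivable1_diffP; by have [] := da z zI.
  apply: (@cvg_comp _ _ _ a tan _ _ _ ca); apply: continuous_tan.
  rewrite /a cos_atan invr_eq0 sqrtr_eq0 -ltNge.
  by apply: (lt_le_trans ltr01); rewrite lerDl sqr_ge0.
- exists (a 0 - prim be 0) => z zI.
  have d0 (x : R) : -1 < x < 1 -> is_derive x 1 (fun y => a y - prim be y) 0.
    move=> xI; apply: (dereq (derB (da x xI) (is_derive_prim cb xI))); exact: subrr.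
  have := const_oo d0 zI (y := 0); rewrite -/(a z) => H.
  by rewrite -H ?subrK//; lra.
Qed.

(** Where [uc > v], monotonicity of the arctangent gives [uc' - v'] and the flux of [v] minus that
    of [uc] opposite signs. Since [uc] is known to be differentiable inside only, the integration by
    parts takes place on [[al, be']], with boundary terms at most [pi] times a test function that
    vanishes at [-1] and [1]. *)
Lemma comparison_ibp (v g uc : R -> R) (c s : R) : regular v c g -> v (-1) = 0 -> v 1 = 0 -> 0 < s ->
  is_stationary s uc -> (forall z, -1 <= z <= 1 -> 0 < uc z + 1) ->
  0 <= \int[mu]_(z in J R) (pos (uc z - v z) ^+ 2 * (curvature s c g z - (s * (uc z + 1))^-1)).
Proof.
move=> rv vN1 v1 s0 st u0; have [cu uN1 u1 stz] := st.
have [cb cu' [k Hk]] := stationary_flux s0 st u0.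
pose be z : R := (s * (uc z + 1))^-1.
have [Ig _] := rv; have [Ia aE] := curvatureP s c Ig.
set a := curvature s c g in Ia aE *.
have cv := regular_continuous rv; have cp := regular_dcontinuous rv.
pose p z := c + prim g z.
have Ib : L1 I be := L1_continuous cb.
have Iab := L1B (measurable_cc (-1) 1) Ia Ib.
pose X z := pos (uc z - v z) ^+ 2.
pose X' z := 2 * pos (uc z - v z) * (derive1 uc z - p z).
have cw : {within `[-1, 1], continuous (fun z => pos (uc z - v z))}.
  move=> z; apply: (cvg_contR (@continuous_pos R)).
  by apply: cvgB; [exact: cu|exact: cv].
have cX : {within `[-1, 1], continuous X}.
  by move=> z; rewrite /X (_ : (fun _ => _) = fun z => pos (uc z - v z) * pos (uc z - v z))//; apply: cvgM; exact: cw.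
have mX : measurable_fun I (X : measurableTypeR R -> R) := L1_measurable (L1_continuous cX).
have l11 : -1 < 1 :> R by lra.
have [C _ HC] : exists2 C : R, True & forall z, I z -> `|X z| <= C.
  have [c0 _ Hc0] := @EVT_max R (fun z => `|X z|) (-1) 1 (ltW l11) (fun x => cvg_norm (cX x)).
  by exists `|X c0| => // z Iz; apply: Hc0.
pose f z := X z * (a z - be z).
have If : L1 I f := L1M (measurable_cc (-1) 1) mX HC Iab.
have X0 z : 0 <= X z := sqr_ge0 _.
have inner (al be' : R) : -1 < al -> al < be' -> be' < 1 ->
    - pi * (X be' + X al) <= prim f be' - prim f al.
  move=> al0 ab b1; rewrite (prim_sub If (ltW al0) (ltW ab) (ltW b1)).
  have sub : (`[al, be']%classic : set R) `<=` `[-1, 1] by apply: subset_itv; rewrite bnd_simp ltW.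
  have inI (z : R) : al <= z <= be' -> -1 < z < 1.
    by move=> /andP[h1 h2]; rewrite (lt_le_trans al0 h1) (le_lt_trans h2 b1).
  have cuab : {within `[al, be'], continuous (derive1 uc)}.
    apply/subspace_continuousP => z zI; apply: cvg_within_filter.
    by apply: cu'; apply: inI; move: zI; rewrite /= in_itv.
  have W (h : R -> R) : {within `[-1, 1], continuous h} -> {within `[al, be'], continuous h}.
    by apply: continuous_subspaceW.
  have cX' : {within `[al, be'], continuous X'}.
    move=> z; apply: cvgM; first by apply: cvgM; [exact: cvg_cst|exact: (W _ cw)].
    by apply: cvgB; [exact: cuab|exact: (W _ cp)].
  have dX (z : R) : al < z < be' -> is_derive z 1 X (X' z).
    move=> /andP[/ltW h1 /ltW h2]; have zI : -1 < z < 1 by apply: inI; rewrite h1.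
    have zJ : J R z by rewrite /J/= in_itv.
    have du : is_derive z 1 uc (derive1 uc z).
      by have [_ d _ _] := stz z zJ; rewrite derive1E; exact/derivableP.
    exact (derC (g := fun z => uc z - v z) (is_derive_pos2 _) (derB du (regular_is_derive rv zI))).
  have := ibp_itv (atan (s * c) - k) Iab (ltW al0) ab (ltW b1) (W _ cX) cX' dX.
  have DE (z : R) : -1 < z < 1 -> atan (s * c) - k + prim (fun z => a z - be z) z = atan (s * p z) - atan (s * derive1 uc z).
    move=> /[dup] zI /andP[/ltW h1 /ltW h2]; have zI' : -1 <= z <= 1 by rewrite h1.
    by rewrite (primD Ia Ib zI') (Hk z zI) (aE z zI'); ring.
  rewrite (DE be') ?(lt_trans al0 ab)// (DE al) ?al0 ?(lt_trans ab b1)// => ->.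
  have neg : \int[mu]_(z in `[al, be']) (X' z * (atan (s * c) - k + prim (fun z => a z - be z) z)) <= 0.
    have IX : L1 `[al, be'] (fun z => X' z * (atan (s * c) - k + prim (fun z => a z - be z) z)).
      apply: L1_continuous => z; apply: cvgM; first exact: cX'.
      apply: cvgD; first exact: cvg_cst.
      exact: (W _ (prim_continuous Iab)).
    rewrite -oppr_ge0 -(RintegralN (measurable_cc al be') IX); apply: Rintegral_ge0 => z.
    rewrite /= in_itv/= => /inI zI; rewrite (DE z zI) /X'.
    have w0 := pos_ge0 (uc z - v z); rewrite oppr_ge0 -mulrA mulr_ge0_le0 ?mulr_ge0//.
    have [h|/ltW h] := leP (derive1 uc z) (p z).
      apply: mulr_le0_ge0; first by rewrite subr_le0.
      by rewrite subr_ge0 le_atan// ler_pM2l.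
    apply: mulr_ge0_le0; first by rewrite subr_ge0.
    by rewrite subr_le0 le_atan// ler_pM2l.
  have := atan_lipP (s * p be') (s * derive1 uc be'); have := atan_lipP (s * p al) (s * derive1 uc al).
  rewrite !ler_norml => /andP[_ h1] /andP[h2 _].
  have g1 : X be' * - pi <= X be' * (atan (s * p be') - atan (s * derive1 uc be')) by exact: ler_wpM2l.
  have g2 : X al * (atan (s * p al) - atan (s * derive1 uc al)) <= X al * pi by exact: ler_wpM2l.
  move: neg g1 g2; move: (\int[mu]_(z in `[al, be']) _) => N neg g1 g2.
  move: (X be' * (_ - _)) (X al * (_ - _)) g1 g2 => Y1 Y2 g1 g2.
  have -> : - pi * (X be' + X al) = X be' * - pi - X al * pi by ring.
  by clear -neg g1 g2; lra.
have JE := etrans (Rintegral_JI If) (esym (prim_sub If (lexx _) (ltW l11) (lexx _))).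
suff H : 0 <= prim f 1 - prim f (-1) by rewrite -JE in H; exact H.
apply/ler_addgt0Pr => e e0.
have p0 := @pi_gt0 R.
(* Four errors of this size: two from the continuity of [prim f], two from the boundary terms. *)
have e4 : 0 < e / 4 by rewrite divr_gt0.
have e4p : 0 < e / 4 / pi by rewrite divr_gt0.
have [k1 k10 H1] := unif_continuous_itv (prim_continuous If) e4.
have [k2 k20 H2] := unif_continuous_itv cX e4p.
pose t := Num.min (k1 / 2) (Num.min (k2 / 2) (1 / 2)).
have t0 : 0 < t by rewrite !lt_min !divr_gt0.
have [t1 t2 t3] : [/\ t <= k1 / 2, t <= k2 / 2 & t <= 1 / 2] by rewrite /t !ge_min !lexx ?orbT.
clearbody t.
have bI : -1 <= 1 - t <= 1 by move: t0 t3; clear; move=> *; apply/andP; split; lra.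
have aI : -1 <= -1 + t <= 1 by move: t0 t3; clear; move=> *; apply/andP; split; lra.
have tk1 : t < k1 by move: t1 k10; clear; lra.
have tk2 : t < k2 by move: t2 k20; clear; lra.
have uI : -1 <= (1 : R) <= 1 by clear; lra.
have lI : -1 <= (-1 : R) <= 1 by clear; lra.
have nb : `|1 - (1 - t)| = t by rewrite subKr gtr0_norm.
have na : `|-1 - (-1 + t)| = t by rewrite opprD addrA subrr sub0r normrN gtr0_norm.
have Xu : X 1 = 0 by rewrite /X u1 v1 subrr pos_le0// expr0n.
have Xl : X (-1) = 0 by rewrite /X uN1 vN1 subrr pos_le0// expr0n.
have := H1 1 (1 - t) uI bI; rewrite nb => /(_ tk1); rewrite ler_norml => /andP[q1 _].
have := H1 (-1) (-1 + t) lI aI; rewrite na => /(_ tk1); rewrite ler_norml => /andP[_ q2].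
have := H2 1 (1 - t) uI bI; rewrite nb Xu => /(_ tk2); rewrite ler_norml => /andP[q3 _].
have := H2 (-1) (-1 + t) lI aI; rewrite na Xl => /(_ tk2); rewrite ler_norml => /andP[q4 _].
have q5 : - pi * (X (1 - t) + X (-1 + t)) <= prim f (1 - t) - prim f (-1 + t).
  by apply: inner; move: t0 t3; clear; lra.
have q6 : pi * X (1 - t) <= e / 4.
  by rewrite mulrC -ler_pdivlMr//; move: q3; clear; lra.
have q7 : pi * X (-1 + t) <= e / 4.
  by rewrite mulrC -ler_pdivlMr//; move: q4; clear; lra.
move: q5; rewrite mulNr mulrDr; move: q1 q2 q6 q7; clear; lra.
Qed.

End spatial_estimates.

(** * Comparison with the catenoid *)

Section comparison.
Context {R : realType}.
Local Notation mu := (@mu1 R).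
Local Notation L1 D f := (mu.-integrable D (EFin \o f)).
Let mJ : measurable (J R : set (measurableTypeR R)) := @measurable_J R.
Let Joo : (mu (J R) < +oo)%E := @J_lty R.

Lemma J_itv (z : R) : J R z -> -1 <= z <= 1.
Proof. by rewrite /J/= in_itv/= => /andP[? ?]; rewrite !ltW. Qed.

Lemma W2qD_cont (q : R) v : W2qD q v -> [/\ {within `[-1, 1], continuous v}, v (-1) = 0 & v 1 = 0].
Proof. by move=> [[cv _ _ _] vN1 v1]. Qed.

Lemma measurable_J_cont (f : R -> R) : {within `[-1, 1], continuous f} ->
  measurable_fun (J R) (f : measurableTypeR R -> R).
Proof. by move=> cf; exact: L1_measurable (L1_IJ (L1_continuous cf)). Qed.

Lemma time_integral_continuous (q : R) (u ut : R -> R -> R) (th : R -> R -> R) (C t1 : R) : 2 < q ->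
  C_W2qD q +oo u -> 0 <= C ->
  (forall s, 0 <= s -> L1 (J R) (fun z => th z (u s z))) ->
  (forall s t z, 0 <= s -> 0 <= t -> J R z -> `|th z (u s z) - th z (u t z)| <= C * `|u s z - u t z|) ->
  {within `[0, t1], continuous (fun s => \int[mu]_(z in J R) th z (u s z))}.
Proof.
move=> q2 hCW C0 Ith lip; apply/subspace_continuousP => t; rewrite /= in_itv/= => /andP[t0 _].
apply/cvgrPdist_le => e e0.
pose e' := e / (C * fine (mu (J R)) + 1).
have m0 : 0 <= C * fine (mu (J R)) by rewrite mulr_ge0// fine_ge0.
have e'0 : 0 < e' by rewrite divr_gt0// ltr_wpDl.
have [eta eta0 H] := sup_continuity q2 hCW t0 e'0.
rewrite /within/=; apply/nbhs_ballP; exists eta => // s; rewrite /ball/= => ts.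
rewrite in_itv/= => /andP[s0 _]; rewrite distrC in ts.
have Id := L1B mJ (Ith _ t0) (Ith _ s0).
rewrite -(RintegralB mJ (Ith _ t0) (Ith _ s0)).
apply: (le_trans (le_normr_Rintegral mJ Id)).
apply: (@le_trans _ _ (\int[mu]_(z in J R) (C * e'))).
  apply: le_Rintegral => //; [exact: (L1_normr Id)|exact: (L1_cst mJ _ Joo)|].
  move=> z Jz; apply: (le_trans (lip _ _ _ t0 s0 Jz)); apply: ler_wpM2l => //.
  by rewrite distrC; apply: H => //; exact: J_itv.
rewrite (Rintegral_cst _ mJ) /e'.
have E (x y z : R) : x * (e / z) * y = e * (x * y) / z by ring.
rewrite E ler_pdivrMr ?ltr_wpDl//.
by apply: ler_wpM2l; [exact: ltW|rewrite lerDl].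
Qed.

(** Positivity of [u + 1] at each time becomes uniform on [[0, t1]] by compactness. The bound may
    degenerate as [t1] grows; it enters the constant of Gronwall's inequality only. *)
Lemma uniform_lower_bound (q : R) (u ut : R -> R -> R) (t1 : R) : 2 < q -> C_W2qD q +oo u ->
  (forall t, 0 <= t -> forall z, J R z -> -1 < u t z < 1) -> 
  exists2 k : R, 0 < k & forall t, 0 <= t <= t1 -> forall z, -1 <= z <= 1 -> k <= u t z + 1.
Proof.
move=> q2 hCW hu.
have /compact_near_coveringP cK := @segment_compact R 0 t1.
pose P (k : R) t := 0 <= t -> forall z, -1 <= z <= 1 -> k <= u t z + 1.
have : \forall k \near (0 : R)^'+, `[0, t1]%classic `<=` P k.
  apply: cK => t; rewrite /= in_itv/= => /andP[t0 _].
  have [cv vN1 v1] := W2qD_cont (hCW _ (time_intervaly t0)).1.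
  have [c cI Hc] := @EVT_min R (u t) (-1) 1 ltac:(lra) cv.
  have /andP[uc0 _] := v_itv vN1 v1 (hu t t0) (ltac:(by rewrite in_itv in cI) : -1 <= c <= 1).
  pose m := u t c + 1; have m0 : 0 < m by rewrite /m; lra.
  have m2 : 0 < m / 2 by rewrite divr_gt0.
  have [d d0 Hd] := sup_continuity q2 hCW t0 m2.
  exists (ball t d, [set k | k < m / 2]); first split => /=.
  - exact: nbhsx_ballx.
  - exact: nbhs_right_lt.
  move=> [s k] [/= ts km] s0 z zI; rewrite /ball/= distrC in ts.
  have := Hd s s0 ts z zI; rewrite ler_norml => /andP[h _].
  have := Hc z; rewrite in_itv/= zI => /(_ isT) h2.
  by move: h h2 km; rewrite /m; lra.
move=> /(filterI (nbhs_right_gt (0 : R))) /filter_ex[k [k0 Hk]].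
exists k => // t /andP[t0 tt1] z zI; apply: Hk => //.
by rewrite /= in_itv/= t0.
Qed.

(** The mean value theorem applied to [expR (- c * t) * W t], whose derivative is nonpositive. *)
Lemma gronwall_le0 (W dW : R -> R) (c t1 : R) : 0 < t1 -> {within `[0, t1], continuous W} ->
  (forall t : R, 0 < t -> is_derive t 1 W (dW t)) -> (forall t, 0 < t -> t < t1 -> dW t <= c * W t) ->
  W 0 <= 0 -> W t1 <= 0.
Proof.
move=> t10 cW derW le W0.
have dE (t : R) : t \in `]0, t1[ -> is_derive t 1 (fun t => expR (- c * t) * W t)
    (expR (- c * t) * (dW t - c * W t)).
  rewrite in_itv/= => /andP[t0 _].
  have de := derC (is_derive_expR _) (derM (dercst (- c) t) (derid t)).
  refine (dereq (derM de (derW t t0)) _); ring.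
have cE : {within `[0, t1], continuous (fun t => expR (- c * t) * W t)}.
  move=> t; apply: cvgM; last exact: cW.
  have ce : continuous (fun t => expR (- c * t)).
    by move=> x; apply: (cvg_contR (@continuous_expR R)); apply: cvgM; [exact: cvg_cst|exact: cvg_id].
  by have := continuous_subspaceT ce; exact.
have [x] := MVT t10 dE cE; rewrite in_itv/= => /andP[x0 x1].
rewrite mulr0 expR0 mul1r subr0 => E.
have : expR (- c * x) * (dW x - c * W x) * t1 <= 0.
  rewrite pmulr_lle0// pmulr_rle0 ?expR_gt0// subr_le0; exact: le.
rewrite -E => h; have {h} : expR (- c * t1) * W t1 <= 0 by lra.
by rewrite pmulr_rle0// expR_gt0.
Qed.

(** Replaces the chosen weak derivatives in the equation by [c + prim g2] and [curvature], for which
    integration by parts is available. *)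
Lemma evolution_regular (q lambda s : R) (v w : R -> R) psi : 2 < q -> W2qD q v ->
  evolution_eq lambda s v w psi -> exists c g2 g, [/\ regular v c g2,
    is_lower_trace v (wD2 (Omega v) (er R) psi) g &
    {ae mu, forall z, J R z -> w z = s * curvature s c g2 z - (v z + 1)^-1
      + lambda * ((1 + (s * (c + prim g2 z)) ^+ 2) `^ (3 / 2) * `|g z| ^+ 2)}].
Proof.
move=> q2 Wv [g tg eqn].
have q1 : 1 <= q by apply: (le_trans _ (ltW q2)); rewrite ler1n.
have [c [g2 [rv E]]] := W2qD_regular q1 Wv; have [Ig2 _] := rv.
exists c, g2, g; split => //.
have mw : measurable_fun (J R) (wD1 v : measurableTypeR R -> R).
  by have [[_ _ _ [[m _] _ _]] _ _] := Wv.
have [_ _ aE] := wD1_atan s Ig2 mw E.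
apply: ae_imp (ae_and eqn (ae_and E aE)) => z [h1 [h2 h3]] Jz.
have e := h1 Jz; rewrite (h2 Jz) -exprMn in e; have e3 := h3 Jz.
move/eqP : e; rewrite e3 subr_eq => /eqP ->.
rewrite /curvature; move: (_ `^ _) (s / _) => P r; ring.
Qed.

(** Gronwall's inequality for the integral of [pos (uc - u) ^+ 3 / 3]. The curvature has a sign by
    [comparison_ibp] and the force pushes upwards; the singular term is monotone the wrong way, but
    Lipschitz as long as [u + 1] and [uc + 1] are bounded below. *)
Lemma comparison (q lambda s delta : R) (u ut : R -> R -> R) psi uc : 2 < q -> 0 <= lambda -> 0 < s ->
  C1_Lq q +oo u ut -> C_W2qD q +oo u -> (forall t, 0 <= t -> forall z, J R z -> -1 < u t z < 1) ->
  (forall t, 0 < t -> evolution_eq lambda s (u t) (ut t) (psi t)) ->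
  is_stationary s uc -> 0 < delta -> (forall z, -1 <= z <= 1 -> delta <= uc z + 1) ->
  (forall z, J R z -> uc z <= u 0 z) ->
  forall t, 0 <= t -> forall z, J R z -> uc z <= u t z.
Proof.
move=> q2 l0 s0 hC1 hCW hu hev st delta0 ucd init t1.
rewrite le_eqVlt => /predU1P[<- //|t10].
have [cuc _ _ stz] := st.
have q1 : 1 <= q by apply: (le_trans _ (ltW q2)); rewrite ler1n.
have [k k0 Hk] := uniform_lower_bound ut t1 q2 hCW hu.
have reg t : 0 <= t -> [/\ {within `[-1, 1], continuous (u t)}, u t (-1) = 0 & u t 1 = 0].
  by move=> t0; exact (W2qD_cont (hCW _ (time_intervaly t0)).1).
pose w t z := pos (uc z - u t z).
have cw t : 0 <= t -> {within `[-1, 1], continuous (w t)}.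
  move=> /reg[cu _ _] z; apply: (cvg_contR (@continuous_pos R)).
  by apply: cvgB; [exact: cuc|exact: cu].
have cw2 t : 0 <= t -> {within `[-1, 1], continuous (fun z => w t z ^+ 2)}.
  by move=> t0 z; rewrite (_ : (fun _ => _) = fun z => w t z * w t z)//; apply: cvgM; exact: cw.
have cw3 t : 0 <= t -> {within `[-1, 1], continuous (fun z => w t z ^+ 3 / 3)}.
  move=> t0 z; apply: cvgM; last exact: cvg_cst.
  by rewrite (_ : (fun _ => _) = fun z => w t z * w t z ^+ 2)//; apply: cvgM; [exact: cw|exact: cw2].
have d2 t z : 0 <= t -> J R z -> `|uc z - u t z| <= 2.
  move=> t0 Jz; have [/andP[h1 h2] _ _ _] := stz z Jz; have /andP[h3 h4] := hu t t0 z Jz.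
  by rewrite ler_norml; apply/andP; split; lra.
have w02 t z : 0 <= t -> J R z -> 0 <= w t z <= 2.
  move=> t0 Jz; rewrite pos_ge0/= /w /pos ge_max; apply/andP; split; first by [].
  by have := d2 t z t0 Jz; rewrite ler_norml => /andP[].
have w2b t z : 0 <= t -> J R z -> `|w t z ^+ 2| <= 4.
  move=> t0 Jz; have /andP[h1 h2] := w02 t z t0 Jz; rewrite ger0_norm ?sqr_ge0// expr2.
  by apply: (le_trans (ler_pM h1 h1 h2 h2)); rewrite -natrM.
have w3b t z : 0 <= t -> J R z -> `|w t z ^+ 3 / 3| <= 4.
  move=> t0 Jz; have /andP[h1 h2] := w02 t z t0 Jz; have w2 := w2b t z t0 Jz.
  rewrite ger0_norm in w2; last exact: sqr_ge0.
  rewrite ger0_norm; last by rewrite divr_ge0// exprn_ge0.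
  rewrite ler_pdivrMr// exprS; apply: (le_trans (ler_pM h1 (sqr_ge0 _) h2 w2)).
  by rewrite -!natrM ler_nat.
pose th z y := pos (uc z - y) ^+ 3 / 3; pose th1 z y := - pos (uc z - y) ^+ 2.
have tay t s' z : 0 <= t -> 0 <= s' -> J R z ->
    `|th z (u s' z) - th z (u t z) - th1 z (u t z) * (u s' z - u t z)| <= 2 * (u s' z - u t z) ^+ 2.
  move=> t0 s'0 Jz; have := pos3_taylor (d2 _ _ t0 Jz) (d2 _ _ s'0 Jz).
  rewrite /th /th1.
  have -> : uc z - u s' z - (uc z - u t z) = - (u s' z - u t z) by ring.
  by rewrite sqrrN mulrN mulNr.
pose W t := \int[mu]_(z in J R) th z (u t z).
have dW (t : R) : 0 < t -> is_derive t 1 W (\int[mu]_(z in J R) (th1 z (u t z) * ut t z)).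
  move=> t0; have t0' := ltW t0; apply: (@is_derive_integral _ q u ut q2 hC1 hCW th th1 4 t t0) => //.
  - by move=> s' s'0; split=> [|z Jz]; [exact: measurable_J_cont (cw3 _ s'0)|exact: w3b].
  - by apply: measurableT_comp => //; exact: measurable_J_cont (cw2 _ t0').
  - by move=> z Jz; rewrite normrN; exact: w2b.
  - move=> s' z s'0 Jz; apply: (le_trans (tay t s' z t0' s'0 Jz)); apply: ler_wpM2r; first exact: sqr_ge0.
    by rewrite ler_nat.
have Iw3 t : 0 <= t -> L1 (J R) (fun z => th z (u t z)).
  by move=> t0; exact: L1_IJ (L1_continuous (cw3 _ t0)).
have cW : {within `[0, t1], continuous W}.
  apply: (@time_integral_continuous q u ut th 8 t1) => // s' t z s'0 t0 Jz.
  have ht := tay t s' z t0 s'0 Jz; have h1 : `|th1 z (u t z)| <= 4 by rewrite normrN; exact: w2b.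
  have h2 : `|u s' z - u t z| <= 2.
    have /andP[? ?] := hu t t0 z Jz; have /andP[? ?] := hu s' s'0 z Jz.
    by rewrite ler_norml; apply/andP; split; lra.
  rewrite -[X in `|X|](subrK (th1 z (u t z) * (u s' z - u t z))).
  apply: (le_trans (ler_normD _ _)); rewrite normrM.
  have h3 : `|th1 z (u t z)| * `|u s' z - u t z| <= 4 * `|u s' z - u t z| by exact: ler_wpM2r.
  have h4 : 2 * (u s' z - u t z) ^+ 2 <= 4 * `|u s' z - u t z|.
    rewrite -real_normK ?num_real// expr2 mulrA; apply: ler_wpM2r => //.
    by apply: (le_trans (ler_wpM2l _ h2)); rewrite // -natrM.
  by apply: (le_trans (lerD (le_trans ht h4) h3)); rewrite -mulrDl -natrD.
have W0 : W 0 <= 0.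
  rewrite /W (_ : \int[mu]_(z in J R) _ = \int[mu]_(z in J R) (0 : R)).
    by rewrite (Rintegral_cst _ mJ) mul0r.
  apply: eq_Rintegral => z; rewrite inE => Jz.
  by rewrite /th pos_le0 ?expr0n/= ?mul0r// subr_le0 init.
(* The singular terms differ by [(uc - u) / ((u + 1) (uc + 1))], and the factor 3 undoes the
   division by 3 in [th]. *)
have W1 := @gronwall_le0 W (fun t => \int[mu]_(z in J R) (th1 z (u t z) * ut t z)) (3 / (k * delta)) t1 t10 cW dW _ W0.
have {}W1 : W t1 <= 0.
  apply: W1 => t t0 tt1; have t0' := ltW t0.
  have Wt := (hCW _ (time_intervaly t0')).1.
  have [c [g2 [g [rv _ E]]]] := evolution_regular q2 Wt (hev t t0).
  have [cu uN1 u1] := reg t t0'.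
  have ib := comparison_ibp rv uN1 u1 s0 st (fun z zI => lt_le_trans delta0 (ucd z zI)).
  have [Ig2 _] := rv; have [Ia _] := curvatureP s c Ig2.
  have [cb _ _] := stationary_flux s0 st (fun z zI => lt_le_trans delta0 (ucd z zI)).
  have mw2 := measurable_J_cont (cw2 _ t0').
  have Iab := L1B mJ (L1_IJ Ia) (L1_IJ (L1_continuous cb)).
  have Iw := L1M mJ mw2 (fun z Jz => w2b t z t0' Jz) Iab.
  have [_ Lut _ _] := hC1 _ (time_intervaly t0').
  have Iut := Lp_L1 mJ Joo q1 Lut.
  have mth1 : measurable_fun (J R) ((fun z => th1 z (u t z)) : measurableTypeR R -> R) by apply: measurableT_comp.
  have bth1 z : J R z -> `|th1 z (u t z)| <= 4 by move=> Jz; rewrite normrN; exact: w2b.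
  have Il := L1M mJ mth1 bth1 Iut.
  have Is := L1Z mJ (- s) Iw; have IW := L1Z mJ (3 / (k * delta)) (Iw3 _ t0').
  apply: (@le_trans _ _ (\int[mu]_(z in J R) (- s * (w t z ^+ 2 * (curvature s c g2 z - (s * (uc z + 1))^-1))
      + 3 / (k * delta) * th z (u t z)))).
    apply: (le_Rintegral_ae mJ Il (L1D mJ Is IW)).
    apply: ae_imp E => z Ez Jz; rewrite (Ez Jz).
    have zI := J_itv Jz; have kz := Hk t (ltac:(by rewrite t0' ltW) : 0 <= t <= t1) z zI.
    have dz := ucd z zI.
    have u0 : 0 < u t z + 1 := lt_le_trans k0 kz; have uc0 : 0 < uc z + 1 := lt_le_trans delta0 dz.
    set F := (1 + _) `^ _ * _.
    have F0 : 0 <= F by rewrite mulr_ge0 ?powR_ge0 ?sqr_ge0.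
    have w0 := pos_ge0 (uc z - u t z); have ws := pos_sqrM (uc z - u t z).
    rewrite /th1 /th /w; move: (pos (uc z - u t z)) w0 ws (curvature s c g2 z) => X X0 XE a.
    have E1 : X ^+ 2 * ((u t z + 1)^-1 - (uc z + 1)^-1) = X ^+ 3 * ((u t z + 1)^-1 * (uc z + 1)^-1).
      by rewrite -XE; field; rewrite !lt0r_neq0.
    have E2 : (u t z + 1)^-1 * (uc z + 1)^-1 <= (k * delta)^-1.
      rewrite -invfM lef_pV2 ?posrE ?mulr_gt0//; apply: ler_pM => //; exact: ltW.
    have E3 : X ^+ 3 * ((u t z + 1)^-1 * (uc z + 1)^-1) <= X ^+ 3 * (k * delta)^-1.
      by apply: ler_wpM2l => //; exact: exprn_ge0.
    have E4 : 0 <= X ^+ 2 * (lambda * F) by rewrite mulr_ge0 ?sqr_ge0// mulr_ge0.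
    have -> : - s * (X ^+ 2 * (a - (s * (uc z + 1))^-1)) = - X ^+ 2 * (s * a) + X ^+ 2 * (uc z + 1)^-1.
      by field; rewrite !lt0r_neq0.
    have -> : 3 / (k * delta) * (X ^+ 3 / 3) = X ^+ 3 * (k * delta)^-1 by field; rewrite !lt0r_neq0.
    rewrite mulrBr in E1; rewrite mulrDr mulrBr !mulNr.
    move: E1 E3 E4; move: (X ^+ 2 * (u t z + 1)^-1) (X ^+ 2 * (uc z + 1)^-1) (X ^+ 2 * (lambda * F)) (X ^+ 2 * (s * a)).
    move: (X ^+ 3 * _) (X ^+ 3 / (k * delta)) => *; lra.
  rewrite (RintegralD mJ Is IW) (RintegralZl _ mJ Iw) (RintegralZl _ mJ (Iw3 _ t0')).
  by rewrite gerDr mulNr oppr_le0; apply: mulr_ge0; [exact: ltW|exact: ib].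
have w3 z : 0 <= w t1 z ^+ 3 / 3 by rewrite divr_ge0// exprn_ge0// pos_ge0.
move=> z Jz; have := continuous_int0 (cw3 _ (ltW t10)) w3 W1; move=> /(_ z).
have zI : -1 < z < 1 by move: Jz; rewrite /J/= in_itv.
move=> /(_ zI) /eqP; rewrite mulf_eq0 invr_eq0 pnatr_eq0 orbF expf_eq0/= => /eqP H.
rewrite -subr_le0 leNgt; apply/negP => h.
by move: H; rewrite /w pos_id ?ltW// => H; rewrite H ltxx in h.
Qed.

End comparison.

(** * Growth of the energy *)

Section energy.
Context {R : realType}.
Local Notation mu := (@mu1 R).
Local Notation L1 D f := (mu.-integrable D (EFin \o f)).
Let mJ : measurable (J R : set (measurableTypeR R)) := @measurable_J R.
Let Joo : (mu (J R) < +oo)%E := @J_lty R.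

(* With [x = sigma u_z] and [k] the flux weight, half of the force is at least
   [B k (1 + x^2) g - a0 / 2 (1 + |x|)] by [flux_quadratic] with
   [e = B / lambda]; this is where [lambda] has to be large. *)
Lemma energy_pointwise (lambda delta Km B a0 y k g x a w : R) : 0 < lambda -> 0 < delta ->
  delta <= y + 1 -> -1 < y < 1 -> 0 <= k <= Km -> 0 <= B -> B ^+ 2 * Km ^+ 2 <= lambda * a0 ->
  w = a - (y + 1)^-1 + lambda * ((1 + x ^+ 2) `^ (3 / 2) * `|g| ^+ 2) ->
  (1 - y / 2) * a + - (3 / (2 * delta)) + B * (g * (k * (1 + x ^+ 2))) + - (a0 / 2 * (1 + `|x|)) <=
  (1 - y / 2) * w.
Proof.
move=> l0 d0 dy /andP[y0 y1] /andP[k0 kK] B0 HB ->.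
pose e := B / lambda.
have e0 : 0 <= e by rewrite divr_ge0// ltW.
have fq := flux_quadratic x g (mulr_ge0 e0 k0).
set F := (1 + x ^+ 2) `^ (3 / 2) * _ in fq *.
have F0 : 0 <= F by rewrite mulr_ge0 ?powR_ge0 ?sqr_ge0.
have yi : 0 <= (y + 1)^-1 <= delta^-1.
  have yp : 0 < y + 1 by lra.
  by apply/andP; split; [rewrite invr_ge0 ltW|rewrite lef_pV2 ?posrE].
(* For [-1 < y < 1] the weight lies between 1/2 and 3/2; the upper bound serves here, the lower one
   for the force. *)
have h1 : (1 - y / 2) * (y + 1)^-1 <= 3 / (2 * delta).
  case/andP: yi => i0 i1; have -> : 3 / (2 * delta) = 3 / 2 * delta^-1 by field; exact: lt0r_neq0.
  by apply: ler_pM => //; lra.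
have h2 : 1 / 2 * (lambda * F) <= (1 - y / 2) * (lambda * F).
  by apply: ler_wpM2r; [apply: mulr_ge0 => //; exact: ltW|lra].
have h3 : 1 / 2 * lambda * (2 * e * (k * (1 + x ^+ 2) * g) - (e * k) ^+ 2 * (1 + `|x|)) <= 1 / 2 * lambda * F.
  by apply: ler_wpM2l => //; rewrite mulr_ge0// ltW.
have h4 : 1 / 2 * lambda * (2 * e * (k * (1 + x ^+ 2) * g)) = B * (g * (k * (1 + x ^+ 2))).
  by rewrite /e; field; exact: lt0r_neq0.
have h5 : 1 / 2 * lambda * (e * k) ^+ 2 <= a0 / 2.
  have -> : 1 / 2 * lambda * (e * k) ^+ 2 = (B ^+ 2 * k ^+ 2) / lambda / 2.
    by rewrite /e; field; exact: lt0r_neq0.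
  rewrite ler_pM2r// ler_pdivrMr// mulrC [a0 * _]mulrC; rewrite mulrC in HB.
  apply: le_trans HB; apply: ler_wpM2r; first exact: sqr_ge0.
  by rewrite ler_sqr ?nnegrE// (le_trans k0).
have h6 : 1 / 2 * lambda * (e * k) ^+ 2 * (1 + `|x|) <= a0 / 2 * (1 + `|x|).
  by apply: ler_wpM2r => //; rewrite addr_ge0.
rewrite mulrBr h4 [1 / 2 * lambda * (_ * _)]mulrA in h3.
have E (p b L : R) : p * (a - b + L) = p * a - p * b + p * L by ring.
rewrite E; rewrite mulrA in h2.
move: h1 h2 h3 h6; move: (1 / 2 * lambda * F) (1 / 2 * lambda * (e * k) ^+ 2 * (1 + `|x|)) => Z1 Z2.
move: ((1 - y / 2) * (y + 1)^-1) ((1 - y / 2) * (lambda * F)) ((1 - y / 2) * a) (B * _) (a0 / 2 * _) (3 / _); clear.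
by move=> *; lra.
Qed.

(** Half of the slope [a0 = pi / 4] of [mulr_atan_ge] is what [energy_ibp] yields in [|x|]; the loss
    in [energy_pointwise] has exactly that slope, so only constants remain. *)
Lemma energy_rate (q lambda s delta K B a0 : R) (v w : R -> R) psi : 2 < q -> 0 < lambda -> 0 < s -> 0 < delta ->
  W2qD q v -> L1 (J R) w -> (forall z, J R z -> -1 < v z < 1) ->
  (forall z, -1 <= z <= 1 -> delta <= v z + 1) -> 1 <= K -> 256 * s ^+ 2 <= K * (delta * K - 1) ->
  is_potential s v psi -> evolution_eq lambda s v w psi ->
  0 <= B -> a0 = pi / 4 -> B ^+ 2 * (2 * expR (K * 2)) ^+ 2 <= lambda * a0 ->
  B * flux_const K - s * pi - (3 / (2 * delta) + a0) * fine (mu (J R)) <=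
  \int[mu]_(z in J R) ((1 - v z / 2) * w z).
Proof.
move=> q2 l0 s0 d0 Wv Iw vJ vd K1 HK Hpsi ev B0 a0E HB.
have K0 : 0 < K := lt_le_trans ltr01 K1.
have [cv vN1 v1] := W2qD_cont Wv.
have [c [g2 [g [rv tg E]]]] := evolution_regular q2 Wv ev.
have [m m0 Hflux] := trace_bound rv vN1 v1 vJ s0 d0 vd K1 HK Hpsi tg.
have en := energy_ibp rv vN1 v1 s0.
have [Ig2 _] := rv; have [Ia _] := curvatureP s c Ig2.
have cp := regular_dcontinuous rv.
have Ig : L1 (J R) g by have [_ Lg _] := tg; exact: (Lp_L1 mJ Joo (ler1n _ 2) Lg).
pose x z := s * (c + prim g2 z).
have cx : {within `[-1, 1], continuous x} by move=> z; apply: cvgM; [exact: cvg_cst|exact: cp].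
have cX : {within `[-1, 1], continuous (fun z => 1 - v z / 2)}.
  move=> z; apply: cvgB; first exact: cvg_cst.
  by apply: cvgM; [exact: cv|exact: cvg_cst].
have bX z : J R z -> `|1 - v z / 2| <= 2.
  by move=> /vJ/andP[h1 h2]; rewrite ler_norml; apply/andP; split; lra.
have cxx : {within `[-1, 1], continuous (fun z => 1 + x z ^+ 2)}.
  move=> z; apply: cvgD; first exact: cvg_cst.
  by rewrite (_ : (fun _ => _) = fun z => x z * x z)//; apply: cvgM; exact: cx.
have cfw : {within `[-1, 1], continuous (flux_weight v K m)} := @continuous_flux_weight R v K m cv.
have cfx : {within `[-1, 1], continuous (fun z => flux_weight v K m z * (1 + x z ^+ 2))}.
  by move=> z; apply: cvgM; [exact: cfw|exact: cxx].
have [Cf _ HCf] := @bounded_itv R (fun z => flux_weight v K m z * (1 + x z ^+ 2)) (-1) 1 ltac:(lra) cfx.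
have I1 : L1 (J R) (fun z => (1 - v z / 2) * (s * curvature s c g2 z)).
  exact (L1M mJ (measurable_J_cont cX) bX (L1Z mJ s (L1_IJ Ia))).
have I2 := L1_cst mJ (- (3 / (2 * delta))) Joo.
have I3' : L1 (J R) (fun z => g z * (flux_weight v K m z * (1 + x z ^+ 2))).
  refine (eq_L1 mJ _ (L1M mJ (measurable_J_cont cfx) (fun z Jz => HCf z (J_itv Jz)) Ig)) => z _.
  exact: mulrC.
have I3 := L1Z mJ B I3'.
have c4 : {within `[-1, 1], continuous (fun z => a0 / 2 * (1 + `|x z|))}.
  move=> z; apply: cvgM; first exact: cvg_cst.
  by apply: cvgD; [exact: cvg_cst|apply: cvg_norm; exact: cx].
have I4' : L1 (J R) (fun z => a0 / 2 * (1 + `|x z|)) := L1_IJ (L1_continuous c4).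
have I4 := L1N mJ I4'.
have Iw' := L1M mJ (measurable_J_cont cX) bX Iw.
have pw : {ae mu, forall z, J R z -> (1 - v z / 2) * (s * curvature s c g2 z) + - (3 / (2 * delta))
    + B * (g z * (flux_weight v K m z * (1 + x z ^+ 2))) + - (a0 / 2 * (1 + `|x z|)) <= (1 - v z / 2) * w z}.
  apply: ae_imp E => z Ez Jz; have zI := J_itv Jz.
  exact (energy_pointwise l0 d0 (vd z zI) (vJ z Jz) (flux_weight_itv vN1 v1 vJ K0 m0 zI) B0 HB (Ez Jz)).
have low := le_Rintegral_ae mJ (L1D mJ (L1D mJ (L1D mJ I1 I2) I3) I4) Iw' pw.
apply: (le_trans _ low).
rewrite (RintegralD mJ (L1D mJ (L1D mJ I1 I2) I3) I4) (RintegralD mJ (L1D mJ I1 I2) I3) (RintegralD mJ I1 I2).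
rewrite (RintegralN mJ I4') (Rintegral_cst _ mJ) (RintegralZl _ mJ I3').
have flux : B * flux_const K <= B * \int[mu]_(z in J R) (g z * (flux_weight v K m z * (1 + x z ^+ 2))).
  apply: ler_wpM2l => //; apply: (le_trans Hflux); rewrite le_eqVlt; apply/orP; left; apply/eqP.
  by apply: eq_Rintegral => z _; rewrite /x exprMn.
have cA : {within `[-1, 1], continuous (fun z => 1 / 2 * (x z * atan (x z)))}.
  move=> z; apply: cvgM; first exact: cvg_cst.
  by apply: cvgM; [exact: cx|exact: (cvg_contR (@continuous_atan R) (cx z))].
have IA : L1 (J R) (fun z => 1 / 2 * (x z * atan (x z))) := L1_IJ (L1_continuous cA).
have at1 : - a0 * fine (mu (J R)) <=
    \int[mu]_(z in J R) (1 / 2 * (x z * atan (x z))) - \int[mu]_(z in J R) (a0 / 2 * (1 + `|x z|)).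
  rewrite -(RintegralB mJ IA I4') -(Rintegral_cst _ mJ); apply: le_Rintegral => //.
  - exact: (L1_cst mJ _ Joo).
  - exact (L1B mJ IA I4').
  - by move=> z _; have := mulr_atan_ge (x z); rewrite -a0E; move: (x z * atan _) `|x z|; clear; move=> *; lra.
have {}en : \int[mu]_(z in J R) (1 / 2 * (x z * atan (x z))) - s * pi <=
    \int[mu]_(z in J R) ((1 - v z / 2) * (s * curvature s c g2 z)) := en.
move: flux en at1; move: (B * \int[mu]_(z in J R) _) (B * flux_const K) (s * pi) => b1 b2 b3.
move: (\int[mu]_(z in J R) ((1 - v z / 2) * _)) (\int[mu]_(z in J R) (1 / 2 * _)) (\int[mu]_(z in J R) (a0 / 2 * _)) => i1 i2 i3.
by move: (fine _) (3 / _); clear; move=> t r *; lra.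
Qed.

End energy.

Lemma no_global_solution (R : realType) (q lambda s delta K B a0 : R) (uc : R -> R) (u ut : R -> R -> R) psi :
  2 < q -> 0 < lambda -> 0 < s -> 0 < delta -> is_stationary s uc ->
  (forall z, -1 <= z <= 1 -> delta <= uc z + 1) -> 1 <= K -> 256 * s ^+ 2 <= K * (delta * K - 1) ->
  0 <= B -> a0 = pi / 4 -> B ^+ 2 * (2 * expR (K * 2)) ^+ 2 <= lambda * a0 ->
  1 <= B * flux_const K - s * pi - (3 / (2 * delta) + a0) * fine (@mu1 R (J R)) ->
  C1_Lq q +oo u ut -> C_W2qD q +oo u ->
  (forall t, 0 <= t -> (forall z, J R z -> -1 < u t z < 1) /\ is_potential s (u t) (psi t)) ->
  (forall z, J R z -> uc z <= u 0 z) ->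
  (forall t, 0 < t -> evolution_eq lambda s (u t) (ut t) (psi t)) -> False.
Proof.
move=> q2 l0 s0 d0 st ucd K1 HK B0 a0E HB H1 hC1 hCW hu init hev.
have mJ := @measurable_J R; have Joo := @J_lty R.
have hu' t : 0 <= t -> forall z, J R z -> -1 < u t z < 1 by move=> /hu[].
have cmp := comparison q2 (ltW l0) s0 hC1 hCW hu' hev st d0 ucd init.
have q1 : 1 <= q by apply: (le_trans _ (ltW q2)); rewrite ler1n.
have [_ ucN1 uc1 _] := st.
have reg t : 0 <= t -> [/\ {within `[-1, 1], continuous (u t)}, u t (-1) = 0 & u t 1 = 0].
  by move=> t0; exact (W2qD_cont (hCW _ (time_intervaly t0)).1).
have ud t : 0 <= t -> forall z, -1 <= z <= 1 -> delta <= u t z + 1.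
  move=> t0 z zI; apply: (le_trans (ucd z zI)); rewrite lerD2r.
  have [_ uN1 u1] := reg t t0; move: zI => /andP[].
  rewrite le_eqVlt => /predU1P[<- _|z0]; first by rewrite ucN1 uN1.
  rewrite le_eqVlt => /predU1P[->|z1]; first by rewrite uc1 u1.
  by apply: cmp => //; rewrite /J/= in_itv/= z0.
pose th (z y : R) := y - y * y / 4; pose th1 (z y : R) := 1 - y / 2.
have cth t : 0 <= t -> {within `[-1, 1], continuous (fun z => th z (u t z))}.
  move=> /reg[cu _ _] z; apply: cvgB; first exact: cu.
  by apply: cvgM; [apply: cvgM; exact: cu|exact: cvg_cst].
have cth1 t : 0 <= t -> {within `[-1, 1], continuous (fun z => th1 z (u t z))}.
  move=> /reg[cu _ _] z; apply: cvgB; first exact: cvg_cst.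
  by apply: cvgM; [exact: cu|exact: cvg_cst].
have bth t z : 0 <= t -> J R z -> `|th z (u t z)| <= 2.
  move=> t0 /(hu' t t0 z); rewrite /th; move: (u t z); clear => y /andP[h1 h2].
  by rewrite ler_norml; apply/andP; split; nra.
have bth1 t z : 0 <= t -> J R z -> `|th1 z (u t z)| <= 2.
  move=> t0 /(hu' t t0 z); rewrite /th1; move: (u t z); clear => y /andP[h1 h2].
  by rewrite ler_norml; apply/andP; split; lra.
pose Y t := \int[@mu1 R]_(z in J R) th z (u t z).
have dY (t : R) : 0 < t -> is_derive t 1 Y (\int[@mu1 R]_(z in J R) (th1 z (u t z) * ut t z)).
  move=> t0; have t0' := ltW t0; apply: (@is_derive_integral R q u ut q2 hC1 hCW th th1 2 t t0) => //.
  - by move=> t' t'0; split=> [|z Jz]; [exact: measurable_J_cont (cth _ t'0)|exact: bth].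
  - exact: measurable_J_cont (cth1 _ t0').
  - by move=> z Jz; exact: bth1.
  - move=> t' z _ _; rewrite /th /th1; move: (u t' z) (u t z); clear => x y.
    have -> : x - x * x / 4 - (y - y * y / 4) - (1 - y / 2) * (x - y) = - ((x - y) ^+ 2 / 4) by field.
    by have := sqr_ge0 (x - y) => h; rewrite normrN ger0_norm; lra.
have rate t : 0 < t -> 1 <= \int[@mu1 R]_(z in J R) (th1 z (u t z) * ut t z).
  move=> t0; have t0' := ltW t0; apply: (le_trans H1).
  have [_ Lut _ _] := hC1 _ (time_intervaly t0').
  have Iut := Lp_L1 mJ Joo q1 Lut.
  exact (energy_rate q2 l0 s0 d0 (hCW _ (time_intervaly t0')).1 Iut (hu' t t0') (ud t t0') K1 HK
    (hu t t0').2 (hev t t0) B0 a0E HB).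
pose M := 2 * fine (@mu1 R (J R)).
have M0 : 0 <= M by rewrite mulr_ge0// fine_ge0.
have bY t : 0 <= t -> `|Y t| <= M.
  move=> t0; have It := L1_IJ (L1_continuous (cth t t0)).
  apply: (le_trans (le_normr_Rintegral mJ It)); rewrite /M -(Rintegral_cst _ mJ).
  apply: le_Rintegral => //; [exact: (L1_normr It)|exact: (L1_cst mJ _ Joo)|].
  by move=> z Jz; exact: bth.
(* A time span over which growth at rate 1 exceeds the largest possible variation [2 M] of [Y]. *)
pose N := 2 * M + 1.
have N0 : 0 < N by rewrite /N; move: M0; clear; lra.
(* The equation holds at positive times, hence the start at time 1. *)
have lt1 : 1 < 1 + N by rewrite ltrDl.
have pos1 (t : R) : t \in `]1, 1 + N[ -> 0 < t.
  by rewrite in_itv/= => /andP[h _]; exact: lt_trans h.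
have dI (t : R) : t \in `]1, 1 + N[ -> is_derive t 1 Y (\int[@mu1 R]_(z in J R) (th1 z (u t z) * ut t z)).
  by move=> /pos1; exact: dY.
have cY : {within `[1, 1 + N], continuous Y}.
  apply: derivable_within_continuous => t; rewrite in_itv/= => /andP[h _].
  by have [] := dY t (lt_le_trans ltr01 h).
have [t tI E] := MVT lt1 dI cY.
have r1 := rate t (pos1 t tI).
have b1 := bY 1 ler01; have b2 := bY (1 + N) (ltW (lt_trans ltr01 lt1)).
have E2 : 1 + N - 1 = N by rewrite addrC addKr.
rewrite E2 in E.
have h : N <= Y (1 + N) - Y 1 by rewrite E ler_peMl// ltW.
move: b1 b2 h; rewrite !ler_norml /N; clear => /andP[? ?] /andP[? ?] ?; lra.
Qed.

Theorem theorem1p3 (R : realType) (sigma_crit : R)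
    (hcrit : is_sigma_crit sigma_crit)
    (sigma : R) (hsigma : sigma_crit <= sigma)
    (ucat : R -> R) (hucat : is_ucat sigma ucat) :
  exists2 lambda_crit : R, 0 < lambda_crit &
    forall lambda : R, lambda_crit < lambda ->
    forall q : R, 2 < q ->
    forall u0 : R -> R, W2qD q u0 ->
      (forall z, J R z -> -1 < u0 z < 1) ->
      (forall z, J R z -> ucat z <= u0 z) ->
    forall (T : \bar R) (u : R -> R -> R) (psi : R -> R * R -> R),
      is_maximal_solution q lambda sigma u0 T u psi ->
      (T < +oo)%E.
Proof.
have s0 : 0 < sigma := lt_le_trans hcrit.1 hsigma.
have st := hucat.1; have [cuc ucN1 uc1 stz] := st.
have [c cI Hc] := @EVT_min R ucat (-1) 1 ltac:(lra) cuc.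
pose delta := ucat c + 1.
have delta0 : 0 < delta.
  have ucJ z : J R z -> -1 < ucat z < 1 by case/stz.
  have /andP[h _] := v_itv ucN1 uc1 ucJ (ltac:(by rewrite in_itv in cI) : -1 <= c <= 1).
  by rewrite /delta; lra.
have ucd z : -1 <= z <= 1 -> delta <= ucat z + 1.
  by move=> zI; rewrite lerD2r; apply: Hc; rewrite in_itv.
pose X := 256 * sigma ^+ 2; have X0 : 0 <= X := mulr_ge0 (ler0n _ _) (sqr_ge0 _).
(* Gives [delta K - 1 >= X] together with [K >= 1], whence the inequality that makes [LG]
   nonnegative. *)
pose K := Num.max 1 ((1 + X) / delta).
have K1 : 1 <= K by rewrite le_max lexx.
have HK : X <= K * (delta * K - 1).
  have h : X <= delta * K - 1.
    have : (1 + X) / delta <= K by rewrite le_max lexx orbT.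
    by rewrite ler_pdivrMr// mulrC lerBrDl.
  by apply: (le_trans h); rewrite ler_peMl// (le_trans X0).
have K0 : 0 < K := lt_le_trans ltr01 K1.
have fc0 := flux_const_gt0 K0.
pose a0 : R := pi / 4.
have a00 : 0 < a0 by rewrite divr_gt0 ?pi_gt0.
pose C0 := sigma * pi + (3 / (2 * delta) + a0) * fine (@mu1 R (J R)).
have C00 : 0 <= C0.
  apply: addr_ge0; first by apply: mulr_ge0; [exact: ltW|exact: pi_ge0].
  apply: mulr_ge0; last exact: fine_ge0.
  apply: addr_ge0; last exact: ltW.
  by apply: divr_ge0 => //; apply: mulr_ge0 => //; exact: ltW.
(* Makes the lower bound of the energy rate equal to 1. *)
pose B := (C0 + 1) / flux_const K.
have B0 : 0 < B by rewrite divr_gt0// ltr_wpDl.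
have Km0 : 0 < 2 * expR (K * 2) by rewrite mulr_gt0// expR_gt0.
(* The condition on [lambda] in [energy_pointwise], where [2 * expR (K * 2)] bounds the flux weight.
   The value is determined by [sigma] and [ucat] alone, before [q] and [u0] are given. *)
exists (B ^+ 2 * (2 * expR (K * 2)) ^+ 2 / a0).
  by rewrite divr_gt0// mulr_gt0// exprn_gt0.
move=> lambda hl q q2 u0 _ _ hu0 T u psi [[_ [ut [hC1 hCW hu init hev]]] _].
rewrite ltNge leye_eq; apply/negP => /eqP TE; rewrite {}TE in hC1 hCW hu hev.
have l0 : 0 < lambda.
  apply: le_lt_trans hl; apply: divr_ge0; last exact: ltW.
  by apply: mulr_ge0; exact: sqr_ge0.
have HB : B ^+ 2 * (2 * expR (K * 2)) ^+ 2 <= lambda * a0 by rewrite -ler_pdivrMr// ltW.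
have H1 : 1 <= B * flux_const K - sigma * pi - (3 / (2 * delta) + a0) * fine (@mu1 R (J R)).
  rewrite /B divfK ?lt0r_neq0// -addrA -opprD -/C0.
  by rewrite addrAC subrr add0r.
apply: (no_global_solution q2 l0 s0 delta0 st ucd K1 HK (ltW B0) (erefl a0) HB H1 hC1 hCW).
- by move=> t t0; apply: hu; exact: time_intervaly.
- move=> z Jz; rewrite init; first exact: hu0.
  by rewrite /= in_itv/=; exact: J_itv.
- by move=> t t0; apply: hev => //; apply: time_intervaly; exact: ltW.
Qed.
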